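(* Assume the weak unobstructedness assumption stated in the context. Then the composition of $A_\infty$ functors $$\mathrm{Fuk}^\pi(M)\xrightarrow{\ P\ }\mathrm{tw}(\mathcal{O}^{\omega,\mathrm{can}})\xrightarrow{\ \Phi^\tau\ }\mathrm{tw}(\mathcal{O}^{\mathrm{hol}}_{TU})$$ is a quasi-equivalence onto its image.
   Context: **Geometric data.** $(M,\omega)$ is a symplectic manifold of dimension $2n$, $\pi:M\to B$ a Lagrangian torus fibration, $U$ a small contractible open subset of its smooth locus, $M(U)=\pi^{-1}(U)$, $L_p=\pi^{-1}(p)$ for $p\in U$, and $u_0\in U$ a base point. $x_1,\dots,x_n$ are action coordinates on $U$, $y_1^\vee,\dots,y_n^\vee$ angle coordinates on the fibres, $\omega=\sum_i dx_i\wedge dy_i^\vee$ on $M(U)$, and $e_i=dy_i^\vee$ is the resulting flat integral basis of $R^1\pi_*\mathbb{Z}$. **Fukaya's operators (known, taken as given).** Fix an $\omega$-tamed almost complex structure $J$. For $p\in U$ let $\phi_p$ be the time-one flow of $\chi\sum_i (x_i(p)-x_i(u_0))\,\partial/\partial x_i$, $\chi$ a cutoff function equal to $1$ over $U$; it carries $L_{u_0}$ to $L_p$, and $U$ is small enough that $(\phi_p)_*J$ is $\omega$-tamed. Using $(\phi_p)_*J$ for $L_p$, the moduli spaces $\mathcal{M}_{k+1,\beta}$ of stable holomorphic disks with $k+1$ boundary marked points and boundary on $L_p$ are identified for all $p$, so the operators $m_{k,\beta}(\alpha_1,\dots,\alpha_k)=(\mathrm{ev}_0)_!(\mathrm{ev}_1^*\alpha_1\wedge\cdots\wedge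 \mathrm{ev}_k^*\alpha_k)$ on $\Omega^*(L_p,\mathbb{C})$, of degree $2-k-\mu(\beta)$, do not depend on $p$. $G$ is the (trivialized) local system of monoids of disk classes $\beta$ generated by those with non-empty moduli space; $\beta$ has energy $\int_\beta\omega$, Maslov index $\mu(\beta)\in 2\mathbb{Z}$ and boundary $\partial\beta\in H_1(L_p,\mathbb{Z})$. The relative Novikov ring is $\Lambda^\pi=\{\sum_i a_iT^{\beta_i}: a_i\in\mathbb{C},\ \beta_i\in G,\ \#\{i: a_i\ne 0,\ \int_{\beta_i}\omega|_{u_0}\le E\}<\infty\ \forall E\in\mathbb{R}\}$, with $T^\beta$ of degree $\mu(\beta)$. Put $m_k=\sum_{\beta\in G} m_{k,\beta}T^\beta$, extended $\Lambda^\pi$-linearly. It is known (Fukaya–Oh–Ohta–Ono, Fukaya) that the $m_k$ form an $A_\infty$ structure (of degree one on the shifted complex, $\sum m_{r+1+t}(\mathrm{id}^{r}\otimes m_s\otimes\mathrm{id}^t)=0$), with strict unit $\mathbf{1}$, cyclic for the Poincaré pairing, with $\beta=0$ part the de Rham algebra, and satisfying the divisor equation $\sum_{l_0+\cdots+l_k=l} m_{k+l,\beta}(b^{\otimes l_0},\alpha_1,b^{\otimes l_1},\dots,\alpha_k,b^{\otimes l_k})=\frac{1}{l!}\langle b,\partial\beta\rangle^l m_{k,\beta}(\alpha_1,\dots,\alpha_k)$ for a degree-one class $b$. The same holds for the canonical (minimal) model on $H^*(L_p,\Lambda^\pi)$, which is used here; its $\beta=0$ part is the exterior algebra $H^*(L_p,\mathbb{C})$.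 The other sign convention is $m_k(a_1\otimes\cdots\otimes a_k)=(-1)^{\epsilon_k}m_k^\epsilon(a_1\otimes\cdots\otimes a_k)$, $\epsilon_k=\sum_{i=1}^{k-1}(k-i)|a_i|$. **$\mathcal{O}^{\omega,\mathrm{can}}$.** $\mathcal{H}=R\pi_*\Lambda^\pi\otimes C_U^\infty$ has fibre $H^*(L_p,\Lambda^\pi)$, with $m_k$ acting $C^\infty_U$-linearly and Gauss–Manin connection $\nabla$ given by $\nabla e_i=0$, $\nabla(T^\beta)=-\sum_i\langle\partial\beta,e_i\rangle T^\beta dx_i$ and the Leibniz rule. On $\mathcal{H}\otimes_{C^\infty_U}\Omega_U^*$ put $\nabla(f\otimes\alpha)=(\nabla f)\wedge\alpha+(-1)^{|f|}f\otimes d\alpha$ and $m_k^\epsilon(f_1\otimes\alpha_1,\dots,f_k\otimes\alpha_k)=(-1)^{\eta_k}m_k^\epsilon(f_1,\dots,f_k)\otimes(\alpha_1\wedge\cdots\wedge\alpha_k)$, $\eta_k=\sum_{i=1}^{k-1}|\alpha_i|(|f_{i+1}|+\cdots+|f_k|)$. With $\omega=-\sum_i e_i\otimes dx_i$, $\mathcal{O}^{\omega,\mathrm{can}}$ is the curved $A_\infty$ algebra over $R=\Omega_U^*(\Lambda^\pi)$ on this complex with $\hat m_0^\epsilon=m_0^\epsilon-\omega$, $\hat m_1^\epsilon=m_1^\epsilon+\nabla$, $\hat m_k^\epsilon=m_k^\epsilon$ $(k\ge2)$. **Weak unobstructedness assumption.** For every $p\in U$ the $m_0$ term of $H^*(L_p,\Lambda^\pi)$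 is a scalar multiple of $\mathbf{1}$. Consequently for $b\in H^1(L_p,\Lambda^\pi)$, $\sum_{k\ge 0}m_k(b^{\otimes k})=W(p,b)\mathbf{1}$ for a scalar $W(p,b)$ (the potential function). **$\mathrm{Fuk}^\pi(M)$.** Objects: pairs $(L_p,\alpha)$, $p\in U$, $\alpha\in H^1(L_p,\mathbb{C})$ purely imaginary. $\mathrm{Hom}((L_{p},\alpha_0),(L_{p'},\alpha_1))$ is zero if $p\neq p'$ or if $p=p'$ and $W(p,\alpha_0)\ne W(p,\alpha_1)$; otherwise it is $H^*(L_p,\Lambda^\pi)$, with operations, for objects $(L_p,\alpha_0),\dots,(L_p,\alpha_k)$, $(a_1,\dots,a_k)\mapsto\sum_{i_0,\dots,i_k\ge 0}m(\alpha_0^{\otimes i_0},a_1,\alpha_1^{\otimes i_1},\dots,a_k,\alpha_k^{\otimes i_k})$. **Twisted complexes.** For a strictly unital $A_\infty$ algebra $A$ over $R$, an odd $b$ is a weak Maurer–Cartan element with internal curvature $\lambda\in R^{\mathrm{even}}$ if $\sum_k(-1)^{k(k-1)/2}m_k^\epsilon(b^{\otimes k})=\lambda\mathbf 1$. $\mathrm{tw}(A)=\coprod_{\lambda}\mathrm{tw}^\lambda(A)$; objects of $\mathrm{tw}^\lambda(A)$ are pairs $(V,b)$ with $V$ a finite rank $\mathbb{Z}/2$-graded free $R$-module and $b$ a weak Maurer–Cartan element of $A\otimes\mathrm{End}_R(V)$ with internal curvature $\lambda$ (no upper-triangularity required); $\mathrm{Hom}((V,b),(V',b'))=A\otimes\mathrm{Hom}_R(V,V')$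 with operations $(a_1,\dots,a_k)\mapsto\sum m(b_0^{\otimes i_0},a_1,b_1^{\otimes i_1},\dots,a_k,b_k^{\otimes i_k})$; there are no morphisms between different $\lambda$. **The functor $P$.** $P(L_p,\alpha)=\mathcal{L}_p(\alpha)$, the rank one twisted complex given by the weak Maurer–Cartan element $\theta$ of $\mathcal{O}^{\omega,\mathrm{can}}$ with $\nabla\theta=\omega$, $\theta|_p=\alpha$; explicitly $\theta=\sum_i(x_i-x_i(p))e_i+\alpha$. On morphisms $P$ is linear and sends $\eta$ to the unique $P(\eta)$ with $\nabla P(\eta)=0$, $P(\eta)|_p=\eta$; on the zero Hom spaces it is zero. **$\mathcal{O}^{\mathrm{hol}}_{TU}$.** Let $y_i$ be the coordinates dual to the $e_i$; $TU$ with coordinates $(x,y)$ is identified with pairs $(p,b)$, $b$ purely imaginary, by $b=\sum_i-\sqrt{-1}\,y_ie_i$, so $W$ becomes a $\Lambda^\pi$-valued function on $TU$. $C^\infty_{TU}(\Lambda^\pi)$ is the space of series $\sum_j f_jT^{\beta_j}$, $f_j\in C^\infty_{TU}$, with finitely many non-zero terms below any energy bound. $\mathcal{O}^{\mathrm{hol}}_{TU}$ is the differential graded algebra $C^\infty_{TU}(\Lambda^\pi)\otimes\Omega^*_U$ with $\bar\partial=\sum_i(\partial_{x_i}+\sqrt{-1}\,\partial_{y_i})dx_i$ ($\partial_{x_i}T^\beta=-\langle\partial\beta,e_i\rangle T^\beta$, $\partial_{y_i}T^\beta=0$), and curvature $-W$. **The functor $\Phi^\tau$.** $\tau=\sum_i-\sqrt{-1}\,y_i\otimes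 e_i$ is a Maurer–Cartan element of $\mathcal{O}^{\mathrm{hol}}_{TU}\otimes_R\mathcal{O}^{\omega,\mathrm{can}}$ (tensor product with operations $\mathbf{1}\otimes \hat m_0^\epsilon-W\otimes\mathbf{1}$, $b\otimes a\mapsto\bar\partial b\otimes a+(-1)^{|b|}b\otimes \hat m_1^\epsilon(a)$, $(b_j\otimes a_j)_j\mapsto(-1)^{\sum_{i<k}|a_i|(|b_{i+1}|+\cdots+|b_k|)}b_1\cdots b_k\otimes m_k^\epsilon(a_1,\dots,a_k)$). $\Phi^\tau$ sends a rank one object given by $\theta$ to $\mathcal{O}^{\mathrm{hol}}_{TU}\otimes_R\mathcal{O}^{\omega,\mathrm{can}}$, as $\mathcal{O}^{\mathrm{hol}}_{TU}$-module via the first factor, with twisted differential $\bar\partial+Q$, $Q(x)=\sum_{k,l\ge0}m_{k+l+1}(\tau^{\otimes l},x,\theta^{\otimes k})$, and its components on morphisms $a_j$ from the object of $\theta_{j-1}$ to that of $\theta_j$ are $\Phi^\tau(a_1,\dots,a_k)(x)=\sum_{l,i_0,\dots,i_k\ge0}m(\tau^{\otimes l},x,\theta_0^{\otimes i_0},a_1,\theta_1^{\otimes i_1},\dots,a_k,\theta_k^{\otimes i_k})$, where $m$ denotes the operations of the tensor product algebra; higher rank objects are treated the same way with matrix indices. *Quasi-equivalence onto its image*: induces quasi-isomorphisms on all Hom complexes. *)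

(* Defs.v *)
From HB Require Import structures.
From mathcomp Require Import all_boot all_order all_algebra.
From mathcomp Require Import all_classical all_reals all_analysis.
From mathcomp Require Import complex.

Set Implicit Arguments.
Unset Strict Implicit.
Unset Printing Implicit Defensive.

Import Order.TTheory GRing.Theory Num.Theory numFieldNormedType.Exports.
Local Open Scope classical_set_scope.
Local Open Scope ring_scope.
Local Open Scope complex_scope.

(* R[i] carries the scaling by R, hence the explicit scaling by R[i]. *)
Definition zscale (R : realType) (X : Type) (c : R[i]) (a : X -> R[i]) :
    X -> R[i] := fun x => c * a x.

(* A graded C-vector space is modelled by functions X -> R[i] on a set X of    *)
(* coordinates (labels of homogeneous basis elements) with degrees            *)
(* d : X -> nat; only the parity of d matters.                                *)
Section Signs.
Variables (R : realType) (X : Type) (d : X -> nat).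

Definition gsgn (a : X -> R[i]) : X -> R[i] := fun x => (-1) ^+ d x * a x.

(* (-1)^(|a|-1) a : the sign of an operation of shifted degree one moving     *)
(* past a.                                                                    *)
Definition ksgn (a : X -> R[i]) : X -> R[i] := fun x => (-1) ^+ (d x).+1 * a x.

(* a_1, .., a_k  |->  (-1)^(eps_k) a_1, .., a_k  with                         *)
(* eps_k = \sum_(i < k) (k - i) |a_i|; this involution exchanges the          *)
(* operations m_k and m_k^eps.                                                *)
Fixpoint eps (s : seq (X -> R[i])) : seq (X -> R[i]) :=
  if s is a :: s' then iter (size s') gsgn a :: eps s' else [::].

End Signs.

(* weave [i_0; ..; i_k] b_0 [(a_1, b_1); ..; (a_k, b_k)]                      *)
(*   = b_0^(i_0), a_1, b_1^(i_1), .., a_k, b_k^(i_k)                          *)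
Fixpoint weave (T : Type) (e : seq nat) (b : T) (s : seq (T * T)) : seq T :=
  nseq (head 0%N e) b ++
  if s is (a, b') :: s' then a :: weave (behead e) b' s' else [::].

(* Sums over i_0, .., i_(k-1) >= 0, as limits of sums over cubes.             *)
Section Series.
Variable R : realType.

Definition cpart (k : nat) (F : seq nat -> R[i]) (N : nat) : R[i] :=
  \sum_(e : k.-tuple 'I_N) F (map val e).

Definition csum_to (k : nat) (F : seq nat -> R[i]) (l : R[i]) : Prop :=
  ((fun N => complex.Re (cpart k F N)) @ \oo --> complex.Re l) /\
  ((fun N => complex.Im (cpart k F N)) @ \oo --> complex.Im l).

Definition csum (k : nat) (F : seq nat -> R[i]) : R[i] :=
  lim ((fun N => complex.Re (cpart k F N)) @ \oo) +i*
  lim ((fun N => complex.Im (cpart k F N)) @ \oo).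

End Series.

(* The exterior algebra on e_0, .., e_(n-1); a K is the coefficient of e_K.   *)
Section Exterior.
Variables (R : realType) (n : nat).
Local Notation H := ({set 'I_n} -> R[i]).

Definition inversions (I J : {set 'I_n}) : nat :=
  #|[set p : 'I_n * 'I_n | [&& p.1 \in I, p.2 \in J & (p.2 < p.1)%N]]%SET|.

Definition wedge (a b : H) : H := fun K =>
  \sum_(I : {set 'I_n} | I \subset K)
     (-1) ^+ inversions I (K :\: I)%SET * a I * b (K :\: I)%SET.

Definition ebasis (I : {set 'I_n}) : H := fun K => (K == I)%:R.

Definition hdeg (K : {set 'I_n}) : nat := #|K|.

Definition class1 (v : 'I_n -> R[i]) : H := fun K =>
  \sum_(i < n) v i * (K == [set i]%SET)%:R.

(* the Poincare pairing, with the sign (-1)^|a| for which the shifted         *)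
(* operations are cyclic                                                      *)
Definition pairing (a b : H) : R[i] := wedge (gsgn hdeg a) b [set: 'I_n]%SET.

End Exterior.

Section Smooth.
Variables (R : realType) (V : normedModType R) (D : set V).

Definition extend (f : D -> R[i]) (v : V) : R[i] :=
  if insub v is Some d then f d else 0.

Definition pderiv (v : V) (f : D -> R[i]) : D -> R[i] := fun d =>
  'D_v (fun w => complex.Re (extend f w) : R^o) (val d) +i*
  'D_v (fun w => complex.Im (extend f w) : R^o) (val d).

Definition c1part (g : V -> R) (w : V) : Prop :=
  {for w, continuous g} /\ forall v, derivable (g : V -> R^o) w v.

Definition smooth (f : D -> R[i]) : Prop := forall (vs : seq V) (d : D),
  c1part (fun w => complex.Re (extend (foldr pderiv f vs) w)) (val d) /\
  c1part (fun w => complex.Im (extend (foldr pderiv f vs) w)) (val d).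

End Smooth.

Definition contractible_set (R : realType) (V : normedModType R) (U : set V) :=
  exists (h : V * R -> V) (c : V),
    [/\ {within U `*` `[0, 1], continuous h},
        forall v t, U v -> 0 <= t <= 1 -> U (h (v, t)),
        forall v, U v -> h (v, 0) = v
      & forall v, U v -> h (v, 1) = c].

(* The geometric input.  The chart U is identified with its image under the   *)
(* action coordinates x_1, .., x_n.  The canonical model operations           *)
(* m_(k,beta) on H^*(L_p, C) = Lambda^*(e_1, .., e_n) do not depend on p;     *)
(* disk_op beta [:: a_1; ..; a_k] is m_(k,beta)(a_1, .., a_k), of degree one  *)
(* for the shifted grading.                                                   *)
Record fukaya_data (R : realType) (n : nat) := FukayaData {
  chart : set 'rV[R]_n;
  basepoint : 'rV[R]_n;
  chart_open : open chart;
  chart_contractible : contractible_set chart;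
  chart_basepoint : chart basepoint;

  cls : nmodType;                      (* the monoid G of disk classes *)
  energy : cls -> R;                   (* \int_beta omega at the base point *)
  maslov : cls -> int;
  bdry : cls -> 'I_n -> int;           (* <d beta, e_i> *)
  energy_0 : energy 0 = 0;
  energyD : forall b c, energy (b + c) = energy b + energy c;
  maslov_0 : maslov 0 = 0;
  maslovD : forall b c, maslov (b + c) = maslov b + maslov c;
  maslov_even : forall b, exists k : int, maslov b = k + k;
  bdry_0 : forall i, bdry 0 i = 0;
  bdryD : forall b c i, bdry (b + c) i = bdry b i + bdry c i;
  (* G is generated by classes of holomorphic disks: positivity of energy and *)
  (* Gromov compactness *)
  energy_ge0 : forall b, 0 <= energy b;
  energy_eq0 : forall b, energy b = 0 -> b = 0;
  energy_finite : forall E : R, finite_set [set b | energy b <= E];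

  disk_op : cls -> seq ({set 'I_n} -> R[i]) -> {set 'I_n} -> R[i];
  m_linear : forall b s1 s2 (c : R[i]) (a a' : {set 'I_n} -> R[i]),
    disk_op b (s1 ++ (zscale c a + a') :: s2) =
    zscale c (disk_op b (s1 ++ a :: s2)) + disk_op b (s1 ++ a' :: s2);
  m_degree : forall b (Js : seq {set 'I_n}) K,
    disk_op b (map (@ebasis R n) Js) K <> 0 ->
    (#|K|)%:Z = (\sum_(J <- Js) #|J|)%N%:Z + 2 - (size Js)%:Z - maslov b;
  m_ainf : forall g s,
    \sum_(bb \in [set bb : cls * cls | bb.1 + bb.2 = g])
      \sum_(r < (size s).+1) \sum_(q < (size s).+1 | (r + q <= size s)%N)
        disk_op bb.1 (map (ksgn (@hdeg n)) (take r s) ++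
                disk_op bb.2 (take q (drop r s)) :: drop (r + q) s) = 0;
  m_classical : forall s,
    disk_op 0 s = if s is [:: a; a'] then wedge (gsgn (@hdeg n) a) a' else 0;
  (* for beta = 0 and two inputs the strict unit axiom is part of m_classical *)
  m_unit : forall b s1 s2, ~ (b = 0 /\ (size s1 + size s2)%N = 1%N) ->
    disk_op b (s1 ++ @ebasis R n finset.set0 :: s2) = 0;
  m_cyclic : forall b (Js : seq {set 'I_n}) J K,
    pairing (disk_op b (map (@ebasis R n) (rcons Js J))) (@ebasis R n K) =
    (-1) ^+ (#|K|.+1 * \sum_(L <- rcons Js J) #|L|.+1)%N *
    pairing (disk_op b (map (@ebasis R n) (K :: Js))) (@ebasis R n J);
  m_divisor : forall b (v : 'I_n -> R[i]) (l : nat) s,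
    \sum_(e : (size s).+1.-tuple 'I_l.+1 | (\sum_(i <- e) i == l)%N)
      disk_op b (weave (map val e) (class1 v) [seq (a, class1 v) | a <- s]) =
    zscale ((l`!)%:R^-1 * (\sum_(i < n) v i * (bdry b i)%:~R) ^+ l) (disk_op b s);
  (* absolute convergence, locally uniform in the deformation parameters, of  *)
  (* the sums \sum m_beta(v_0^(i_0), a_1, v_1^(i_1), .., a_k, v_k^(i_k)),     *)
  (* v_j in H^1(L_p, C); it is implicit in the deformed operations below      *)
  m_convergent : forall b s K (r : R), exists M : R,
    forall (N : nat) (v : nat -> 'I_n -> R[i]),
    (forall j i, `|v j i| <= r%:C) ->
    \sum_(e : (size s).+1.-tuple 'I_N)
      `|disk_op b (weave (map val e) (class1 (v 0%N))
               [seq (a.1, class1 (v a.2)) | a <- zip s (iota 1 (size s))]) K|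
    <= M%:C
}.

Section Blocks.
Variable T : Type.

(* all decompositions of a sequence into consecutive non-empty blocks *)
Fixpoint blocks (s : seq T) : seq (seq (seq T)) :=
  if s is x :: s' then
    flatten [seq ([:: x] :: p) ::
                 (if p is b :: p' then [:: (x :: b) :: p'] else [::])
            | p <- blocks s']
  else [:: [::]].

End Blocks.

(* The data of an A_infinity category.  A string of composable morphisms      *)
(* X_0 -> X_1 -> .. -> X_k is the object X_0 together with the sequence        *)
(* [:: (a_1, X_1); ..; (a_k, X_k)].                                           *)
Record ainf_cat (R : realType) := AinfCat {
  obj : Type;
  isobj : obj -> Prop;
  crd : Type;
  cdeg : crd -> nat;
  mor : obj -> obj -> set (crd -> R[i]);
  mu : obj -> seq ((crd -> R[i]) * obj) -> crd -> R[i]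
}.

Record ainf_map (R : realType) (A B : ainf_cat R) := AinfMap {
  fobj : obj A -> obj B;
  fmor : obj A -> seq ((crd A -> R[i]) * obj A) -> crd B -> R[i]
}.

Section Functors.
Variable R : realType.

Definition last_obj (A : ainf_cat R) (X : obj A)
  (s : seq ((crd A -> R[i]) * obj A)) : obj A := last X (unzip2 s).

Fixpoint is_chain (A : ainf_cat R) (X : obj A)
    (s : seq ((crd A -> R[i]) * obj A)) : Prop :=
  if s is (a, Y) :: s' then [/\ isobj Y, mor X Y a & is_chain Y s'] else True.

Definition ksgn_chain (A : ainf_cat R) (s : seq ((crd A -> R[i]) * obj A)) :=
  [seq (ksgn (@cdeg _ A) aY.1, aY.2) | aY <- s].

Section Map.
Variables (A B : ainf_cat R) (F : ainf_map A B).

Fixpoint map_blocks (X : obj A) (p : seq (seq ((crd A -> R[i]) * obj A))) :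
    seq ((crd B -> R[i]) * obj B) :=
  if p is b :: p' then
    (fmor F X b, fobj F (last_obj X b)) :: map_blocks (last_obj X b) p'
  else [::].

Record is_ainf_functor : Prop := IsAinfFunctor {
  functor_obj : forall X, isobj X -> isobj (fobj F X);
  functor_hom : forall X s, isobj X -> is_chain X s -> (0 < size s)%N ->
    mor (fobj F X) (fobj F (last_obj X s)) (fmor F X s);
  functor_degree : forall X s, isobj X -> is_chain X s -> (0 < size s)%N ->
    fmor F X (ksgn_chain s) = ksgn (@cdeg _ B) (fmor F X s);
  functor_linear : forall X s1 s2 (c : R[i]) (a a' : crd A -> R[i]) Y,
    isobj X ->
    is_chain X (s1 ++ (a, Y) :: s2) -> is_chain X (s1 ++ (a', Y) :: s2) ->
    fmor F X (s1 ++ (zscale c a + a', Y) :: s2) =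
    zscale c (fmor F X (s1 ++ (a, Y) :: s2)) + fmor F X (s1 ++ (a', Y) :: s2);
  functor_ainf : forall X s, isobj X -> is_chain X s -> (0 < size s)%N ->
    \sum_(p <- blocks s) mu (fobj F X) (map_blocks X p) =
    \sum_(r < (size s).+1)
      \sum_(q < (size s).+1 | (0 < q)%N && (r + q <= size s)%N)
        fmor F X (ksgn_chain (take r s) ++
                  (mu (last_obj X (take r s)) (take q (drop r s)),
                   last_obj X (take (r + q) s)) :: drop (r + q) s)
}.

Definition is_complex (C : ainf_cat R) (X Y : obj C) : Prop :=
  forall a, mor X Y a ->
    mor X Y (mu X [:: (a, Y)]) /\ mu X [:: (mu X [:: (a, Y)], Y)] = 0.

(* a |-> fmor F X [:: (a, Y)] is a morphism of complexes which is bijective   *)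
(* on cohomology                                                              *)
Definition quasi_iso (X Y : obj A) : Prop :=
  let d := fun a => mu X [:: (a, Y)] in
  let d' := fun b => mu (fobj F X) [:: (b, fobj F Y)] in
  let f := fun a => fmor F X [:: (a, Y)] in
  let homF := mor (fobj F X) (fobj F Y) in
  [/\ is_complex X Y /\ is_complex (fobj F X) (fobj F Y),
      forall a, mor X Y a -> homF (f a) /\ f (d a) = d' (f a),
      forall a, mor X Y a -> d a = 0 -> (exists2 b, homF b & f a = d' b) ->
        exists2 a', mor X Y a' & a = d a'
    & forall b, homF b -> d' b = 0 ->
        exists a, [/\ mor X Y a, d a = 0 & exists2 b', homF b' & b = f a + d' b']].

Definition quasi_equivalence_onto_image : Prop :=
  is_ainf_functor /\ forall X Y, isobj X -> isobj Y -> quasi_iso X Y.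

End Map.

Definition ainf_comp (A B C : ainf_cat R) (F : ainf_map A B) (G : ainf_map B C) :
    ainf_map A C :=
  AinfMap (fun X => fobj G (fobj F X))
    (fun X s => \sum_(p <- blocks s) fmor G (fobj F X) (map_blocks F X p)).

End Functors.

Section Fukaya.
Variables (R : realType) (n : nat) (D : fukaya_data R n).

Local Notation C := R[i].
Local Notation G := (cls D).
Local Notation U := (set_type (chart D)).
Local Notation TU := (set_type (chart D `*` [set: 'rV[R]_n])).

(* finitely many classes below any energy bound *)
Definition novikov (S : set G) : Prop :=
  forall E : R, finite_set (S `&` [set b | energy b <= E]).

(* (K, b) is the coefficient of e_K T^b in H^*(L_p, Lambda^pi). *)

Definition Lcrd : Type := ({set 'I_n} * G)%type.
Definition Ldeg (c : Lcrd) : nat := #|c.1|.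

(* m_k = \sum_beta m_(k,beta) T^beta, extended Lambda^pi-linearly *)
Definition Lop (s : seq (Lcrd -> C)) : Lcrd -> C := fun '(K, g) =>
  \sum_(bs \in [set bs : (size s).+1.-tuple G | \sum_(b <- bs) b = g])
    disk_op (thead bs)
      (mkseq (fun i J => nth 0 s i (J, nth 0 bs i.+1)) (size s)) K.

Definition Lmem (a : Lcrd -> C) : Prop :=
  novikov [set b | exists K, a (K, b) <> 0].

Definition Lclass (v : 'I_n -> C) : Lcrd -> C := fun '(K, b) =>
  class1 v K * (b == 0)%:R.

(* The m_0 term of H^*(L_p, Lambda^pi) is a multiple of the unit; it is the   *)
(* same for all p, as are the operations.                                     *)
Definition weakly_unobstructed : Prop :=
  exists c : G -> C, forall K b, Lop [::] (K, b) = c b * (K == finset.set0)%:R.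

(* the coefficient of T^b in W(p, v); it does not depend on p *)
Definition potential (v : 'I_n -> C) (b : G) : C :=
  csum 1 (fun e => Lop (nseq (head 0%N e) (Lclass v)) (finset.set0, b)).

Definition Fuk_mu (X : U * ('I_n -> C))
    (s : seq ((Lcrd -> C) * (U * ('I_n -> C)))) : Lcrd -> C := fun c =>
  csum (size s).+1 (fun e =>
    Lop (weave e (Lclass X.2) [seq (aY.1, Lclass aY.2.2) | aY <- s]) c).

Definition Fuk : ainf_cat R := {|
  obj := (U * ('I_n -> C))%type;
  isobj := fun X => forall i, complex.Re (X.2 i) = 0;
  crd := Lcrd;
  cdeg := Ldeg;
  mor := fun X Y => [set a | Lmem a /\
    ((X.1 = Y.1 /\ potential X.2 = potential Y.2) \/ a = 0)];
  mu := Fuk_mu |}.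

(* (F, b, u) is the coefficient of dx_F T^b at u in Omega_U^*(Lambda^pi). *)
Definition Rcrd : Type := ({set 'I_n} * G * U)%type.

Definition Reven (l : Rcrd -> C) : Prop :=
  [/\ forall F b, smooth (fun u : U => l (F, b, u)),
      novikov [set b | exists F u, l (F, b, u) <> 0]
    & forall (F : {set 'I_n}) b u, odd #|F| -> l (F, b, u) = 0].

(* aop is in the shifted convention; ascal is lambda |-> lambda 1. *)
Record calgebra := CAlgebra {
  acrd : Type;
  adeg : acrd -> nat;
  amem : set (acrd -> C);
  aop : seq (acrd -> C) -> acrd -> C;
  ascal : (Rcrd -> C) -> acrd -> C
}.

Section Twisted.
Variables (A : calgebra) (lab : eqType) (ldeg : lab -> nat).

(* Free graded modules V have bases of labels, the degree of a basis element  *)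
(* being that of its label.  A tensor Hom_R(V, V') consists of matrices with  *)
(* rows indexed by the basis of V and columns by the basis of V'.             *)
Definition mcrd : Type := (lab * lab * acrd A)%type.
Definition mdeg : mcrd -> nat := fun '(l, l', x) =>
  (ldeg l + ldeg l' + adeg x)%N.

Record twobj := TwObj { tbasis : seq lab; ttwist : mcrd -> C }.

(* The operations of A extended to matrices,                                  *)
(*   m(a_1 f_1, .., a_k f_k) = +- m(a_1, .., a_k) f_1 .. f_k,                 *)
(* f_1 .. f_k being first f_1, then f_2, etc.  The sign is                    *)
(* \sum_(i < j) |f_i| (|a_j| - 1), and along a path of labels                 *)
(* |f_1| + .. + |f_(j-1)| is the degree of l0 plus that of the row of a_j.    *)
(* acc holds the matrix entries chosen so far, in reverse order.              *)
Fixpoint mop_rec (l0 l l' : lab) (acc : seq (acrd A -> C))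
    (s : seq ((mcrd -> C) * seq lab)) : acrd A -> C :=
  if s is (a, B) :: s' then
    fun x => \sum_(k <- B)
      mop_rec l0 k l'
        (iter (ldeg l0 + ldeg l) (ksgn (@adeg A)) (fun y => a (l, k, y)) :: acc)
        s' x
  else fun x => (l == l')%:R * aop (rev acc) x.

Definition mop (s : seq ((mcrd -> C) * seq lab)) : mcrd -> C :=
  fun '(l, l', x) => mop_rec l l l' [::] s x.

Definition tw_item (X : twobj) := (ttwist X, tbasis X).

Definition tw_mu (X : twobj) (s : seq ((mcrd -> C) * twobj)) : mcrd -> C :=
  fun c => csum (size s).+1 (fun e =>
    mop (weave e (tw_item X)
          [seq ((aY.1, tbasis aY.2), tw_item aY.2) | aY <- s]) c).

(* For odd b the shifted m_k(b, .., b) is (-1)^(k(k-1)/2) m_k^eps(b, .., b).  *)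
Definition has_curvature (X : twobj) (lam : Rcrd -> C) : Prop :=
  forall l l' x, l \in tbasis X -> l' \in tbasis X ->
    csum_to 1 (fun e => mop (nseq (head 0%N e) (tw_item X)) (l, l', x))
            ((l == l')%:R * ascal lam x).

Definition tw_mem (X Y : twobj) (a : mcrd -> C) : Prop :=
  (forall l l', amem (fun x => a (l, l', x))) /\
  (forall l l' x, a (l, l', x) <> 0 -> (l \in tbasis X) && (l' \in tbasis Y)).

Definition tw_isobj (X : twobj) : Prop :=
  [/\ uniq (tbasis X), tw_mem X X (ttwist X),
      forall c, ttwist X c <> 0 -> odd (mdeg c)
    & exists2 lam, Reven lam & has_curvature X lam].

Definition tw : ainf_cat R := {|
  obj := twobj;
  isobj := tw_isobj;
  crd := mcrd;
  cdeg := mdeg;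
  mor := fun X Y => [set a | tw_mem X Y a /\
    ((exists lam, [/\ Reven lam, has_curvature X lam & has_curvature Y lam])
     \/ a = 0)];
  mu := tw_mu |}.

End Twisted.

(* (F, J, b, p) is the coefficient at p of e_J T^b (x) dx_F in the sections   *)
(* of O^(omega,can), and of dx_F T^b (x) e_J in the tensor product algebra.   *)
Definition Scrd (P : Type) : Type := ({set 'I_n} * {set 'I_n} * G * P)%type.
Definition Sdeg (P : Type) : Scrd P -> nat := fun '(F, J, b, p) => (#|F| + #|J|)%N.

(* dx_(F_1) ^ .. ^ dx_(F_k) *)
Definition wedges (Fs : seq {set 'I_n}) : {set 'I_n} -> C :=
  foldr (fun F w => wedge (ebasis R F) w) (ebasis R finset.set0) Fs.

Definition m_eps (b : G) (s : seq ({set 'I_n} -> C)) : {set 'I_n} -> C :=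
  disk_op b (eps (@hdeg n) s).

(* The operations m_k^eps on forms: for inputs with form degrees d_1, .., d_k *)
(* the sign is gl d + \sum_i (tw d i) |f_i|, f_i being the components in      *)
(* H^*(L_p, C).                                                               *)
Definition form_op (P : Type) (sg : seq nat -> nat -> nat) (gl : seq nat -> nat)
    (s : seq (Scrd P -> C)) : Scrd P -> C := fun '(F, J, g, p) =>
  \sum_(bs \in [set bs : (size s).+1.-tuple G | \sum_(b <- bs) b = g])
    \sum_(Fs : (size s).-tuple {set 'I_n})
      let d := map (@hdeg n) Fs in
      (-1) ^+ gl d * wedges Fs F *
      m_eps (thead bs)
        (mkseq (fun i => iter (sg d i) (gsgn (@hdeg n))
            (fun K => nth 0 s i (nth finset.set0 Fs i, K, nth 0 bs i.+1, p)))
          (size s)) J.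

Definition evec (i : 'I_n) : 'rV[R]_n := delta_mx 0 i.

Definition nabla (a : Scrd U -> C) : Scrd U -> C := fun '(F, J, b, u) =>
  (-1) ^+ #|J| * \sum_(i in F) (-1) ^+ inversions [set i]%SET (F :\ i)%SET *
    (pderiv (evec i) (fun u' : U => a ((F :\ i)%SET, J, b, u')) u
     - (bdry b i)%:~R * a ((F :\ i)%SET, J, b, u)).

(* omega = - \sum_i e_i (x) dx_i *)
Definition omega : Scrd U -> C := fun '(F, J, b, u) =>
  - \sum_(i < n) (F == [set i]%SET)%:R * (J == [set i]%SET)%:R * (b == 0)%:R.

Definition Ocan_op_eps (s : seq (Scrd U -> C)) : Scrd U -> C :=
  form_op (fun d i => sumn (take i d)) (fun=> 0%N) s +
  match s with [::] => - omega | [:: a] => nabla a | _ => 0 end.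

Definition Ocan : calgebra := {|
  acrd := Scrd U;
  adeg := @Sdeg U;
  amem := [set a | (forall F J b, smooth (fun u : U => a (F, J, b, u))) /\
                   novikov [set b | exists F J u, a (F, J, b, u) <> 0]];
  aop := fun s => Ocan_op_eps (eps (@Sdeg U) s);
  ascal := fun l '(F, J, b, u) => l (F, b, u) * (J == finset.set0)%:R |}.

(* Labels of degree equal to their value; the rank one module R has label 0.  *)
Definition ndeg (l : nat) : nat := l.

Definition entry00 (X : Type) (a : X -> C) : nat * nat * X -> C :=
  fun '(l, l', x) => ((l == 0%N) && (l' == 0%N))%:R * a x.

Definition theta (X : U * ('I_n -> C)) : Scrd U -> C := fun '(F, J, b, u) =>
  class1 (fun i => (val u 0 i - val X.1 0 i)%:C + X.2 i) J *
  ((F == finset.set0) && (b == 0))%:R.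

Definition flat_extension (p : U) (eta : Lcrd -> C) : set (Scrd U -> C) :=
  [set a | [/\ @amem Ocan a,
               forall F J b u, F != finset.set0 -> a (F, J, b, u) = 0,
               nabla a = 0
             & forall J b, a (finset.set0, J, b, p) = eta (J, b)]].

(* P is strict: its components of arity at least two vanish.                  *)
Definition P_functor : ainf_map Fuk (tw Ocan ndeg) :=
  @AinfMap R Fuk (tw Ocan ndeg)
  (fun X => @TwObj Ocan nat [:: 0%N] (entry00 (theta X)))
  (fun X s => if s is [:: (eta, _)] then
                entry00 (xget 0 (flat_extension X.1 eta))
              else 0).

(* (F, b, z) is the coefficient of dx_F T^b at z = (x, y) *)
Definition Hcrd : Type := ({set 'I_n} * G * TU)%type.
Definition Hdeg (c : Hcrd) : nat := #|c.1.1|.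

Definition dbar (a : Hcrd -> C) : Hcrd -> C := fun '(F, b, z) =>
  \sum_(i in F) (-1) ^+ inversions [set i]%SET (F :\ i)%SET *
    (pderiv (evec i, 0) (fun z' : TU => a ((F :\ i)%SET, b, z')) z
     - (bdry b i)%:~R * a ((F :\ i)%SET, b, z)
     + 'i * pderiv (0, evec i) (fun z' : TU => a ((F :\ i)%SET, b, z')) z).

Definition hprod (a a' : Hcrd -> C) : Hcrd -> C := fun '(F, g, z) =>
  \sum_(bb \in [set bb : G * G | bb.1 + bb.2 = g])
    wedge (fun K => a (K, bb.1, z)) (fun K => a' (K, bb.2, z)) F.

(* b = \sum_i - sqrt(-1) y_i e_i *)
Definition fibre_class (z : TU) (i : 'I_n) : C := 0 +i* (- (val z).2 0 i).

Definition W (b : G) (z : TU) : C := potential (fibre_class z) b.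

(* Curvature -W means that the modules over O^hol_TU are the free modules     *)
(* with Dx = dbar x + (-1)^|x| x b on row vectors and D^2 = lambda - W.        *)
(* As D^2 x = x (dbar b - b b), in terms of the Maurer-Cartan equation of b   *)
(* this is m_0 + dbar b - b b = lambda with m_0 = W; the sign of m_0 enters   *)
(* only here, the Hom complexes do not involve it.                            *)
Definition Ohol_op_eps (s : seq (Hcrd -> C)) : Hcrd -> C :=
  match s with
  | [::] => fun '(F, b, z) => (F == finset.set0)%:R * W b z
  | [:: a] => dbar a
  | [:: a; a'] => hprod a a'
  | _ => 0
  end.

Definition Ohol : calgebra := {|
  acrd := Hcrd;
  adeg := Hdeg;
  amem := [set a | (forall F b, smooth (fun z : TU => a (F, b, z))) /\
                   novikov [set b | exists F z, a (F, b, z) <> 0]];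
  aop := fun s => Ohol_op_eps (eps Hdeg s);
  ascal := fun l '(F, b, z) => extend (fun u : U => l (F, b, u)) (val z).1 |}.

(* O^(omega,can) -> tensor product, e_J (x) dx_F |-> (-1)^(|F||J|) dx_F (x) e_J *)
Definition to_tens (a : Scrd U -> C) : Scrd TU -> C := fun '(F, J, b, z) =>
  (-1) ^+ (#|F| * #|J|) *
  extend (fun u : U => a (F, J, b, u)) (val z).1.

(* Every m_k^eps carries (-1)^(k (|b_1| + .. + |b_k|)): this is the sign      *)
(* (-1)^|b| of b (x) m_1^eps(a) for k = 1, it is trivial for even k, and it   *)
(* makes the operations for odd k well defined over R.                        *)
Definition tens_op_eps (s : seq (Scrd TU -> C)) : Scrd TU -> C :=
  form_op (fun d i => sumn (drop i.+1 d)) (fun d => (size d * sumn d)%N) s +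
  match s with
  | [::] => - to_tens omega -
            (fun '(F, J, b, z) => ((F == finset.set0) && (J == finset.set0))%:R * W b z)
  | [:: a] => fun '(F, J, b, z) =>
      dbar (fun '(F', b', z') => a (F', J, b', z')) (F, b, z)
  | _ => 0
  end.

Definition tens : calgebra := {|
  acrd := Scrd TU;
  adeg := @Sdeg TU;
  amem := [set a | (forall F J b, smooth (fun z : TU => a (F, J, b, z))) /\
                   novikov [set b | exists F J z, a (F, J, b, z) <> 0]];
  aop := fun s => tens_op_eps (eps (@Sdeg TU) s);
  ascal := fun l '(F, J, b, z) =>
    extend (fun u : U => l (F, b, u)) (val z).1 * (J == finset.set0)%:R |}.

Definition tau : Scrd TU -> C := fun '(F, J, b, z) =>
  class1 (fibre_class z) J * ((F == finset.set0) && (b == 0))%:R.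

Definition to_tens_mat (a : mcrd Ocan nat -> C) : mcrd tens nat -> C :=
  fun '(l, l', c) => to_tens (fun x => a (l, l', x)) c.

Definition to_tens_obj (X : twobj Ocan nat) : twobj tens nat :=
  @TwObj tens nat (tbasis X) (to_tens_mat (ttwist X)).

Definition tau_obj : twobj tens nat := @TwObj tens nat [:: 0%N] (entry00 tau).

(* e_J tensored with the basis element v of V, as a morphism from R to V *)
Definition basis_mat (J : {set 'I_n}) (v : nat) : mcrd tens nat -> C :=
  fun '(l, l', (F, K, b, z)) =>
    [&& l == 0%N, l' == v, F == finset.set0, K == J & b == 0]%:R.

(* the labels of the basis e_J (x) v of H^*(L_p, C) (x) V *)
Definition Hlab : Type := ({set 'I_n} * nat)%type.
Definition Hlabdeg (l : Hlab) : nat := (#|l.1| + l.2)%N.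

(* Phi^tau(a_1, .., a_k)(x), x in O^hol (x)_R O^(omega,can) (x) V_0, is       *)
(* \sum m(tau^l, x, b_0^(i_0), a_1, b_1^(i_1), .., a_k, b_k^(i_k)), which is  *)
(* a composition in twisted complexes over the tensor product algebra.        *)
Definition Phi_action (X : twobj Ocan nat)
    (s : seq ((mcrd Ocan nat -> C) * twobj Ocan nat))
    (x : mcrd tens nat -> C) : mcrd tens nat -> C :=
  tw_mu ndeg tau_obj
    ((x, to_tens_obj X) :: [seq (to_tens_mat aY.1, to_tens_obj aY.2) | aY <- s]).

(* The matrix phi over O^hol with Phi^tau(a_1, .., a_k)(x) = m_2(x, phi) on   *)
(* the basis elements x = e_J (x) v; the sign is that of m_2(x, phi) in the   *)
(* matrix extension.  For k = 0 this is the matrix of Q.                      *)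
Definition Phi_matrix (X : twobj Ocan nat)
    (s : seq ((mcrd Ocan nat -> C) * twobj Ocan nat)) : mcrd Ohol Hlab -> C :=
  fun '((J, v), (J', v'), (F, b, z)) =>
    (-1) ^+ (#|F|.+1 * (#|J| + v)) *
    Phi_action X s (basis_mat J v) (0%N, v', (F, J', b, z)).

Definition Phi_functor : ainf_map (tw Ocan ndeg) (@tw Ohol Hlab Hlabdeg) :=
  @AinfMap R (tw Ocan ndeg) (@tw Ohol Hlab Hlabdeg)
    (fun X => @TwObj Ohol Hlab
       [seq (J, v) | J <- enum {set 'I_n}, v <- tbasis X] (Phi_matrix X [::]))
    Phi_matrix.

End Fukaya.

(* Main.v *)
Require Import Defs.
From HB Require Import structures.
From mathcomp Require Import all_boot all_order all_algebra.
From mathcomp Require Import all_classical all_reals all_analysis.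
From mathcomp Require Import complex finmap ring lra zify.


(* On a string of objects the composite functor is the multiplication          *)
(* x |-> m(v^l, x, c_0^i_0, a_1, c_1^i_1, ..) of H^*(L), where by the divisor  *)
(* equation the affine shifts x_i - x_i(p) are absorbed into the deforming     *)
(* class, so that v = - (x + i y) and c_j = alpha_j - x(p_j) depend only on    *)
(* holomorphic coordinates; hence dbar of it vanishes, and its A_infinity      *)
(* equations are those of the deformed m_k.                                    *)
(*                                                                             *)
(* The gauge T^b |-> exp <x, d b> T^b identifies the complex of matrices       *)
(* between the images of X and Y with D = dbar + (composition with m_1), which *)
(* is filtered by energy and by the row degree.  For X, Y over the same point  *)
(* the leading part of D on a row is the Dolbeault-Koszul complex of a point,  *)
(* d = dbar + kappa ^ with kappa the holomorphic coordinates centred at the    *)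
(* point: its cohomology is one dimensional, spanned by the top class.  Near   *)
(* the point this follows from a radial homotopy, away from it kappa is        *)
(* inverted by contraction.  The top classes of the rows are exactly the       *)
(* leading parts of the images of the morphisms, and completing along the      *)
(* filtration gives the quasi-isomorphism.  Over distinct points the leading   *)
(* part is contractible, as kappa_X - kappa_Y is a non-zero constant.          *)

Set Implicit Arguments.
Unset Strict Implicit.
Unset Printing Implicit Defensive.

Import Order.TTheory GRing.Theory Num.Theory numFieldNormedType.Exports.
Local Open Scope classical_set_scope.
Local Open Scope ring_scope.
Local Open Scope complex_scope.

(** The composite is of Yoneda type: it sends a_1, .., a_k to the operator x |-> sum of m(tau^l, x,
    theta_0^(i_0), a_1, theta_1^(i_1), ..) on the cohomology of the fibre, with coefficients in
    functions on TU. Everything algebraic therefore comes from the deformed operations [M]. Their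
    convergence ([csum_M]), multilinearity ([M_lin]) and A-infinity relations ([M_ainf]) are
    obtained by summing the relations of the undeformed operations over words in the inputs and the
    deforming classes.

    The divisor equation sums to an exponential ([M_shift]): shifting all deforming classes by the
    same real class x amounts to the automorphism T^b |-> exp <x, db> T^b. Since [P] takes flat
    sections ([xget_flat]) and is strict, this gives the closed form [Fx] of the composite
    ([Phi_matrixE], [comp_fmor]). There the base point enters only through - (x + i y), so the
    components are holomorphic ([dcs_M]), and the functor equations are the relations of [M] with a
    basis vector e_J as additional first input ([ainf_id], [FF_ainf]). Weak unobstructedness gives
    m_1 m_1 = (W_1 - W_0) id ([M_ainf1]); hence the images have internal curvature given by the
    potential ([FO_curvature]) and the Hom complexes square to zero ([Dg_Dg]).

    The quasi-isomorphism rests on one statement, [solve]: if D w lies in the image of the Fukaya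
    morphisms, then w is the image of a morphism plus a D-exact matrix. For D w = f(a) it yields
    injectivity on cohomology, for D w = 0 surjectivity. It is proved by successive approximation
    along a filtration by energy and row degree ([completion]), so only a leading-order problem has
    to be solved ([lead_same], [lead_diff]). Over one point it is the exactness, up to the top
    class, of the Dolbeault-Koszul complex of that point ([kd_exact]): near the point by a radial
    Poincare homotopy ([kd_homotopy]), away from it by contraction with the conjugate coordinates
    ([kd_exact_away]). Over distinct points the two Koszul vectors differ by a constant with a
    non-zero entry, and contraction in that direction is a homotopy. *)

(** * Combinatorics of words with repeated letters *)

Section Words.
Variable T : Type.

(* The words of length L in a letter b repeated, then a_1, then b_1 repeated, *)
(* etc., listed by their first letter.                                        *)
Fixpoint words (L : nat) (b : T) (s : seq (T * T)) : seq (seq T) :=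
  if L is L'.+1 then
    map (cons b) (words L' b s) ++
    (if s is (a, b') :: s' then map (cons a) (words L' b' s') else [::])
  else if s is [::] then [:: [::]] else [::].

Arguments words : simpl never.

Definition state (b : T) (s : seq (T * T)) : T := last b (unzip2 s).

Lemma state_cat b s s' : state b (s ++ s') = state (state b s) s'.
Proof. by rewrite /state /unzip2 map_cat last_cat. Qed.

Lemma words_short L b s : (L < size s)%N -> words L b s = [::].
Proof.
elim: L b s => [|L IH] b [|[a b'] s] //= Ls.
by rewrite /words -/words IH ?IH //= ltnW.
Qed.

Section Sums.
Variable V : nmodType.
Implicit Types (F : seq T -> V) (b : T) (s : seq (T * T)).

Lemma sum_words0 F b s :
  \sum_(w <- words 0 b s) F w = if s is [::] then F [::] else 0.
Proof. by case: s => [|a s]; rewrite /words ?big_seq1 ?big_nil. Qed.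

Lemma sum_wordsS F L b s :
  \sum_(w <- words L.+1 b s) F w =
  \sum_(w <- words L b s) F (b :: w) +
  (if s is (a, b') :: s' then \sum_(w <- words L b' s') F (a :: w) else 0).
Proof.
rewrite /words -/words big_cat big_map; congr (_ + _).
by case: s => [|[a b'] s']; rewrite ?big_nil // big_map.
Qed.

Lemma eq_words F F' L b s : (forall w, size w = L -> F w = F' w) ->
  \sum_(w <- words L b s) F w = \sum_(w <- words L b s) F' w.
Proof.
elim: L b s F F' => [|L IH] b s F F' eqF.
  by rewrite !sum_words0; case: s => // ; rewrite eqF.
rewrite !sum_wordsS; congr (_ + _).
  by apply: IH => w sw; rewrite eqF //= sw.
by case: s => [|[a b'] s] //; apply: IH => w sw; rewrite eqF //= sw.
Qed.

(** The index i counts the letters a_1, .., a_i in the first piece; the second piece restarts from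
    the repeated letter in force at the cut. *)
Lemma words_split (Psi : seq T -> seq T -> V) r L b s : (r <= L)%N ->
  \sum_(w <- words L b s) Psi (take r w) (drop r w) =
  \sum_(i < (size s).+1) \sum_(w1 <- words r b (take i s))
     \sum_(w2 <- words (L - r) (state b (take i s)) (drop i s)) Psi w1 w2.
Proof.
elim: r L b s Psi => [|r IH] L b s Psi rL.
  rewrite big_ord_recl take0 drop0 subn0 sum_words0 [X in _ = _ + X]big1 ?addr0.
    by apply: eq_bigr => w _; rewrite take0 drop0.
  by case: s => [|[a b'] s] [i /= lti] _; rewrite sum_words0 //; case: i lti.
case: L rL => // L rL; rewrite subSS.
under [RHS]eq_bigr => i _ do rewrite sum_wordsS.
rewrite big_split sum_wordsS; congr (_ + _).
  by rewrite -(IH L b s (fun u v => Psi (b :: u) v)).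
case: s => [|[a b'] s] /=; first by rewrite big_ord1.
rewrite big_ord_recl add0r -(IH L b' s (fun u v => Psi (a :: u) v)) //.
Qed.

(** A word through the marked letter y is given by its r letters before y and its L - r letters
    after it. *)
Lemma words_merge (Psi : seq T -> V) L b s1 y b' s2 :
  \sum_(w <- words L.+1 b (s1 ++ (y, b') :: s2)) Psi w =
  \sum_(r < L.+1) \sum_(w1 <- words r b s1)
     \sum_(w3 <- words (L - r) b' s2) Psi (w1 ++ y :: w3).
Proof.
elim: L b s1 Psi => [|L IH] b s1 Psi.
  rewrite big_ord_recl big_ord0 addr0 sum_wordsS !sum_words0.
  case: s1 => [|[a c] s1] /=; rewrite sum_words0 add0r ?sum_words0 //.
  by case: s1.
rewrite big_ord_recl subn0 sum_words0 sum_wordsS IH.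
under [X in _ = _ + X]eq_bigr => r _ do rewrite sum_wordsS.
rewrite [X in _ = _ + X]big_split /= addrCA; congr (_ + _).
case: s1 => [|[a c] s1] /=.
  by rewrite big1_eq addr0.
by rewrite add0r IH.
Qed.

(* Shifting every repeated letter by u amounts to inserting letters u. *)
Lemma words_shift (opa : T -> T -> T) (u : T) (P : (seq T -> V) -> Prop)
    L b s Psi :
  (forall F w x b', P F -> F (w ++ opa b' u :: x) = F (w ++ b' :: x) + F (w ++ u :: x)) ->
  (forall F x, P F -> P (fun w => F (x :: w))) -> P Psi ->
  \sum_(w <- words L (opa b u) [seq (x.1, opa x.2 u) | x <- s]) Psi w =
  \sum_(r < L.+1) \sum_(w <- words r b s)
     \sum_(w' <- words L u [seq (x, u) | x <- w]) Psi w'.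
Proof.
move=> Pop Pcons; elim: L b s Psi => [|L IH] b s Psi PPsi.
  rewrite big_ord1 sum_words0; case: s => [|x s] /=; rewrite ?big_nil //.
  by rewrite !big_seq1.
have split1 : \sum_(w <- words L (opa b u) [seq (x.1, opa x.2 u) | x <- s])
      Psi (opa b u :: w) =
    \sum_(w <- words L (opa b u) [seq (x.1, opa x.2 u) | x <- s]) Psi (b :: w) +
    \sum_(w <- words L (opa b u) [seq (x.1, opa x.2 u) | x <- s]) Psi (u :: w).
  by rewrite -big_split; apply: eq_bigr => w _; rewrite (Pop Psi [::] w).
rewrite sum_wordsS split1.
under [RHS]eq_bigr => r _ do under eq_bigr => w _ do rewrite sum_wordsS.
under [RHS]eq_bigr => r _ do rewrite big_split.
rewrite [RHS]big_split big_ord_recr /=.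
(* Words of length L cannot contain the L + 1 prescribed letters of w. *)
have -> : \sum_(w <- words L.+1 b s)
    \sum_(w' <- words L u [seq (x, u) | x <- w]) Psi (u :: w') = 0.
  rewrite (@eq_words _ (fun=> 0)) ?big1 // => w sw.
  by rewrite words_short ?big_nil // size_map sw.
rewrite addr0.
rewrite (IH b s (fun w => Psi (b :: w))) ?(IH b s (fun w => Psi (u :: w)));
  try exact: Pcons.
rewrite addrAC [RHS]addrC; congr (_ + _).
rewrite [RHS]big_ord_recl sum_words0.
under [X in _ = _ + X]eq_bigr => r _ do rewrite sum_wordsS.
rewrite [X in _ = _ + X]big_split /= addrCA; congr (_ + _).
case: s {split1} => [|[a b'] s] /=; first by rewrite big1_eq addr0.
rewrite add0r -(IH b' s (fun w => Psi (a :: w))) //; exact: Pcons.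
Qed.

End Sums.

Section Telescope.
Variable V : zmodType.

(* Moving every repeated letter from b to b', one after the other. *)
Lemma words_telescope (subT : T -> T -> T) L b b' (s : seq (T * (T * T)))
    (Psi : seq T -> V) (P : (seq T -> V) -> Prop) :
  (forall F x c c', P F -> F (subT c c' :: x) = F (c :: x) - F (c' :: x)) ->
  (forall F x, P F -> P (fun w => F (x :: w))) -> P Psi ->
  \sum_(w <- words L b' [seq (x.1, x.2.2) | x <- s]) Psi w -
  \sum_(w <- words L b [seq (x.1, x.2.1) | x <- s]) Psi w =
  \sum_(j < (size s).+1)
    \sum_(w <- words L b' ([seq (x.1, x.2.2) | x <- take j s] ++
       (let c := last (b, b') (unzip2 (take j s)) in (subT c.2 c.1, c.1)) ::
       [seq (x.1, x.2.1) | x <- drop j s])) Psi w.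
Proof.
move=> Psub Pcons; elim: L b b' s Psi => [|L IH] b b' s Psi PPsi.
  rewrite !sum_words0 [RHS]big1; first by case: s => [|x s]; rewrite subrr.
  by move=> j _; rewrite sum_words0; case: (map _ (take j s)).
rewrite !sum_wordsS.
under [RHS]eq_bigr => j _ do rewrite sum_wordsS.
rewrite [RHS]big_split /= -(IH b b' s (fun w => Psi (b' :: w))); last exact: Pcons.
rewrite [X in _ = _ + X]big_ord_recl take0 drop0 /=.
have -> : \sum_(w <- words L b [seq (x.1, x.2.1) | x <- s]) Psi (subT b' b :: w) =
    \sum_(w <- words L b [seq (x.1, x.2.1) | x <- s]) Psi (b' :: w) -
    \sum_(w <- words L b [seq (x.1, x.2.1) | x <- s]) Psi (b :: w).
  by rewrite -sumrB; apply: eq_bigr => w _; rewrite Psub.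
case: s => [|[a [c c']] s] /=.
  by rewrite big_ord0 !addr0 subrKA.
rewrite opprD addrACA -(IH c c' s (fun w => Psi (a :: w))); last exact: Pcons.
by rewrite [RHS]addrA; congr (_ + _); rewrite addrA subrK.
Qed.

End Telescope.
End Words.

Arguments words {T} L b s : simpl never.

(** * Absolutely convergent complex series *)

Section ComplexLimits.
Variable R : realType.
Local Notation C := R[i].
Implicit Types (u v : nat -> C) (z l : C).

(** The norm on [R[i]] takes values in [R[i]]; this is the same number as a real, so that real
    analysis applies. *)
Definition nc (z : C) : R := complex.Re `|z|.

Lemma ncE z : (nc z)%:C = `|z|.
Proof. by rewrite /nc normc_def. Qed.

Lemma nc_leE z (M : R) : (`|z| <= M%:C) = (nc z <= M).
Proof. by rewrite -ncE lecR. Qed.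

Lemma nc_ge0 z : 0 <= nc z.
Proof. by rewrite -ler0c ncE. Qed.

Lemma ncM z z' : nc (z * z') = nc z * nc z'.
Proof. by apply: (@complexI R); rewrite rmorphM /= !ncE normrM. Qed.

Lemma ncD z z' : nc (z + z') <= nc z + nc z'.
Proof. by rewrite -lecR rmorphD /= !ncE ler_normD. Qed.

Lemma ncN z : nc (- z) = nc z.
Proof. by rewrite /nc normrN. Qed.

Lemma nc0 : nc 0 = 0.
Proof. by rewrite /nc normr0. Qed.

Lemma nc_real (x : R) : nc x%:C = `|x|.
Proof. by rewrite /nc normc_def /= expr0n addr0 sqrtr_sqr. Qed.

Lemma nc_sum I (r : seq I) (P : pred I) (F : I -> C) :
  nc (\sum_(i <- r | P i) F i) <= \sum_(i <- r | P i) nc (F i).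
Proof.
elim/big_rec2: _ => [|i y x _ h]; first by rewrite nc0.
by apply: le_trans (ncD _ _) _; rewrite lerD2l.
Qed.

Lemma Re_nc z : `|complex.Re z| <= nc z.
Proof. by rewrite -lecR ncE normc_ge_Re. Qed.

Lemma nci : nc 'i = 1.
Proof. by rewrite /nc normc_def /= expr0n expr1n add0r sqrtr1. Qed.

Lemma Im_nc z : `|complex.Im z| <= nc z.
Proof.
have -> : nc z = nc (z * 'i) by rewrite ncM nci mulr1.
by apply: le_trans (Re_nc _); rewrite ReiNIm normrN.
Qed.

Lemma nc_ReIm z : nc z <= `|complex.Re z| + `|complex.Im z|.
Proof.
rewrite {1}[z]complexE; apply: le_trans (ncD _ _) _.
by rewrite ncM !nc_real nci mul1r.
Qed.

Lemma ReD z z' : complex.Re (z + z') = complex.Re z + complex.Re z'.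
Proof. by case: z; case: z'. Qed.

Lemma ImD z z' : complex.Im (z + z') = complex.Im z + complex.Im z'.
Proof. by case: z; case: z'. Qed.

Lemma ReN z : complex.Re (- z) = - complex.Re z.
Proof. by case: z. Qed.

Lemma ImN z : complex.Im (- z) = - complex.Im z.
Proof. by case: z. Qed.

Lemma ReM z z' : complex.Re (z * z') =
  complex.Re z * complex.Re z' - complex.Im z * complex.Im z'.
Proof. by case: z; case: z'. Qed.

Lemma ImM z z' : complex.Im (z * z') =
  complex.Re z * complex.Im z' + complex.Im z * complex.Re z'.
Proof. by case: z; case: z'. Qed.

Definition ReImE := (ReD, ImD, ReN, ImN, ReM, ImM).

Definition cto u l : Prop :=
  ((fun N => complex.Re (u N)) @ \oo --> complex.Re l) /\
  ((fun N => complex.Im (u N)) @ \oo --> complex.Im l).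

Lemma cto_unique u l l' : cto u l -> cto u l' -> l = l'.
Proof.
move=> [a b] [a' b']; apply/eqP; rewrite eq_complex; apply/andP.
have h (f : nat -> R) (x y : R) : f @ \oo --> x -> f @ \oo --> y -> x = y.
  by move=> fx fy; rewrite -(cvg_lim (@Rhausdorff R) fx) -(cvg_lim (@Rhausdorff R) fy).
by split; apply/eqP; [apply: h a a'|apply: h b b'].
Qed.

Lemma ctoP u l : cto u l <-> (fun N => nc (u N - l)) @ \oo --> (0 : R).
Proof.
split=> [[a b]|h].
  apply: (@squeeze_cvgr _ _ _ _ (fun=> 0)
    (fun N => `|complex.Re (u N - l)| + `|complex.Im (u N - l)|)).
  - by apply: nearW => N; rewrite nc_ge0 nc_ReIm.
  - exact: cvg_cst.
  rewrite -[0](addr0 (0:R)) -[X in _ --> X + X](@normr0 R R).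
  apply: cvgD; apply: cvg_norm; under eq_fun do rewrite !ReImE; exact/subr_cvg0.
split; apply/subr_cvg0; apply: norm_cvg0;
  apply: (@squeeze_cvgr _ _ _ _ (fun=> 0) (fun N => nc (u N - l))) => //;
  try exact: cvg_cst; apply: nearW => N; rewrite normr_ge0 /=.
- by rewrite -ReN -ReD Re_nc.
- by rewrite -ImN -ImD Im_nc.
Qed.

Lemma cto_squeeze u l (e : nat -> R) : (forall N, nc (u N - l) <= e N) ->
  e @ \oo --> (0 : R) -> cto u l.
Proof.
move=> ue e0; apply/ctoP; apply: (@squeeze_cvgr _ _ _ _ (fun=> 0) e) => //.
  by apply: nearW => N; rewrite nc_ge0 ue.
exact: cvg_cst.
Qed.

Lemma cto_cst l : cto (fun=> l) l.
Proof. by split; exact: cvg_cst. Qed.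

Lemma ctoD u v l l' : cto u l -> cto v l' -> cto (fun N => u N + v N) (l + l').
Proof.
by move=> [a b] [a' b']; split; under eq_fun do rewrite ReImE;
  rewrite ReImE; exact: cvgD.
Qed.

Lemma ctoM u v l l' : cto u l -> cto v l' -> cto (fun N => u N * v N) (l * l').
Proof.
move=> [a b] [a' b']; split; under eq_fun do rewrite ReImE; rewrite ReImE.
  by apply: cvgB; exact: cvgM.
by apply: cvgD; exact: cvgM.
Qed.

Lemma ctoZ u l c : cto u l -> cto (fun N => c * u N) (c * l).
Proof. exact/ctoM/cto_cst. Qed.

Lemma cto_near u v l N0 : (forall N, (N0 <= N)%N -> u N = v N) -> cto u l -> cto v l.
Proof.
move=> uv [a b]; split.
  apply: cvg_trans a; apply: near_eq_cvg; near=> N.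
  by rewrite -uv //; near: N; exact: nbhs_infty_ge.
apply: cvg_trans b; apply: near_eq_cvg; near=> N.
by rewrite -uv //; near: N; exact: nbhs_infty_ge.
Unshelve. all: by end_near. Qed.

Lemma cto_sub u l (f : nat -> nat) : f @ \oo --> \oo -> cto u l -> cto (u \o f) l.
Proof.
by move=> fo [a b]; split; [apply: (cvg_comp _ _ fo a)|apply: (cvg_comp _ _ fo b)].
Qed.

Lemma cto_nc u l (B : R) : (forall N, nc (u N) <= B) -> cto u l -> nc l <= B.
Proof.
move=> uB /ctoP ul; have h : (fun N => nc (u N - l) + B) @ \oo --> 0 + B.
  by apply: cvgD => //; exact: cvg_cst.
rewrite -[B]add0r -(cvg_lim _ h) //; apply: limr_ge; first exact: cvgP h.
apply: nearW => N; rewrite -[l in leLHS](subrK (u N)) (le_trans (ncD _ _)) //.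
by rewrite lerD // -ncN opprB.
Qed.

Lemma csumE k (F : seq nat -> C) l : csum_to k F l -> csum k F = l.
Proof.
move=> [a b]; rewrite /csum (cvg_lim _ a) // (cvg_lim _ b) //.
by case: l {a b}.
Qed.

(** The bound on the sums of norms is kept beside the limit, because Cauchy products need it. *)
Definition asum u l : Prop :=
  (exists B : R, forall N : nat, \sum_(i < N) nc (u i) <= B) /\
  cto (fun N => \sum_(i < N) u i) l.

Lemma bounded_tail (g : nat -> R) (B : R) : (forall i, 0 <= g i) ->
  (forall N, \sum_(i < N) g i <= B) ->
  exists2 l : R, (fun N => \sum_(i < N) g i) @ \oo --> l &
    forall N, \sum_(i < N) g i <= l.
Proof.
move=> g0 gB.
have nd : nondecreasing_seq (fun N => \sum_(i < N) g i).
  move=> N N' NN'; rewrite -!(big_mkord xpredT g).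
  by rewrite (big_cat_nat (leq0n _) NN') /= lerDl sumr_ge0.
have cv : cvgn (fun N => \sum_(i < N) g i).
  by apply: nondecreasing_is_cvgn => //; exists B => _ [N _ <-].
exists (limn (fun N => \sum_(i < N) g i)) => // N.
exact: nondecreasing_cvgn_le.
Qed.

Lemma asum_unique u l l' : asum u l -> asum u l' -> l = l'.
Proof. by move=> [_ h] [_ h']; exact: cto_unique h h'. Qed.

Lemma asum_ex u (B : R) : (forall N, \sum_(i < N) nc (u i) <= B) ->
  exists l, asum u l.
Proof.
move=> uB.
have cv (g : nat -> R) : (forall i, `|g i| <= nc (u i)) ->
    cvgn (fun N => \sum_(i < N) g i).
  move=> gu; have -> : (fun N => \sum_(i < N) g i) = series (g : nat -> R^o).
    by apply/funext => N /=; rewrite -(big_mkord xpredT g).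
  apply: normed_cvg.
  have [|N|l hl _] := @bounded_tail (fun i => `|g i|) B; first by [].
    by apply: le_trans (uB N); exact: ler_sum.
  apply/cvg_ex; exists l.
  have <- : (fun N => \sum_(i < N) `|g i|) = [normed series (g : nat -> R^o)].
    by apply/funext => N /=; rewrite -(big_mkord xpredT (fun i => `|g i|)).
  exact: hl.
have hr : cvgn (fun N => \sum_(i < N) complex.Re (u i)).
  by apply: (cv (fun i => complex.Re (u i))) => i; exact: Re_nc.
have hi : cvgn (fun N => \sum_(i < N) complex.Im (u i)).
  by apply: (cv (fun i => complex.Im (u i))) => i; exact: Im_nc.
exists (limn (fun N => \sum_(i < N) complex.Re (u i)) +i*
        limn (fun N => \sum_(i < N) complex.Im (u i))).
split; first by exists B.
have Resum N : complex.Re (\sum_(i < N) u i) = \sum_(i < N) complex.Re (u i).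
  by elim/big_rec2: _ => // i y x _ <-; rewrite ReD.
have Imsum N : complex.Im (\sum_(i < N) u i) = \sum_(i < N) complex.Im (u i).
  by elim/big_rec2: _ => // i y x _ <-; rewrite ImD.
by split; [under eq_fun do rewrite Resum|under eq_fun do rewrite Imsum].
Qed.

Lemma asumD u v l l' : asum u l -> asum v l' -> asum (fun i => u i + v i) (l + l').
Proof.
move=> [[B uB] ul] [[B' vB] vl]; split.
  exists (B + B') => N; apply: le_trans (lerD (uB N) (vB N)).
  by rewrite -big_split ler_sum // => i _; exact: ncD.
by under eq_fun do rewrite big_split; exact: ctoD.
Qed.

Lemma asumZ u l c : asum u l -> asum (fun i => c * u i) (c * l).
Proof.
move=> [[B uB] ul]; split.
  exists (nc c * B) => N; under eq_bigr do rewrite ncM.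
  by rewrite -mulr_sumr ler_wpM2l // nc_ge0.
by under eq_fun do rewrite -mulr_sumr; exact: ctoZ.
Qed.

Lemma asum0 : asum (fun=> 0) 0.
Proof.
split; first by exists 0 => N; rewrite big1 // => i _; rewrite nc0.
by under eq_fun do rewrite big1 //; exact: cto_cst.
Qed.

Lemma asum_sum I (r : seq I) (P : pred I) (U : I -> nat -> C) (l : I -> C) :
  (forall i, P i -> asum (U i) (l i)) ->
  asum (fun N => \sum_(i <- r | P i) U i N) (\sum_(i <- r | P i) l i).
Proof.
move=> h; elim: r => [|i r IH].
  by under eq_fun do rewrite big_nil; rewrite big_nil; exact: asum0.
under eq_fun do rewrite big_cons; rewrite big_cons.
by case: ifP => // Pi; apply: asumD => //; exact: h.
Qed.

Lemma asum_shift u l : u 0%N = 0 -> asum u l -> asum (fun i => u i.+1) l.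
Proof.
move=> u0 [[B uB] ul]; split.
  by exists B => N; move: (uB N.+1); rewrite big_ord_recl u0 nc0 add0r.
have -> : (fun N => \sum_(i < N) u i.+1) = (fun N => \sum_(i < N) u i) \o S.
  by apply/funext => N; rewrite /= big_ord_recl u0 add0r.
by apply: cto_sub => //; move=> A [M _ MA]; exists M => // N /= MN; apply: MA; exact: ltnW.
Qed.

Lemma sum_triangle (V : nmodType) (f : nat -> nat -> V) N :
  \sum_(m < N) \sum_(i < m.+1) f i (m - i)%N =
  \sum_(i < N) \sum_(j < N | (i + j < N)%N) f i j.
Proof.
have -> : \sum_(m < N) \sum_(i < m.+1) f i (m - i)%N =
    \sum_(m < N) \sum_(i < N | (i <= m)%N) f i (m - i)%N.
  apply: eq_bigr => m _; rewrite (big_ord_widen N (fun i => f i (m - i)%N)) //.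
rewrite (exchange_big_dep xpredT) //=; apply: eq_bigr => i _.
have -> : \sum_(j < N | (i + j < N)%N) f i j = \sum_(j < N - i) f i j.
  rewrite (big_ord_widen N (f i)) ?leq_subr //; apply: eq_bigl => j.
  by rewrite ltn_subRL.
rewrite -(big_mkord (fun m => i <= m)%N (fun m => f i (m - i)%N)).
rewrite -(big_nat_widenl i 0 N xpredT) // -{1}[nat_of_ord i]add0n big_addn big_mkord.
by apply: eq_bigr => j _; rewrite addnK.
Qed.

(** The triangle i + j < N contains the square of side N / 2. So the part of the square of side N
    outside the triangle is dominated by [G N * H N - G N./2 * H N./2], a difference of two
    sequences with the same limit. *)
Lemma asum_cauchy u v l l' : asum u l -> asum v l' ->
  asum (fun m => \sum_(i < m.+1) u i * v (m - i)%N) (l * l').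
Proof.
move=> [[B uB] ul] [[B' vB] vl].
pose g i := nc (u i); pose h i := nc (v i).
have g0 i : 0 <= g i by exact: nc_ge0.
have h0 i : 0 <= h i by exact: nc_ge0.
pose G N := \sum_(i < N) g i; pose H N := \sum_(i < N) h i.
have [lg gl gle] := bounded_tail g0 uB; have [lh hl hle] := bounded_tail h0 vB.
have GH N : \sum_(i < N) \sum_(j < N) g i * h j = G N * H N.
  by rewrite mulr_suml; apply: eq_bigr => i _; rewrite mulr_sumr.
split.
  exists (lg * lh) => N; apply: (@le_trans _ _ (G N * H N)); last first.
    by apply: ler_pM; rewrite ?sumr_ge0 ?gle ?hle.
  rewrite -GH; apply: (@le_trans _ _ (\sum_(m < N) \sum_(i < m.+1) g i * h (m - i)%N)).
    apply: ler_sum => m _; apply: le_trans (nc_sum _ _ _) _.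
    by apply: ler_sum => i _; rewrite ncM.
  rewrite (sum_triangle (fun i j => g i * h j)); apply: ler_sum => i _.
  by rewrite [leRHS](bigID (fun j : 'I_N => (i + j < N)%N)) /= lerDl sumr_ge0 // => j _; exact: mulr_ge0.
pose A N := \sum_(i < N) u i; pose A' N := \sum_(i < N) v i.
have AA : cto (fun N => A N * A' N) (l * l') by exact: ctoM.
have half : (fun N => N./2) @ \oo --> \oo.
  move=> E [M _ ME]; exists M.*2 => // N /= MN; apply: ME => /=.
  by rewrite -(doubleK M) half_leq.
have EC : (fun N => G N * H N - G N./2 * H N./2) @ \oo --> (0 : R).
  rewrite -(subrr (lg * lh)); apply: cvgB; first exact: cvgM.
  by apply: cvgM; [exact: (cvg_comp _ _ half gl)|exact: (cvg_comp _ _ half hl)].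
have -> : (fun N => \sum_(m < N) \sum_(i < m.+1) u i * v (m - i)%N) =
    (fun N => A N * A' N + - (\sum_(i < N) \sum_(j < N | ~~ (i + j < N)%N) u i * v j)).
  apply/funext => N; rewrite (sum_triangle (fun i j => u i * v j)) mulr_suml.
  apply/esym/eqP; rewrite subr_eq -big_split; apply/eqP; apply: eq_bigr => i _.
  by rewrite mulr_sumr (bigID (fun j : 'I_N => (i + j < N)%N)).
rewrite -[l * l']addr0; apply: ctoD => //.
apply: (cto_squeeze _ EC) => N; rewrite subr0 ncN.
apply: (@le_trans _ _ (\sum_(i < N) \sum_(j < N | ~~ (i + j < N)%N) g i * h j)).
  apply: le_trans (nc_sum _ _ _) _; apply: ler_sum => i _.
  by apply: le_trans (nc_sum _ _ _) _; apply: ler_sum => j _; rewrite ncM.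
rewrite lerBrDr -!GH.
have -> : \sum_(i < N) \sum_(j < N) g i * h j =
    \sum_(i < N) \sum_(j < N | ~~ (i + j < N)%N) g i * h j +
    \sum_(i < N) \sum_(j < N | (i + j < N)%N) g i * h j.
  rewrite -big_split; apply: eq_bigr => i _.
  by rewrite (bigID (fun j : 'I_N => (i + j < N)%N)) [RHS]addrC.
rewrite lerD2l; have N2 : (N./2 <= N)%N by rewrite -{2}(odd_double_half N); lia.
rewrite (big_ord_widen N (fun i => \sum_(j < N./2) g i * h j)) //.
rewrite [leRHS](bigID (fun i : 'I_N => (i < N./2)%N)) /= ler_wpDr //.
  by apply: sumr_ge0 => i _; apply: sumr_ge0 => j _; exact: mulr_ge0.
apply: ler_sum => i iN; rewrite (big_ord_widen N (fun j => g i * h j)) //.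
rewrite big_mkcond [leRHS]big_mkcond; apply: ler_sum => j _.
case: ifP => jN; last by case: ifP => // _; exact: mulr_ge0.
by rewrite ifT //; have := odd_double_half N; lia.
Qed.

End ComplexLimits.

(** * Cubes and simplices of exponents *)

Section Cubes.
Local Open Scope nat_scope.

Fixpoint degs (k d : nat) : seq (seq nat) :=
  if k is k'.+1 then
    flatten [seq [seq i :: e | e <- degs k' (d - i)] | i <- iota 0 d.+1]
  else if d is 0 then [:: [::]] else [::].

Arguments degs : simpl never.

Lemma mem_degs k d e : (e \in degs k d) = (size e == k) && (sumn e == d).
Proof.
elim: k d e => [|k IH] d e; first by case: d => [|d]; case: e.
rewrite /degs -/degs.
apply/flattenP/idP => [[_ /mapP[i + ->] /mapP[e' + ->]]|].
  rewrite mem_iota add0n ltnS IH /= => id /andP[/eqP-> /eqP->].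
  by rewrite subnKC ?eqxx.
case: e => [//|i e] /= /andP[se /eqP ed].
exists [seq i :: e' | e' <- degs k (d - i)].
  have im : i \in iota 0 d.+1 by rewrite mem_iota -ed; lia.
  exact: (map_f (fun i => [seq i :: e' | e' <- degs k (d - i)]) im).
by rewrite map_f // IH -eqSS se -ed addKn eqxx.
Qed.

Lemma degs_uniq k d : uniq (degs k d).
Proof.
elim: k d => [|k IH] d; first by case: d.
rewrite /degs -/degs; elim: (iota 0 d.+1) (iota_uniq 0 d.+1) => //= i s IHs /andP[is_ us].
rewrite cat_uniq IHs // andbT map_inj_uniq ?IH => [|e e' []] //=.
apply/hasPn => e /flattenP[_ /mapP[j js ->] /mapP[e' _ ->]].
by apply/mapP => -[e'' _ [ij _]]; rewrite -ij js in is_.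
Qed.

Definition cubes k N : seq (seq nat) :=
  [seq map val (val e) | e <- enum {: k.-tuple 'I_N}].

Lemma mem_cubes k N e : (e \in cubes k N) = (size e == k) && all (ltn^~ N) e.
Proof.
apply/mapP/andP => [[t _ ->]|[/eqP se eN]].
  rewrite size_map size_tuple eqxx; split=> //.
  by apply/allP => _ /mapP[i _ ->] /=.
case: N eN => [|N] eN.
  have e0 : e = [::] by case: e eN {se}.
  by move: se; rewrite e0 => <-; exists [tuple] => //; rewrite mem_enum.
have st : size (map (@inord N) e) == k by rewrite size_map se.
exists (Tuple st); rewrite ?mem_enum //= -map_comp map_id_in // => i ie /=.
by rewrite inordK //; exact: (allP eN).
Qed.

Lemma cubes_uniq k N : uniq (cubes k N).
Proof.
rewrite map_inj_uniq ?enum_uniq // => t t' h.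
by apply/val_inj/(inj_map val_inj).
Qed.

Lemma sum_cubes (V : nmodType) k N (P : pred (seq nat)) (F : seq nat -> V) :
  (\sum_(e : k.-tuple 'I_N | P (map val e)) F (map val e) =
   \sum_(e <- cubes k N | P e) F e)%R.
Proof. by rewrite big_map big_enum_cond. Qed.

Lemma sum_degs_cubes (V : nmodType) k d N (F : seq nat -> V) : d < N ->
  (\sum_(e <- degs k d) F e = \sum_(e <- cubes k N | sumn e == d) F e)%R.
Proof.
move=> dN; rewrite -[RHS]big_filter; apply: perm_big; apply: uniq_perm.
- exact: degs_uniq.
- by rewrite filter_uniq // cubes_uniq.
move=> e; rewrite mem_filter mem_degs mem_cubes andbC.
case: (sumn e =P d) => //= ed; case: (size e == k) => //=.
apply/esym/allP => i ie /=; apply: leq_ltn_trans dN; rewrite -ed.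
by elim: e ie {ed} => //= j e IH; rewrite in_cons => /orP[/eqP->|/IH h]; lia.
Qed.

Lemma sum_simplex (V : nmodType) k M N (F : seq nat -> V) : M <= N ->
  (\sum_(d < M) \sum_(e <- degs k d) F e =
   \sum_(e <- cubes k N | (sumn e < M)%N) F e)%R.
Proof.
move=> MN.
under eq_bigr => d _ do rewrite (sum_degs_cubes k F (leq_trans (ltn_ord d) MN)).
rewrite (exchange_big_dep (fun e => sumn e < M)) /=.
  by apply: eq_bigr => e eM; rewrite (big_pred1 (Ordinal eM)).
by move=> d e _ /eqP->.
Qed.

Lemma sum_degsS (V : nmodType) k d (F : seq nat -> V) :
  (\sum_(e <- degs k.+1 d) F e =
   \sum_(i < d.+1) \sum_(e <- degs k (d - i)%N) F (nat_of_ord i :: e))%R.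
Proof.
rewrite /degs -/degs big_flatten big_map -{1}[d.+1]subn0 -/(index_iota 0 d.+1).
by rewrite big_mkord; apply: eq_bigr => i _; rewrite big_map.
Qed.

(** A tuple of exponents of total degree d and a word of length d + size s are the same datum. This
    passes from [weave], in which the operations are defined, to [words], which can be cut and
    merged. *)
Lemma sum_degs_weave (V : nmodType) (T : Type) (b : T) s d (Psi : seq T -> V) :
  (\sum_(e <- degs (size s).+1 d) Psi (weave e b s) =
   \sum_(w <- words (d + size s)%N b s) Psi w)%R.
Proof.
elim: s b d Psi => [|[a b'] s IH] b d Psi.
  rewrite addn0 /=; elim: d Psi => [|d IHd] Psi.
    by rewrite sum_degsS big_ord1 sum_words0 big_seq1.
  rewrite sum_wordsS -(IHd (fun w => Psi (b :: w))) !sum_degsS big_ord_recl.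
  by rewrite subn0 [degs 0 _]/degs big_nil add0r addr0.
elim: d Psi => [|d IHd] Psi /=; rewrite sum_degsS big_ord_recl subn0 /=.
  rewrite big_ord0 addr0 (IH b' 0 (fun w => Psi (a :: w))) sum_wordsS.
  by rewrite [words _ b _]words_short //= big_nil add0r.
rewrite (IH b' d.+1 (fun w => Psi (a :: w))) [in RHS]addSn [RHS]sum_wordsS addrC.
congr (_ + _)%R; last by rewrite addSnnS.
by rewrite -(IHd (fun w => Psi (b :: w))) sum_degsS.
Qed.

End Cubes.

Arguments degs : simpl never.

Section CubeLimits.
Variables (R : realType) (k : nat) (F : seq nat -> R[i]).
Hypothesis Fb : exists B : R, forall N : nat,
  \sum_(e : k.-tuple 'I_N) nc (F (map val e)) <= B.

(** The cube of side N contains the simplex of exponents of sum below N and lies in the simplex of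
    sum at most k N. Hence cube sums and simplex sums differ by at most a tail of an absolutely
    convergent series. *)
Lemma csum_degs : exists l : R[i],
  csum_to k F l /\ asum (fun d => \sum_(e <- degs k d) F e) l.
Proof.
have [B FB] := Fb.
pose g d := \sum_(e <- degs k d) nc (F e).
have g0 d : 0 <= g d by apply: sumr_ge0 => e _; exact: nc_ge0.
have gB N : \sum_(d < N) g d <= B.
  rewrite (sum_simplex k (fun e => nc (F e)) (leqnn N)); apply: le_trans (FB N).
  rewrite (sum_cubes k N xpredT (fun e => nc (F e))).
  by rewrite [leRHS](bigID (fun e => (sumn e < N)%N)) /= lerDl sumr_ge0 // => e _; exact: nc_ge0.
have [l hl] : exists l, asum (fun d => \sum_(e <- degs k d) F e) l.
  apply: (@asum_ex _ _ B) => N; apply: le_trans (gB N).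
  by apply: ler_sum => d _; exact: nc_sum.
exists l; split=> //.
have [lg cg gl] := bounded_tail g0 gB.
have EC : (fun N => lg - \sum_(d < N) g d) @ \oo --> (0 : R).
  by rewrite -{2}(subrr lg); apply: (cvgB (cvg_cst lg) cg).
suff h : cto (fun N => cpart k F N - \sum_(d < N) \sum_(e <- degs k d) F e) 0.
  have := ctoD h hl.2; rewrite add0r; apply: (@cto_near _ _ _ _ 0) => N _.
  by rewrite subrK.
apply: (cto_squeeze _ EC) => N; rewrite subr0.
rewrite (sum_simplex k F (leqnn N)) /cpart (sum_cubes k N xpredT F).
rewrite [X in nc (X - _)](bigID (fun e => (sumn e < N)%N)) /= addrAC subrr add0r.
apply: le_trans (nc_sum _ _ _) _; rewrite lerBrDr.
rewrite (sum_simplex k (fun e => nc (F e)) (leqnn N)) addrC.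
rewrite -(bigID (fun e => (sumn e < N)%N) xpredT (fun e => nc (F e))).
apply: le_trans (gl (k * N).+1).
rewrite (sum_simplex k (fun e => nc (F e)) (leq_addr N _)).
rewrite -big_filter -[leRHS]big_filter.
have sub : {subset cubes k N <= [seq e <- cubes k ((k * N).+1 + N) | (sumn e < (k * N).+1)%N]}.
  move=> e; rewrite mem_filter !mem_cubes => /andP[/eqP <- eN]; rewrite eqxx /=.
  apply/andP; split; last by apply/allP => i /(allP eN) /= iN; exact: leq_trans iN (leq_addl _ _).
  rewrite ltnS; elim: e eN => //= i e IH /andP[iN /IH h].
  by rewrite mulSn leq_add // ltnW.
rewrite filter_predT.
pose s2 := [seq e <- cubes k ((k * N).+1 + N) | (sumn e < (k * N).+1)%N].
rewrite -/s2 in sub *; set s1 := cubes k N in sub *.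
have us1 : uniq s1 by exact: cubes_uniq.
have us2 : uniq s2 by rewrite filter_uniq // cubes_uniq.
rewrite [leRHS](bigID (fun e => e \in s1)) /=.
have -> : \sum_(e <- s2 | e \in s1) nc (F e) = \sum_(e <- s1) nc (F e).
  rewrite -big_filter; apply: perm_big; apply: uniq_perm => //.
    by rewrite filter_uniq.
  by move=> e; rewrite mem_filter andb_idr // => /sub.
by rewrite lerDl sumr_ge0 // => e _; exact: nc_ge0.
Qed.

End CubeLimits.

(** * The Novikov ring *)

Section Novikov.
Variables (R : realType) (n : nat) (D : fukaya_data R n).
Local Notation C := R[i].
Local Notation G := (cls D).

(** By Gromov compactness there are only finitely many classes below any energy. *)
Lemma novikov_true (S : set G) : novikov S.
Proof. by move=> E; apply: sub_finite_set (energy_finite D E) => b []. Qed.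

(** Energies are non-negative and additive, so both parts have energy at most that of g. *)
Lemma dec_finite (g : G) : finite_set [set bb : G * G | bb.1 + bb.2 = g].
Proof.
apply: (@sub_finite_set _ _ ([set b | energy b <= energy g] `*` [set b | energy b <= energy g])).
  by move=> [b c] /= <-; rewrite energyD; split => /=;
    rewrite ?lerDl ?lerDr energy_ge0.
by apply: finite_setX; exact: energy_finite.
Qed.

Definition dec (g : G) : seq (G * G) :=
  enum_fset (fset_set [set bb : G * G | bb.1 + bb.2 = g]).

Lemma dec_uniq g : uniq (dec g).
Proof. exact: fset_uniq. Qed.

Lemma mem_dec g bb : (bb \in dec g) = (bb.1 + bb.2 == g).
Proof.
rewrite /dec -[LHS]/(bb \in fset_set _) in_fset_set; last exact: dec_finite.
by apply/idP/eqP => [/set_mem//|h]; exact/mem_set.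
Qed.

Lemma fsbig_dec (V : nmodType) g (F : G * G -> V) :
  \sum_(bb \in [set bb : G * G | bb.1 + bb.2 = g]) F bb = \sum_(bb <- dec g) F bb.
Proof. by rewrite fsbig_finite //; exact: dec_finite. Qed.

Lemma dec0 : dec 0 = [:: (0, 0)].
Proof.
have mem bb : (bb \in dec 0) = (bb == (0, 0)).
  rewrite mem_dec; case: bb => b c /=; apply/eqP/eqP => [h|[-> ->]]; last exact: addr0.
  have := energyD b c; rewrite h energy_0 => e.
  have b0 := energy_ge0 b; have c0 := energy_ge0 c.
  have -> : b = 0 by apply: energy_eq0; lra.
  have -> : c = 0 by apply: energy_eq0; lra.
  by [].
apply: perm_small_eq => //; apply: uniq_perm => //; first exact: dec_uniq.
by move=> bb; rewrite mem inE.
Qed.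

(** Both sides run over the ordered triples of classes with sum g; this is associativity of
    convolution. *)
Lemma sum_dec3 (V : nmodType) g (F : G -> G -> G -> V) :
  \sum_(bb <- dec g) \sum_(cc <- dec bb.1) F cc.1 cc.2 bb.2 =
  \sum_(bb <- dec g) \sum_(cc <- dec bb.2) F bb.1 cc.1 cc.2.
Proof.
pose r1 := [seq (cc.1, cc.2, bb.2) | bb <- dec g, cc <- dec bb.1].
pose r2 := [seq (bb.1, cc.1, cc.2) | bb <- dec g, cc <- dec bb.2].
pose F' (t : G * G * G) := F t.1.1 t.1.2 t.2.
suff : \sum_(t <- r1) F' t = \sum_(t <- r2) F' t by rewrite !big_allpairs_dep.
have uq (f : G * G -> G * G -> G * G * G) (p : G * G -> G) :
    (forall b c b' c', c \in dec (p b) -> c' \in dec (p b') -> f b c = f b' c' ->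
      b = b' /\ c = c') ->
    uniq [seq f bb cc | bb <- dec g, cc <- dec (p bb)].
  move=> inj; apply: allpairs_uniq_dep => [|bb _|]; try exact: dec_uniq.
  move=> _ _ /allpairsPdep[b [c [_ hc ->]]] /allpairsPdep[b' [c' [_ hc' ->]]] /= e.
  by have [-> ->] := inj _ _ _ _ hc hc' e.
apply: perm_big; apply: uniq_perm.
- apply: (uq (fun bb cc => (cc.1, cc.2, bb.2)) fst) => -[b1 b2] [c1 c2] [d1 d2] [e1 e2] /=.
  by rewrite !mem_dec /= => /eqP <- /eqP <- [-> -> ->].
- apply: (uq (fun bb cc => (bb.1, cc.1, cc.2)) snd) => -[b1 b2] [c1 c2] [d1 d2] [e1 e2] /=.
  by rewrite !mem_dec /= => /eqP <- /eqP <- [-> -> ->].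
move=> [[a b] c]; apply/allpairsPdep/allpairsPdep => -[[x y] [[x' y'] []]];
  rewrite !mem_dec /= => /eqP h1 /eqP h2 [-> -> ->].
- by exists (x', y' + y), (y', y); rewrite !mem_dec /= !eqxx -h1 -h2 addrA eqxx.
- by exists (x + x', y'), (x, x'); rewrite !mem_dec /= !eqxx -h1 -h2 addrA eqxx.
Qed.

Lemma sum_decC (V : nmodType) g (F : G -> G -> V) :
  \sum_(bb <- dec g) F bb.1 bb.2 = \sum_(bb <- dec g) F bb.2 bb.1.
Proof.
pose sw (bb : G * G) := (bb.2, bb.1).
have -> : \sum_(bb <- dec g) F bb.1 bb.2 = \sum_(bb <- map sw (dec g)) F bb.1 bb.2.
  apply: perm_big; apply: uniq_perm; first exact: dec_uniq.
    by rewrite map_inj_uniq ?dec_uniq // => -[b c] [b' c'] [-> ->].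
  move=> [b c]; apply/idP/mapP => [h|[[b' c'] h [-> ->]]].
    by exists (c, b) => //; move: h; rewrite !mem_dec /= addrC.
  by move: h; rewrite !mem_dec /= addrC.
by rewrite big_map.
Qed.

(** A synonym carrying the convolution product, which keeps it apart from the pointwise product of
    functions. *)
Definition nov : Type := G -> C.
HB.instance Definition _ := GRing.Zmodule.copy nov (G -> C).

Implicit Types x y z : nov.

Definition nmul x y : nov := fun g => \sum_(bb <- dec g) x bb.1 * y bb.2.
Definition none : nov := fun g => (g == 0)%:R.

Lemma nmulA : associative nmul.
Proof.
move=> x y z; apply/funext => g; rewrite /nmul.
under eq_bigr => bb _ do rewrite mulr_sumr.
under [RHS]eq_bigr => bb _ do rewrite mulr_suml.
rewrite (sum_dec3 g (fun a b c => x a * y b * z c)).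
by apply: eq_bigr => bb _; apply: eq_bigr => cc _; rewrite mulrA.
Qed.

Lemma nmulC : commutative nmul.
Proof.
move=> x y; apply/funext => g; rewrite /nmul (sum_decC g (fun a b => x a * y b)).
by apply: eq_bigr => bb _; rewrite mulrC.
Qed.

Lemma sum_dec_delta (V : nmodType) g (F : G -> V) :
  \sum_(bb <- dec g | bb.1 == 0) F bb.2 = F g.
Proof.
rewrite -big_filter (_ : seq.filter _ _ = [:: (0, g)]) ?big_seq1 //.
apply: perm_small_eq => //; apply: uniq_perm => //; first by rewrite filter_uniq ?dec_uniq.
move=> [b c]; rewrite mem_filter mem_dec inE xpair_eqE /=.
by case: eqP => //= ->; rewrite add0r.
Qed.

Lemma nmul1 : left_id none nmul.
Proof.
move=> x; apply/funext => g; rewrite /nmul /none -[RHS](sum_dec_delta g x).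
rewrite [RHS]big_mkcond; apply: eq_bigr => bb _.
by case: eqP; rewrite ?mul1r ?mul0r.
Qed.

Lemma nmulDl : left_distributive nmul +%R.
Proof.
move=> x y z; apply/funext => g; rewrite /nmul [RHS]/GRing.add /= -big_split.
by apply: eq_bigr => bb _; exact: mulrDl.
Qed.

Lemma none_neq0 : none != 0.
Proof.
apply/eqP => /(congr1 (fun x : nov => x 0)); rewrite /none eqxx => /eqP.
by rewrite oner_eq0.
Qed.

HB.instance Definition _ :=
  GRing.Zmodule_isComNzRing.Build nov nmulA nmulC nmul1 nmulDl none_neq0.

Lemma novM x y g : (x * y) g = \sum_(bb <- dec g) x bb.1 * y bb.2.
Proof. by []. Qed.

Lemma novD x y g : (x + y) g = x g + y g.
Proof. by []. Qed.

Lemma novN x g : (- x) g = - x g.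
Proof. by []. Qed.

Lemma nov0 g : (0 : nov) g = 0.
Proof. by []. Qed.

Lemma nov1 g : (1 : nov) g = (g == 0)%:R.
Proof. by []. Qed.

Lemma nov_sum I (r : seq I) (P : pred I) (F : I -> nov) g :
  (\sum_(i <- r | P i) F i) g = \sum_(i <- r | P i) F i g.
Proof. by elim/big_rec2: _ => // i y z _ <-. Qed.

Lemma nov_sgnM k x g : ((-1) ^+ k * x) g = (-1) ^+ k * x g.
Proof.
elim: k => [|k IH]; first by rewrite !expr0 !mul1r.
by rewrite !exprS !mulN1r !mulNr novN IH.
Qed.

Lemma nov_at0 x y : (x * y) 0 = x 0 * y 0.
Proof. by rewrite novM dec0 big_seq1. Qed.

Definition ncst (c : C) : nov := fun g => c * (g == 0)%:R.

Lemma ncstM c x g : (ncst c * x) g = c * x g.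
Proof.
rewrite novM -[X in _ = c * X](sum_dec_delta g x) mulr_sumr [RHS]big_mkcond.
by apply: eq_bigr => bb _; rewrite /ncst; case: eqP; rewrite ?mulr1 ?mulr0 ?mul0r.
Qed.

End Novikov.

Arguments dec {R n D} g.

(** * The A-infinity operations in coordinates *)

Section Multilinear.
Variables (R : realType) (n : nat) (D : fukaya_data R n).
Local Notation C := R[i].
Local Notation G := (cls D).
Local Notation H := ({set 'I_n} -> C).
Local Notation Lm := ({set 'I_n} -> nov D).
Local Notation eb := (@ebasis R n).

Definition lc (a : Lcrd D -> C) : Lm := fun J b => a (J, b).
Definition LE (J : {set 'I_n}) : Lm := fun K => (K == J)%:R.
Definition lsc (x : nov D) (a : Lm) : Lm := fun J => x * a J.
Definition lks (a : Lm) : Lm := fun J => (-1) ^+ #|J|.+1 * a J.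

Definition sdisk (Js : seq {set 'I_n}) : Lm := fun K g => disk_op g (map eb Js) K.

(* the operations m_k in terms of their structure constants on the basis *)
Fixpoint LB (acc : seq {set 'I_n}) (s : seq Lm) : Lm :=
  if s is a :: s' then fun K => \sum_J a J * LB (rcons acc J) s' K else sdisk acc.

Lemma lmE (a b : Lm) J : (a + b) J = a J + b J. Proof. by []. Qed.
Lemma lm0E J : (0 : Lm) J = 0. Proof. by []. Qed.

Lemma lm_sum I (r : seq I) (P : pred I) (F : I -> Lm) J :
  (\sum_(i <- r | P i) F i) J = \sum_(i <- r | P i) F i J.
Proof. by elim/big_rec2: _ => // i y z _ <-. Qed.

Lemma sum_LE (F : {set 'I_n} -> nov D) J : \sum_K LE J K * F K = F J.
Proof.
rewrite (bigD1 J) //= /LE eqxx mul1r big1 ?addr0 // => K /negbTE ->.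
by rewrite mul0r.
Qed.

Lemma lm_expand (a : Lm) : a = \sum_J lsc (a J) (LE J).
Proof.
apply/funext => K; rewrite lm_sum -[LHS](sum_LE a) /lsc.
by apply: eq_bigr => J _; rewrite /LE eq_sym mulrC.
Qed.

Definition lin (f : Lm -> Lm) := forall x a a', f (lsc x a + a') = lsc x (f a) + f a'.

Lemma lin0 f : lin f -> f 0 = 0.
Proof.
move=> h; have z (a : Lm) : lsc (-1) a + a = 0.
  by apply/funext => J; rewrite lmE /lsc mulN1r addNr.
by rewrite -{1}(z 0) h z.
Qed.

Lemma lin_sum f I (r : seq I) (P : pred I) (x : I -> nov D) (a : I -> Lm) : lin f ->
  f (\sum_(i <- r | P i) lsc (x i) (a i)) = \sum_(i <- r | P i) lsc (x i) (f (a i)).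
Proof.
move=> h; elim: r => [|i r IH]; first by rewrite !big_nil (lin0 h).
by rewrite !big_cons; case: ifP => // _; rewrite h IH.
Qed.

Lemma lin_expand f a K : lin f -> f a K = \sum_J a J * f (LE J) K.
Proof. by move=> h; rewrite {1}(lm_expand a) lin_sum // lm_sum. Qed.

Lemma linZ f x a : lin f -> f (lsc x a) = lsc x (f a).
Proof. by move=> h; have := h x a 0; rewrite (lin0 h) !addr0. Qed.

Lemma lsc1 a : lsc 1 a = a.
Proof. by apply/funext => J; rewrite /lsc mul1r. Qed.

Lemma linD f a a' : lin f -> f (a + a') = f a + f a'.
Proof. by move=> h; have := h 1 a a'; rewrite !lsc1. Qed.

Lemma lin_add f g : lin f -> lin g -> lin (fun a => f a + g a).
Proof.
move=> hf hg x a a'; rewrite hf hg addrACA; congr (_ + _).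
by apply/funext => J; rewrite lmE /lsc -mulrDr.
Qed.

Lemma LB_lin acc s1 s2 : lin (fun a => LB acc (s1 ++ a :: s2)).
Proof.
move=> x a a'; elim: s1 acc => [|a1 s1 IH] acc /=; apply/funext => K; rewrite lmE /lsc.
  rewrite mulr_sumr -big_split; apply: eq_bigr => J _ /=.
  by rewrite mulrDl mulrA.
rewrite mulr_sumr -big_split; apply: eq_bigr => J _ /=.
by rewrite IH lmE mulrDr /lsc mulrCA.
Qed.

Lemma LB_LE acc J s : LB acc (LE J :: s) = LB (rcons acc J) s.
Proof. by apply/funext => K; rewrite /= (sum_LE (fun J => LB (rcons acc J) s K)). Qed.

Lemma LB_map acc Js s : LB acc (map LE Js ++ s) = LB (acc ++ Js) s.
Proof.
elim: Js acc => [|J Js IH] acc; first by rewrite cats0.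
by rewrite map_cons cat_cons LB_LE IH cat_rcons.
Qed.

Lemma LB_basis Js : LB [::] (map LE Js) = sdisk Js.
Proof. by rewrite -[map LE Js]cats0 LB_map. Qed.

Lemma disk_lin b s1 s2 c a a' K :
  disk_op (f:=D) b (s1 ++ (zscale c a + a') :: s2) K =
  c * disk_op b (s1 ++ a :: s2) K + disk_op b (s1 ++ a' :: s2) K.
Proof. by rewrite m_linear. Qed.

Lemma disk_expand b s1 s2 (a : H) K :
  disk_op (f:=D) b (s1 ++ a :: s2) K = \sum_J a J * disk_op b (s1 ++ eb J :: s2) K.
Proof.
have disk0 : disk_op (f:=D) b (s1 ++ 0 :: s2) K = 0.
  have := disk_lin b s1 s2 (-1) 0 0 K; rewrite mulN1r addNr.
  by have -> : zscale (-1) (0 : H) + 0 = 0 by apply/funext => J; rewrite /zscale addr0 mulr0.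
have -> : a = \sum_J zscale (a J) (eb J).
  apply/funext => J; rewrite (_ : (\sum_I _) J = \sum_I zscale (a I) (eb I) J); last first.
    by elim/big_rec2: _ => // i y z _ <-.
  rewrite (bigD1 J) //= /zscale /ebasis eqxx mulr1 big1 ?addr0 // => I.
  by rewrite eq_sym => /negbTE ->; rewrite mulr0.
rewrite [LHS](_ : _ = \sum_J a J * disk_op b (s1 ++ eb J :: s2) K).
  apply: eq_bigr => J _; congr (_ * _).
  rewrite (_ : (\sum_I _) J = \sum_I zscale (a I) (eb I) J); last first.
    by elim/big_rec2: _ => // i y z _ <-.
  rewrite (bigD1 J) //= /zscale /ebasis eqxx mulr1 big1 ?addr0 // => I.
  by rewrite eq_sym => /negbTE ->; rewrite mulr0.
elim: (index_enum _) => [|J r IH]; first by rewrite !big_nil.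
by rewrite !big_cons disk_lin IH.
Qed.

(** Intermediate between the sum over tuples of classes in [Lop] and the basis expansion [LB]: the
    accumulator holds the complex components already extracted from the inputs, and the remaining
    class is distributed input by input. *)
Fixpoint Lrec (acc : seq H) (s : seq Lm) : G -> H :=
  if s is a :: s' then
    fun g K => \sum_(bb <- dec g) Lrec (rcons acc (fun J => a J bb.1)) s' bb.2 K
  else fun g => disk_op g acc.

Lemma LrecS acc a s g K :
  Lrec acc (a :: s) g K = \sum_(bb <- dec g) Lrec (rcons acc (fun J => a J bb.1)) s bb.2 K.
Proof. by []. Qed.

Lemma Lrec_expand acc1 acc2 h s g K :
  Lrec (acc1 ++ h :: acc2) s g K = \sum_J h J * Lrec (acc1 ++ eb J :: acc2) s g K.
Proof.
elim: s acc2 g => [|a s IH] acc2 g /=; first exact: disk_expand.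
under eq_bigr => bb _ do rewrite rcons_cat rcons_cons IH.
rewrite exchange_big; apply: eq_bigr => J _; rewrite mulr_sumr.
by apply: eq_bigr => bb _; rewrite rcons_cat rcons_cons.
Qed.

Lemma LrecE acc s g K : Lrec (map eb acc) s g K = LB acc s K g.
Proof.
elim: s acc g => [|a s IH] acc g //=; rewrite nov_sum.
under eq_bigr => bb _ do rewrite -cats1 Lrec_expand.
rewrite exchange_big; apply: eq_bigr => J _; rewrite novM.
by apply: eq_bigr => bb _; rewrite cats1 -map_rcons IH.
Qed.

(** Pairs of the class b_0 of the disk, which is what remains at the end, and the classes b_1, ..,
    b_k of the inputs. *)
Fixpoint tups k (g : G) : seq (G * seq G) :=
  if k is k'.+1 then [seq (l.1, bb.1 :: l.2) | bb <- dec g, l <- tups k' bb.2]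
  else [:: (g, [::])].

Lemma tupsS k g :
  tups k.+1 g = [seq (l.1, bb.1 :: l.2) | bb <- dec g, l <- tups k bb.2].
Proof. by []. Qed.

Lemma mem_tups k g l :
  (l \in tups k g) = (size l.2 == k) && (l.1 + \sum_(b <- l.2) b == g).
Proof.
elim: k g l => [|k IH] g [b l] /=.
  rewrite inE xpair_eqE /=; case: l => [|? ?] //=; last by rewrite andbF.
  by rewrite big_nil addr0 andbT.
apply/allpairsPdep/andP => [[bb [[b' l'] [hbb]]]|[]].
  rewrite IH /= => /andP[/eqP sl /eqP hl] [-> ->]; rewrite /= sl eqxx; split=> //.
  by move: hbb; rewrite mem_dec => /eqP <-; rewrite big_cons addrCA hl.
case: l => [//|c l] /= sl hl; exists (c, b + \sum_(i <- l) i), (b, l).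
rewrite mem_dec IH /= -eqSS sl !eqxx; split=> //.
by rewrite -(eqP hl) big_cons addrCA.
Qed.

Lemma tups_uniq k g : uniq (tups k g).
Proof.
elim: k g => [//|k IH] g; apply: allpairs_uniq_dep => [|bb _|].
- exact: dec_uniq.
- exact: IH.
move=> _ _ /allpairsPdep[[b c] [l [hb hl ->]]] /allpairsPdep[[b' c'] [l' [hb' hl' ->]]] /= [e1 e2 e3].
have ll : l = l' by case: l l' e1 e3 {hl hl'} => [? ?] [? ?] /= -> ->.
move: hl hl'; rewrite ll e2 !mem_tups => /andP[_ /eqP h] /andP[_ /eqP h'].
by move: h; rewrite h' /= => ->.
Qed.

Lemma tuple_sum k g (Phi : G -> seq G -> C) :
  \sum_(bs \in [set bs : k.+1.-tuple G | \sum_(b <- bs) b = g]) Phi (thead bs) (behead bs) =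
  \sum_(l <- tups k g) Phi l.1 l.2.
Proof.
pose r := pmap (insub : seq G -> option (k.+1.-tuple G)) [seq l.1 :: l.2 | l <- tups k g].
have ur : uniq r.
  apply: (pmap_uniq (insubK _)); rewrite map_inj_uniq ?tups_uniq //.
  by move=> [a b] [a' b'] [/= -> ->].
have -> : [set bs : k.+1.-tuple G | \sum_(b <- bs) b = g] = [set bs | bs \in r].
  apply/seteqP; split=> bs; case/tupleP: bs => b t; rewrite /= /r mem_pmap_sub /=.
    rewrite big_cons => hg; apply/mapP; exists (b, val t) => //.
    by rewrite mem_tups /= size_tuple hg !eqxx.
  move=> /mapP[[b' l]]; rewrite mem_tups /= => /andP[_ /eqP <-] [-> ->].
  by rewrite big_cons.
rewrite -fsbig_seq // /r big_pmap big_map big_seq [RHS]big_seq; apply: eq_bigr => -[b l].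
rewrite mem_tups /= => /andP[/eqP sl _]; case: insubP => [bs _ e|]; last by rewrite /= sl eqxx.
by move: e; case/tupleP: bs => b' t /= [<- <-]; rewrite theadE.
Qed.

Lemma LopE (s : seq (Lcrd D -> C)) K g : Lop s (K, g) = LB [::] (map lc s) K g.
Proof.
rewrite -(LrecE [::]) /=.
pose Phi b0 (l : seq G) := disk_op (f:=D) b0
  (mkseq (fun i J => nth 0 s i (J, nth 0 l i)) (size s)) K.
rewrite [LHS](_ : _ = \sum_(l <- tups (size s) g) Phi l.1 l.2); last first.
  rewrite -(tuple_sum (size s) g Phi); apply: eq_fsbigr => bs _.
  rewrite /Phi; congr (disk_op _ _ _); apply: eq_mkseq => i; apply/funext => J.
  by rewrite nth_behead.
rewrite /Phi {Phi}; suff h acc g' : \sum_(l <- tups (size s) g') disk_op (f:=D) l.1 (acc ++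
    mkseq (fun i J => nth 0 s i (J, nth 0 l.2 i)) (size s)) K = Lrec acc (map lc s) g' K.
  exact: (h [::]).
elim: s acc g' {g} => [|a s IH] acc g; first by rewrite /= big_seq1 cats0.
rewrite [size _]/= tupsS big_allpairs_dep map_cons LrecS; apply: eq_bigr => bb _.
rewrite -IH; apply: eq_bigr => l _ /=; congr (disk_op _ _ _).
rewrite /mkseq /= cat_rcons; congr (_ ++ _ :: _).
by rewrite -[iota 1 _]/(iota (1 + 0) _) iotaDl -map_comp.
Qed.

(** The inputs are expanded in basis vectors one after the other, from the left. *)
Lemma multi_ext k (Phi : seq Lm -> Lm) :
  (forall s1 s2, (size s1 + size s2).+1 = k -> lin (fun a => Phi (s1 ++ a :: s2))) ->
  (forall Js, size Js = k -> Phi (map LE Js) = 0) ->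
  forall s, size s = k -> Phi s = 0.
Proof.
move=> Plin Pb s sk.
suff h Js s' : (size Js + size s' = k)%N -> Phi (map LE Js ++ s') = 0 by exact: (h [::]).
elim: s' Js => [|a s' IH] Js; first by rewrite addn0 cats0 => /Pb.
rewrite /= addnS => sz; apply/funext => K.
have hl := Plin (map LE Js) s'; rewrite size_map in hl.
rewrite (lin_expand _ _ (hl sz)) big1 // => J _.
by rewrite -cat_rcons -map_rcons IH ?mulr0 // size_rcons.
Qed.

Definition sdeg (Js : seq {set 'I_n}) : nat := sumn [seq #|J|.+1 | J : {set 'I_n} <- Js].

Lemma LB_ks acc Js s :
  LB acc (map lks (map LE Js) ++ s) = lsc ((-1) ^+ sdeg Js) (LB acc (map LE Js ++ s)).
Proof.
elim: Js acc => [|J Js IH] acc; apply/funext => K; first by rewrite /lsc mul1r.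
rewrite !map_cons !cat_cons /sdeg /= exprD /lsc.
rewrite (eq_bigr (fun I => LE J I * ((-1) ^+ #|I|.+1 *
    LB (rcons acc I) (map lks (map LE Js) ++ s) K))); last first.
  by move=> I _; rewrite /lks mulrCA mulrA.
rewrite (sum_LE (fun I => (-1) ^+ #|I|.+1 *
  LB (rcons acc I) (map lks (map LE Js) ++ s) K)) IH /lsc -mulrA; congr (_ * (_ * _)).
by rewrite (sum_LE (fun I => LB (rcons acc I) (map LE Js ++ s) K)).
Qed.

Lemma disk_ks b acc Js s K :
  disk_op (f:=D) b (acc ++ map (ksgn (@hdeg n)) (map eb Js) ++ s) K =
  (-1) ^+ sdeg Js * disk_op b (acc ++ map eb Js ++ s) K.
Proof.
elim: Js acc => [|J Js IH] acc; first by rewrite mul1r.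
rewrite !map_cons !cat_cons /sdeg /= exprD.
have -> : ksgn (@hdeg n) (eb J) = zscale ((-1) ^+ #|J|.+1) (eb J) + 0.
  apply/funext => I; rewrite [RHS]addr0 /ksgn /zscale /ebasis /hdeg.
  by case: eqP => [->|]; rewrite ?mulr0.
rewrite m_linear -[RHS]mulrA -[X in _ = _ * (_ * disk_op _ X _)]cat_rcons -IH cat_rcons.
rewrite [LHS](_ : _ = (-1) ^+ #|J|.+1 *
    disk_op b (acc ++ eb J :: map (ksgn (@hdeg n)) (map eb Js) ++ s) K +
    disk_op b (acc ++ 0 :: map (ksgn (@hdeg n)) (map eb Js) ++ s) K) //.
by rewrite [X in _ + X]disk_expand big1 ?addr0 // => I _; rewrite mul0r.
Qed.

Definition ainf_term (s : seq Lm) r q : Lm :=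
  LB [::] (map lks (take r s) ++ LB [::] (take q (drop r s)) :: drop (r + q) s).

Lemma lks_lin : lin lks.
Proof. by move=> x a a'; apply/funext => J; rewrite /lks /lsc !lmE mulrDr mulrCA. Qed.

Lemma lin_comp f g : lin f -> lin g -> lin (f \o g).
Proof. by move=> hf hg x a a'; rewrite /= hg hf. Qed.

(** The varying input lies before, inside or after the inner operation; in each case the term is a
    composite of linear maps in it. *)
Lemma ainf_term_lin s1 s2 r q : (r + q <= (size s1 + size s2).+1)%N ->
  lin (fun a => ainf_term (s1 ++ a :: s2) r q).
Proof.
move=> rq; rewrite /ainf_term.
have [r1|r1] := ltnP (size s1) r.
  have [k ->] : exists k, r = (size s1 + k.+1)%N by exists (r - size s1).-1; lia.
  rewrite (_ : (fun a => _) = (fun a => LB [::]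
    (map lks s1 ++ a :: (map lks (take k s2) ++
      LB [::] (take q (drop k s2)) :: drop (k + q) s2))) \o lks).
    exact/lin_comp/lks_lin/LB_lin.
  apply/funext => a /=; rewrite take_cat drop_cat drop_cat -!addnA !ltnNge leq_addr /=.
  by rewrite leq_addr /= !addKn addSn /= map_cat -catA.
have [q1|q1] := ltnP (size s1) (r + q).
  have [k qk] : exists k, q = (size s1 - r + k.+1)%N by exists (q - (size s1 - r)).-1; lia.
  rewrite (_ : (fun a => _) = (fun Y => LB [::] (map lks (take r s1) ++ Y :: drop k s2)) \o
     (fun a => LB [::] (drop r s1 ++ a :: take k s2))).
    by apply: lin_comp; exact: LB_lin.
  apply/funext => a /=; rewrite takel_cat // drop_cat.
  have -> : drop (r + q) (s1 ++ a :: s2) = drop k s2.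
    rewrite drop_cat ltnNge ltnW //= (_ : r + q - size s1 = k.+1)%N //; lia.
  rewrite (_ : (if _ then _ else _) = drop r s1 ++ a :: s2); last first.
    have [//|r2] := ltnP r (size s1); rewrite (_ : r - size s1 = 0)%N; last lia.
    by rewrite [drop r s1]drop_oversize ?drop0.
  congr (LB _ (_ ++ LB _ _ :: _)).
  by rewrite take_cat size_drop qk ltnNge leq_addr /= addKn.
rewrite (_ : (fun a => _) = (fun a => LB [::]
    ((map lks (take r s1) ++ LB [::] (take q (drop r s1)) :: drop (r + q) s1) ++ a :: s2))).
  exact: LB_lin.
apply/funext => a; rewrite takel_cat // -catA /=.
congr (LB _ (_ ++ LB _ _ :: _)).
  rewrite drop_cat; have [r2|r2] := ltnP r (size s1).
    by rewrite takel_cat // size_drop; lia.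
  by rewrite (_ : q = 0)%N ?take0 //; lia.
rewrite drop_cat; have [//|r2] := ltnP (r + q) (size s1).
by rewrite (_ : r + q - size s1 = 0)%N ?[drop _ s1]drop_oversize //; lia.
Qed.

(** The left side is multilinear over the Novikov ring, so it suffices to take basis vectors. There
    the coefficient of each class g is the relation [m_ainf] of g. *)
Lemma LB_ainf s : \sum_(r < (size s).+1)
  \sum_(q < (size s).+1 | (r + q <= size s)%N) ainf_term s r q = 0.
Proof.
pose k := size s.
suff h s' : size s' = k -> \sum_(r < k.+1)
    \sum_(q < k.+1 | (r + q <= k)%N) ainf_term s' r q = 0 by exact: h.
move: s'; apply: multi_ext.
  move=> s1 s2 sk x a a'.
  apply/funext => K; rewrite lmE /lsc !lm_sum mulr_sumr -big_split; apply: eq_bigr => r _ /=.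
  rewrite !lm_sum mulr_sumr -big_split; apply: eq_bigr => q rq /=.
  by rewrite ainf_term_lin ?sk.
move=> Js sJ; apply/funext => K; apply/funext => g; rewrite lm0E nov0.
have := congr1 (fun f : H => f K) (@m_ainf _ _ D g (map eb Js)).
rewrite fsbig_dec size_map sJ => m0; rewrite -[RHS]m0 {m0}.
have fs I (r : seq I) (P : pred I) (F : I -> H) :
    (\sum_(i <- r | P i) F i) K = \sum_(i <- r | P i) F i K.
  by elim/big_rec2: _ => // i y z _ <-.
rewrite fs; under [RHS]eq_bigr => bb _ do rewrite fs.
rewrite exchange_big lm_sum nov_sum; apply: eq_bigr => r _.
under [RHS]eq_bigr => bb _ do rewrite fs.
rewrite exchange_big lm_sum nov_sum; apply: eq_bigr => q _.
rewrite /ainf_term -!map_take -!map_drop -map_take LB_basis LB_ks /lsc nov_sgnM.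
rewrite (lin_expand _ _ (LB_lin _ _ _)) nov_sum mulr_sumr.
under [RHS]eq_bigr => bb _ do rewrite (disk_ks _ [::]) disk_expand mulr_sumr.
rewrite [RHS]exchange_big; apply: eq_bigr => J _ /=.
rewrite -map_cons -map_cat LB_basis [sdisk _ J * _]mulrC novM mulr_sumr.
apply: eq_bigr => bb _; congr (_ * _); rewrite mulrC -map_take.
by rewrite /sdisk map_cat map_cons.
Qed.

End Multilinear.

(** * Deformed operations and their convergence *)

Lemma weave_map (T T' : Type) (f : T -> T') e b (s : seq (T * T)) :
  map f (weave e b s) = weave e (f b) [seq (f x.1, f x.2) | x <- s].
Proof.
elim: s e b => [|[a b'] s IH] e b /=; rewrite map_cat map_nseq //=.
by rewrite IH.
Qed.

Lemma weave_pos (T : Type) e (b : T) s1 b' s2 :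
  exists w1 w2, forall a, weave e b (s1 ++ (a, b') :: s2) = w1 ++ a :: w2.
Proof.
elim: s1 e b => [|[a1 b1] s1 IH] e b.
  by exists (nseq (head 0%N e) b), (weave (behead e) b' s2).
have [w1 [w2 h]] := IH (behead e) b1.
by exists (nseq (head 0%N e) b ++ a1 :: w1), w2 => a; rewrite /= h -catA.
Qed.

Lemma zip_map_r (S T T' : Type) (h : T -> T') (s : seq S) t :
  zip s (map h t) = [seq (a.1, h a.2) | a <- zip s t].
Proof. by elim: s t => [|x s IH] [|y t] //=; rewrite IH. Qed.

Section AsumExtra.
Variable R : realType.
Implicit Types u : nat -> R[i].

Lemma asum_unshift u k l : (forall i, (i < k)%N -> u i = 0) ->
  asum (fun i => u (k + i)%N) l -> asum u l.
Proof.
move=> u0 [[B uB] ul].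
have E (V : nmodType) (F : nat -> V) N : (forall i, (i < k)%N -> F i = 0) ->
    \sum_(i < k + N) F i = \sum_(i < N) F (k + i)%N.
  by move=> F0; rewrite big_split_ord /= big1 ?add0r // => i _; exact: F0.
have Enc := E _ (fun i => nc (u i)) _ (fun i ik => etrans (congr1 _ (u0 i ik)) (@nc0 R)).
split.
  exists B => N; apply: le_trans (uB N); rewrite -Enc.
  by rewrite addnC big_split_ord /= lerDl sumr_ge0 // => i _; exact: nc_ge0.
have h : cto (fun N => (fun N => \sum_(i < N) u (k + i)%N) (N - k)%N) l.
  apply: (@cto_sub _ _ _ (fun N => N - k)%N) ul.
  move=> A [M _ MA]; exists (k + M)%N => // N /= MN; apply: MA => /=; lia.
apply: (cto_near (N0 := k)) h => N kN.
by rewrite -(E _ u _ u0) subnKC.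
Qed.

Lemma asum_fin u k : (forall i, i != k -> u i = 0) -> asum u (u k).
Proof.
move=> u0; have fin (V : nmodType) (F : nat -> V) N : (forall i, i != k -> F i = 0) ->
    \sum_(i < N) F i = if (k < N)%N then F k else 0.
  move=> F0; case: ltnP => kN; last by apply: big1 => i _; apply: F0; have := ltn_ord i; lia.
  rewrite (bigD1 (Ordinal kN)) //= big1 ?addr0 // => i; rewrite -val_eqE /=; exact: F0.
split.
  exists (nc (u k)) => N; rewrite (fin _ (fun i => nc (u i))); last by move=> i /u0->; rewrite nc0.
  by case: ifP => // _; exact: nc_ge0.
by apply: (cto_near (N0 := k.+1)) (cto_cst _) => N kN; rewrite (fin _ u) // kN.
Qed.
End AsumExtra.

Section Deformed.
Variables (R : realType) (n : nat) (D : fukaya_data R n).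
Local Notation C := R[i].
Local Notation G := (cls D).
Local Notation H := ({set 'I_n} -> C).
Local Notation Lm := ({set 'I_n} -> nov D).
Local Notation vec := ('I_n -> C).
Local Notation eb := (@ebasis R n).
Local Notation LE := (@LE R n D).
Local Notation lin := (@lin R n D).

Definition hl (h : H) : Lm := fun K g => h K * (g == 0)%:R.
Definition lv (v : vec) : Lm := hl (class1 v).

Lemma lc_Lclass (v : vec) : lc (@Lclass R n D v) = lv v.
Proof. by []. Qed.

Lemma LE_hl J : LE J = hl (eb J).
Proof.
apply/funext => K; apply/funext => g; rewrite /LE /hl /ebasis.
by case: eqP => _; rewrite ?mul1r ?mul0r.
Qed.

Lemma LB_hl acc hs K g :
  LB acc (map hl hs) K g = disk_op (f:=D) g (map eb acc ++ hs) K.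
Proof.
elim: hs acc => [|h hs IH] acc; first by rewrite cats0.
rewrite disk_expand /= nov_sum; apply: eq_bigr => J _.
by rewrite -[hl h J]/(@ncst R n D (h J)) ncstM IH map_rcons cat_rcons.
Qed.

Lemma class1D (u v : vec) : class1 (fun i => u i + v i) = (class1 u + class1 v : H).
Proof.
apply/funext => K; rewrite /class1 [RHS](_ : _ = \sum_i u i * (K == [set i]%SET)%:R +
  \sum_i v i * (K == [set i]%SET)%:R) // -big_split.
by apply: eq_bigr => i _; rewrite mulrDl.
Qed.

Lemma class1_hdeg (v : vec) (K : {set 'I_n}) : #|K| != 1%N -> class1 v K = 0.
Proof.
move=> K1; rewrite /class1 big1 // => i _; case: eqP => [h|]; rewrite ?mulr0 //.
by rewrite h cards1 in K1.
Qed.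

(** Degree-one classes have shifted degree zero, so moving an operation past them costs no sign. *)
Lemma lks_lv v : lks (lv v) = lv v.
Proof.
apply/funext => K; apply/funext => g; rewrite /lks nov_sgnM /lv /hl.
have [->|/class1_hdeg ->] := eqVneq #|K| 1%N; last by rewrite mul0r mulr0.
by rewrite expr2 mulrNN mulr1 mul1r.
Qed.

Definition wch (s : seq (Lm * vec)) : seq (Lm * Lm) := [seq (x.1, lv x.2) | x <- s].

(** The contribution of words of length L. Identities between deformed operations are proved length
    by length and then summed over L. *)
Definition Mh L v0 s : Lm := \sum_(w <- words L (lv v0) (wch s)) LB [::] w.

Definition M v0 s : Lm := fun K g =>
  csum (size s).+1 (fun e => LB [::] (weave e (lv v0) (wch s)) K g).

Definition vbounded (r : R) (v0 : vec) (vs : seq vec) :=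
  forall j i, nc (nth v0 (v0 :: vs) j i) <= r.

Lemma vbounded_ex v0 vs : exists r, vbounded r v0 vs.
Proof.
exists (\sum_(j < (size vs).+1) \sum_i nc (nth v0 (v0 :: vs) j i)) => j i.
have [jn|jn] := ltnP j (size vs).+1.
  rewrite (bigD1 (Ordinal jn)) //= (bigD1 i) //= -addrA lerDl.
  by rewrite addr_ge0 ?sumr_ge0 // => k _; rewrite ?sumr_ge0 // => *; exact: nc_ge0.
rewrite nth_default // big_ord_recl (bigD1 i) //= -addrA lerDl.
by rewrite addr_ge0 ?sumr_ge0 // => k _; rewrite ?sumr_ge0 // => *; exact: nc_ge0.
Qed.

Lemma bound_basis Js K g r : exists B : R, forall N v0 vs, size vs = size Js ->
  vbounded r v0 vs ->
  \sum_(e : (size Js).+1.-tuple 'I_N)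
    nc (LB [::] (weave (map val e) (lv v0) (wch (zip (map LE Js) vs))) K g) <= B.
Proof.
have [B hB] := m_convergent g (map eb Js) K r; exists B => N v0 vs sv vb.
have hv j i : `|nth v0 (v0 :: vs) j i| <= r%:C by rewrite nc_leE.
have {hB} := hB N (nth v0 (v0 :: vs)) hv; rewrite size_map => hB.
rewrite -lecR rmorph_sum /=; apply: le_trans hB; apply: ler_sum => e _; rewrite ncE.
have -> : weave (map val e) (lv v0) (wch (zip (map LE Js) vs)) =
    map hl (weave (map val e) (class1 v0) [seq (a.1, class1 (nth v0 (v0 :: vs) a.2)) |
      a <- zip (map eb Js) (iota 1 (size Js))]).
  rewrite weave_map -map_comp /wch; congr (weave _ _ _).
  have {1}-> : vs = [seq nth v0 (v0 :: vs) j | j <- iota 1 (size Js)].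
    rewrite -sv -[1%N]addn0 iotaDl -map_comp -[LHS](mkseq_nth v0).
    exact: eq_map.
  rewrite zip_map_r -map_comp; move: (iota 1 _); clear; elim: Js => [|J Js IH] [|j t] //=.
  by rewrite IH LE_hl.
by rewrite LB_hl.
Qed.

Lemma zip_pos (s1 s2 : seq Lm) (vs : seq vec) : size vs = (size s1 + size s2).+1 ->
  exists v, forall a, zip (s1 ++ a :: s2) vs =
    zip s1 (take (size s1) vs) ++ (a, v) :: zip s2 (drop (size s1).+1 vs).
Proof.
move=> sv; have lt1 : (size s1 < size vs)%N by rewrite sv ltnS leq_addr.
case: vs sv lt1 => // v vs sv lt1; exists (nth v (v :: vs) (size s1)) => a'.
rewrite -{1}[v :: vs](cat_take_drop (size s1)) zip_cat ?size_takel 1?ltnW //.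
by rewrite (drop_nth v).
Qed.

(** For basis inputs this is [m_convergent]; general inputs are expanded one at a time, which costs
    only finite sums over J and over decompositions of g. The bound is uniform over deforming
    classes of norm at most r, as the smooth dependence on these classes requires. *)
Lemma LB_bound (s : seq Lm) K g r : exists B : R, forall N v0 vs, size vs = size s ->
  vbounded r v0 vs ->
  \sum_(e : (size s).+1.-tuple 'I_N)
    nc (LB [::] (weave (map val e) (lv v0) (wch (zip s vs))) K g) <= B.
Proof.
suff h Js : exists B : R, forall N v0 vs, size vs = size (map LE Js ++ s) ->
  vbounded r v0 vs -> \sum_(e : (size (map LE Js ++ s)).+1.-tuple 'I_N)
    nc (LB [::] (weave (map val e) (lv v0) (wch (zip (map LE Js ++ s) vs))) K g) <= B.
  exact: (h [::]).
elim: s Js K g => [|a s IH] Js K g.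
  rewrite cats0; have [B hB] := bound_basis Js K g r; exists B => N v0 vs.
  by rewrite size_map => sv vb; have := hB N v0 vs sv vb.
have /choice[B hB] : forall p : {set 'I_n} * G, exists B : R, forall N v0 vs,
    size vs = size (map LE Js ++ LE p.1 :: s) ->
    vbounded r v0 vs -> \sum_(e : (size (map LE Js ++ LE p.1 :: s)).+1.-tuple 'I_N)
    nc (LB [::] (weave (map val e) (lv v0) (wch (zip (map LE Js ++ LE p.1 :: s) vs))) K p.2) <= B.
  by move=> [J g']; have := IH (rcons Js J) K g'; rewrite map_rcons cat_rcons.
exists (\sum_J \sum_(bb <- dec g) nc (a J bb.1) * B (J, bb.2)) => N v0 vs sv vb.
have sE J : size (map LE Js ++ a :: s) = size (map LE Js ++ LE J :: s) by rewrite !size_cat.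
apply: (@le_trans _ _ (\sum_(e : (size (map LE Js ++ a :: s)).+1.-tuple 'I_N)
  \sum_J \sum_(bb <- dec g) nc (a J bb.1) *
    nc (LB [::] (weave (map val e) (lv v0) (wch (zip (map LE Js ++ LE J :: s) vs))) K bb.2))).
  apply: ler_sum => e _.
  have [|v hv] := @zip_pos (map LE Js) s vs; first by rewrite sv size_cat /= addnS.
  have [w1 [w2 hw]] := weave_pos (map val e) (lv v0) (wch (zip (map LE Js) (take (size (map LE Js)) vs)))
    (lv v) (wch (zip s (drop (size (map LE Js)).+1 vs))).
  have hE x : weave (map val e) (lv v0) (wch (zip (map LE Js ++ x :: s) vs)) = w1 ++ x :: w2.
    by rewrite hv /wch map_cat /= hw.
  rewrite hE (lin_expand _ _ (LB_lin _ _ _)) nov_sum; apply: le_trans (nc_sum _ _ _) _.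
  apply: ler_sum => J _; rewrite novM; apply: le_trans (nc_sum _ _ _) _.
  by apply: ler_sum => bb _; rewrite hE ncM.
rewrite exchange_big; apply: ler_sum => J _; rewrite exchange_big; apply: ler_sum => bb _.
rewrite -mulr_sumr ler_wpM2l ?nc_ge0 //; have := hB (J, bb.2) N v0 vs.
by rewrite -sE; exact.
Qed.

(** The cube limit defining [M] agrees with the sum over word lengths; words shorter than the number
    of inputs do not exist, which accounts for the shift by [size s]. *)
Lemma csum_M v0 s K g :
  csum_to (size s).+1 (fun e => LB [::] (weave e (lv v0) (wch s)) K g) (M v0 s K g) /\
  asum (fun L => Mh L v0 s K g) (M v0 s K g).
Proof.
have sv : size (unzip2 s) = size (unzip1 s) by rewrite !size_map.
have [r vb] := vbounded_ex v0 (unzip2 s).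
have [B hB] := LB_bound (unzip1 s) K g r.
have := @csum_degs R (size s).+1 (fun e => LB [::] (weave e (lv v0) (wch s)) K g).
case=> [|l [h1 h2]].
  by exists B => N; have := hB N v0 _ sv vb; rewrite zip_unzip size_map.
rewrite [M _ _ _ _](csumE h1); split=> //.
apply: (@asum_unshift _ _ (size s)).
  by move=> i ik; rewrite /Mh words_short ?big_nil // size_map.
congr (asum _ _): h2; apply/funext => d; rewrite /Mh lm_sum nov_sum.
have -> : size s = size (wch s) by rewrite size_map.
by rewrite (sum_degs_weave (lv v0) (wch s) d (fun w => LB [::] w K g)) addnC.
Qed.

Lemma M_asum v0 s K g : asum (fun L => Mh L v0 s K g) (M v0 s K g).
Proof. by have [] := csum_M v0 s K g. Qed.

Lemma M_bound (s : seq Lm) K g r : exists B : R, forall v0 vs, size vs = size s ->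
  vbounded r v0 vs -> nc (M v0 (zip s vs) K g) <= B.
Proof.
have [B hB] := LB_bound s K g r; exists B => v0 vs sv vb.
have [h _] := csum_M v0 (zip s vs) K g.
apply: cto_nc h => N; rewrite /cpart; apply: le_trans (nc_sum _ _ _) _.
by have := hB N v0 vs sv vb; rewrite size_zip sv minnn.
Qed.

Lemma Mh_lin L v0 s1 v s2 : lin (fun a => Mh L v0 (s1 ++ (a, v) :: s2)).
Proof.
move=> x a a'; rewrite /Mh /wch !map_cat /=.
case: L => [|L].
  rewrite !words_short ?size_cat ?addnS // !big_nil.
  by apply/funext => J; rewrite lmE /lsc mulr0 addr0.
rewrite !words_merge; apply/funext => K; rewrite lmE /lsc !lm_sum mulr_sumr -big_split.
apply: eq_bigr => r _ /=; rewrite !lm_sum mulr_sumr -big_split.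
apply: eq_bigr => w1 _ /=; rewrite !lm_sum mulr_sumr -big_split.
by apply: eq_bigr => w3 _ /=; rewrite LB_lin.
Qed.

Lemma M_lin v0 s1 v s2 : lin (fun a => M v0 (s1 ++ (a, v) :: s2)).
Proof.
move=> x a a'; apply/funext => K; apply/funext => g; rewrite lmE novD /lsc novM.
apply: asum_unique (M_asum _ _ _ _) _.
under [X in asum X]eq_fun => L do rewrite Mh_lin lmE novD /lsc novM.
by apply: asumD; last exact: M_asum; apply: asum_sum => bb _; apply: asumZ; exact: M_asum.
Qed.

Definition ksc (s : seq (Lm * vec)) : seq (Lm * vec) := [seq (lks x.1, x.2) | x <- s].
Definition vstate (v0 : vec) (s : seq (Lm * vec)) : vec := last v0 (unzip2 s).

End Deformed.

(** * A-infinity relations of the deformed operations *)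

Lemma sum_words_map (T T' : Type) (V : nmodType) (f : T -> T') (F : seq T' -> V) L b s :
  \sum_(w <- words L b s) F (map f w) =
  \sum_(w <- words L (f b) [seq (f x.1, f x.2) | x <- s]) F w.
Proof.
elim: L b s F => [|L IH] b s F; first by rewrite !sum_words0; case: s.
rewrite !sum_wordsS -(IH b s (fun w => F (f b :: w))); congr (_ + _).
by case: s => [|[a b'] s] //=; rewrite -(IH b' s (fun w => F (f a :: w))).
Qed.

Section Relations.
Variables (R : realType) (n : nat) (D : fukaya_data R n).
Local Notation C := R[i].
Local Notation G := (cls D).
Local Notation H := ({set 'I_n} -> C).
Local Notation Lm := ({set 'I_n} -> nov D).
Local Notation vec := ('I_n -> C).
Local Notation eb := (@ebasis R n).
Local Notation LE := (@LE R n D).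
Implicit Types (s : seq (Lm * vec)).

Lemma state_wch v0 s : state (lv v0) (wch s) = lv (vstate v0 s).
Proof. by rewrite /state /vstate /unzip2 /wch -map_comp -[RHS]last_map -map_comp. Qed.

Lemma wch_ksc s : wch (ksc s) = [seq (lks x.1, lks x.2) | x <- wch s].
Proof. by rewrite /wch /ksc -!map_comp; apply: eq_map => x /=; rewrite lks_lv. Qed.

Lemma take_wch i s : take i (wch s) = wch (take i s).
Proof. by rewrite /wch map_take. Qed.

Lemma drop_wch i s : drop i (wch s) = wch (drop i s).
Proof. by rewrite /wch map_drop. Qed.

Definition ainf_summand v0 s i j : Lm :=
  M v0 (ksc (take i s) ++ (M (vstate v0 (take i s)) (take j (drop i s)),
        vstate v0 (take (i + j) s)) :: drop (i + j) s).

(** The relation [LB_ainf] is summed over all words of length L, and each word is cut at both ends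
    of the inner operation. With i inputs before it and j inside it, the outer word consists of L -
    q letters and the inner output, hence the length [(L - q).+1]. *)
Lemma Mh_ainf L v0 s :
  \sum_(i < (size s).+1) \sum_(j < (size s).+1 | (i + j <= size s)%N)
   \sum_(q < L.+1) Mh (L - q).+1 v0
     (ksc (take i s) ++ (Mh q (vstate v0 (take i s)) (take j (drop i s)),
        vstate v0 (take (i + j) s)) :: drop (i + j) s) = 0.
Proof.
pose Phi w1 w2 w3 := LB (D := D) [::] (map (@lks R n D) w1 ++ LB [::] w2 :: w3).
have h0 : 0 = \sum_(r < L.+1) \sum_(q < L.+1 | (r + q <= L)%N)
    \sum_(w <- words L (lv v0) (wch s)) Phi (take r w) (take q (drop r w)) (drop q (drop r w)).
  transitivity (\sum_(w <- words L (lv v0) (wch s)) \sum_(r < (size w).+1)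
    \sum_(q < (size w).+1 | (r + q <= size w)%N) ainf_term w r q).
    by rewrite big1 // => w _; rewrite LB_ainf.
  transitivity (\sum_(w <- words L (lv v0) (wch s)) \sum_(r < L.+1)
    \sum_(q < L.+1 | (r + q <= L)%N) ainf_term w r q).
    by apply: eq_words => w ->.
  rewrite exchange_big; apply: eq_bigr => r _; rewrite exchange_big; apply: eq_bigr => q _.
  by apply: eq_bigr => w _; rewrite /ainf_term /Phi drop_drop addnC.
rewrite [RHS]h0 {h0}.
under [RHS]eq_bigr => r _ do under eq_bigr => q rq do
  rewrite (words_split (fun w1 w => Phi w1 (take q w) (drop q w))) -1?ltnS //.
under [RHS]eq_bigr => r _ do rewrite exchange_big.
rewrite [RHS]exchange_big /= size_map; apply: eq_bigr => i _.
pose F q r j := \sum_(w1 <- words r (lv v0) (take i (wch s)))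
   \sum_(w2 <- words q (state (lv v0) (take i (wch s))) (take j (drop i (wch s))))
   \sum_(w3 <- words (L - r - q) (state (lv v0) (take (i + j) (wch s))) (drop (i + j) (wch s)))
      Phi w1 w2 w3.
have -> : \sum_(r < L.+1) \sum_(q < L.+1 | (r + q <= L)%N)
    \sum_(w1 <- words r (lv v0) (take i (wch s)))
       \sum_(w2 <- words (L - r) (state (lv v0) (take i (wch s))) (drop i (wch s)))
          Phi w1 (take q w2) (drop q w2) =
   \sum_(r < L.+1) \sum_(q < L.+1 | (r + q <= L)%N) \sum_(j < (size s).+1 | (i + j <= size s)%N)
      F q r j.
  apply: eq_bigr => r _; apply: eq_bigr => q rq.
  rewrite /F [RHS]exchange_big; apply: eq_bigr => w1 _.
  rewrite (words_split (Phi w1)); last by lia.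
  rewrite size_drop size_map (big_ord_widen (size s).+1 (fun j => \sum_(w2 <- words q (state (lv v0) (take i (wch s))) (take j (drop i (wch s))))
   \sum_(w3 <- words (L - r - q) (state (state (lv v0) (take i (wch s))) (take j (drop i (wch s)))) (drop j (drop i (wch s))))
      Phi w1 w2 w3)); last by lia.
  apply: eq_big => j; first by have := ltn_ord i; lia.
  move=> _; rewrite -state_cat -takeD drop_drop [(j + i)%N]addnC.
  by apply: eq_bigr => w2 _.
(* The lengths r, q and the number j are summed in the opposite order, so that the position of the
   inputs is fixed before the lengths. *)
rewrite [RHS](exchange_big_dep xpredT) //=.
under [RHS]eq_bigr => q _ do rewrite (exchange_big_dep (fun j : 'I_(size s).+1 => (i + j <= size s)%N)) //=.
rewrite [RHS](exchange_big_dep (fun j : 'I_(size s).+1 => (i + j <= size s)%N)) //=.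
apply: eq_bigr => j ij; rewrite ij; apply: eq_bigr => q _; under [RHS]eq_bigl => r do rewrite andbT.
rewrite /Mh /wch map_cat /= -!/(wch _) wch_ksc words_merge.
rewrite (big_ord_widen L.+1 (fun r => \sum_(w1 <- words r (lv v0) [seq (lks x.1, lks x.2) | x <- wch (take i s)])
  \sum_(w3 <- words (L - q - r) (lv (vstate v0 (take (i + j) s))) (wch (drop (i + j) s))) LB [::] (w1 ++ (\sum_(w <- words q (lv (vstate v0 (take i s))) (wch (take j (drop i s)))) LB [::] w) :: w3))); last by lia.
apply: eq_big => r; first by have := ltn_ord q; lia.
(* The deforming letters are fixed by [lks], so a prefix with signs is again a word of the same
   kind. *)
move=> _; rewrite -[in LHS](lks_lv D v0) -(sum_words_map _ (fun w1 =>
  \sum_(w3 <- words (L - q - r) (lv (vstate v0 (take (i + j) s))) (wch (drop (i + j) s))) LB [::] (w1 ++ (\sum_(w <- words q (lv (vstate v0 (take i s))) (wch (take j (drop i s)))) LB [::] w) :: w3))).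
rewrite /F !drop_wch !take_wch !state_wch.
apply: eq_bigr => w1 _; rewrite [RHS]exchange_big; rewrite subnAC; apply: eq_bigr => w3 _.
rewrite /Phi; have hl := LB_lin (D := D) [::] (map (@lks R n D) w1) w3.
elim: (words q _ _) => [|w ws IH]; first by rewrite !big_nil (lin0 hl).
by rewrite !big_cons (linD _ _ hl) IH.
Qed.

(** After expansion of the inner output in basis vectors and classes, each summand is a Cauchy
    product of the length series of the inner and of the outer operation. *)
Lemma M_ainf v0 s :
  \sum_(i < (size s).+1) \sum_(j < (size s).+1 | (i + j <= size s)%N)
     ainf_summand v0 s i j = 0.
Proof.
apply/funext => K; apply/funext => g; rewrite lm0E nov0 lm_sum nov_sum.
apply: (@asum_unique R (fun=> 0)); last exact: asum0.
rewrite [X in asum X](_ : _ = fun L => \sum_(i < (size s).+1)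
  \sum_(j < (size s).+1 | (i + j <= size s)%N)
   \sum_(q < L.+1) Mh (L - q).+1 v0
     (ksc (take i s) ++ (Mh q (vstate v0 (take i s)) (take j (drop i s)),
        vstate v0 (take (i + j) s)) :: drop (i + j) s) K g); last first.
  apply/funext => L; apply: etrans (esym (congr1 (fun a : Lm => a K g) (Mh_ainf L v0 s))) _.
  rewrite lm_sum nov_sum; apply: eq_bigr => i _.
  rewrite lm_sum nov_sum; apply: eq_bigr => j _; rewrite lm_sum nov_sum.
  by apply: eq_bigr => q _.
apply: asum_sum => i _; rewrite lm_sum nov_sum; apply: asum_sum => j _.
rewrite /ainf_summand.
set pre := ksc _; set mid := take j _; set post := drop _ s; set vi := vstate _ _; set v' := vstate _ _.
have E L : \sum_(q < L.+1) Mh (L - q).+1 v0 (pre ++ (Mh q vi mid, v') :: post) K g =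
    \sum_J \sum_(bb <- dec g) \sum_(q < L.+1) Mh q vi mid J bb.1 *
      Mh (L - q).+1 v0 (pre ++ (LE J, v') :: post) K bb.2.
  under [RHS]eq_bigr => J _ do rewrite exchange_big.
  rewrite [RHS]exchange_big; apply: eq_bigr => q _.
  rewrite (lin_expand _ _ (Mh_lin _ _ _ _ _)) nov_sum.
  by apply: eq_bigr => J _; rewrite novM.
rewrite (lin_expand _ _ (M_lin _ _ _ _)) nov_sum.
under [X in asum X]eq_fun => L do rewrite E.
apply: asum_sum => J _; rewrite novM; apply: asum_sum => bb _.
apply: (@asum_cauchy R (fun q => Mh q vi mid J bb.1) (fun m => Mh m.+1 v0 (pre ++ (LE J, v') :: post) K bb.2)).
  exact: M_asum.
(* The outer word contains the inner output, so its series starts at length one. *)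
apply: (@asum_shift R (fun m => Mh m v0 (pre ++ (LE J, v') :: post) K bb.2)).
  by rewrite /Mh words_short ?big_nil // size_map size_cat /= addnS.
exact: M_asum.
Qed.

End Relations.

(** * The divisor equation as a change of gauge *)

Section Divisor.
Variables (R : realType) (n : nat) (D : fukaya_data R n).
Local Notation C := R[i].
Local Notation G := (cls D).
Local Notation H := ({set 'I_n} -> C).
Local Notation Lm := ({set 'I_n} -> nov D).
Local Notation vec := ('I_n -> C).
Local Notation eb := (@ebasis R n).
Local Notation LE := (@LE R n D).
Implicit Types (s : seq (Lm * vec)).

Lemma divisor_words b (u : vec) l (w : seq H) K :
  \sum_(w' <- words (l + size w) (class1 u) [seq (a, class1 u) | a <- w]) disk_op (f:=D) b w' K =
  (l`!)%:R^-1 * (\sum_i u i * (bdry b i)%:~R) ^+ l * disk_op b w K.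
Proof.
have := congr1 (fun h : H => h K) (m_divisor b u l w); rewrite /zscale => <-.
have fs I (r : seq I) (P : pred I) (F : I -> H) :
    (\sum_(i <- r | P i) F i) K = \sum_(i <- r | P i) F i K.
  by elim/big_rec2: _ => // i y z _ <-.
rewrite fs; have sw : size [seq (a, class1 u) | a <- w] = size w by rewrite size_map.
rewrite -sw -(sum_degs_weave (class1 u) _ l (fun w' => disk_op (f:=D) b w' K)).
rewrite sw (sum_degs_cubes _ _ (ltnSn l)) -sum_cubes; apply: eq_bigl => e.
by rewrite sumnE big_map.
Qed.

Definition pairb (u : 'I_n -> R) (g : G) : R := \sum_i u i * (bdry g i)%:~R.

Lemma pairb0 u : pairb u 0 = 0.
Proof. by rewrite /pairb big1 // => i _; rewrite bdry_0 mulr0. Qed.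

Lemma pairbD u b c : pairb u (b + c) = pairb u b + pairb u c.
Proof.
by rewrite /pairb -big_split; apply: eq_bigr => i _; rewrite bdryD intrD mulrDr.
Qed.

Lemma pairb_addu u u' g : pairb (fun i => u i + u' i) g = pairb u g + pairb u' g.
Proof. by rewrite /pairb -big_split; apply: eq_bigr => i _; rewrite mulrDl. Qed.

(* the ring automorphism T^b |-> exp <u, d b> T^b *)
Definition gau u (x : nov D) : nov D := fun g => (expR (pairb u g))%:C * x g.

Lemma gauM u x y : gau u (x * y) = gau u x * gau u y.
Proof.
apply/funext => g; rewrite /gau !novM mulr_sumr big_seq [RHS]big_seq.
apply: eq_bigr => bb; rewrite mem_dec => /eqP <-.
by rewrite pairbD expRD rmorphM /= mulrACA.
Qed.

Lemma gauD u x y : gau u (x + y) = gau u x + gau u y.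
Proof. by apply/funext => g; rewrite /gau !novD mulrDr. Qed.

Lemma gau0 u : gau u 0 = 0.
Proof. by apply/funext => g; rewrite /gau nov0 mulr0. Qed.

Lemma gau_sum u I (r : seq I) (P : pred I) (F : I -> nov D) :
  gau u (\sum_(i <- r | P i) F i) = \sum_(i <- r | P i) gau u (F i).
Proof. by apply: (big_morph (gau u)) => [x y|]; rewrite ?gauD ?gau0. Qed.

Lemma gau_nat u (b : bool) : gau u (b%:R) = b%:R.
Proof.
case: b; rewrite ?mulr1n ?mulr0n ?gau0 //; apply/funext => g; rewrite /gau nov1.
by case: eqP => [->|_]; rewrite ?mulr0 // pairb0 expR0 mul1r.
Qed.

Lemma gau_add u u' x : gau u (gau u' x) = gau (fun i => u i + u' i) x.
Proof. by apply/funext => g; rewrite /gau pairb_addu expRD rmorphM /= mulrA. Qed.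

Lemma gau_id u x : (forall i, u i = 0) -> gau u x = x.
Proof.
move=> u0; apply/funext => g; rewrite /gau /pairb big1 ?expR0 ?mul1r // => i _.
by rewrite u0 mul0r.
Qed.

Definition lgau u (a : Lm) : Lm := fun J => gau u (a J).

Lemma lgau_LE u J : lgau u (LE J) = LE J.
Proof. by apply/funext => K; rewrite /lgau /LE gau_nat. Qed.

Lemma exp_asum (x : R) : asum (fun l => (l`!)%:R^-1 * x%:C ^+ l) (expR x)%:C.
Proof.
have E l : (l`!)%:R^-1 * x%:C ^+ l = (exp_coeff x l)%:C :> C.
  by rewrite /exp_coeff /= rmorphM fmorphV rmorph_nat rmorphXn mulrC.
under [X in asum X]eq_fun do rewrite E.
have S y N : series (exp_coeff (y : R)) N = \sum_(i < N) exp_coeff y i.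
  by rewrite /series /= big_mkord.
split.
  exists (limn (series (exp_coeff `|x|))) => N.
  apply: (@le_trans _ _ (series (exp_coeff `|x|) N)).
    rewrite S; apply: ler_sum => i _; rewrite nc_real /exp_coeff /= normrM normrX.
    by rewrite normfV normr_nat.
  apply: nondecreasing_cvgn_le; last exact: is_cvg_series_exp_coeff.
  apply: nondecreasing_series => i _ _; rewrite /exp_coeff /=.
  by rewrite divr_ge0 ?exprn_ge0.
have R1 N : \sum_(i < N) (exp_coeff x i)%:C = (series (exp_coeff x) N)%:C :> C.
  by rewrite S rmorph_sum.
split; under eq_fun do rewrite R1 /=; last exact: cvg_cst.
exact: is_cvg_series_exp_coeff.
Qed.

Lemma Mh_basis L v0 (js : seq ({set 'I_n} * vec)) K g :
  Mh L v0 [seq (LE p.1, p.2) | p <- js] K g =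
  \sum_(w <- words L (class1 v0) [seq (eb p.1, class1 p.2) | p <- js]) disk_op (f:=D) g w K.
Proof.
rewrite /Mh lm_sum nov_sum.
rewrite [RHS](_ : _ = \sum_(w <- words L (class1 v0) [seq (eb p.1, class1 p.2) | p <- js])
  LB (D := D) [::] (map (@hl R n D) w) K g); last first.
  by apply: eq_bigr => w _; rewrite LB_hl.
rewrite (sum_words_map (@hl R n D) (fun w => LB [::] w K g)) /wch -!map_comp.
by congr (\sum_(w <- words _ _ _) _); apply: eq_map => p /=; rewrite LE_hl.
Qed.

Definition vadd (v : vec) (u : 'I_n -> R) : vec := fun i => v i + (u i)%:C.

(** In class g, inserting l further letters u multiplies by <u, dg>^l / l!, so the shifted series is
    the Cauchy product of the original one with the series of exp <u, dg>. Basis vectors are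
    invariant under the gauge. *)
Lemma M_shift_basis (u : 'I_n -> R) v0 (js : seq ({set 'I_n} * vec)) K :
  M v0 [seq (LE p.1, p.2) | p <- js] K =
  gau (fun i => - u i) (M (vadd v0 u) [seq (LE p.1, vadd p.2 u) | p <- js] K).
Proof.
have key v (us : 'I_n -> R) jv : M (vadd v us) [seq (LE p.1, vadd p.2 us) | p <- jv] K =
    gau us (M v [seq (LE p.1, p.2) | p <- jv] K).
  apply/funext => g; rewrite /gau mulrC; apply: asum_unique (M_asum _ _ _ _) _.
  have -> : (fun L => Mh L (vadd v us) [seq (LE p.1, vadd p.2 us) | p <- jv] K g) =
      (fun L => \sum_(r < L.+1) Mh r v [seq (LE p.1, p.2) | p <- jv] K g *
         (((L - r)`!)%:R^-1 * (pairb us g)%:C ^+ (L - r))).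
    apply/funext => L.
    rewrite -[[seq (LE p.1, vadd p.2 us) | p <- jv]]/(map ((fun p => (LE p.1, p.2)) \o (fun p => (p.1, vadd p.2 us))) jv).
    rewrite map_comp Mh_basis -map_comp /=.
    have -> : [seq ((fun p => (eb p.1, class1 p.2)) \o (fun p => (p.1, vadd p.2 us))) i | i <- jv] =
       [seq (x.1, (x.2 + class1 (fun i => (us i)%:C) : H)) | x <- [seq (eb p.1, class1 p.2) | p <- jv]].
      by rewrite -map_comp; apply: eq_map => p /=; rewrite class1D.
    rewrite class1D (@words_shift _ _ (fun a b : H => a + b) _
      (fun F => exists acc, F = fun w => disk_op (f:=D) g (acc ++ w) K)); first last.
    - by exists [::].
    - by move=> F x [acc ->]; exists (rcons acc x); apply/funext => w; rewrite cat_rcons.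
    - move=> F w x b' [acc ->]; rewrite !catA.
      have := disk_lin (D := D) g (acc ++ w) x 1 b' (class1 (fun i => (us i)%:C)) K.
      have -> : zscale 1 b' = b' by apply/funext => J; rewrite /zscale mul1r.
      by rewrite mul1r.
    apply: eq_bigr => r _; rewrite Mh_basis mulr_suml.
    apply: eq_words => w sw; have rL : (L = L - r + size w)%N by have := ltn_ord r; lia.
    rewrite {1}rL divisor_words mulrC; congr (_ * (_ * _ ^+ _)).
    by rewrite /pairb rmorph_sum; apply: eq_bigr => i _; rewrite rmorphM rmorph_int.
  exact: (@asum_cauchy R (fun r => Mh r v [seq (LE p.1, p.2) | p <- jv] K g)
    (fun l => (l`!)%:R^-1 * (pairb us g)%:C ^+ l) _ _ (M_asum _ _ _ _) (exp_asum _)).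
rewrite key gau_add gau_id // => i; exact: addNr.
Qed.

(* Summing the divisor axiom over the number of insertions gives the exponential. *)
Lemma M_shift (u : 'I_n -> R) v0 s :
  M (vadd v0 u) [seq (lgau u x.1, vadd x.2 u) | x <- s] = lgau u (M v0 s).
Proof.
suff h (js : seq ({set 'I_n} * vec)) s' :
    M (vadd v0 u) ([seq (LE p.1, vadd p.2 u) | p <- js] ++ [seq (lgau u x.1, vadd x.2 u) | x <- s']) =
    lgau u (M v0 ([seq (LE p.1, p.2) | p <- js] ++ s')).
  exact: (h [::]).
elim: s' js => [|[a v] s' IH] js /=; apply/funext => K.
  rewrite !cats0 /lgau (M_shift_basis u) gau_add gau_id // => i; exact: addrN.
rewrite (lin_expand _ _ (M_lin _ _ _ _)) /lgau (lin_expand a _ (M_lin _ _ _ _)).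
rewrite gau_sum; apply: eq_bigr => J _; rewrite gauM; congr (_ * _).
have := congr1 (fun x : Lm => x K) (IH (rcons js (J, v))).
by rewrite !map_rcons !cat_rcons.
Qed.

End Divisor.

(** * Parity, energy-zero part, units and curvature *)

Section Properties.
Variables (R : realType) (n : nat) (D : fukaya_data R n).
Local Notation C := R[i].
Local Notation G := (cls D).
Local Notation H := ({set 'I_n} -> C).
Local Notation Lm := ({set 'I_n} -> nov D).
Local Notation vec := ('I_n -> C).
Local Notation eb := (@ebasis R n).
Local Notation LE := (@LE R n D).
Implicit Types (s : seq (Lm * vec)).

(** Maslov indices are even, so [m_degree] fixes the parity of the output independently of the
    class. *)
Lemma sdisk_parity Js K g : sdisk (D := D) Js K g <> 0 -> odd (sdeg Js) = odd #|K|.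
Proof.
move=> /m_degree; have [k ->] := maslov_even g => h.
have hs : sdeg Js = (\sum_(J <- Js) #|J| + size Js)%N.
  elim: {h} Js => [|J Js IH]; first by rewrite /sdeg big_nil.
  by rewrite big_cons -[LHS]/(#|J|.+1 + sdeg Js)%N IH /= addSn addnS addnA.
rewrite hs; move: (\sum_(J <- Js) #|J|)%N (size Js) h => a b; lia.
Qed.

(** The operations have odd shifted degree on basis vectors, hence anticommute with [lks] on all
    inputs by multilinearity. *)
Lemma LB_lks w : LB (D := D) [::] (map (@lks R n D) w) = fun K => (-1) ^+ #|K| * LB [::] w K.
Proof.
pose Phi (w : seq Lm) : Lm := LB [::] (map (@lks R n D) w) + lks (LB [::] w).
suff h : Phi w = 0.
  apply/funext => K; have := congr1 (fun a : Lm => a K) h.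
  rewrite /Phi lmE lm0E /lks exprS mulN1r mulNr => /eqP; rewrite subr_eq0.
  by move/eqP.
apply: (multi_ext (k := size w)) => // [s1 s2 _|Js _].
  have -> : (fun a => Phi (s1 ++ a :: s2)) = (fun a =>
      ((fun b => LB [::] (map (@lks R n D) s1 ++ b :: map (@lks R n D) s2)) \o @lks R n D) a +
      (@lks R n D \o (fun b => LB [::] (s1 ++ b :: s2))) a).
    by apply/funext => a; rewrite /Phi map_cat.
  by apply: lin_add; apply: lin_comp; first [exact: LB_lin | exact: lks_lin].
rewrite /Phi -[map _ (map _ _)]cats0 LB_ks cats0 LB_basis.
apply/funext => K; apply/funext => g; rewrite lmE novD /lsc /lks !nov_sgnM lm0E nov0.
have [-> | /eqP/sdisk_parity hp] := eqVneq (sdisk Js K g) 0; first by rewrite !mulr0 addr0.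
by rewrite -signr_odd hp signr_odd exprS mulN1r mulNr addrN.
Qed.

Lemma M_lks v0 s : M v0 (ksc s) = fun K => (-1) ^+ #|K| * M v0 s K.
Proof.
apply/funext => K; apply/funext => g; rewrite nov_sgnM.
apply: asum_unique (M_asum _ _ _ _) _.
rewrite [X in asum X](_ : _ = fun L => (-1) ^+ #|K| * Mh L v0 s K g).
  by apply: asumZ; exact: M_asum.
apply/funext => L; rewrite /Mh !lm_sum !nov_sum mulr_sumr.
rewrite wch_ksc -[in LHS](lks_lv D v0) -(sum_words_map _ (fun w => LB [::] w K g)).
by apply: eq_bigr => w _; rewrite LB_lks nov_sgnM.
Qed.

Lemma lvB (v v' : vec) : lv (fun i => v i - v' i) = lv v - lv v' :> Lm.
Proof.
apply/funext => K; apply/funext => g; rewrite [RHS](_ : _ = lv v K g - lv v' K g) //.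
rewrite /lv /hl -mulrBl; congr (_ * _); rewrite /class1 -sumrB.
by apply: eq_bigr => i _; rewrite mulrBl.
Qed.

(** Gaps before the j-th carry the new classes and later gaps the old ones; in gap j itself new
    letters come first, then one letter equal to the difference, then old letters. *)
Lemma M_telescope v0 v0' (t : seq (Lm * (vec * vec))) K g :
  M v0' [seq (x.1, x.2.2) | x <- t] K g - M v0 [seq (x.1, x.2.1) | x <- t] K g =
  \sum_(j < (size t).+1)
    M v0' ([seq (x.1, x.2.2) | x <- take j t] ++
       (let c := last (v0, v0') (unzip2 (take j t)) in (lv (fun i => c.2 i - c.1 i), c.1)) ::
       [seq (x.1, x.2.1) | x <- drop j t]) K g.
Proof.
rewrite -mulN1r; apply: asum_unique.
  by apply: asumD; [exact: M_asum | apply: asumZ; exact: M_asum].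
rewrite [X in asum X](_ : _ = fun L => \sum_(j < (size t).+1)
    Mh L v0' ([seq (x.1, x.2.2) | x <- take j t] ++
       (let c := last (v0, v0') (unzip2 (take j t)) in (lv (fun i => c.2 i - c.1 i), c.1)) ::
       [seq (x.1, x.2.1) | x <- drop j t]) K g).
  by apply: asum_sum => j _; exact: M_asum.
apply/funext => L; rewrite mulN1r /Mh !lm_sum !nov_sum.
pose t' := [seq (x.1, (lv x.2.1 : Lm, lv x.2.2 : Lm)) | x <- t].
have := @words_telescope Lm C (fun a b : Lm => a - b) L (lv v0) (lv v0') t'
  (fun w => LB (D := D) [::] w K g) (fun F => exists acc, F = fun w => LB (D := D) [::] (acc ++ w) K g).
rewrite /wch -!map_comp /= => ->.
- rewrite size_map; apply: eq_bigr => j _; rewrite lm_sum nov_sum.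
  congr (\sum_(w <- words _ _ _) _); rewrite map_cat /= -!map_comp -map_take -map_drop -!map_comp.
  have hl r : last (lv v0 : Lm, lv v0' : Lm)
      (unzip2 [seq (x.1, (lv x.2.1 : Lm, lv x.2.2 : Lm)) | x : Lm * (vec * vec) <- r]) =
      (fun c : vec * vec => (lv c.1 : Lm, lv c.2 : Lm)) (last (v0, v0') (unzip2 r)).
    by rewrite -(last_map (fun c : vec * vec => (lv c.1 : Lm, lv c.2 : Lm))) /unzip2 -!map_comp.
  by rewrite hl /= lvB.
- move=> F x c c' [acc ->]; have h := LB_lin (D := D) [::] acc x (-1) c' c.
  have -> : c - c' = lsc (-1) c' + c.
    by apply/funext => J; rewrite !lmE /lsc mulN1r addrC.
  by rewrite h lmE novD /lsc mulN1r novN addrC.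
- by move=> F x [acc ->]; exists (rcons acc x); apply/funext => w; rewrite cat_rcons.
- by exists [::].
Qed.

Lemma LB_at0 acc (s : seq Lm) K :
  LB (D := D) acc s K 0 = disk_op (f:=D) 0 (map eb acc ++ [seq (fun J => a J 0) | a : Lm <- s]) K.
Proof.
elim: s acc => [|a s IH] acc; first by rewrite cats0.
rewrite disk_expand /= nov_sum; apply: eq_bigr => J _.
by rewrite nov_at0 IH map_rcons cat_rcons.
Qed.

Arguments LB : simpl never.

(** In class zero only the exterior product is left, hence only the words made of the input and one
    deforming letter. *)
Lemma M_lead1 v0 (a : Lm) v1 K : M v0 [:: (a, v1)] K 0 =
  wedge (gsgn (@hdeg n) (class1 v0)) (fun J => a J 0) K +
  wedge (gsgn (@hdeg n) (fun J => a J 0)) (class1 v1) K.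
Proof.
have cl (v : vec) : (fun J => (lv v : Lm) J 0) = class1 v.
  by apply/funext => J; rewrite /lv /hl eqxx mulr1.
apply: asum_unique (M_asum _ _ _ _) _.
rewrite [X in asum _ X](_ : _ = Mh 2 v0 [:: (a, v1)] K 0).
  apply: asum_fin => i i2; rewrite /Mh lm_sum nov_sum (@eq_words _ _ _ (fun=> 0)) ?big1 //.
  move=> w sw; rewrite LB_at0 m_classical; move: sw i2.
  by case: w => [|? [|? [|? ?]]] //= <-.
rewrite /Mh /wch /= lm_sum nov_sum !sum_wordsS !sum_words0 /= !add0r !addr0.
by rewrite !LB_at0 !m_classical /= !cl.
Qed.

Lemma M_lead2 v0 (a : Lm) v1 (a' : Lm) v2 K : M v0 [:: (a, v1); (a', v2)] K 0 =
  wedge (gsgn (@hdeg n) (fun J => a J 0)) (fun J => a' J 0) K.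
Proof.
apply: asum_unique (M_asum _ _ _ _) _.
rewrite [X in asum _ X](_ : _ = Mh 2 v0 [:: (a, v1); (a', v2)] K 0).
  apply: asum_fin => i i2; rewrite /Mh lm_sum nov_sum (@eq_words _ _ _ (fun=> 0)) ?big1 //.
  move=> w sw; rewrite LB_at0 m_classical; move: sw i2.
  by case: w => [|? [|? [|? ?]]] //= <-.
rewrite /Mh /wch /= lm_sum nov_sum !sum_wordsS !sum_words0 /= !add0r ?addr0.
by rewrite !LB_at0 !m_classical.
Qed.

(** With at least two further inputs the exceptional case of [m_unit], multiplication by 1, cannot
    occur. *)
Lemma LB_unit w1 w2 : (2 <= size w1 + size w2)%N -> LB (D := D) [::] (w1 ++ LE finset.set0 :: w2) = 0.
Proof.
move=> sw; pose k := size w1.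
pose Phi w := LB (D := D) [::] (take k w ++ LE finset.set0 :: drop k w).
suff : Phi (w1 ++ w2) = 0 by rewrite /Phi take_size_cat // drop_size_cat.
apply: (multi_ext (k := (size w1 + size w2)%N)); rewrite ?size_cat //.
  move=> s1 s2 ss; rewrite /Phi; have [ks|ks] := ltnP (size s1) k.
    have [m km] : exists m, k = (size s1 + m.+1)%N by exists (k - size s1).-1; lia.
    rewrite (_ : (fun a => _) = (fun a => LB [::] (s1 ++ a :: (take m s2 ++ LE finset.set0 :: drop m s2)))).
      exact: LB_lin.
    by apply/funext => a; rewrite km take_cat drop_cat ltnNge leq_addr /= addKn /= -catA.
  rewrite (_ : (fun a => _) = (fun a => LB [::] ((take k s1 ++ LE finset.set0 :: drop k s1) ++ a :: s2))).
    exact: LB_lin.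
  apply/funext => a; rewrite takel_cat // drop_cat -catA /=.
  have [//|k1] := ltnP k (size s1); rewrite (_ : k - size s1 = 0)%N ?[drop k s1]drop_oversize //; lia.
move=> Js sJ; rewrite /Phi -map_take -map_drop -map_cons -map_cat LB_basis.
apply/funext => K; apply/funext => g; rewrite /sdisk map_cat map_cons m_unit // => -[_].
by rewrite !size_map size_takel ?size_drop; lia.
Qed.

Lemma M_unit v0 (s1 : seq (Lm * vec)) v s2 : (2 <= size s1 + size s2)%N -> M v0 (s1 ++ (LE finset.set0, v) :: s2) = 0.
Proof.
move=> ss; apply/funext => K; apply/funext => g; apply: asum_unique (M_asum _ _ _ _) _.
rewrite [X in asum X](_ : _ = fun=> 0); first exact: asum0.
apply/funext => L; rewrite /Mh; have [L3|L3] := ltnP L 3.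
  by rewrite words_short ?big_nil // size_map size_cat /=; lia.
case: L L3 => // L L3; rewrite /wch map_cat /= words_merge big1 // => r _.
rewrite (@eq_words _ _ _ (fun=> 0)) ?big1 // => w1 sw1.
rewrite (@eq_words _ _ _ (fun=> 0)) ?big1 // => w3 sw3.
by rewrite LB_unit // sw1 sw3; have := ltn_ord r; lia.
Qed.

Lemma wedge1l (a : H) K : wedge (eb finset.set0) a K = a K.
Proof.
rewrite /wedge (bigD1 finset.set0) ?finset.sub0set //= big1 ?addr0 => [|I /andP[_ /negbTE I0]].
  rewrite finset.setD0 /ebasis eqxx /inversions (_ : [set p | _]%SET = finset.set0) ?cards0 ?mul1r //.
  by apply/finset.setP => p; rewrite !inE.
by rewrite /ebasis I0 mulr0 mul0r.
Qed.

Lemma wedge1r (a : H) K : wedge a (eb finset.set0) K = a K.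
Proof.
rewrite /wedge (bigD1 K) //= big1 ?addr0 => [|I /andP[IK nIK]].
  rewrite finset.setDv /ebasis eqxx mulr1 /inversions (_ : [set p | _]%SET = finset.set0) ?cards0 ?mul1r //.
  by apply/finset.setP => p; rewrite !inE andbF.
rewrite /ebasis finset.setD_eq0 (_ : (K \subset I) = false) ?mulr0 //.
by apply/negP => KI; case/negP: nIK; rewrite finset.eqEsubset IK.
Qed.

Lemma LE_at (I J : {set 'I_n}) g : LE J I g = (eb J) I * (g == 0)%:R.
Proof. by rewrite LE_hl. Qed.

Lemma LB_unitl (a : Lm) : LB [::] [:: LE finset.set0; a] = a.
Proof.
apply/funext => K; rewrite (lin_expand _ _ (LB_lin (D := D) [::] [:: LE finset.set0] [::])).
rewrite -[RHS](sum_LE a); apply: eq_bigr => J _; rewrite mulrC; congr (_ * _).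
rewrite -[_ ++ _]/(map LE [:: finset.set0; J]) LB_basis; apply/funext => g.
rewrite LE_at /sdisk /=; have [->|g0] := eqVneq g 0.
  rewrite m_classical mulr1 [RHS](_ : _ = eb J K); last by rewrite /ebasis eq_sym.
  rewrite -[RHS](wedge1l (eb J)); congr (wedge _ _ K); apply/funext => I.
  by rewrite /gsgn /ebasis /hdeg; case: eqP => [->|]; rewrite ?mulr0 // cards0 mul1r.
rewrite mulr0 (m_unit (f:=D) (s1 := [::])) // => -[g0' _].
by rewrite g0' eqxx in g0.
Qed.

Lemma LB_unitr (a : Lm) K : LB [::] [:: lks a; LE finset.set0] K = - a K.
Proof.
have hl : lin (fun a : Lm => LB [::] [:: lks a; LE finset.set0]).
  exact: (lin_comp (LB_lin (D := D) [::] [::] [:: LE finset.set0]) (@lks_lin R n D)).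
rewrite (lin_expand _ _ hl) -(sum_LE a) -sumrN; apply: eq_bigr => J _.
rewrite -mulNr mulrC; congr (_ * _); apply/funext => g.
have -> : [:: lks (LE J); LE finset.set0] = map (@lks R n D) (map LE [:: J]) ++ map LE [:: finset.set0].
  by [].
rewrite LB_ks -map_cat LB_basis /lsc nov_sgnM novN LE_at /sdisk /=.
have [->|g0] := eqVneq g 0.
  rewrite m_classical /= mulr1 wedge1r /gsgn /hdeg /sdeg /= addn0.
  rewrite /ebasis eq_sym; have [->|KJ] := eqVneq J K; last by rewrite !mulr0 oppr0.
  by rewrite !mulr1 exprS -mulrA -exprD addnn -signr_odd odd_double mulr1.
rewrite mulr0 (m_unit (f:=D) (s1 := [:: eb J])) ?mulr0 ?oppr0 // => -[g0' _].
by rewrite g0' eqxx in g0.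
Qed.

Lemma M_unitl v0 (a : Lm) v : M v0 [:: (LE finset.set0, v0); (a, v)] = a.
Proof.
apply/funext => K; apply/funext => g; apply: asum_unique (M_asum _ _ _ _) _.
rewrite -[in X in asum _ X](LB_unitl a).
rewrite [X in asum _ X](_ : _ = Mh 2 v0 [:: (LE finset.set0, v0); (a, v)] K g); last first.
  by rewrite /Mh /wch /= lm_sum nov_sum !sum_wordsS !sum_words0 /= !add0r ?addr0.
apply: asum_fin => i i2; rewrite /Mh; case: i i2 => [_|[_|[//|i _]]].
- by rewrite words_short // big_nil.
- by rewrite words_short // big_nil.
rewrite /wch /= (words_merge _ _ _ [::]) lm_sum nov_sum big1 // => r _.
rewrite (@eq_words _ _ _ (fun=> 0)) ?big1 // => w1 sw1.
rewrite (@eq_words _ _ _ (fun=> 0)) ?big1 // => w3 sw3.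
by rewrite LB_unit // sw1 sw3; have := ltn_ord r; lia.
Qed.

Lemma M_unitr v0 (a : Lm) v v' : M v0 [:: (lks a, v); (LE finset.set0, v')] = - a.
Proof.
apply/funext => K; apply/funext => g; apply: asum_unique (M_asum _ _ _ _) _.
rewrite [X in asum _ X](_ : _ = LB [::] [:: lks a; LE finset.set0] K g); last by rewrite LB_unitr.
rewrite [X in asum _ X](_ : _ = Mh 2 v0 [:: (lks a, v); (LE finset.set0, v')] K g); last first.
  by rewrite /Mh /wch /= lm_sum nov_sum !sum_wordsS !sum_words0 /= !add0r ?addr0.
apply: asum_fin => i i2; rewrite /Mh; case: i i2 => [_|[_|[//|i _]]].
- by rewrite words_short // big_nil.
- by rewrite words_short // big_nil.
rewrite /wch /= (words_merge _ _ _ [:: (lks a, lv v)]) lm_sum nov_sum big1 // => r _.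
rewrite (@eq_words _ _ _ (fun=> 0)) ?big1 // => w1 sw1.
rewrite (@eq_words _ _ _ (fun=> 0)) ?big1 // => w3 sw3.
by rewrite LB_unit // sw1 sw3; have := ltn_ord r; lia.
Qed.

Definition Wv (v : vec) : nov D := M v [::] finset.set0.

Hypothesis hW : weakly_unobstructed D.

(** By the divisor equation the words in v alone only rescale m_(0,g), so the deformed curvature
    remains proportional to the unit. *)
Lemma M_curv v : M v [::] = lsc (Wv v) (LE finset.set0).
Proof.
apply/funext => K; rewrite /lsc /LE; have [->|K0] := eqVneq K finset.set0; first by rewrite mulr1.
rewrite mulr0; apply/funext => g; apply: asum_unique (M_asum _ _ _ _) _.
rewrite [X in asum X](_ : _ = fun=> 0); first exact: asum0.
apply/funext => L; rewrite -[[::]]/(map (fun p : {set 'I_n} * vec => (LE p.1, p.2)) [::]) Mh_basis.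
have := @divisor_words R n D g v L [::] K; rewrite addn0 => ->.
have [c hc] := hW; have := hc K g; rewrite LopE -[LHS]/(disk_op g [::] K) => ->.
by rewrite (negbTE K0) !mulr0.
Qed.

(** In the relation with one input the two terms with inner curvature are products with the unit
    from the left and from the right, times W(v0) and W(v1), with opposite signs. *)
Lemma M_ainf1 v0 (a : Lm) v1 : M v0 [:: (M v0 [:: (a, v1)], v1)] = lsc (Wv v1 - Wv v0) a.
Proof.
have := M_ainf v0 [:: (a, v1)]; rewrite !big_mkcond !big_ord_recl !big_ord0 /=.
rewrite !big_mkcond !big_ord_recl !big_ord0 /=.
rewrite !big_mkcond !big_ord_recl !big_ord0 /= ?add0r !addr0 /ainf_summand /vstate /=.
rewrite !M_curv => h; apply/funext => K.
have := congr1 (fun x : Lm => x K) h; rewrite /= !lmE lm0E.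
rewrite (linZ _ _ (M_lin v0 [::] v0 [:: (a, v1)])) M_unitl.
rewrite (linZ _ _ (M_lin v0 [:: (lks a, v1)] v1 [::])) M_unitr /lsc.
rewrite -[(- a) K]/(- a K) mulrN mulrBl => /eqP.
by rewrite subr_eq0 => /eqP <-; rewrite addrAC subrr add0r.
Qed.

(** Inner curvature puts a multiple of the unit beside at least two inputs, where strict unitality
    kills it. *)
Lemma M_ainf2 v0 s : (2 <= size s)%N ->
  \sum_(i < (size s).+1) \sum_(j < (size s).+1 | (0 < j)%N && (i + j <= size s)%N)
     ainf_summand v0 s i j = 0.
Proof.
move=> s2; rewrite -[RHS](M_ainf v0 s); apply: eq_bigr => i _.
rewrite [RHS](bigID (fun j : 'I_(size s).+1 => (0 < j)%N)) /=.
rewrite [X in _ = _ + X]big1 ?addr0 => [|j /andP[ij]].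
  by apply: eq_bigl => j; rewrite andbC.
rewrite lt0n negbK => /eqP j0; rewrite /ainf_summand j0 take0 M_curv addn0.
rewrite (linZ _ _ (M_lin _ _ _ _)) M_unit; last first.
  by rewrite size_map size_takel ?size_drop; lia.
by apply/funext => J; rewrite /lsc lm0E mulr0.
Qed.

End Properties.

(** * Smooth complex functions on open sets *)

Section SmoothToolkit.
Variables (R : realType) (V : normedModType R).
Local Notation C := R[i].
Implicit Types (D : set V) (f g : V -> C) (x v : V).

Definition isd f x v (d : C) : Prop :=
  is_derive x v (fun w => complex.Re (f w) : R^o) (complex.Re d) /\
  is_derive x v (fun w => complex.Im (f w) : R^o) (complex.Im d).

Definition dC v f : V -> C := fun x =>
  'D_v (fun w => complex.Re (f w) : R^o) x +i* 'D_v (fun w => complex.Im (f w) : R^o) x.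

Definition c1 f x : Prop :=
  c1part (fun w => complex.Re (f w)) x /\ c1part (fun w => complex.Im (f w)) x.

(** Functions are total on V; on an open set D only their values on D matter ([smo_ext]). *)
Record smo D f : Prop := Smo {
  smoE : forall vs x, D x -> c1 (foldr dC f vs) x
}.

Lemma isd_dC f x v d : isd f x v d -> dC v f x = d.
Proof. by move=> [[_ a] [_ b]]; rewrite /dC a b; case: d {a b}. Qed.

Lemma c1_isd f x v : c1 f x -> isd f x v (dC v f x).
Proof. by move=> [[_ a] [_ b]]; split; apply: DeriveDef. Qed.

Lemma isd_c1 f x : {for x, continuous (fun w => complex.Re (f w))} ->
  {for x, continuous (fun w => complex.Im (f w))} ->
  (forall v, exists d, isd f x v d) -> c1 f x.
Proof.
move=> cr ci h; split; split; [exact: cr| |exact: ci|] => v;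
  have [d [[a _] [b _]]] := h v; [exact: a | exact: b].
Qed.

Lemma isd_cst (c : C) x v : isd (fun=> c) x v 0.
Proof. by split; exact: is_derive_cst. Qed.

Lemma isd_add f g x v d d' : isd f x v d -> isd g x v d' ->
  isd (fun w => f w + g w) x v (d + d').
Proof.
move=> [a b] [a' b']; split; under eq_fun do rewrite ReImE; rewrite ReImE; exact: is_deriveD.
Qed.

Lemma isd_mul f g x v d d' : isd f x v d -> isd g x v d' ->
  isd (fun w => f w * g w) x v (d * g x + f x * d').
Proof.
move=> [a b] [a' b']; split; under eq_fun do rewrite ReImE.
  have := is_deriveB (is_deriveM a a') (is_deriveM b b').
  by move=> h; apply: (is_derive_eq h); rewrite !ReImE /GRing.scale /=; ring.
have := is_deriveD (is_deriveM a b') (is_deriveM b a').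
by move=> h; apply: (is_derive_eq h); rewrite !ReImE /GRing.scale /=; ring.
Qed.

Lemma c1_cst (c : C) x : c1 (fun=> c) x.
Proof. by split; split=> [|v]; [exact: cvg_cst|exact: derivable_cst|exact: cvg_cst|exact: derivable_cst]. Qed.

Lemma c1_add f g x : c1 f x -> c1 g x -> c1 (fun w => f w + g w) x.
Proof.
move=> cf cg; apply: isd_c1 => [||v].
- rewrite (funext (fun w => ReD (f w) (g w))); exact: (continuousD cf.1.1 cg.1.1).
- rewrite (funext (fun w => ImD (f w) (g w))); exact: (continuousD cf.2.1 cg.2.1).
- by eexists; apply: isd_add; apply: c1_isd.
Qed.

Lemma c1_mul f g x : c1 f x -> c1 g x -> c1 (fun w => f w * g w) x.
Proof.
move=> cf cg; apply: isd_c1 => [||v].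
- rewrite (funext (fun w => ReM (f w) (g w))).
  exact: (continuousB (continuousM cf.1.1 cg.1.1) (continuousM cf.2.1 cg.2.1)).
- rewrite (funext (fun w => ImM (f w) (g w))).
  exact: (continuousD (continuousM cf.1.1 cg.2.1) (continuousM cf.2.1 cg.1.1)).
- by eexists; apply: isd_mul; apply: c1_isd.
Qed.

Lemma near_open D x : open D -> D x -> \forall y \near x, D y.
Proof. by move=> oD Dx; exact: open_nbhs_nbhs. Qed.

Lemma cont_near (a b : V -> R) x : {for x, continuous a} ->
  (\forall y \near x, a y = b y) -> {for x, continuous b}.
Proof.
move=> ca ab; have ax : a x = b x by exact: nbhs_singleton ab.
change (b @ x --> b x); rewrite -ax; apply: cvg_trans ca.
exact: near_eq_cvg.
Qed.

Lemma isd_near D f g x v d : open D -> D x -> (forall y, D y -> f y = g y) ->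
  isd f x v d -> isd g x v d.
Proof.
move=> oD Dx fg [a b]; have nD := near_open oD Dx.
by split; [apply: near_eq_is_derive a|apply: near_eq_is_derive b];
  apply: filterS nD => y Dy; rewrite fg.
Qed.

Lemma dC_ext D f g x v : open D -> D x -> (forall y, D y -> f y = g y) ->
  dC v f x = dC v g x.
Proof.
move=> oD Dx fg; have nD := near_open oD Dx.
by congr (_ +i* _); apply: near_eq_derive; apply: filterS nD => y Dy; rewrite fg.
Qed.

Lemma c1_ext D f g x : open D -> D x -> (forall y, D y -> f y = g y) -> c1 f x -> c1 g x.
Proof.
move=> oD Dx fg cf; have nD := near_open oD Dx; apply: isd_c1 => [||v].
- by apply: (cont_near cf.1.1); apply: filterS nD => y Dy; rewrite fg.
- by apply: (cont_near cf.2.1); apply: filterS nD => y Dy; rewrite fg.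
- by exists (dC v f x); apply: isd_near oD Dx fg _; exact: c1_isd.
Qed.

Lemma foldr_dC_ext D f g vs x : open D -> D x -> (forall y, D y -> f y = g y) ->
  foldr dC f vs x = foldr dC g vs x.
Proof.
move=> oD Dx fg; elim: vs x Dx => [|v vs IH] x Dx /=; first exact: fg.
exact: dC_ext oD Dx IH.
Qed.

Lemma smo_ext D f g : open D -> (forall y, D y -> f y = g y) -> smo D f -> smo D g.
Proof.
move=> oD fg [sf]; split=> vs x Dx; apply: (c1_ext oD Dx _ (sf vs x Dx)) => y Dy.
exact: (foldr_dC_ext _ oD Dy fg).
Qed.

Lemma smo_sub D D' f : D `<=` D' -> smo D' f -> smo D f.
Proof. by move=> DD [sf]; split=> vs x /DD; exact: sf. Qed.

Lemma smo_dC D f v : smo D f -> smo D (dC v f).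
Proof. by move=> [sf]; split=> vs x Dx; rewrite -foldr_rcons; exact: sf. Qed.

Lemma smo_c1 D f x : smo D f -> D x -> c1 f x.
Proof. by move=> [sf]; exact: (sf [::]). Qed.

Inductive alg D (P : (V -> C) -> Prop) : (V -> C) -> Prop :=
| alg_base f : P f -> alg D P f
| alg_smo f : smo D f -> alg D P f
| alg_add f g : alg D P f -> alg D P g -> alg D P (fun w => f w + g w)
| alg_mul f g : alg D P f -> alg D P g -> alg D P (fun w => f w * g w)
| alg_ext f g : alg D P f -> (forall y, D y -> f y = g y) -> alg D P g.

(* Smoothness is coinductive: a family of C^1 functions whose derivatives are *)
(* polynomials in the family and in smooth functions is smooth.               *)
Lemma smo_alg D (P : (V -> C) -> Prop) : open D ->
  (forall f x, P f -> D x -> c1 f x) -> (forall f v, P f -> alg D P (dC v f)) ->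
  forall f, alg D P f -> smo D f.
Proof.
move=> oD Pc1 PdC f Pf.
have step h : alg D P h -> (forall x, D x -> c1 h x) /\ (forall v, alg D P (dC v h)).
  elim=> {h} [h Ph|h sh|h k _ [c1h dh] _ [c1k dk]|h k ah [c1h dh] ak [c1k dk]|h k _ [c1h dh] hk].
  - by split=> [x Dx|v]; [exact: Pc1|exact: PdC].
  - by split=> [x Dx|v]; [exact: smo_c1 sh Dx|apply: alg_smo; exact: smo_dC].
  - split=> [x Dx|v]; first by apply: c1_add; [exact: c1h|exact: c1k].
    apply: (alg_ext (alg_add (dh v) (dk v))) => y Dy.
    by apply/esym/isd_dC/isd_add; apply: c1_isd; [exact: c1h|exact: c1k].
  - split=> [x Dx|v]; first by apply: c1_mul; [exact: c1h|exact: c1k].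
    apply: (alg_ext (alg_add (alg_mul (dh v) ak) (alg_mul ah (dk v)))) => y Dy.
    by apply/esym/isd_dC/isd_mul; apply: c1_isd; [exact: c1h|exact: c1k].
  - split=> [x Dx|v]; first exact: c1_ext oD Dx hk (c1h x Dx).
    by apply: (alg_ext (dh v)) => y Dy; exact: dC_ext oD Dy hk.
split=> vs x Dx; have : alg D P (foldr dC f vs).
  by elim: vs => //= v vs IH; exact: (step _ IH).2.
by move=> /step[h _]; exact: h.
Qed.

Lemma smo_cst D (c : C) : open D -> smo D (fun=> c).
Proof.
move=> oD; apply: (smo_alg oD (P := fun f => exists c, f = fun=> c)).
- by move=> _ x [c' ->] _; exact: c1_cst.
- move=> _ v [c' ->]; apply: alg_base; exists 0; apply/funext => x.
  by apply: isd_dC; exact: isd_cst.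
- by apply: alg_base; exists c.
Qed.

Lemma smoD D f g : open D -> smo D f -> smo D g -> smo D (fun w => f w + g w).
Proof.
by move=> oD sf sg; apply: (smo_alg oD (P := fun=> False)) => //; apply: alg_add; exact: alg_smo.
Qed.

Lemma smoM D f g : open D -> smo D f -> smo D g -> smo D (fun w => f w * g w).
Proof.
by move=> oD sf sg; apply: (smo_alg oD (P := fun=> False)) => //; apply: alg_mul; exact: alg_smo.
Qed.

Lemma smoZ D c f : open D -> smo D f -> smo D (fun w => c * f w).
Proof. by move=> oD sf; apply: smoM => //; exact: smo_cst. Qed.

Lemma smoB D f g : open D -> smo D f -> smo D g -> smo D (fun w => f w - g w).
Proof.
move=> oD sf sg; apply: (@smo_ext _ (fun w => f w + (-1) * g w)) => //.
  by move=> y _; rewrite mulN1r.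
by apply: smoD => //; exact: smoZ.
Qed.

Lemma smo_sum D I (r : seq I) (P : pred I) (F : I -> V -> C) : open D ->
  (forall i, P i -> smo D (F i)) -> smo D (fun w => \sum_(i <- r | P i) F i w).
Proof.
move=> oD sF; elim: r => [|i r IH].
  by under eq_fun do rewrite big_nil; exact: smo_cst.
under eq_fun do rewrite big_cons.
have [Pi|nPi] := boolP (P i); last exact: IH.
by apply: smoD => //; exact: sF.
Qed.

Lemma dCD D f g v x : smo D f -> smo D g -> D x ->
  dC v (fun w => f w + g w) x = dC v f x + dC v g x.
Proof. by move=> sf sg Dx; apply/isd_dC/isd_add; apply: c1_isd; apply: smo_c1 Dx. Qed.

Lemma dCM D f g v x : smo D f -> smo D g -> D x ->
  dC v (fun w => f w * g w) x = dC v f x * g x + f x * dC v g x.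
Proof. by move=> sf sg Dx; apply/isd_dC/isd_mul; apply: c1_isd; apply: smo_c1 Dx. Qed.

Lemma dC_cst v (c : C) x : dC v (fun=> c) x = 0.
Proof. by apply: isd_dC; exact: isd_cst. Qed.

Lemma dCZ D c f v x : open D -> smo D f -> D x -> dC v (fun w => c * f w) x = c * dC v f x.
Proof.
by move=> oD sf Dx; rewrite (dCM _ (smo_cst c oD) sf Dx) dC_cst mul0r add0r.
Qed.

Lemma dCB D f g v x : open D -> smo D f -> smo D g -> D x ->
  dC v (fun w => f w - g w) x = dC v f x - dC v g x.
Proof.
move=> oD sf sg Dx; rewrite -mulN1r -(dCZ _ _ oD sg Dx) -(dCD _ sf _ Dx); last exact: smoZ.
by apply: (dC_ext _ oD Dx) => y _; rewrite mulN1r.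
Qed.

Lemma dC_sum D I (r : seq I) (P : pred I) (F : I -> V -> C) v x : open D ->
  (forall i, P i -> smo D (F i)) -> D x ->
  dC v (fun w => \sum_(i <- r | P i) F i w) x = \sum_(i <- r | P i) dC v (F i) x.
Proof.
move=> oD sF Dx; elim: r => [|i r IH].
  by under eq_fun do rewrite big_nil; rewrite big_nil dC_cst.
under eq_fun do rewrite big_cons; rewrite big_cons.
case: ifP => // Pi; rewrite (dCD _ (sF i Pi) _ Dx) ?IH //.
exact: smo_sum.
Qed.

(** Meant for an explicit difference quotient [Phi] whose distance to the derivative is at most
    linear in h. *)
Lemma isd_quot f x v d (Phi : R -> C) :
  (forall h : R, f (h *: v + x) - f x = h%:C * Phi h) ->
  (exists B e : R, 0 < e /\ forall h : R, `|h| < e -> nc (Phi h - d) <= B * `|h|) ->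
  isd f x v d.
Proof.
move=> fPhi [B [e [e0 hB]]].
have cvg0 : (fun h : R => B * `|h|) @ 0^' --> (0 : R).
  suff : (fun h : R => B * `|h|) @ 0^' --> B * `|0 : R| by rewrite normr0 mulr0.
  apply: cvgM; first exact: cvg_cst.
  by apply: cvg_norm; exact: cvg_within.
have key (P : C -> R) : (forall a b, P (a + b) = P a + P b) -> (forall a, P (- a) = - P a) ->
    (forall (h : R) a, P (h%:C * a) = h * P a) -> (forall a, `|P a| <= nc a) ->
    is_derive x v (fun w => P (f w) : R^o) (P d).
  move=> PD PN PZ Ple.
  have h : (fun h : R => h^-1 *: (((fun w => P (f w) : R^o) \o shift x) (h *: v) - P (f x))) @ 0^' --> (P d : R^o).
    apply/subr_cvg0; apply: norm_cvg0.
    apply: (squeeze_cvgr _ (cvg_cst 0) cvg0).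
    have en : \forall h \near 0^', `|h| < e /\ h != 0 :> R.
      near=> h; split; near: h.
        by exists e => //= h /=; rewrite sub0r normrN.
      exact: nbhs_dnbhs_neq.
    apply: filterS en => h [he h0] /=; rewrite normr_ge0 /=.
    rewrite -PN -PD fPhi PZ /GRing.scale /= mulKf // -PN -PD.
    exact: le_trans (Ple _) (hB h he).
  by split; [apply: cvgP h|exact: cvg_lim h].
split; apply: key.
- exact: ReD.
- exact: ReN.
- by move=> h a; rewrite ReM /= mul0r subr0.
- exact: Re_nc.
- exact: ImD.
- exact: ImN.
- by move=> h a; rewrite ImM /= mul0r addr0.
- exact: Im_nc.
Unshelve. all: by end_near. Qed.

Lemma cont_lip f x (B e : R) : 0 < e ->
  (forall y, `|y - x| < e -> nc (f y - f x) <= B * `|y - x|) ->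
  {for x, continuous (fun w => complex.Re (f w))} /\
  {for x, continuous (fun w => complex.Im (f w))}.
Proof.
move=> e0 fB.
have cvg0 : (fun y => B * `|y - x|) @ x --> (0 : R).
  suff : (fun y => B * `|y - x|) @ x --> B * `|x - x| by rewrite subrr normr0 mulr0.
  apply: cvgM; first exact: cvg_cst.
  by apply: cvg_norm; apply: cvgB; [exact: cvg_id|exact: cvg_cst].
have en : \forall y \near x, `|y - x| < e.
  by apply: filterS (nbhsx_ballx x e e0) => y; rewrite -ball_normE /= distrC.
split; apply/subr_cvg0; apply: norm_cvg0; apply: (squeeze_cvgr _ (cvg_cst 0) cvg0);
  apply: filterS en => y ye; rewrite normr_ge0 /=; apply: le_trans (fB y ye).
  by rewrite -ReN -ReD Re_nc.
by rewrite -ImN -ImD Im_nc.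
Qed.

End SmoothToolkit.

Section SmoothSub.
Variables (R : realType) (V : normedModType R) (D : set V).
Hypothesis oD : open D.
Local Notation C := R[i].

Lemma extend_val (f : D -> C) (d : D) : extend f (val d) = f d.
Proof. by rewrite /extend valK. Qed.

Lemma extend_restr (F : V -> C) x : D x -> extend (fun d : D => F (val d)) x = F x.
Proof. by move=> /mem_set Dx; rewrite -[x]/(val (SigSub Dx)) extend_val. Qed.

Lemma foldr_pderiv (f : D -> C) vs x : D x ->
  extend (foldr (@pderiv R V D) f vs) x = foldr (@dC R V) (extend f) vs x.
Proof.
elim: vs x => //= v vs IH x Dx; rewrite -(dC_ext v oD Dx IH).
by move: Dx => /mem_set Dx; rewrite -[x]/(val (SigSub Dx)) extend_val.
Qed.

(** The extension by zero off D is invisible to derivatives at points of the open set D. *)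
Lemma smoothP (f : D -> C) : smooth f <-> smo D (extend f).
Proof.
split=> [h|[h] vs]; last first.
  move=> d; have Dd : D (val d) by exact: set_valP.
  by apply: (c1_ext oD Dd _ (h vs _ Dd)) => y Dy; rewrite foldr_pderiv.
split=> vs x Dx; have := Dx => /mem_set Dx'; have := h vs (SigSub Dx').
by move=> cx; apply: (c1_ext oD Dx _ cx) => y Dy; rewrite foldr_pderiv.
Qed.

Lemma smooth_restr (F : V -> C) : smo D F -> smooth (fun d : D => F (val d)).
Proof.
by move=> sF; apply/smoothP; apply: smo_ext oD _ sF => y Dy; rewrite extend_restr.
Qed.

Lemma pderiv_restr (F : V -> C) v (d : D) : pderiv v (fun d : D => F (val d)) d = dC v F (val d).
Proof.
have Dd : D (val d) by exact: set_valP.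
by rewrite /pderiv -/(dC _ _ _); apply: (dC_ext v oD Dd) => y; exact: extend_restr.
Qed.

End SmoothSub.

(** * Linearity in the direction and symmetry of second derivatives *)

Lemma tri3 (R : realFieldType) (a b c p q e : R) :
  `|a - (q + p)| < e / 3 -> `|b - q| < e / 3 -> `|c - p| < e / 3 -> `|a - (b + c)| <= e.
Proof.
have -> : a - (b + c) = (a - (q + p)) - (b - q) - (c - p) by ring.
move=> l1 l2 l3; apply: le_trans (ler_normB _ _) _.
by apply: le_trans (lerD (ler_normB _ _) (lexx _)) _; lra.
Qed.

Lemma tri2 (R : realFieldType) (a b c e : R) :
  `|a - c| < e / 2 -> `|b - c| < e / 2 -> `|a - b| <= e.
Proof.
have -> : a - b = (a - c) - (b - c) by ring.
by move=> l1 l2; apply: le_trans (ler_normB _ _) _; lra.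
Qed.

Lemma subrACA (R : comPzRingType) (a b c d : R) : a - b - (c - d) = a - c - (b - d).
Proof. by ring. Qed.

Section Directional.
Variables (R : realType) (V : normedModType R).
Implicit Types (g : V -> R) (x v w : V).

Lemma is_derive_line g x v (s : R) : derivable (g : V -> R^o) (x + s *: v) v ->
  is_derive s 1 (fun t : R => g (x + t *: v) : R^o) ('D_v (g : V -> R^o) (x + s *: v)).
Proof.
move=> dg.
have E : (fun h : R => h^-1 *: (((fun t : R => g (x + t *: v) : R^o) \o shift s) (h *: 1) -
    g (x + s *: v))) = (fun h : R => h^-1 *: (((g : V -> R^o) \o shift (x + s *: v)) (h *: v) -
    g (x + s *: v))).
  apply/funext => h /=; congr (_ *: (g _ - _)).
  by rewrite [h *: 1]mulr1 scalerDl addrCA.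
by split; rewrite /derivable /derive E.
Qed.

Lemma mvt_line g x v (h : R) : 0 < h ->
  (forall s, 0 <= s <= h -> derivable (g : V -> R^o) (x + s *: v) v) ->
  exists2 s, 0 <= s <= h & g (x + h *: v) - g x = h * 'D_v (g : V -> R^o) (x + s *: v).
Proof.
move=> h0 dg.
have [||s sh e] := @MVT R (fun t => g (x + t *: v)) (fun s => 'D_v (g : V -> R^o) (x + s *: v)) 0 h h0.
- move=> s; rewrite in_itv /= => /andP[s0 sh]; apply: is_derive_line; apply: dg.
  by rewrite !ltW.
- apply: derivable_within_continuous => s; rewrite in_itv /= => sh.
  by have [] := is_derive_line (dg s sh).
exists s; first by move: sh; rewrite in_itv /= => /andP[s0 sh]; rewrite !ltW.
by move: e; rewrite scale0r addr0 subr0 mulrC.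
Qed.

Lemma ball_line x v w (s s' h d : R) : 0 <= s <= h -> 0 <= s' <= h ->
  h * (`|v| + `|w|) < d -> `|x + s *: v + s' *: w - x| < d.
Proof.
move=> /andP[s0 sh] /andP[s'0 s'h] hd; apply: le_lt_trans hd.
rewrite addrAC [x + s *: v]addrC addrK; apply: le_trans (ler_normD _ _) _.
by rewrite mulrDr !normrZ !ger0_norm // lerD // ler_wpM2r.
Qed.

Lemma small_h v w (d : R) : 0 < d -> exists2 h : R, 0 < h & h * (`|v| + `|w|) < d.
Proof.
move=> d0; have c0 : 0 <= `|v| + `|w| by rewrite addr_ge0.
exists (d / (`|v| + `|w| + 1)); first by rewrite divr_gt0 // ltr_wpDl.
by rewrite -mulrA gtr_pMr // mulrC ltr_pdivrMr ?mul1r ?ltrDl // ltr_wpDl.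
Qed.

(** An increment along v + w is one along v followed by one along w; the mean value theorem turns
    the second into a value of D_w at a nearby point, close to D_w at x. This has to be proved
    because C^1 is expressed through directional derivatives only. *)
Lemma deriveDdir g x v w (d : R) : 0 < d ->
  (forall y, `|y - x| < d -> derivable (g : V -> R^o) y v /\ derivable (g : V -> R^o) y w) ->
  {for x, continuous ('D_w (g : V -> R^o))} -> derivable (g : V -> R^o) x (v + w) ->
  'D_(v + w) (g : V -> R^o) x = 'D_v (g : V -> R^o) x + 'D_w (g : V -> R^o) x.
Proof.
move=> d0 dg cw dvw; apply/eqP; rewrite -subr_eq0 -normr_le0; apply/ler_addgt0Pl => e e0.
rewrite addr0; have e3 : 0 < e / 3 by rewrite divr_gt0.
have lim u : derivable (g : V -> R^o) x u -> \forall h \near (0 : R)^'+,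
    `|'D_u (g : V -> R^o) x - h^-1 * (g (h *: u + x) - g x)| < e / 3.
  move=> du; have : (fun h : R => h^-1 *: (((g : V -> R^o) \o shift x) (h *: u) - g x)) @ 0^'+ -->
     'D_u (g : V -> R^o) x.
    by apply: cvg_dnbhs_at_right; exact: du.
  by move=> /cvgrPdist_lt /(_ _ e3).
have x0 : `|x - x| < d by rewrite subrr normr0.
have [dv dw] := dg x x0.
have [d1 /= d10 hd1] : exists2 d1 : R, 0 < d1 & forall y, `|x - y| < d1 ->
    `|'D_w (g : V -> R^o) x - 'D_w (g : V -> R^o) y| < e / 3.
  have /cvgrPdist_lt/(_ _ e3) := cw => /nbhs_ballP[d1 d10 h1]; exists d1 => // y yd.
  by apply: h1; rewrite -ball_normE.
have dm0 : 0 < Order.min d d1 by rewrite lt_min d0.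
have [h0 h00 hh0] := small_h v w dm0.
have hsmall : \forall h \near (0 : R)^'+, h < h0 by exact: nbhs_right_lt.
have hpos : \forall h \near (0 : R)^'+, 0 < h by exact: nbhs_right_gt.
near (0 : R)^'+ => h.
have l1 : `|'D_(v + w) (g : V -> R^o) x - h^-1 * (g (h *: (v + w) + x) - g x)| < e / 3.
  by near: h; exact: lim.
have l2 : `|'D_v (g : V -> R^o) x - h^-1 * (g (h *: v + x) - g x)| < e / 3.
  by near: h; exact: lim.
have hs : h < h0 by near: h.
have hp : 0 < h by near: h.
have hd : h * (`|v| + `|w|) < Order.min d d1.
  by apply: le_lt_trans hh0; rewrite ler_wpM2r ?addr_ge0 // ltW.
have hh : 0 <= h <= h by rewrite lexx ltW.
have [s sh es] : exists2 s, 0 <= s <= h & g (x + h *: v + h *: w) - g (x + h *: v) =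
    h * 'D_w (g : V -> R^o) (x + h *: v + s *: w).
  apply: (mvt_line hp) => s' sh'; apply: (dg _ _).2.
  by apply: lt_le_trans (ball_line x hh sh' hd) _; rewrite ge_min lexx.
have l3 : `|'D_w (g : V -> R^o) x - 'D_w (g : V -> R^o) (x + h *: v + s *: w)| < e / 3.
  apply: hd1; rewrite distrC.
  by apply: lt_le_trans (ball_line x hh sh hd) _; rewrite ge_min lexx orbT.
move: l1 l2 l3 es; set a := 'D_(v + w) _ _; set b := 'D_v _ _; set c := 'D_w _ x.
set p := 'D_w _ _ => l1 l2 l3 es.
have E : h^-1 * (g (h *: (v + w) + x) - g x) = h^-1 * (g (h *: v + x) - g x) + p.
  have -> : p = h^-1 * (h * p) by rewrite mulKf // gt_eqF.
  rewrite -es -mulrDr scalerDr [h *: v + x]addrC [h *: v + h *: w + x]addrC addrA; congr (_ * _).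
  by rewrite [RHS]addrC addrA subrK.
move: l1; rewrite E; move: l2 l3; set q := _ * _ => l2 l3 l1.
exact: tri3 l1 l2 l3.
Unshelve. all: by end_near. Qed.

(** The mean value theorem is applied to z |-> g (z + h w) - g z along v, then to D_v g along w. *)
Lemma mixed_diff g x v w (d h : R) : 0 < h -> h * (`|v| + `|w|) < d ->
  (forall y, `|y - x| < d -> derivable (g : V -> R^o) y v /\
     derivable ('D_v (g : V -> R^o) : V -> R^o) y w) ->
  exists2 y, `|y - x| < d &
    g (x + h *: v + h *: w) - g (x + h *: v) - (g (x + h *: w) - g x) =
    h * (h * 'D_w ('D_v (g : V -> R^o) : V -> R^o) y).
Proof.
move=> h0 hd dg; have hh : 0 <= h <= h by rewrite lexx ltW.
have z0 : (0 : R) <= 0 <= h by rewrite lexx ltW.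
pose k z := g (z + h *: w) - g z.
have dk z : `|z - x| < d -> `|z + h *: w - x| < d ->
    is_derive z v (k : V -> R^o) ('D_v (g : V -> R^o) (z + h *: w) - 'D_v (g : V -> R^o) z).
  move=> z1 z2; apply: is_deriveB; last by apply: derivableP; exact: (dg _ z1).1.
  have dz := (dg _ z2).1.
  have E : (fun h' : R => h'^-1 *: (((fun y => g (y + h *: w) : R^o) \o shift z) (h' *: v) -
      g (z + h *: w))) = (fun h' : R => h'^-1 *: (((g : V -> R^o) \o shift (z + h *: w)) (h' *: v) -
      g (z + h *: w))).
    by apply/funext => h' /=; rewrite addrA.
  by split; rewrite /derivable /derive E.
have pt (s : R) : 0 <= s <= h -> `|x + s *: v - x| < d /\ `|x + s *: v + h *: w - x| < d.
  move=> sh; split; last exact: ball_line sh hh hd.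
  by have := ball_line x sh z0 hd; rewrite scale0r addr0.
have [s sh es] : exists2 s, 0 <= s <= h & k (x + h *: v) - k x =
    h * 'D_v (k : V -> R^o) (x + s *: v).
  by apply: (mvt_line h0) => s /pt[p1 p2]; have [dks _] := dk _ p1 p2; exact: dks.
have [p1 p2] := pt s sh; have [_ dkE] := dk _ p1 p2.
have [s' sh' es'] : exists2 s', 0 <= s' <= h &
    'D_v (g : V -> R^o) (x + s *: v + h *: w) - 'D_v (g : V -> R^o) (x + s *: v) =
    h * 'D_w ('D_v (g : V -> R^o) : V -> R^o) (x + s *: v + s' *: w).
  apply: (@mvt_line ('D_v (g : V -> R^o)) (x + s *: v) w h h0) => s' sh'.
  by have [_ h2] := dg _ (ball_line x sh sh' hd); exact: h2.
exists (x + s *: v + s' *: w); first exact: ball_line sh sh' hd.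
by rewrite -es' -dkE -es /k.
Qed.

(** The second difference is symmetric in v and w, and it is h^2 times either mixed derivative at
    some point near x. *)
Lemma schwarz g x v w (d : R) : 0 < d ->
  (forall y, `|y - x| < d -> derivable (g : V -> R^o) y v /\ derivable (g : V -> R^o) y w) ->
  (forall y, `|y - x| < d -> derivable ('D_v (g : V -> R^o) : V -> R^o) y w /\
     derivable ('D_w (g : V -> R^o) : V -> R^o) y v) ->
  {for x, continuous ('D_w ('D_v (g : V -> R^o) : V -> R^o))} ->
  {for x, continuous ('D_v ('D_w (g : V -> R^o) : V -> R^o))} ->
  'D_w ('D_v (g : V -> R^o) : V -> R^o) x = 'D_v ('D_w (g : V -> R^o) : V -> R^o) x.
Proof.
move=> d0 d1 d2 c1 c2; apply/eqP; rewrite -subr_eq0 -normr_le0; apply/ler_addgt0Pl => e e0.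
rewrite addr0; have e3 : 0 < e / 2 by rewrite divr_gt0.
have ball (F : V -> R) : {for x, continuous F} ->
    exists2 d3 : R, 0 < d3 & forall y, `|y - x| < d3 -> `|F x - F y| < e / 2.
  move=> cF; have /cvgrPdist_lt/(_ _ e3) := cF => /nbhs_ballP[d3 d30 h1]; exists d3 => // y yd.
  by apply: h1; rewrite -ball_normE /= distrC.
have [d3 d30 h3] := ball _ c1; have [d4 d40 h4] := ball _ c2.
pose m := Order.min d (Order.min d3 d4).
have m0 : 0 < m by rewrite !lt_min d0 d30.
have md y : `|y - x| < m -> [/\ `|y - x| < d, `|y - x| < d3 & `|y - x| < d4].
  by rewrite !lt_min => /and3P[-> -> ->].
have [h h0 hd] := small_h v w m0.
have [y yd ey] : exists2 y, `|y - x| < m &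
    g (x + h *: v + h *: w) - g (x + h *: v) - (g (x + h *: w) - g x) =
    h * (h * 'D_w ('D_v (g : V -> R^o) : V -> R^o) y).
  by apply: (mixed_diff h0 hd) => y /md[yd _ _]; split; [exact: (d1 y yd).1|exact: (d2 y yd).1].
have [z zd ez] : exists2 z, `|z - x| < m &
    g (x + h *: w + h *: v) - g (x + h *: w) - (g (x + h *: v) - g x) =
    h * (h * 'D_v ('D_w (g : V -> R^o) : V -> R^o) z).
  have hd' : h * (`|w| + `|v|) < m by rewrite (addrC `|w|).
  by apply: (mixed_diff h0 hd') => z /md[zd _ _]; split; [exact: (d1 z zd).2|exact: (d2 z zd).2].
have yz : 'D_w ('D_v (g : V -> R^o) : V -> R^o) y = 'D_v ('D_w (g : V -> R^o) : V -> R^o) z.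
  apply: (mulfI (lt0r_neq0 h0)); apply: (mulfI (lt0r_neq0 h0)).
  apply: (etrans (esym ey)); apply: (etrans _ ez).
  apply: (etrans (subrACA _ _ _ _)); apply: (f_equal (fun t => t - _ - _)).
  apply: (f_equal g); exact: addrAC.
have [_ y3 _] := md y yd; have [_ _ z4] := md z zd.
have := h3 y y3; have := h4 z z4; rewrite yz => l1 l2.
exact: tri2 l2 l1.
Qed.

End Directional.

Section DirectionalC.
Variables (R : realType) (V : normedModType R) (D : set V).
Hypothesis oD : open D.
Local Notation C := R[i].
Implicit Types (f : V -> C) (x v w : V).

Lemma open_ball x : D x -> exists2 d : R, 0 < d & forall y, `|y - x| < d -> D y.
Proof.
move=> Dx; have /nbhs_ballP[d d0 h] := open_nbhs_nbhs (conj oD Dx).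
by exists d => // y yd; apply: h; rewrite -ball_normE /= distrC.
Qed.

Lemma dCDdir f x v w : smo D f -> D x -> dC (v + w) f x = dC v f x + dC w f x.
Proof.
move=> sf Dx; have [d d0 hd] := open_ball Dx.
have cf y : `|y - x| < d -> c1 f y by move/hd; exact: smo_c1 sf.
have cw := smo_c1 (smo_dC w sf) Dx.
have cx := smo_c1 sf Dx.
apply/eqP; rewrite eq_complex /=; apply/andP; split; apply/eqP; apply: (deriveDdir d0).
- by move=> y /cf[[_ h] _]; split; exact: h.
- exact: cw.1.1.
- exact: cx.1.2.
- by move=> y /cf[_ [_ h]]; split; exact: h.
- exact: cw.2.1.
- exact: cx.2.2.
Qed.

Lemma dC_schwarz f x v w : smo D f -> D x -> dC w (dC v f) x = dC v (dC w f) x.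
Proof.
move=> sf Dx; have [d d0 hd] := open_ball Dx.
have cf y : `|y - x| < d -> c1 f y by move/hd; exact: smo_c1 sf.
have cf1 u y : `|y - x| < d -> c1 (dC u f) y by move/hd; exact: (smo_c1 (smo_dC u sf)).
have cvw := smo_c1 (smo_dC w (smo_dC v sf)) Dx.
have cwv := smo_c1 (smo_dC v (smo_dC w sf)) Dx.
apply/eqP; rewrite eq_complex /=; apply/andP; split; apply/eqP; apply: (schwarz d0).
- by move=> y /cf[[_ h] _]; split; exact: h.
- by move=> y yd; split; [exact: (cf1 v y yd).1.2|exact: (cf1 w y yd).1.2].
- exact: cvw.1.1.
- exact: cwv.1.1.
- by move=> y /cf[_ [_ h]]; split; exact: h.
- by move=> y yd; split; [exact: (cf1 v y yd).2.2|exact: (cf1 w y yd).2.2].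
- exact: cvw.2.1.
- exact: cwv.2.1.
Qed.

Lemma dCZdir f x v (c : R) : smo D f -> D x -> dC (c *: v) f x = c%:C * dC v f x.
Proof.
move=> sf Dx; have [c0|c0] := eqVneq c 0.
  by rewrite c0 scale0r mul0r /dC !derive0.
have cx := smo_c1 sf Dx.
have key (g : V -> R) : c1part g x ->
    'D_(c *: v) (g : V -> R^o) x = c * 'D_v (g : V -> R^o) x.
  move=> [_ dg]; have dl u : is_derive (0 : R^o) 1 (fun t : R => g (x + t *: u) : R^o)
      ('D_u (g : V -> R^o) x).
    have := @is_derive_line R V g x u 0; rewrite scale0r addr0; apply; exact: dg.
  have dc : is_derive (0 : R^o) 1 ((fun t : R => g (x + t *: v) : R^o) \o (fun t : R^o => c *: t))
      ('D_v (g : V -> R^o) x * c).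
    apply: is_derive1_comp; first by rewrite scaler0; exact: dl.
    by have := is_deriveZ c (is_derive_id (0 : R^o) 1); rewrite /GRing.scale /= mulr1.
  have [_ <-] := dl (c *: v); case: dc => _; rewrite mulrC => <-.
  have -> : (fun t : R => g (x + t *: (c *: v))) =
      (fun t : R => g (x + t *: v)) \o (fun t : R^o => c *: t).
    by apply/funext => t /=; rewrite scalerA mulrC.
  by [].
apply/eqP; rewrite eq_complex !ReImE /= !mul0r subr0 addr0.
by rewrite (key _ cx.1) (key _ cx.2) !eqxx.
Qed.

End DirectionalC.

(** * Smooth dependence of the deformed operations on parameters *)

Section AffineM.
Variables (R : realType) (n : nat) (D : fukaya_data R n).
Local Notation C := R[i].
Local Notation G := (cls D).
Local Notation Lm := ({set 'I_n} -> nov D).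
Local Notation vec := ('I_n -> C).
Local Notation LE := (@LE R n D).

Definition vbd (r : R) (v : vec) := forall i, nc (v i) <= r.

Lemma vbounded_Forall r v0 vs : vbd r v0 -> List.Forall (vbd r) vs -> vbounded r v0 vs.
Proof.
move=> h0 h [|j] i /=; first exact: h0.
by elim: vs h j => [_ j|v vs IH h j]; [rewrite nth_nil; exact: h0|];
  inversion h; subst; case: j => [|j]; [exact: H1 | exact: IH].
Qed.

Lemma Forall_last T (P : T -> Prop) x0 xs : P x0 -> List.Forall P xs -> P (last x0 xs).
Proof. by elim: xs x0 => //= x xs IH x0 _ h; inversion h; subst; exact: IH. Qed.

Lemma Forall_cat T (P : T -> Prop) s1 s2 :
  List.Forall P (s1 ++ s2) <-> List.Forall P s1 /\ List.Forall P s2.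
Proof. exact: List.Forall_app. Qed.

Lemma Forall_take T (P : T -> Prop) s j : List.Forall P s -> List.Forall P (take j s).
Proof. by rewrite -{1}(cat_take_drop j s) => /Forall_cat[]. Qed.

Lemma Forall_drop T (P : T -> Prop) s j : List.Forall P s -> List.Forall P (drop j s).
Proof. by rewrite -{1}(cat_take_drop j s) => /Forall_cat[]. Qed.

Lemma lv_sum (v : vec) : lv v = \sum_i lsc (ncst (v i) : nov D) (LE [set i]%SET) :> Lm.
Proof.
apply/funext => K; rewrite lm_sum; apply/funext => g; rewrite nov_sum.
rewrite /lv /hl /class1 mulr_suml; apply: eq_bigr => i _.
by rewrite /lsc ncstM LE_at /ebasis mulrA.
Qed.

Lemma M_sum I (r : seq I) (P : pred I) (x : I -> nov D) (a : I -> Lm) v0 s1 v s2 :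
  M v0 (s1 ++ (\sum_(i <- r | P i) lsc (x i) (a i), v) :: s2) =
  \sum_(i <- r | P i) lsc (x i) (M v0 (s1 ++ (a i, v) :: s2)).
Proof. by have := lin_sum r P x a (M_lin (D := D) v0 s1 v s2). Qed.

Lemma M_Z (x : nov D) (a : Lm) v0 s1 v s2 :
  M v0 (s1 ++ (lsc x a, v) :: s2) = lsc x (M v0 (s1 ++ (a, v) :: s2)).
Proof. by have := linZ x a (M_lin (D := D) v0 s1 v s2). Qed.

(** By [M_telescope] the difference is a finite sum of operations with one additional input, the
    change of a parameter. Its coordinates are at most d, and the operations on its basis vectors
    are bounded by [M_bound]. *)
Lemma M_lip (s : seq Lm) K g r : exists B : R, forall (t : seq (Lm * (vec * vec))) v0 v0' d,
  unzip1 t = s -> vbd r v0 -> vbd r v0' -> vbd d (fun i => v0' i - v0 i) ->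
  List.Forall (fun p => [/\ vbd r p.1, vbd r p.2 & vbd d (fun i => p.2 i - p.1 i)]) (unzip2 t) ->
  nc (M v0' [seq (x.1, x.2.2) | x <- t] K g - M v0 [seq (x.1, x.2.1) | x <- t] K g) <= B * d.
Proof.
have [B hB] := @choice _ _ (fun (ji : nat * 'I_n) B => forall v0 vs,
  size vs = size (take ji.1 s ++ (LE [set ji.2]%SET : Lm) :: drop ji.1 s) -> vbounded r v0 vs ->
  nc (M v0 (zip (take ji.1 s ++ (LE [set ji.2]%SET : Lm) :: drop ji.1 s) vs) K g) <= B)
  (fun ji => M_bound _ K g r).
exists (\sum_(j < (size s).+1) \sum_i `|B (val j, i)|) => t v0 v0' d ts b0 b0' bd bt.
rewrite M_telescope -ts size_map mulr_suml; apply: le_trans (nc_sum _ _ _) _.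
apply: ler_sum => j _; rewrite mulr_suml; set c := last _ _.
have [c1 c2 c3] : [/\ vbd r c.1, vbd r c.2 & vbd d (fun i => c.2 i - c.1 i)].
  apply: (Forall_last (P := fun p : vec * vec =>
    [/\ vbd r p.1, vbd r p.2 & vbd d (fun i => p.2 i - p.1 i)])) => //.
  by rewrite /unzip2 map_take; exact: Forall_take.
move=> /=; rewrite lv_sum M_sum lm_sum nov_sum; apply: le_trans (nc_sum _ _ _) _.
apply: ler_sum => i _; rewrite /lsc ncstM ncM mulrC.
apply: ler_pM; [exact: nc_ge0|exact: nc_ge0| |exact: c3].
apply: le_trans (ler_norm _).
have := hB (val j, i) v0' ([seq x.2.2 | x <- take j t] ++ c.1 :: [seq x.2.1 | x <- drop j t]).
rewrite /= -ts zip_cat ?size_map -?map_take ?size_map //= -map_drop.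

have -> : zip (unzip1 (take j t)) [seq x.2.2 | x <- take j t] = [seq (x.1, x.2.2) | x <- take j t].
  by elim: (take j t) => //= x l ->.
have -> : zip (unzip1 (drop j t)) [seq x.2.1 | x <- drop j t] = [seq (x.1, x.2.1) | x <- drop j t].
  by elim: (drop j t) => //= x l ->.
apply; first by rewrite !size_cat /= !size_map.
apply: vbounded_Forall => //; apply/Forall_cat; split.
  rewrite map_comp; apply/List.Forall_map; rewrite -/(unzip2 _) /unzip2 map_take.
  by apply: Forall_take; apply: List.Forall_impl bt => p [].
constructor => //; rewrite map_comp; apply/List.Forall_map; rewrite map_drop.
by apply: Forall_drop; apply: List.Forall_impl bt => p [].
Qed.

End AffineM.

Lemma alg_sum (R : realType) (V : normedModType R) (E : set V) P I (r : seq I) (F : I -> V -> R[i]) :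
  open E -> (forall i, alg E P (F i)) -> alg E P (fun x => \sum_(i <- r) F i x).
Proof.
move=> oE aF; elim: r => [|i r IH].
  rewrite (_ : (fun x => _) = fun=> 0); last by apply/funext => x; rewrite big_nil.
  by apply: alg_smo; exact: smo_cst.
rewrite (_ : (fun x => _) = fun x => F i x + \sum_(j <- r) F j x).
  exact: alg_add.
by apply/funext => x; rewrite big_cons.
Qed.

Section SmoothM.
Variables (R : realType) (n : nat) (D : fukaya_data R n) (V : normedModType R).
Local Notation C := R[i].
Local Notation G := (cls D).
Local Notation Lm := ({set 'I_n} -> nov D).
Local Notation vec := ('I_n -> C).
Local Notation path := ((V -> vec) * (V -> vec))%type.
Implicit Types (p : path) (s : seq (Lm * path)).

(** A deforming class [p.1] varying affinely over V, with linear part [p.2] and a Lipschitz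
    bound. *)
Definition affm p : Prop :=
  (forall x h (t : R) i, p.1 (t *: h + x) i = p.1 x i + t%:C * p.2 h i) /\
  exists2 B : R, 0 <= B & forall x y i, nc (p.1 y i - p.1 x i) <= B * `|y - x|.

Definition ev x s : seq (Lm * vec) := [seq (a.1, a.2.1 x) | a <- s].

Lemma affm_bound p x (r : R) : affm p ->
  exists B, forall y, `|y - x| <= r -> vbd B (p.1 y).
Proof.
move=> [_ [B B0 hB]]; exists (B * r + \sum_i nc (p.1 x i)) => y yr i.
rewrite -(subrK (p.1 x i) (p.1 y i)); apply: le_trans (ncD _ _) _; apply: lerD.
  by apply: le_trans (hB x y i) _; exact: ler_wpM2l.
by rewrite (bigD1 i) //= lerDl sumr_ge0 // => *; exact: nc_ge0.
Qed.

Lemma aff_lip p0 s K g x : affm p0 -> List.Forall affm (unzip2 s) ->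
  exists B : R, forall y, `|y - x| < 1 ->
    nc (M (p0.1 y) (ev y s) K g - M (p0.1 x) (ev x s) K g) <= B * `|y - x|.
Proof.
move=> a0 as_.
have [B [B0 hB]] : exists B : R, 0 <= B /\ List.Forall (fun p : path =>
   forall y, `|y - x| <= 1 -> vbd B (p.1 y) /\ vbd (B * `|y - x|) (fun i => p.1 y i - p.1 x i))
   (p0 :: unzip2 s).
  have : List.Forall affm (p0 :: unzip2 s) by constructor.
  elim: (p0 :: unzip2 s) => [|p l IH] h; first by exists 0.
  inversion h; subst; have [B [B0 hB]] := IH H2.
  have [B' hB'] := affm_bound x 1 H1; case: (H1) => _ [B'' B''0 hB''].
  have le1 : B <= B + `|B'| + B'' by rewrite -addrA lerDl addr_ge0.
  have le2 : B' <= B + `|B'| + B''.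
    by apply: le_trans (ler_norm _) _; rewrite addrAC lerDr addr_ge0.
  have le3 : B'' <= B + `|B'| + B'' by rewrite lerDr addr_ge0.
  exists (B + `|B'| + B''); split; first exact: le_trans le1.
  constructor.
    move=> y y1; split=> i; first exact: le_trans (hB' y y1 i) le2.
    by apply: le_trans (hB'' x y i) _; rewrite ler_wpM2r.
  apply: List.Forall_impl hB => q hq y y1; have [h1 h2] := hq y y1; split=> i.
    exact: le_trans (h1 i) le1.
  by apply: le_trans (h2 i) _; rewrite ler_wpM2r.
inversion hB as [|? ? h0 hs]; subst.
have [B' hB'] := M_lip (unzip1 s) K g B.
exists (B' * B) => y y1; have y1' := ltW y1; have xx : `|x - x| <= 1 by rewrite subrr normr0.
have := hB' [seq (a.1, (a.2.1 x, a.2.1 y)) | a <- s] (p0.1 x) (p0.1 y) (B * `|y - x|).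
rewrite /ev -!map_comp mulrA; apply.
- by rewrite /unzip1 -map_comp.
- exact: (h0 x xx).1.
- exact: (h0 y y1').1.
- exact: (h0 y y1').2.
- rewrite /unzip2 -map_comp; apply/List.Forall_map.
  move/List.Forall_map: hs; apply: List.Forall_impl => a ha /=; split.
  + exact: (ha x xx).1.
  + exact: (ha y y1').1.
  + exact: (ha y y1').2.
Qed.

(** The derivative in direction v of the class of gap j, inserted as an additional input inside that
    gap. *)
Definition dslot p0 s v (j : nat) : seq (Lm * path) :=
  take j s ++ (let c := last p0 (unzip2 (take j s)) in (lv (c.2 v), c)) :: drop j s.

Lemma dslot_affm p0 s v j : affm p0 -> List.Forall affm (unzip2 s) ->
  List.Forall affm (unzip2 (dslot p0 s v j)).
Proof.
move=> a0 as_; rewrite /dslot /unzip2 map_cat /= map_take map_drop; apply/Forall_cat; split.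
  exact: Forall_take.
by constructor; [apply: Forall_last => //; exact: Forall_take|exact: Forall_drop].
Qed.

Lemma lvZ (c : C) (v : vec) : lv (fun i => c * v i) = lsc (ncst c : nov D) (lv v) :> Lm.
Proof.
apply/funext => K; apply/funext => g; rewrite /lsc ncstM /lv /hl /class1 mulrA; congr (_ * _).
by rewrite mulr_sumr; apply: eq_bigr => i _; rewrite mulrA.
Qed.

(** Telescoping computes the difference quotient exactly: gaps before j sit at the moved point,
    later ones at x, and the linear part is inserted in gap j. The Lipschitz bound lets the moved
    point tend to x. *)
Lemma isd_M p0 s K g x v : affm p0 -> List.Forall affm (unzip2 s) ->
  isd (fun y => M (p0.1 y) (ev y s) K g) x v
      (\sum_(j < (size s).+1) M (p0.1 x) (ev x (dslot p0 s v j)) K g).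
Proof.
move=> a0 as_.
pose mix (y : V) (j : nat) : seq (Lm * vec) :=
  ev y (take j s) ++ (let c := last p0 (unzip2 (take j s)) in (lv (c.2 v), c.1 x)) ::
  ev x (drop j s).
pose Phi (h : R) : C := \sum_(j < (size s).+1) M (p0.1 (h *: v + x)) (mix (h *: v + x) j) K g.
apply: (isd_quot (Phi := Phi)).
- move=> h; set y := h *: v + x.
  have := M_telescope (p0.1 x) (p0.1 y) [seq (a.1, (a.2.1 x, a.2.1 y)) | a <- s] K g.
  rewrite -!map_comp /= /ev => ->; rewrite size_map mulr_sumr; apply: eq_bigr => j _.
  have aj : affm (last p0 (unzip2 (take j s))).
    by apply: Forall_last => //; rewrite /unzip2 map_take; exact: Forall_take.
  rewrite /mix /ev -map_take -map_drop -!map_comp /=.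
  have -> : last (p0.1 x, p0.1 y) (unzip2 [seq (a.1, (a.2.1 x, a.2.1 y)) | a <- take j s]) =
      ((last p0 (unzip2 (take j s))).1 x, (last p0 (unzip2 (take j s))).1 y).
    rewrite /unzip2 -map_comp /= -[(p0.1 x, p0.1 y)]/((fun c : path => (c.1 x, c.1 y)) p0).
    by rewrite -(last_map (fun c : path => (c.1 x, c.1 y))) -map_comp.
  move: aj; set c := last _ _ => -[ac _] /=.
  have -> : (fun i => c.1 y i - c.1 x i) = (fun i => h%:C * c.2 v i).
    by apply/funext => i; rewrite ac addrC addKr.
  by rewrite lvZ M_Z /lsc ncstM.
- have hj (j : 'I_(size s).+1) : exists B : R, forall y, `|y - x| < 1 ->
      nc (M (p0.1 y) (mix y j) K g - M (p0.1 x) (ev x (dslot p0 s v j)) K g) <= B * `|y - x|.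
    (* The later gaps are frozen at x; as constant paths they are again affine, so [aff_lip] covers
       the mixed chain. *)
    pose s' := take j s ++ (let c := last p0 (unzip2 (take j s)) in
        (lv (c.2 v) : Lm, (fun=> c.1 x, fun _ _ => 0) : path)) ::
        [seq (a.1, (fun=> a.2.1 x, fun _ _ => 0) : path) | a <- drop j s].
    have cst (u : vec) : affm (fun=> u, fun _ _ => 0).
      split=> [*|]; first by rewrite /= mulr0 addr0.
      by exists 0 => // *; rewrite /= subrr nc0 mul0r.
    have [] := @aff_lip p0 s' K g x a0.
      rewrite /s' /unzip2 map_cat /=; apply/Forall_cat; split.
        by rewrite map_take; exact: Forall_take.
      constructor; first exact: cst.
      by elim: (drop j s) => [|a l IH]; constructor; [exact: cst|exact: IH].
    move=> B hB; exists B => y yx; have := hB y yx.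
    by rewrite /mix /dslot /ev /s' !map_cat /= -!map_comp.
  have [B hB] := choice hj.
  (* For |h| below 1 / (|v| + 1) the point h v + x stays in the unit ball around x, where the
     Lipschitz bounds hold. *)
  exists ((\sum_j `|B j|) * `|v|), ((`|v| + 1)^-1); have v1 : 0 < `|v| + 1 by rewrite ltr_wpDl.
  split; first by rewrite invr_gt0.
  move=> h hv; have nx : `|h *: v + x - x| = `|h| * `|v| by rewrite addrK normrZ.
  have hx : `|h *: v + x - x| < 1.
    rewrite nx; apply: (@le_lt_trans _ _ (`|h| * (`|v| + 1))).
      by rewrite ler_wpM2l // lerDl.
    by rewrite -ltr_pdivlMr // mul1r.
  rewrite /Phi -sumrB; apply: le_trans (nc_sum _ _ _) _.
  rewrite -mulrA (mulrC `|v|) -nx mulr_suml; apply: ler_sum => j _.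
  apply: le_trans (hB j _ hx) _; rewrite ler_wpM2r // ler_norm //.
Qed.

(** A derivative of such an operation is a sum of operations of the same kind with one more input,
    so the family is closed under differentiation and [smo_alg] applies. *)
Lemma smo_M E p0 s K g : open E -> affm p0 -> List.Forall affm (unzip2 s) ->
  smo E (fun y => M (p0.1 y) (ev y s) K g).
Proof.
move=> oE a0 as_.
apply: (smo_alg oE (P := fun f => exists s', List.Forall affm (unzip2 s') /\
   f = fun y => M (p0.1 y) (ev y s') K g)).
- move=> f x [s' [as' ->]] _.
  have [B hB] := aff_lip K g x a0 as'.
  have [cr ci] := cont_lip ltr01 hB.
  by apply: isd_c1 => // v; eexists; exact: isd_M.
- move=> f v [s' [as' ->]].
  rewrite (_ : dC v _ = fun x => \sum_(j < (size s').+1) M (p0.1 x) (ev x (dslot p0 s' v j)) K g).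
    by apply: alg_sum => // j; apply: alg_base; exists (dslot p0 s' v j); split=> //; exact: dslot_affm.
  by apply/funext => x; apply: isd_dC; exact: isd_M.
- by apply: alg_base; exists s.
Qed.

End SmoothM.

(** * Compositions with real functions and cut-offs *)

Section Compose.
Variables (R : realType) (V : normedModType R) (D : set V).
Hypothesis oD : open D.
Local Notation C := R[i].

Lemma is_derive_of_line (g : V -> R) x v (d : R) :
  is_derive (0 : R^o) 1 (fun t : R => g (x + t *: v) : R^o) d ->
  is_derive x v (g : V -> R^o) d.
Proof.
move=> dl.
have E : (fun h : R => h^-1 *: (((fun t : R => g (x + t *: v) : R^o) \o shift (0 : R)) (h *: 1) -
    g (x + 0 *: v))) = (fun h : R => h^-1 *: (((g : V -> R^o) \o shift x) (h *: v) - g x)).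
  apply/funext => h /=; rewrite scale0r addr0 addr0.
  by rewrite [h%:A]mulr1 [x + _]addrC.
case: dl; rewrite /derivable /derive E => d1 d2.
by split; rewrite /derivable /derive.
Qed.

Lemma isd_comp (f : R -> R) (q : V -> R) x v (d : R) :
  is_derive (q x : R^o) 1 (f : R^o -> R^o) d -> c1 (fun z => (q z)%:C) x ->
  isd (fun z => (f (q z))%:C) x v (d%:C * dC v (fun z => (q z)%:C) x).
Proof.
move=> df [[_ /(_ v) dq] _].
have dq0 : derivable (q : V -> R^o) (x + 0 *: v) v by rewrite scale0r addr0.
have dl : is_derive (0 : R^o) 1 (fun t : R => q (x + t *: v) : R^o) ('D_v (q : V -> R^o) x).
  by have := is_derive_line dq0; rewrite scale0r addr0.
split; last first.
  by rewrite ImM /= derive_cst mulr0 mul0r addr0; exact: is_derive_cst.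
rewrite ReM /= mul0r subr0; apply: is_derive_of_line.
rewrite [X in is_derive _ _ X](_ : _ = (f : R^o -> R^o) \o (fun t : R^o => q (x + t *: v) : R^o)); last reflexivity.
have df' : is_derive (q (x + 0 *: v) : R^o) 1 (f : R^o -> R^o) d by rewrite scale0r addr0.
exact: is_derive1_comp.
Qed.

Lemma c1_comp (f : R -> R) (q : V -> R) x :
  derivable (f : R^o -> R^o) (q x) 1 -> c1 (fun z => (q z)%:C) x ->
  c1 (fun z => (f (q z))%:C) x.
Proof.
move=> df cq; apply: isd_c1; last by move=> v; eexists; apply: isd_comp cq; apply: derivableP df.
  apply: (@continuous_comp V R R q f); first exact: cq.1.1.
  by apply: differentiable_continuous; apply/derivable1_diffP.
by move=> /=; exact: cvg_cst.
Qed.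

(** The compositions form a family whose derivatives are linear combinations of its members times
    derivatives of q, which is the form that [smo_alg] accepts. *)
Lemma smo_comp (S : set R) (phi : nat -> R -> R) (N : nat -> nat) (c : nat -> nat -> R)
    (q : V -> R) k :
  (forall k s, S s -> is_derive (s : R^o) 1 (phi k : R^o -> R^o)
     (\sum_(j < N k) c k j * phi j s)) ->
  smo D (fun z => (q z)%:C) -> (forall z, D z -> S (q z)) ->
  smo D (fun z => (phi k (q z))%:C).
Proof.
move=> dphi sq qS.
pose P (f : V -> C) := exists k (z0 : unit), forall z, D z -> f z = (phi k (q z))%:C.
have Pk j : P (fun z => (phi j (q z))%:C) by exists j, tt.
apply: (smo_alg oD (P := P)).
- move=> f x [j [_ fE]] Dx; apply: (c1_ext oD Dx (f := fun z => (phi j (q z))%:C)).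
    by move=> y Dy; rewrite fE.
  by apply: c1_comp; [case: (dphi j _ (qS _ Dx))|exact: smo_c1 sq Dx].
- move=> f v [j [_ fE]].
  apply: (alg_ext (f := fun z => \sum_(i < N j) (c j i)%:C * (phi i (q z))%:C *
      dC v (fun z => (q z)%:C) z)).
    apply: alg_sum => // i; apply: alg_mul; last by apply: alg_smo; exact: smo_dC.
    by apply: alg_mul; [apply: alg_smo; exact: smo_cst|apply: alg_base].
  move=> y Dy; rewrite (dC_ext v oD Dy fE) (isd_dC (isd_comp v (dphi j _ (qS _ Dy)) (smo_c1 sq Dy))).
  by rewrite -mulr_suml rmorph_sum; congr (_ * _); apply: eq_bigr => i _; rewrite rmorphM.
- exact: alg_base.
Qed.

Lemma smo_exp (q : V -> R) : smo D (fun z => (q z)%:C) -> smo D (fun z => (expR (q z))%:C).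
Proof.
move=> sq; apply: (@smo_comp setT (fun _ => expR) (fun=> 1%N) (fun _ _ => 1) q 0%N) => // k s _.
by rewrite big_ord1 mul1r; exact: is_derive_expR.
Qed.

Lemma dC_exp (q : V -> R) v x : smo D (fun z => (q z)%:C) -> D x ->
  dC v (fun z => (expR (q z))%:C) x = (expR (q x))%:C * dC v (fun z => (q z)%:C) x.
Proof.
by move=> sq Dx; exact: (isd_dC (isd_comp v (is_derive_expR (q x)) (smo_c1 sq Dx))).
Qed.

Lemma smo_inv (q : V -> R) : smo D (fun z => (q z)%:C) -> (forall z, D z -> q z != 0) ->
  smo D (fun z => ((q z)^-1)%:C).
Proof.
move=> sq q0.
(* The family of powers s^-(k+1) is closed: the derivative of the k-th is - (k+1) times the next. *)
have := @smo_comp (fun s => s != 0) (fun k s => (s^-1) ^+ k.+1) (fun k => k.+2)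
  (fun k j => if j == k.+1 then - k.+1%:R else 0) q 0%N; apply => // k s /= s0.
rewrite big_ord_recr /= eqxx big1 ?add0r => [|i _]; last first.
  by rewrite (ltn_eqF (ltn_ord i)) mul0r.
have dV : is_derive (s : R^o) 1 (fun s : R^o => s^-1 : R^o) (- s ^- 2).
  by have := is_deriveV s0 (is_derive_id (s : R^o) 1); rewrite /GRing.scale /= mulr1.
have := is_deriveX k.+1 dV; rewrite exprfctE /GRing.scale /= => h.
by apply: (is_derive_eq h); rewrite -[in LHS]exprVn !exprS; ring.
Qed.

End Compose.

Section Flat.
Variable R : realType.

(** The factors s^-k make the family closed under differentiation, starting from the flat function
    exp (- 1/s). *)
Definition flat (k : nat) (s : R) : R := if 0 < s then s^-1 ^+ k * expR (- s^-1) else 0.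

(** With t = 1/s, t^(k+2) <= (k+2)! exp t. Quadratic decay gives the derivative zero at the
    origin. *)
Lemma flat_le (k : nat) (s : R) : `|flat k s| <= (k.+2)`!%:R * s ^+ 2.
Proof.
rewrite /flat; case: ifP => [s0|_]; last by rewrite normr0 mulr_ge0 ?sqr_ge0.
rewrite ger0_norm; last by rewrite mulr_ge0 ?expR_ge0 ?exprn_ge0 // invr_ge0 ltW.
rewrite expRN ler_pdivrMr ?expR_gt0 //.
have y0 : 0 <= s^-1 by rewrite invr_ge0 ltW.
have le : s^-1 ^+ k.+2 / (k.+2)`!%:R <= expR s^-1.
  by apply: le_trans (expR_ge1Dxn k.+1 y0); rewrite lerDr ler01.
move: le; rewrite ler_pdivrMr ?ltr0n ?fact_gt0 // => le.
have -> : s^-1 ^+ k = s ^+ 2 * s^-1 ^+ k.+2.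
  by rewrite -[k.+2]addn2 exprD mulrCA -exprMn divff ?expr1n ?mulr1 // gt_eqF.
rewrite [X in _ <= X](_ : _ = s ^+ 2 * (expR s^-1 * (k.+2)`!%:R)); last by ring.
by rewrite ler_wpM2l ?sqr_ge0.
Qed.

Lemma flat_derive k s : is_derive (s : R^o) 1 (flat k : R^o -> R^o)
  (flat k.+2 s - k%:R * flat k.+1 s).
Proof.
have [s0|s0|->] := ltgtP s 0.
- have -> : flat k.+2 s - k%:R * flat k.+1 s = 0.
    by rewrite /flat [0 < s]ltNge (ltW s0) /= mulr0 subr0.
  apply: near_eq_is_derive (is_derive_cst (0 : R^o) _ _).
  near=> t; have t0 : t < 0 by near: t; exact: lt_nbhsl.
  by rewrite /flat ltNge (ltW t0).
- pose f (t : R) := t^-1 ^+ k * expR (- t^-1).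
  apply: (@near_eq_is_derive _ _ _ f).
    near=> t; have t0 : 0 < t by near: t; exact: lt_nbhsr.
    by rewrite /flat t0.
  have sn : s != 0 by rewrite gt_eqF.
  have dV : is_derive (s : R^o) 1 (fun s : R^o => s^-1 : R^o) (- s ^- 2).
    by have := is_deriveV sn (is_derive_id (s : R^o) 1); rewrite /GRing.scale /= mulr1.
  have dE : is_derive (s : R^o) 1 (fun s : R^o => expR (- s^-1) : R^o) (expR (- s^-1) * s ^- 2).
    have := is_deriveN dV; rewrite opprK => dN.
    by have := @is_derive1_comp R expR (fun t : R^o => - t^-1 : R^o) s _ _ (is_derive_expR _) dN.
  have := is_deriveX k dV; rewrite exprfctE /GRing.scale /= => dX.
  have := is_deriveM dX dE; rewrite /GRing.scale /= => h; apply: (is_derive_eq h).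
  rewrite /flat s0 -exprVn; case: k f h dX => [|k] f h dX; first by rewrite !mul0r subr0; ring.
  by rewrite /= !exprS; ring.
- have -> : flat k.+2 0 - k%:R * flat k.+1 0 = complex.Re (0 : R[i]).
    by rewrite /flat ltxx mulr0 subr0.
  apply: (proj1 (@isd_quot R (R^o) (fun y => (flat k y)%:C) 0 1 0 (fun h => (h^-1 * flat k h)%:C) _ _)).
  + move=> h; rewrite addr0 [h%:A]mulr1 [in flat k 0]/flat ltxx subr0 -rmorphM.
    have [->|h0] := eqVneq h 0; first by rewrite /flat ltxx mul0r.
    by rewrite mulrA divff // mul1r.
  + exists (k.+2)`!%:R, 1; split=> // h _; rewrite subr0 nc_real normrM.
    have [->|h0] := eqVneq h 0; first by rewrite /flat ltxx invr0 !normr0 !mulr0.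
    rewrite normfV ler_pdivrMl ?normr_gt0 //; apply: le_trans (flat_le k h) _.
    by rewrite [X in _ <= X]mulrCA ler_wpM2l ?ler0n // -normrM -expr2 ler_norm.
Unshelve. all: by end_near. Qed.

Lemma smo_flat (V : normedModType R) (D : set V) (q : V -> R) k : open D ->
  smo D (fun z => (q z)%:C) -> smo D (fun z => (flat k (q z))%:C).
Proof.
move=> oD sq; apply: (@smo_comp R V D oD setT flat (fun k => k.+3)
  (fun k j => if j == k.+2 then 1 else if j == k.+1 then - k%:R else 0)) => // {}k s _.
apply: (is_derive_eq (flat_derive k s)).
have E (j m : nat) : (j < m)%N -> (j == m) = false by lia.
rewrite !big_ord_recr big1 /= => [|i _]; last first.
  by rewrite !E ?mul0r //; have := ltn_ord i; lia.
by rewrite !eqxx !E ?mul0r ?add0r ?mul1r ?mulNr 1?addrC //; lia.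
Qed.

Lemma flat_gt0 k s : 0 < s -> 0 < flat k s.
Proof. by move=> s0; rewrite /flat s0 mulr_gt0 ?expR_gt0 // exprn_gt0 // invr_gt0. Qed.

Lemma flat_eq0 k s : s <= 0 -> flat k s = 0.
Proof. by move=> s0; rewrite /flat ltNge s0. Qed.

Lemma flat_ge0 k s : 0 <= flat k s.
Proof. by have [s0|s0] := ltP 0 s; [exact/ltW/flat_gt0|rewrite flat_eq0]. Qed.

(** For a < b the two summands of the denominator never vanish together. *)
Definition bump (a b s : R) : R := flat 0 (b - s) * (flat 0 (b - s) + flat 0 (s - a))^-1.

Lemma bump1 a b s : a < b -> s <= a -> bump a b s = 1.
Proof.
move=> ab sa; rewrite /bump [flat 0 (s - a)]flat_eq0 ?subr_le0 // addr0 divff //.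
by rewrite gt_eqF // flat_gt0 // subr_gt0 (le_lt_trans sa).
Qed.

Lemma bump0 a b s : b <= s -> bump a b s = 0.
Proof. by move=> sb; rewrite /bump flat_eq0 ?mul0r // subr_le0. Qed.

Lemma smo_bump (V : normedModType R) (D : set V) (q : V -> R) a b : a < b -> open D ->
  smo D (fun z => (q z)%:C) -> smo D (fun z => (bump a b (q z))%:C).
Proof.
move=> ab oD sq.
have s1 : smo D (fun z => (b - q z)%:C).
  apply: (smo_ext oD _ (smoB oD (smo_cst b%:C oD) sq)) => y _ /=.
  by rewrite rmorphB.
have s2 : smo D (fun z => (q z - a)%:C).
  apply: (smo_ext oD _ (smoB oD sq (smo_cst a%:C oD))) => y _ /=.
  by rewrite rmorphB.
have s3 : smo D (fun z => (flat 0 (b - q z) + flat 0 (q z - a))%:C).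
  apply: (smo_ext oD _ (smoD oD (smo_flat 0 oD s1) (smo_flat 0 oD s2))) => y _ /=.
  by rewrite rmorphD.
apply: (smo_ext oD _ (smoM oD (smo_flat 0 oD s1) (smo_inv oD s3 _))) => y _ /=.
  by rewrite /bump rmorphM.
rewrite gt_eqF //; have [qa|qa] := lerP (q y) a.
  by rewrite ltr_pwDl ?flat_ge0 // flat_gt0 // subr_gt0 (le_lt_trans qa).
by rewrite ltr_wpDl ?flat_ge0 // flat_gt0 // subr_gt0.
Qed.

End Flat.

(** * Radial averages and Euler's identity *)

Section UnitIntegral.
Variable R : realType.
Local Notation mu := (@lebesgue_measure R).
Implicit Types f g : R -> R.

Definition int01 f : R := \int[mu]_(t in `[0, 1]) f t.

Lemma int01_integrable f : continuous f -> mu.-integrable `[0, 1] (EFin \o f).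
Proof.
move=> cf; apply: continuous_compact_integrable; first exact: segment_compact.
exact: continuous_subspaceT.
Qed.

Lemma mI01 : measurable (`[0, 1]%classic : set (measurableTypeR R)).
Proof. exact: measurable_itv. Qed.

Lemma eq_int01 f g : (forall t, 0 <= t <= 1 -> f t = g t) -> int01 f = int01 g.
Proof.
by move=> fg; apply: eq_Rintegral => t /set_mem; rewrite /= in_itv /=; exact: fg.
Qed.

Lemma int01D f g : continuous f -> continuous g ->
  int01 (fun t => f t + g t) = int01 f + int01 g.
Proof. by move=> cf cg; apply: RintegralD; [exact: mI01|exact: int01_integrable..]. Qed.

Lemma int01Z (c : R) f : continuous f -> int01 (fun t => c * f t) = c * int01 f.
Proof. by move=> cf; apply: RintegralZl; [exact: mI01|exact: int01_integrable]. Qed.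

Lemma int01B f g : continuous f -> continuous g ->
  int01 (fun t => f t - g t) = int01 f - int01 g.
Proof. by move=> cf cg; apply: RintegralB; [exact: mI01|exact: int01_integrable..]. Qed.

Lemma int01_cst (c : R) : int01 (fun=> c) = c.
Proof.
rewrite /int01 Rintegral_cst; last exact: mI01.
have e : mu `[0, 1]%classic = 1%E by rewrite lebesgue_measure_itv /= lte_fin ltr01 oppr0 adde0.
by rewrite [X in fine X]e mulr1.
Qed.

Lemma int01_le f (B : R) : continuous f -> (forall t, 0 <= t <= 1 -> `|f t| <= B) ->
  `|int01 f| <= B.
Proof.
move=> cf fB; rewrite -(int01_cst B); apply: le_trans (le_normr_Rintegral _ _) _.
- exact: mI01.
- exact: int01_integrable.
apply: le_Rintegral; first exact: mI01.
- apply: (@int01_integrable (fun t => `|f t|)) => t.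
  by apply: (@continuous_comp _ _ _ f Num.norm t); [exact: cf|exact: norm_continuous].
- by apply: (@int01_integrable (fun=> B)) => t; exact: cvg_cst.
- by move=> t; rewrite /= in_itv /=; exact: fB.
Qed.

Lemma int01_FTC (F f : R -> R) : continuous f ->
  (forall t : R, is_derive (t : R^o) 1 (F : R^o -> R^o) (f t)) -> int01 f = F 1 - F 0.
Proof.
move=> cf dF.
have cF : continuous F.
  move=> t; apply: differentiable_continuous; apply/derivable1_diffP.
  by case: (dF t).
rewrite /int01 /Rintegral (@continuous_FTC2 R f F 0 1) //.
- exact: continuous_subspaceT.
- split; first by move=> t _; case: (dF t).
    by apply: cvg_at_right_filter; exact: cF.
  by apply: cvg_at_left_filter; exact: cF.
- by move=> t _; rewrite derive1E; case: (dF t).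
Qed.

End UnitIntegral.

Section Radial.
Variables (R : realType) (V : normedModType R) (z0 : V).
Implicit Types (g : V -> R) (z v : V).

Definition radial (t : R) z : V := z0 + t *: (z - z0).

Lemma radial1 z : radial 1 z = z.
Proof. by rewrite /radial scale1r addrC subrK. Qed.

Lemma radial0 z : radial 0 z = z0.
Proof. by rewrite /radial scale0r addr0. Qed.

Lemma radialD t z v : radial t (z + v) = radial t z + t *: v.
Proof. by rewrite /radial addrAC scalerDr addrA. Qed.

Lemma radial_cont2 t z : (fun p : R * V => radial p.1 p.2) @ (t, z) --> radial t z.
Proof.
apply: cvgD; first exact: cvg_cst.
apply: cvgZ; first exact: cvg_fst.
by apply: cvgB; [exact: cvg_snd|exact: cvg_cst].
Qed.

Lemma radial_cont z : continuous (fun t => radial t z).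
Proof.
move=> t; apply: cvgD; first exact: cvg_cst.
by apply: cvgZ; [exact: cvg_id|exact: cvg_cst].
Qed.

Definition radint (c : nat) g z : R := int01 (fun t => t ^+ c * g (radial t z)).

Lemma radint_cont_arg c g z : continuous g -> continuous (fun t : R => t ^+ c * g (radial t z)).
Proof.
move=> cg t; apply: cvgM; first exact: exprn_continuous.
by apply: (@continuous_comp _ _ _ (fun t => radial t z) g); [exact: radial_cont|exact: cg].
Qed.

(** Compactness of [0, 1] makes the continuity along the segment from z0 uniform in t. *)
Lemma tube g z (e : R) : continuous g -> 0 < e ->
  \forall y \near z, forall t, 0 <= t <= 1 -> `|g (radial t y) - g (radial t z)| <= e.
Proof.
move=> cg e0.
have := @segment_compact R 0 1; rewrite compact_near_coveringP => /(_ V (nbhs z)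
  (fun y t => `|g (radial t y) - g (radial t z)| <= e) _).
move=> h; apply: filterS (h _) => [y yd t t01|t _].
- by apply: yd; rewrite /= in_itv.
- have e2 : 0 < e / 2 by rewrite divr_gt0.
  have c2 : (fun p : R * V => g (radial p.1 p.2)) @ (t, z) --> g (radial t z).
    by apply: (@cvg_comp _ _ _ (fun p : R * V => radial p.1 p.2) g _ _ _ (radial_cont2 (t:=t) (z:=z))); exact: cg.
  have c3 : (fun p : R * V => g (radial p.1 z)) @ (t, z) --> g (radial t z).
    apply: (@cvg_comp _ _ _ fst (fun s => g (radial s z)) _ (nbhs t)); first exact: cvg_fst.
    apply: (@cvg_comp _ _ _ (fun s => radial s z) g); [exact: radial_cont|exact: cg].
  move/cvgrPdist_lt/(_ _ e2): c2; move/cvgrPdist_lt/(_ _ e2): c3.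
  apply: filterS2 => -[s y] /= h1 h2; apply: tri2; first by rewrite distrC; exact: h2.
  by rewrite distrC.
Qed.

Lemma radint_cont c g : continuous g -> continuous (radint c g).
Proof.
move=> cg z; apply/cvgrPdist_le => e e0; apply: filterS (tube z cg e0) => y ye.
rewrite distrC /radint -int01B; [|exact: radint_cont_arg..].
apply: int01_le => [t|t t01]; first by apply: cvgB; exact: radint_cont_arg.
rewrite -mulrBr normrM; have /andP[t0 t1] := t01.
rewrite -[e]mul1r; apply: ler_pM => //; last exact: ye.
by rewrite ger0_norm ?exprn_ge0 // exprn_ile1.
Qed.

Lemma mvt_abs g x v (h : R) : (forall s, derivable (g : V -> R^o) (x + s *: v) v) ->
  exists2 s, `|s| <= `|h| & g (x + h *: v) - g x = h * 'D_v (g : V -> R^o) (x + s *: v).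
Proof.
move=> dg; have [h0|h0|->] := ltgtP h 0; last first.
- by exists 0; rewrite ?normr0 // scale0r addr0 subrr mul0r.
- have [s /andP[s0 sh] e] := mvt_line h0 (fun s _ => dg s).
  by exists s; rewrite ?ger0_norm // ltW.
- have h0' : 0 < - h by rewrite oppr_gt0.
  have [|s /andP[s0 sh] e] := @mvt_line R V g (x + h *: v) v (- h) h0'.
    by move=> s _; rewrite -addrA -scalerDl; exact: dg.
  exists (h + s); last first.
    rewrite scalerDl addrA -[LHS]opprB; apply/eqP; rewrite eqr_oppLR -mulNr -e.
    by rewrite scaleNr addrK.
  by rewrite (ltr0_norm h0) ler_norml; move: s0 sh; clear; lra.
Qed.

(** Differentiation under the integral: the chain rule for z |-> z0 + t (z - z0) contributes the
    factor t that raises the weight. The error of the difference quotient is a variation of D_v g by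
    the mean value theorem, uniformly small by [tube]. *)
Lemma radint_derive c g z v : continuous g -> (forall y, derivable (g : V -> R^o) y v) ->
  continuous ('D_v (g : V -> R^o)) ->
  is_derive z v (radint c g : V -> R^o) (radint c.+1 ('D_v (g : V -> R^o)) z).
Proof.
move=> cg dg cdg.
have [lim1 lim2] : (fun h : R => h^-1 *: (((radint c g : V -> R^o) \o shift z) (h *: v) - radint c g z))
    @ 0^' --> (radint c.+1 ('D_v (g : V -> R^o)) z : R^o) /\ True.
  split=> //; apply/cvgrPdist_le => e e0.
  have : \forall h \near (0 : R), forall s, `|s| <= `|h| -> forall t, 0 <= t <= 1 ->
     `|'D_v (g : V -> R^o) (radial t (z + s *: v)) - 'D_v (g : V -> R^o) (radial t z)| <= e.
    have /nbhs_ballP[d d0 hd] := tube z cdg e0.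
    have [h1 h10 hh] := small_h v v d0.
    exists h1 => // h /=; rewrite sub0r normrN => hh1 s sh; apply: hd.
    rewrite -ball_normE /= opprD addrA subrr sub0r normrN normrZ.
    apply: le_lt_trans hh; rewrite mulrDr; apply: (@le_trans _ _ (h1 * `|v|)).
      by rewrite ler_wpM2r // (le_trans sh) // ltW.
    by rewrite lerDl mulr_ge0 // ltW.
  move=> nh; near=> h.
  have h0 : h != 0 by near: h; exact: nbhs_dnbhs_neq.
  have hs : forall s, `|s| <= `|h| -> forall t, 0 <= t <= 1 ->
     `|'D_v (g : V -> R^o) (radial t (z + s *: v)) - 'D_v (g : V -> R^o) (radial t z)| <= e.
    by near: h; exact: nbhs_dnbhs nh.
  rewrite distrC /= [h *: v + z]addrC -[h^-1 *: _]/(h^-1 * _).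
  pose A (t : R) := t ^+ c * g (radial t (z + h *: v)); pose B (t : R) := t ^+ c * g (radial t z).
  pose E (t : R) := t ^+ c.+1 * 'D_v (g : V -> R^o) (radial t z).
  have cA : continuous A by exact: radint_cont_arg.
  have cB : continuous B by exact: radint_cont_arg.
  have cE : continuous E := @radint_cont_arg c.+1 _ z cdg.
  have cAB : continuous (fun t => A t - B t) by move=> t; apply: cvgB; [exact: cA|exact: cB].
  have cH : continuous (fun t => h^-1 * (A t - B t)).
    by move=> t; apply: cvgM; [exact: cvg_cst|exact: cAB].
  have -> : h^-1 * (radint c g (z + h *: v) - radint c g z) - radint c.+1 ('D_v (g : V -> R^o)) z =
      int01 (fun t => h^-1 * (A t - B t) - E t).
    by rewrite (int01B cH cE) (int01Z _ cAB) (int01B cA cB).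
  apply: int01_le => [t|t t01]; first by apply: cvgB; [exact: cH|exact: cE].
  rewrite /A /B /E.
  have /andP[t0 t1] := t01.
  have [s sh es] : exists2 s, `|s| <= `|h| & g (radial t (z + h *: v)) - g (radial t z) =
      t * h * 'D_v (g : V -> R^o) (radial t (z + s *: v)).
    have [s sh es] := @mvt_abs g (radial t z) v (t * h) (fun s => dg _).
    rewrite radialD scalerA es; have [t00|tn0] := eqVneq t 0.
      by exists 0; rewrite ?normr0 // t00 !mul0r.
    exists (t^-1 * s); last by rewrite radialD scalerA mulVKf.
    have t0' : 0 < t by rewrite lt_neqAle eq_sym tn0.
    by move: sh; rewrite !normrM normfV (ger0_norm t0) ler_pdivrMl.
  have -> : h^-1 * (t ^+ c * g (radial t (z + h *: v)) - t ^+ c * g (radial t z)) -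
      t ^+ c.+1 * 'D_v (g : V -> R^o) (radial t z) =
      t ^+ c.+1 * ('D_v (g : V -> R^o) (radial t (z + s *: v)) - 'D_v (g : V -> R^o) (radial t z)).
    rewrite -mulrBr es exprS; move: ('D_v _ _) ('D_v _ _) => a b.
    by field.
  rewrite normrM -[e]mul1r; apply: ler_pM => //; last exact: hs.
  by rewrite ger0_norm ?exprn_ge0 // exprn_ile1.
by split; [apply: cvgP lim1|exact: cvg_lim lim1].
Unshelve. all: by end_near. Qed.

End Radial.

Section CRadial.
Variables (R : realType) (V : normedModType R) (z0 : V).
Local Notation C := R[i].
Local Notation radial := (radial z0).
Local Notation radint := (radint z0).
Implicit Types (f g : V -> C) (z v : V).

Definition cradint (c : nat) f z : C :=
  radint c (fun w => complex.Re (f w)) z +i* radint c (fun w => complex.Im (f w)) z.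

Definition ccont f := continuous (fun w => complex.Re (f w)) /\ continuous (fun w => complex.Im (f w)).

Lemma smo_ccont f : smo setT f -> ccont f.
Proof. by move=> sf; split=> x; have [[h _] [h' _]] := smo_c1 sf (I : setT x). Qed.

Lemma isd_cradint c f z v : smo setT f -> isd (cradint c f) z v (cradint c.+1 (dC v f) z).
Proof.
move=> sf; have [c1 c2] := smo_ccont sf; have [c3 c4] := smo_ccont (smo_dC v sf).
have d1 y : derivable ((fun w => complex.Re (f w)) : V -> R^o) y v by exact: ((smo_c1 sf (I : setT y)).1.2 v).
have d2 y : derivable ((fun w => complex.Im (f w)) : V -> R^o) y v by exact: ((smo_c1 sf (I : setT y)).2.2 v).
split.
  exact: (@radint_derive R V z0 c (fun w => complex.Re (f w)) z v c1 d1 c3).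
exact: (@radint_derive R V z0 c (fun w => complex.Im (f w)) z v c2 d2 c4).
Qed.

Lemma dC_cradint c f v : smo setT f -> dC v (cradint c f) = cradint c.+1 (dC v f).
Proof. by move=> sf; apply/funext => z; exact/isd_dC/isd_cradint. Qed.

Lemma smo_cradint c f : smo setT f -> smo setT (cradint c f).
Proof.
move=> sf; apply: (smo_alg openT (P := fun h => exists c f, smo setT f /\ h = cradint c f)).
- move=> h x [c' [f' [sf' ->]]] _; have [c1 c2] := smo_ccont sf'.
  apply: isd_c1 => [||v]; [exact: (radint_cont c1)|exact: (radint_cont c2)|].
  by eexists; exact: isd_cradint.
- move=> h v [c' [f' [sf' ->]]]; apply: alg_base; exists c'.+1, (dC v f').
  by split; [exact: smo_dC|exact: dC_cradint].
- by apply: alg_base; exists c, f.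
Qed.

Lemma cradintD c f g z : ccont f -> ccont g ->
  cradint c (fun w => f w + g w) z = cradint c f z + cradint c g z.
Proof.
move=> [f1 f2] [g1 g2]; apply/eqP; rewrite eq_complex ReImE ImD /=; apply/andP; split; apply/eqP.
  rewrite /radint -(int01D (@radint_cont_arg _ _ z0 c _ z f1) (@radint_cont_arg _ _ z0 c _ z g1)).
  by congr int01; apply/funext => t; rewrite ReD mulrDr.
rewrite /radint -(int01D (@radint_cont_arg _ _ z0 c _ z f2) (@radint_cont_arg _ _ z0 c _ z g2)).
by congr int01; apply/funext => t; rewrite ImD mulrDr.
Qed.

(** On the ray through z the factor l is t^k times its value at z, so it leaves the integral and
    raises the weight by k. *)
Lemma cradintM c k (l f : V -> C) z : ccont f ->
  (forall t, 0 <= t <= 1 -> l (radial t z) = (t ^+ k)%:C * l z) ->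
  cradint c (fun w => l w * f w) z = l z * cradint (c + k) f z.
Proof.
move=> [f1 f2] lt; have cr := @radint_cont_arg _ _ z0 (c + k) _ z f1.
have ci := @radint_cont_arg _ _ z0 (c + k) _ z f2.
have czr (a : R) : continuous (fun t : R => a * (t ^+ (c + k) * complex.Re (f (radial t z)))).
  by move=> t; apply: cvgM; [exact: cvg_cst|exact: cr].
have czi (a : R) : continuous (fun t : R => a * (t ^+ (c + k) * complex.Im (f (radial t z)))).
  by move=> t; apply: cvgM; [exact: cvg_cst|exact: ci].
apply/eqP; rewrite eq_complex ReM ImM /= /radint; apply/andP; split; apply/eqP.
  rewrite -(int01Z _ cr) -(int01Z _ ci) -(int01B (czr _) (czi _)).
  apply: eq_int01 => t t01.
  by rewrite ReM lt // ReM ImM /= exprD; ring.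
rewrite -(int01Z _ cr) -(int01Z _ ci) -(int01D (czi _) (czr _)).
apply: eq_int01 => t t01.
by rewrite ImM lt // ReM ImM /= exprD; ring.
Qed.

(** The sum of the two integrands is the derivative of h. *)
Lemma euler_real (g : V -> R) c z (h := fun t : R => t ^+ c * g (radial t z)) :
  continuous g -> (forall y, derivable (g : V -> R^o) y (z - z0)) ->
  continuous ('D_(z - z0) (g : V -> R^o)) ->
  c%:R * radint c.-1 g z + radint c ('D_(z - z0) (g : V -> R^o)) z = h 1 - h 0.
Proof.
move=> cg dg cdg; have c1 := @radint_cont_arg _ _ z0 c.-1 _ z cg.
have c2 := @radint_cont_arg _ _ z0 c _ z cdg.
have c3 : continuous (fun t : R => c%:R * (t ^+ c.-1 * g (radial t z))).
  by move=> t; apply: cvgM; [exact: cvg_cst|exact: c1].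
rewrite /radint -(int01Z _ c1) -(int01D c3 c2); apply: int01_FTC => [t|t].
  by apply: cvgD; [exact: c3|exact: c2].
have d1 := is_deriveX c (is_derive_id (t : R^o) 1).
have d3 := is_derive_line (g := g) (x := z0) (v := z - z0) (s := t) (dg _).
have := is_deriveM d1 d3; rewrite exprfctE /GRing.scale /= => d.
apply: (is_derive_eq d); rewrite /radial mulr1 addrC; congr (_ + _).
exact: (etrans (mulrC _ _) (esym (mulrA _ _ _))).
Qed.

(** For c > 0 the boundary term at t = 0 vanishes; for c = 0, treated in [euler0], it is the value
    at the centre. *)
Lemma euler f z c : smo setT f -> (0 < c)%N ->
  c%:R * cradint c.-1 f z + cradint c (dC (z - z0) f) z = f z.
Proof.
move=> sf c0; have [c1 c2] := smo_ccont sf; have [c3 c4] := smo_ccont (smo_dC (z - z0) sf).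
have d y := smo_c1 sf (I : setT y).
have nR : (c%:R : C) = (c%:R : R)%:C by rewrite rmorph_nat.
apply/eqP; rewrite eq_complex ReD ImD ReM ImM nR /= !mul0r subr0 addr0.
apply/andP; split; apply/eqP.
  have := euler_real c (z := z) c1 (fun y => (d y).1.2 _) c3.
  by rewrite /= expr1n mul1r radial1 expr0n gtn_eqF // mul0r subr0.
have := euler_real c (z := z) c2 (fun y => (d y).2.2 _) c4.
by rewrite /= expr1n mul1r radial1 expr0n gtn_eqF // mul0r subr0.
Qed.

Lemma euler0 f z : smo setT f -> cradint 0 (dC (z - z0) f) z = f z - f z0.
Proof.
move=> sf; have [c1 c2] := smo_ccont sf; have [c3 c4] := smo_ccont (smo_dC (z - z0) sf).
have d y := smo_c1 sf (I : setT y).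
apply/eqP; rewrite eq_complex ReD ImD ReN ImN /=; apply/andP; split; apply/eqP.
  have := euler_real 0 (z := z) c1 (fun y => (d y).1.2 _) c3.
  by rewrite /= !expr0 !mul1r radial1 radial0 mul0r add0r.
have := euler_real 0 (z := z) c2 (fun y => (d y).2.2 _) c4.
by rewrite /= !expr0 !mul1r radial1 radial0 mul0r add0r.
Qed.

End CRadial.

(** * Coordinates and directional derivatives *)

Section LinearForms.
Variables (R : realType) (V : normedModType R) (D : set V) (l : V -> R[i]) (B : R).
Hypothesis oD : open D.
Hypothesis lD : forall (h : R) v x, l (h *: v + x) = h%:C * l v + l x.
Hypothesis lB : forall v, nc (l v) <= B * `|v|.

Lemma isd_linear x v : isd l x v (l v).
Proof.
apply: (isd_quot (Phi := fun=> l v)); first by move=> h; rewrite lD addrK.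
by exists 0, 1; split=> // h _; rewrite subrr nc0 mul0r.
Qed.

Lemma dC_linear x v : dC v l x = l v.
Proof. exact/isd_dC/isd_linear. Qed.

Lemma smo_linear : smo D l.
Proof.
apply: (smo_alg oD (P := fun f => f = l)).
- move=> f x -> _; have [|cr ci] := @cont_lip _ _ l x B 1 ltr01.
    move=> y _; have -> : l y - l x = l (y - x); last exact: lB.
    by have := lD (-1) x y; rewrite scaleN1r addrC => ->; rewrite rmorphN1 mulN1r addrC.
  by apply: isd_c1 => // v; exists (l v); exact: isd_linear.
- move=> f v ->; apply: (alg_ext (f := fun=> l v)); first exact/alg_smo/smo_cst.
  by move=> y _; rewrite dC_linear.
- exact: alg_base.
Qed.

End LinearForms.

Section Coordinates.
Variables (R : realType) (n : nat).
Local Notation C := R[i].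
Local Notation V := ('rV[R]_n * 'rV[R]_n)%type.
Implicit Types (z v : V) (i k : 'I_n).

Definition xco i z : C := (z.1 0 i)%:C.
Definition yco i z : C := (z.2 0 i)%:C.
Definition ex i : V := (evec R i, 0).
Definition ey i : V := (0, evec R i).

Lemma coord_le (u : 'rV[R]_n) i : `|u 0 i| <= `|u|.
Proof.
rewrite [X in _ <= X]mx_normrE.
exact: (@le_bigmax _ _ _ 0 (fun ij : 'I_1 * 'I_n => `|u ij.1 ij.2|) (0, i)).
Qed.

Lemma xco_le i z : nc (xco i z) <= 1 * `|z|.
Proof. by rewrite nc_real mul1r; apply: le_trans (coord_le _ _) _; rewrite prod_normE le_max lexx. Qed.

Lemma yco_le i z : nc (yco i z) <= 1 * `|z|.
Proof. by rewrite nc_real mul1r; apply: le_trans (coord_le _ _) _; rewrite prod_normE le_max lexx orbT. Qed.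

Lemma xcoD i (h : R) v z : xco i (h *: v + z) = h%:C * xco i v + xco i z.
Proof. by rewrite /xco /= !mxE rmorphD rmorphM. Qed.

Lemma ycoD i (h : R) v z : yco i (h *: v + z) = h%:C * yco i v + yco i z.
Proof. by rewrite /yco /= !mxE rmorphD rmorphM. Qed.

Lemma smo_xco (D : set V) i : open D -> smo D (xco i).
Proof. by move=> oD; exact: smo_linear oD (xcoD i) (xco_le i). Qed.

Lemma smo_yco (D : set V) i : open D -> smo D (yco i).
Proof. by move=> oD; exact: smo_linear oD (ycoD i) (yco_le i). Qed.

Lemma dC_xco i v z : dC v (xco i) z = xco i v.
Proof. exact: dC_linear (xcoD i) _ _. Qed.

Lemma dC_yco i v z : dC v (yco i) z = yco i v.
Proof. exact: dC_linear (ycoD i) _ _. Qed.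

Lemma decomp_dir v : v = \sum_i (v.1 0 i *: ex i + v.2 0 i *: ey i).
Proof.
rewrite big_split /=; apply/eqP; rewrite -pair_eqE /=.
have s1 (f : 'I_n -> V) : (\sum_i f i).1 = \sum_i (f i).1 by exact: (big_morph fst).
have s2 (f : 'I_n -> V) : (\sum_i f i).2 = \sum_i (f i).2 by exact: (big_morph snd).
rewrite !s1 !s2 /=; apply/andP; split; apply/eqP.
  rewrite [X in _ + X]big1 ?addr0 => [|i _]; last by rewrite scaler0.
  exact: row_sum_delta.
rewrite [X in X + _]big1 ?add0r => [|i _]; last by rewrite scaler0.
exact: row_sum_delta.
Qed.

Lemma dC_decomp (D : set V) (f : V -> C) v z : open D -> smo D f -> D z ->
  dC v f z = \sum_i (xco i v * dC (ex i) f z + yco i v * dC (ey i) f z).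
Proof.
move=> oD sf Dz; have d0 : dC (0 : V) f z = 0.
  by have := dCZdir 0 0 sf Dz; rewrite scale0r mul0r.
rewrite [in LHS](decomp_dir v); elim: (index_enum _) => [|i r IH]; first by rewrite !big_nil.
rewrite !big_cons (dCDdir oD _ _ sf Dz) IH (dCDdir oD _ _ sf Dz).
by rewrite !(dCZdir _ _ sf Dz).
Qed.

End Coordinates.

(** * Signs of creation and annihilation operators *)

Section Fermions.
Variables (R : realType) (n : nat).
Local Notation C := R[i].
Implicit Types (i k : 'I_n) (K F : {set 'I_n}).

(** The sign with which e_i ^ e_K is the sorted product, for i outside K. *)
Definition sg i K : C := (-1) ^+ inversions [set i]%SET K.

Lemma inversions1 i K : inversions [set i]%SET K = #|[set k in K | (k < i)%N]%SET|.
Proof.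
rewrite /inversions -(card_imset (f := fun k => (i, k))); last by move=> a b [].
congr #|pred_of_set _|; apply/finset.setP => -[j k]; rewrite finset.inE /= finset.in_set1.
apply/and3P/imsetP => [[/eqP-> kK ki]|[k' + [-> ->]]].
  by exists k => //; rewrite finset.inE kK.
by rewrite finset.inE eqxx => /andP[].
Qed.

Lemma sg_U1 i k K : k \notin K -> sg i (k |: K) = (-1) ^+ (k < i)%N * sg i K.
Proof.
move=> kK; rewrite /sg -exprD !inversions1; congr (_ ^+ _).
have [ki|ki] := boolP (k < i)%N.
  have -> : [set j in k |: K | (j < i)%N]%SET = k |: [set j in K | (j < i)%N]%SET.
    by apply/finset.setP => j; rewrite !finset.inE; case: eqP => // ->; rewrite ki.
  by rewrite cardsU1 finset.inE (negbTE kK).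
rewrite add0n; congr #|pred_of_set _|; apply/finset.setP => j; rewrite !finset.inE.
by case: eqP => // ->; rewrite (negbTE ki) !andbF.
Qed.

Lemma sg2 i K : sg i K * sg i K = 1.
Proof. by rewrite -expr2 sqrr_sign. Qed.

(** Exactly one of k < i and i < k holds, so exactly one of the two signs changes. *)
Lemma sg_swap i k K : i != k -> i \notin K -> k \notin K ->
  sg i K * sg k K + sg k (i |: K) * sg i (k |: K) = 0.
Proof.
move=> ik iK kK; rewrite !sg_U1 //.
have : (val i != val k) by [].
by rewrite neq_ltn => /orP[] h; rewrite h (ltnNge _ _) (ltnW h) /= expr1 expr0; ring.
Qed.

(* The canonical anticommutation relations, the operators acting on different *)
(* factors of the summand. *)
Lemma car_sum (G : 'I_n -> 'I_n -> {set 'I_n} -> C) F :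
  \sum_(i in F) \sum_(k | k \notin F :\ i)
     sg i (F :\ i) * (sg k (F :\ i) * G k i (k |: F :\ i)) +
  \sum_(k | k \notin F) \sum_(i in k |: F)
     sg k F * (sg i ((k |: F) :\ i) * G k i ((k |: F) :\ i)) =
  \sum_i G i i F.
Proof.
pose T1 i k := if (i \in F) && (k \notin F :\ i) then
  sg i (F :\ i) * (sg k (F :\ i) * G k i (k |: F :\ i)) else 0.
pose T2 i k := if (k \notin F) && (i \in k |: F) then
  sg k F * (sg i ((k |: F) :\ i) * G k i ((k |: F) :\ i)) else 0.
have e1 : \sum_(i in F) \sum_(k | k \notin F :\ i)
     sg i (F :\ i) * (sg k (F :\ i) * G k i (k |: F :\ i)) = \sum_i \sum_k T1 i k.
  rewrite big_mkcond; apply: eq_bigr => i _; rewrite /T1; case: (i \in F) => /=.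
    by rewrite big_mkcond.
  by rewrite big1.
have e2 : \sum_(k | k \notin F) \sum_(i in k |: F)
     sg k F * (sg i ((k |: F) :\ i) * G k i ((k |: F) :\ i)) = \sum_i \sum_k T2 i k.
  rewrite exchange_big big_mkcond; apply: eq_bigr => k _; rewrite /T2; case: (k \notin F) => /=.
    by rewrite big_mkcond.
  by rewrite big1.
rewrite e1 e2 -big_split; apply: eq_bigr => i _; rewrite -big_split (bigD1 i) //= big1 ?addr0 => [|k ki].
  rewrite /T1 /T2 !finset.in_setD1 !finset.in_setU1 eqxx /=; have [iF|iF] := boolP (i \in F).
    by rewrite finset.setD1K // addr0 mulrA sg2 mul1r.
  rewrite finset.setU1K // add0r mulrA sg2 mul1r //.
rewrite /T1 /T2 !finset.in_setD1 !finset.in_setU1 ki eq_sym (negbTE ki) /=.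
have [iF|iF] := boolP (i \in F); last by rewrite andbF addr0.
have [kF|kF] := boolP (k \in F); first by rewrite addr0.
have -> : (k |: F) :\ i = k |: F :\ i.
  apply/finset.setP => j; rewrite !finset.inE; case: (eqVneq j k) => [->|//].
  by rewrite ki.
have iF' : i \notin F :\ i by rewrite finset.setD11.
have kF' : k \notin F :\ i by rewrite finset.in_setD1 (negbTE kF) andbF.
rewrite /= -[in sg k F](finset.setD1K iF) !mulrA -mulrDl.
by rewrite sg_swap ?mul0r // eq_sym.
Qed.

End Fermions.

(** * Wirtinger calculus in centred coordinates *)

Lemma leibniz_comb (R : comPzRingType) (a a' b b' f g s : R) :
  a * g + f * b + s * (a' * g + f * b') = (a + s * a') * g + f * (b + s * b').
Proof. by ring. Qed.

Lemma schwarz_comb (R : comPzRingType) (a b c d a' b' c' d' s s' : R) :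
  a = a' -> b = b' -> c = c' -> d = d' ->
  (a + s' * b) + s * (c + s' * d) = (a' + s * c') + s' * (b' + s * d').
Proof. by move=> -> -> -> ->; ring. Qed.

Lemma euler_comb (R : comPzRingType) (a b x y s : R) : s * s = -1 ->
  (x + - s * y) * (a + s * b) + (x + s * y) * (a + - s * b) = 2 * (x * a + y * b).
Proof.
move=> s2; transitivity (2 * (x * a + y * b * - (s * s))); first by ring.
by rewrite s2 opprK mulr1.
Qed.

Section Wirtinger.
Variables (R : realType) (n : nat).
Local Notation C := R[i].
Local Notation V := ('rV[R]_n * 'rV[R]_n)%type.
Implicit Types (f g : V -> C) (z : V) (i k : 'I_n) (s : C) (D : set V).

(* [dcs 'i] and [dcs (- 'i)] are twice the Wirtinger derivatives. *)
Definition dcs s i f z : C := dC (ex R i) f z + s * dC (ey R i) f z.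

Lemma smo_dcs D s i f : open D -> smo D f -> smo D (dcs s i f).
Proof. by move=> oD sf; apply: smoD => //; [exact: smo_dC|apply: smoZ => //; exact: smo_dC]. Qed.

Lemma dcs_ext D s i f g z : open D -> D z -> (forall y, D y -> f y = g y) ->
  dcs s i f z = dcs s i g z.
Proof. by move=> oD Dz fg; rewrite /dcs !(dC_ext _ oD Dz fg). Qed.

Lemma dcsD D s i f g z : smo D f -> smo D g -> D z ->
  dcs s i (fun w => f w + g w) z = dcs s i f z + dcs s i g z.
Proof. by move=> sf sg Dz; rewrite /dcs !(dCD _ sf sg Dz) mulrDr addrACA. Qed.

Lemma dcsM D s i f g z : smo D f -> smo D g -> D z ->
  dcs s i (fun w => f w * g w) z = dcs s i f z * g z + f z * dcs s i g z.
Proof. by move=> sf sg Dz; rewrite /dcs !(dCM _ sf sg Dz); exact: leibniz_comb. Qed.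

Lemma dcs_cst s i (c : C) z : dcs s i (fun=> c) z = 0.
Proof. by rewrite /dcs !dC_cst mulr0 addr0. Qed.

Lemma dcsZ D s i (c : C) f z : open D -> smo D f -> D z ->
  dcs s i (fun w => c * f w) z = c * dcs s i f z.
Proof. by move=> oD sf Dz; rewrite (dcsM _ _ (smo_cst c oD) sf Dz) dcs_cst mul0r add0r. Qed.

Lemma dcs_sum D s i I (r : seq I) (P : pred I) (f : I -> V -> C) z : open D ->
  (forall j, P j -> smo D (f j)) -> D z ->
  dcs s i (fun w => \sum_(j <- r | P j) f j w) z = \sum_(j <- r | P j) dcs s i (f j) z.
Proof. by move=> oD sf Dz; rewrite /dcs !(dC_sum _ _ oD sf Dz) mulr_sumr -big_split. Qed.

Lemma dcs_comm D s s' i k f z : open D -> smo D f -> D z ->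
  dcs s i (dcs s' k f) z = dcs s' k (dcs s i f) z.
Proof.
move=> oD sf Dz; have sd v : smo D (dC v f) by exact: smo_dC.
have sz (a : C) v : smo D (fun w => a * dC v f w) by exact: smoZ.
have E u (a : C) j : dC u (dcs a j f) z = dC u (dC (ex R j) f) z + a * dC u (dC (ey R j) f) z.
  by rewrite /dcs (dCD _ (sd _) (sz _ _) Dz) (dCZ _ _ oD (sd _) Dz).
have S v w : dC v (dC w f) z = dC w (dC v f) z := dC_schwarz oD w v sf Dz.
rewrite -[LHS]/(dC (ex R i) (dcs s' k f) z + s * dC (ey R i) (dcs s' k f) z).
rewrite -[RHS]/(dC (ex R k) (dcs s i f) z + s' * dC (ey R k) (dcs s i f) z) !E.
by apply: schwarz_comb; exact: S.
Qed.

Variable z0 : V.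

(* kap 'i i is the i-th holomorphic coordinate centred at z0, kap (- 'i) i its conjugate. *)
Definition kap s i z : C := xco i (z - z0) + s * yco i (z - z0).

Lemma kapE s i z : kap s i z = (xco i z + s * yco i z) - (xco i z0 + s * yco i z0).
Proof. by rewrite /kap /xco /yco /= !mxE !rmorphB; ring. Qed.

Lemma smo_kap D s i : open D -> smo D (kap s i).
Proof.
move=> oD; apply: (smo_ext oD (f := fun z => (xco i z + s * yco i z) - (xco i z0 + s * yco i z0))).
  by move=> z _; rewrite kapE.
apply: smoB => //; last exact: smo_cst.
by apply: smoD => //; [exact: smo_xco|apply: smoZ => //; exact: smo_yco].
Qed.

(** For s = t = i the factor 1 + i^2 vanishes, so the centred coordinates are holomorphic; for
    opposite signs it is 2, the source of the weights in the homotopy. *)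
Lemma dcs_kap s t i k z : dcs s i (kap t k) z = (1 + s * t) * (i == k)%:R.
Proof.
have T (y : V) : setT y by []; have oT := @openT V.
have sx := smo_xco k oT; have sy := smo_yco k oT.
have E v : dC v (kap t k) z = xco k v + t * yco k v.
  rewrite (dC_ext v oT (T z) (fun w _ => kapE t k w)).
  rewrite (dCB _ oT (smoD oT sx (smoZ t oT sy)) (smo_cst _ oT) (T z)) dC_cst subr0.
  by rewrite (dCD _ sx (smoZ t oT sy) (T z)) (dCZ _ _ oT sy (T z)) dC_xco dC_yco.
rewrite /dcs !E /xco /yco /= !mxE !eqxx /= ![k == i]eq_sym.
by case: (i == k); rewrite /= ?mulr0n ?mulr1n; ring.
Qed.

Lemma kap_radial s i t z : kap s i (radial z0 t z) = t%:C * kap s i z.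
Proof.
rewrite /kap /radial addrAC subrr add0r /xco /yco /= !mxE !rmorphM; ring.
Qed.

Lemma kap0 s i : kap s i z0 = 0.
Proof. by rewrite /kap subrr /xco /yco /= !mxE; ring. Qed.

Lemma ccontM f g : smo setT f -> smo setT g -> ccont (fun w => f w * g w).
Proof. by move=> sf sg; apply: smo_ccont; apply: smoM => //; exact: openT. Qed.

Lemma cradintZ c (a : C) f z : smo setT f ->
  cradint z0 c (fun w => a * f w) z = a * cradint z0 c f z.
Proof.
move=> sf; rewrite (@cradintM _ _ _ c 0 (fun=> a)) ?addn0 //; first exact: smo_ccont.
by move=> t _; rewrite expr0 mul1r.
Qed.

Lemma cradint_kap c s i f z : smo setT f ->
  cradint z0 c (fun w => kap s i w * f w) z = kap s i z * cradint z0 c.+1 f z.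
Proof.
move=> sf; rewrite (@cradintM _ _ _ c 1 (kap s i)) ?addn1 //; first exact: smo_ccont.
by move=> t _; rewrite expr1 kap_radial.
Qed.

Lemma cradint0 c z : cradint z0 c (fun=> 0) z = 0.
Proof.
have s0 := smo_cst (0 : C) (@openT V).
have := cradintZ c 0 z s0; rewrite [RHS]mul0r => {2}<-.
by congr (cradint _ _ _ _); apply/funext => w; rewrite mul0r.
Qed.

Lemma cradint_sum c I (r : seq I) (P : pred I) (f : I -> V -> C) z :
  (forall j, P j -> smo setT (f j)) ->
  cradint z0 c (fun w => \sum_(j <- r | P j) f j w) z = \sum_(j <- r | P j) cradint z0 c (f j) z.
Proof.
move=> sf; elim: r => [|j r IH].
  by rewrite big_nil -[RHS](cradint0 c z); congr (cradint _ _ _ _); apply/funext => w; rewrite big_nil.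
rewrite big_cons; case: ifP => Pj; last first.
  by rewrite -IH; congr (cradint _ _ _ _); apply/funext => w; rewrite big_cons Pj.
rewrite -IH -cradintD; first by congr (cradint _ _ _ _); apply/funext => w; rewrite big_cons Pj.
  by apply: smo_ccont; exact: sf.
by apply: smo_ccont; apply: smo_sum => //; exact: openT.
Qed.

Lemma dcs_cradint c s i f z : smo setT f ->
  dcs s i (cradint z0 c f) z = cradint z0 c.+1 (dcs s i f) z.
Proof.
move=> sf; have sd v : smo setT (dC v f) by exact: smo_dC.
rewrite {1}/dcs !dC_cradint // -cradintZ // -cradintD //; first exact: smo_ccont.
by apply: smo_ccont; apply: smoZ => //; exact: openT.
Qed.

(** The Euler field is the sum of the zbar_i dbar_i and the z_i d_i, and [dcs] is twice a Wirtinger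
    derivative. *)
Lemma euler_kap c f z : smo setT f ->
  \sum_i (kap (- 'i) i z * cradint z0 c (dcs 'i i f) z +
          kap 'i i z * cradint z0 c (dcs (- 'i) i f) z) =
  2 * cradint z0 c (dC (z - z0) f) z.
Proof.
move=> sf; have oT := @openT V; have sd v : smo setT (dC v f) by exact: smo_dC.
have sz (a : C) v : smo setT (fun w => a * dC v f w) by exact: smoZ.
have cE s i : cradint z0 c (dcs s i f) z =
    cradint z0 c (dC (ex R i) f) z + s * cradint z0 c (dC (ey R i) f) z.
  by rewrite -cradintZ // -cradintD //; exact: smo_ccont.
have -> : dC (z - z0) f = fun w => \sum_i (xco i (z - z0) * dC (ex R i) f w +
    yco i (z - z0) * dC (ey R i) f w).
  by apply/funext => w; exact: (dC_decomp _ oT sf I).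
rewrite cradint_sum => [|j _]; last by apply: smoD.
rewrite mulr_sumr; apply: eq_bigr => i _; rewrite [in RHS]cradintD; [|exact: smo_ccont..].
have i2 : 'i * 'i = -1 :> C by rewrite -expr2 sqr_i.
have e1 := cradintZ c (xco i (z - z0)) z (sd (ex R i)).
have e2 := cradintZ c (yco i (z - z0)) z (sd (ey R i)).
rewrite !cE; apply: (etrans (euler_comb _ _ _ _ i2)).
exact: (congr1 (fun t => 2 * t) (esym (f_equal2 +%R e1 e2))).
Qed.

End Wirtinger.

(** * The Dolbeault-Koszul complex of a point *)

Lemma kd_comb8 (C : comPzRingType) (h nF nJ I a1 a2 b1 b2 s c1 c2 SA SB : C) :
  a1 + a2 = SA -> b1 + b2 = SB ->
  h * (nF * (2 * I) + a1 - s * c1) + h * (s * c2 + b1) +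
    h * (a2 - s * c2 + (s * c1 + (nJ * (2 * I) + b2))) =
  h * (2 * ((nF + nJ) * I) + (SA + SB)).
Proof. by move=> <- <-; ring. Qed.

Lemma kd_comb7 (C : comPzRingType) (d w : C) : (1 + 1) * d * w = d * (2 * w).
Proof. by ring. Qed.

Lemma kd_comb5 (C : comPzRingType) (a b s c x : C) : a * (b * (s * (c * x))) = s * (a * (c * (b * x))).
Proof. by ring. Qed.

Lemma kd_comb6 (C : comPzRingType) (c d a x : C) : c * (d * (2 * a) + x) = d * (c * (2 * a)) + c * x.
Proof. by ring. Qed.

Lemma kd_comb2 (C : comPzRingType) (a b h x y s : C) :
  a * (b * (h * (x + s * y))) = h * ((a * b) * x + s * ((a * b) * y)).
Proof. by ring. Qed.

Lemma kd_comb3 (C : comPzRingType) (a b c d t : C) : (a * b) * (c * (d * t)) = c * (a * (d * (b * t))).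
Proof. by ring. Qed.

Lemma kd_comb4 (C : comPzRingType) (a b c t : C) : (a * b) * (c * t) = a * (c * (b * t)).
Proof. by ring. Qed.

Lemma kd_comb (C : comPzRingType) (a h x y s t : C) : a * a = 1 ->
  a * (h * (a * x + y + - s * t)) = h * (x + a * y - s * (a * t)).
Proof.
move=> aa; have -> : a * (h * (a * x + y + - s * t)) = h * (a * a * x + a * y - s * (a * t)) by ring.
by rewrite aa mul1r.
Qed.

Section Koszul.
Variables (R : realType) (n : nat) (z0 : 'rV[R]_n * 'rV[R]_n) (e : R[i]).
Hypothesis e2 : e * e = 1.
Local Notation C := R[i].
Local Notation V := ('rV[R]_n * 'rV[R]_n)%type.
Local Notation forms := ({set 'I_n} -> {set 'I_n} -> V -> C).
Local Notation db := (dcs 'i).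
Local Notation dd := (dcs (- 'i)).
Local Notation zeta := (kap z0 'i).
Local Notation zbar := (kap z0 (- 'i)).
Local Notation rint := (cradint z0).
Local Notation sg := (sg R).
Implicit Types (w : forms) (F J : {set 'I_n}) (z : V).

(** The Dolbeault operator in F plus exterior multiplication by the holomorphic coordinates in J;
    the sign e will be the parity of a matrix row. *)
Definition kd w : forms := fun F J z =>
  \sum_(i in F) sg i (F :\ i) * db i (w (F :\ i) J) z +
  e * (-1) ^+ #|F| * \sum_(i in J) sg i (J :\ i) * (zeta i z * w F (J :\ i) z).

(** The weight for scaling towards z0: one for each dzbar, and one for each index missing in J,
    since [zeta] is homogeneous of degree one. *)
Definition wt F J : nat := (#|F| + #|~: J|)%N.

(** Contraction by zbar in F and by the derivatives d in J form an operator whose anticommutator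
    with [kd] is twice the Euler operator shifted by [wt]. The radial averages invert that operator;
    d raises the weight by one, whence the exponent [(wt F J).-1]. *)
Definition kdh w : forms := fun F J z => 2^-1 *
  (\sum_(i | i \notin F) sg i F * (zbar i z * rint (wt F J) (w (i |: F) J) z) +
   e * (-1) ^+ #|F| *
     \sum_(i | i \notin J) sg i J * rint (wt F J).-1 (dd i (w F (i |: J))) z).

Section Homotopy.
Variables (w : forms) (F J : {set 'I_n}) (z : V).
Hypothesis sw : forall F J, smo setT (w F J).
Let oT := @openT V.
(** A and B enter through diagonal anticommutators, while the mixed terms E and Q cancel between the
    two orders of composition. *)
Let A k i K := zbar k z * rint (wt F J) (db i (w K J)) z.
Let B j k K := zeta j z * rint (wt F J) (dd k (w F K)) z.
Let E i k := rint (wt F J).-1 (db i (dd k (w (F :\ i) (k |: J)))) z.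
Let Q k j := zbar k z * (zeta j z * rint (wt F J).+1 (w (k |: F) (J :\ j)) z).
Let I0 := rint (wt F J).-1 (w F J) z.
Let s := e * (-1) ^+ #|F|.

Lemma s2 : s * s = 1.
Proof. by rewrite /s mulrACA e2 -expr2 sqrr_sign mulr1. Qed.

Lemma wtD1l i : i \in F -> wt (F :\ i) J = (wt F J).-1.
Proof. by move=> iF; rewrite /wt [#|F|](cardsD1 i) iF. Qed.

Lemma wtD1r j : j \in J -> wt F (J :\ j) = (wt F J).+1.
Proof.
move=> jJ; rewrite /wt (_ : ~: (J :\ j) = j |: ~: J).
  by rewrite cardsU1 finset.in_setC jJ addnCA.
by apply/finset.setP => k; rewrite !finset.inE negb_and negbK.
Qed.

Lemma wt_gt0 k : k \notin J -> (0 < wt F J)%N.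
Proof.
by move=> kJ; rewrite /wt addn_gt0 orbC; apply/orP; left; apply/card_gt0P; exists k; rewrite finset.inE.
Qed.

Lemma card_pos i : i \in F -> (0 < wt F J)%N.
Proof. by move=> iF; rewrite /wt addn_gt0; apply/orP; left; apply/card_gt0P; exists i. Qed.

(** The multiple of [I0] comes from dbar_i zbar_i = 2, once for each i in F; in [kd_part4] it comes
    from d_k zeta_k = 2, once for each k outside J. *)
Lemma kd_part1 : \sum_(i in F) sg i (F :\ i) * db i (kdh w (F :\ i) J) z =
  2^-1 * (#|F|%:R * (2 * I0) +
   \sum_(i in F) \sum_(k | k \notin F :\ i) sg i (F :\ i) * (sg k (F :\ i) * A k i (k |: F :\ i)) -
   s * \sum_(i in F) \sum_(k | k \notin J) sg i (F :\ i) * (sg k J * E i k)).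
Proof.
rewrite (_ : #|F|%:R * (2 * I0) = \sum_(i in F) (2 * I0)); last first.
  by rewrite sumr_const mulr_natl.
rewrite [s * _]mulr_sumr -sumrN -!big_split mulr_sumr; apply: eq_bigr => i iF.
have sk k K : smo setT (fun z => zbar k z * rint (wt (F :\ i) J) (w K J) z).
  by apply: smoM oT _ _; [exact: smo_kap|exact: smo_cradint].
have sI k K : smo setT (rint (wt (F :\ i) J).-1 (dd k (w (F :\ i) K))).
  by apply: smo_cradint; exact: smo_dcs.
rewrite /kdh (dcsZ _ _ _ oT (z := z)) //; last first.
  apply: (smoD oT); first by apply: smo_sum => // k _; exact: smoZ.
  by apply: smoZ => //; apply: smo_sum => // k _; exact: smoZ.
rewrite (dcsD _ _ (D := setT) (z := z)) //; [|by apply: smo_sum => // k _; exact: smoZ|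
  by apply: smoZ => //; apply: smo_sum => // k _; exact: smoZ].
rewrite (dcs_sum _ _ _ oT) //; last by move=> k _; exact: smoZ.
rewrite (dcsZ _ _ _ oT) //; last by apply: smo_sum => // k _; exact: smoZ.
rewrite (dcs_sum _ _ _ oT) //; last by move=> k _; exact: smoZ.
have -> : \sum_(k | k \notin F :\ i) db i (fun y => sg k (F :\ i) *
    (zbar k y * rint (wt (F :\ i) J) (w (k |: F :\ i) J) y)) z =
    sg i (F :\ i) * (2 * I0) + \sum_(k | k \notin F :\ i) sg k (F :\ i) * A k i (k |: F :\ i).
  rewrite (eq_bigr (fun k => (i == k)%:R * (sg k (F :\ i) * (2 * rint (wt F J).-1 (w (k |: F :\ i) J) z)) +
     sg k (F :\ i) * A k i (k |: F :\ i))) => [|k kF].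
    rewrite big_split (bigD1 i) ?finset.setD11 //= eqxx mul1r finset.setD1K // big1 ?addr0 // => k /andP[_ ki].
    by rewrite eq_sym (negbTE ki) mul0r.
  rewrite (dcsZ _ _ _ oT) // (dcsM _ _ (smo_kap _ _ _ oT) (smo_cradint _ _ (sw _ _))) //.
  rewrite dcs_kap dcs_cradint // wtD1l // (prednK (card_pos iF)) /A.
  rewrite mulrN -expr2 sqr_i opprK; move: (rint _ _ _) (rint _ _ _) => a b.
  by rewrite mulrDr; congr (_ + _); ring.
have -> : \sum_(k | k \notin J) db i (fun y => sg k J *
    rint (wt (F :\ i) J).-1 (dd k (w (F :\ i) (k |: J))) y) z = \sum_(k | k \notin J) sg k J * E i k.
  apply: eq_bigr => k kJ; rewrite (dcsZ _ _ _ oT) // dcs_cradint; last exact: smo_dcs.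
  have w0 : (0 < wt (F :\ i) J)%N.
    by rewrite /wt addn_gt0 orbC; apply/orP; left; apply/card_gt0P; exists k; rewrite finset.inE.
  by rewrite (prednK w0) wtD1l.
have -> : e * (-1) ^+ #|F :\ i| = - s.
  by rewrite /s [#|F|](cardsD1 i) iF exprS mulN1r mulrN opprK.
apply: (etrans (kd_comb _ (2 * I0) _ s _ (sg2 R i (F :\ i)))).
apply: (f_equal (fun t => 2^-1 * t)); apply: (f_equal2 (fun a b => a - s * b)).
  by apply: (f_equal2 (fun a b => a + b)) => //; exact: mulr_sumr.
exact: mulr_sumr.
Qed.

Lemma kd_part2 : s * \sum_(j in J) sg j (J :\ j) * (zeta j z * kdh w F (J :\ j) z) =
  2^-1 * (s * (\sum_(k | k \notin F) \sum_(j in J) sg k F * (sg j (J :\ j) * Q k j)) +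
   \sum_(j in J) \sum_(k | k \notin J :\ j) sg j (J :\ j) * (sg k (J :\ j) * B j k (k |: J :\ j))).
Proof.
have Xj j : j \in J -> sg j (J :\ j) * (zeta j z * kdh w F (J :\ j) z) =
    2^-1 * (\sum_(k | k \notin F) sg k F * (sg j (J :\ j) * Q k j) +
      s * \sum_(k | k \notin J :\ j) sg j (J :\ j) * (sg k (J :\ j) * B j k (k |: J :\ j))).
  move=> jJ; rewrite /kdh (wtD1r jJ) -/s; apply: (etrans (kd_comb2 _ _ _ _ _ _)).
  apply: (f_equal (fun t => 2^-1 * t)); apply: (f_equal2 (fun a b => a + s * b)).
    by rewrite mulr_sumr; apply: eq_bigr => k _; exact: kd_comb3.
  by rewrite mulr_sumr; apply: eq_bigr => k _; exact: kd_comb4.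
rewrite (eq_bigr _ Xj) -mulr_sumr big_split -mulr_sumr [X in _ = 2^-1 * (s * X + _)]exchange_big.
by rewrite [LHS]mulrCA mulrDr [s * (s * _)]mulrA s2 mul1r.
Qed.

Lemma smo_kdpart1 K K' i : smo setT (fun y => sg i (K :\ i) * db i (w (K :\ i) K') y).
Proof. by apply: smoZ => //; exact: smo_dcs. Qed.

Lemma smo_kdpart2 K K' j : smo setT (fun y => sg j (K' :\ j) * (zeta j y * w K (K' :\ j) y)).
Proof. by apply: smoZ => //; apply: smoM => //; exact: smo_kap. Qed.

Lemma kd_part3 : \sum_(k | k \notin F) sg k F * (zbar k z * rint (wt F J) (kd w (k |: F) J) z) =
  \sum_(k | k \notin F) \sum_(i in k |: F) sg k F * (sg i ((k |: F) :\ i) * A k i ((k |: F) :\ i)) -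
  s * \sum_(k | k \notin F) \sum_(j in J) sg k F * (sg j (J :\ j) * Q k j).
Proof.
rewrite mulr_sumr -sumrN -big_split; apply: eq_bigr => k kF /=.
rewrite /kd cradintD; last first.
- by apply: smo_ccont; apply: smoZ => //; apply: smo_sum => // j _; exact: smo_kdpart2.
- by apply: smo_ccont; apply: smo_sum => // i _; exact: smo_kdpart1.
rewrite cradintZ; last by apply: smo_sum => // j _; exact: smo_kdpart2.
rewrite cradint_sum; last by move=> i _; exact: smo_kdpart1.
rewrite cradint_sum; last by move=> i _; exact: smo_kdpart2.
rewrite mulrDr mulrDr; congr (_ + _).
  rewrite !mulr_sumr; apply: eq_bigr => i _; rewrite /A cradintZ; last exact: smo_dcs.
  by apply: (f_equal (fun t => _ * t)); exact: mulrCA.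
have -> : e * (-1) ^+ #|k |: F| = - s by rewrite /s cardsU1 kF exprS mulN1r mulrN.
rewrite mulNr !mulrN; congr (- _); rewrite !mulr_sumr; apply: eq_bigr => j _.
rewrite /Q cradintZ ?cradint_kap //; last by apply: smoM => //; exact: smo_kap.
exact: kd_comb5.
Qed.

Lemma kd_part4 : s * \sum_(k | k \notin J) sg k J * rint (wt F J).-1 (dd k (kd w F (k |: J))) z =
  s * (\sum_(i in F) \sum_(k | k \notin J) sg i (F :\ i) * (sg k J * E i k)) +
  (#|~: J|%:R * (2 * I0) +
   \sum_(k | k \notin J) \sum_(j in k |: J) sg k J * (sg j ((k |: J) :\ j) * B j k ((k |: J) :\ j))).
Proof.
rewrite (_ : #|~: J|%:R * (2 * I0) = \sum_(k | k \notin J) (2 * I0)); last first.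
  rewrite sumr_const mulr_natl; congr (_ *+ _).
  by apply: eq_card => k; rewrite !inE.
rewrite exchange_big -big_split /= !mulr_sumr -big_split; apply: eq_bigr => k kJ /=.
have wg := wt_gt0 kJ.
have -> : dd k (kd w F (k |: J)) = fun y =>
    \sum_(i in F) sg i (F :\ i) * db i (dd k (w (F :\ i) (k |: J))) y +
    s * \sum_(j in k |: J) sg j ((k |: J) :\ j) *
      ((j == k)%:R * (2 * w F ((k |: J) :\ j) y) + zeta j y * dd k (w F ((k |: J) :\ j)) y).
  apply/funext => y; rewrite /kd (dcsD _ _ (D := setT)) //; last first.
  - by apply: smoZ => //; apply: smo_sum => // j _; exact: smo_kdpart2.
  - by apply: smo_sum => // i _; exact: smo_kdpart1.
  rewrite (dcsZ _ _ _ oT) //; last by apply: smo_sum => // j _; exact: smo_kdpart2.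
  rewrite !(dcs_sum _ _ _ oT) //; [|by move=> j _; exact: smo_kdpart2|by move=> i _; exact: smo_kdpart1].
  congr (_ + _ * _); apply: eq_bigr => i _.
    apply: (etrans (dcsZ (- 'i) k (sg i (F :\ i)) oT (smo_dcs 'i i oT (sw (F :\ i) (k |: J))) I)).
    apply: (f_equal (fun t => sg i (F :\ i) * t)).
    exact: (dcs_comm (- 'i) 'i k i oT (sw (F :\ i) (k |: J)) I).
  apply: (etrans (dcsZ (- 'i) k (sg i ((k |: J) :\ i)) oT
    (smoM oT (smo_kap z0 'i i oT) (sw F ((k |: J) :\ i))) I)).
  apply: (f_equal (fun t => sg i ((k |: J) :\ i) * t)).
  apply: (etrans (dcsM (- 'i) k (smo_kap z0 'i i oT) (sw F ((k |: J) :\ i)) I)).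
  apply: (f_equal2 (fun a b => a + b)) => //.
  by rewrite dcs_kap mulNr -expr2 sqr_i opprK [k == i]eq_sym; exact: kd_comb7.
have smT j : smo setT (fun y => (j == k)%:R * (2 * w F ((k |: J) :\ j) y) + zeta j y * dd k (w F ((k |: J) :\ j)) y).
  apply: smoD => //; first by apply: smoZ => //; exact: smoZ.
  by apply: smoM => //; [exact: smo_kap|exact: smo_dcs].
have smS i : smo setT (db i (dd k (w (F :\ i) (k |: J)))).
  by apply: smo_dcs => //; exact: smo_dcs.
rewrite cradintD; last first.
- by apply: smo_ccont; apply: smoZ => //; apply: smo_sum => // j _; exact: smoZ.
- by apply: smo_ccont; apply: smo_sum => // i _; exact: smoZ.
rewrite cradintZ; last by apply: smo_sum => // j _; exact: smoZ.
rewrite !cradint_sum; [|by move=> j _; exact: smoZ|by move=> i _; exact: smoZ].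
rewrite !mulrDr; congr (_ + _).
  congr (s * _); rewrite mulr_sumr; apply: eq_bigr => i _.
  by rewrite cradintZ // /E mulrCA.
rewrite (_ : s * (sg k J * (s * _)) = sg k J * \sum_(j in k |: J) rint (wt F J).-1 (fun y =>
   sg j ((k |: J) :\ j) * ((j == k)%:R * (2 * w F ((k |: J) :\ j) y) + zeta j y * dd k (w F ((k |: J) :\ j)) y)) z);
  last by rewrite mulrCA [s * (s * _)]mulrA s2 mul1r.
rewrite (eq_bigr (fun j => (j == k)%:R * (sg j ((k |: J) :\ j) * (2 * rint (wt F J).-1 (w F ((k |: J) :\ j)) z)) +
   sg j ((k |: J) :\ j) * B j k ((k |: J) :\ j))) => [|j _].
  rewrite big_split mulrDr; congr (_ + _); last by rewrite mulr_sumr.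
  rewrite (bigD1 k) ?finset.setU11 //= eqxx mul1r finset.setU1K // big1 ?addr0 => [|j /andP[_ jk]].
    by rewrite mulrA sg2 mul1r.
  by rewrite (negbTE jk) mul0r.
rewrite cradintZ // cradintD; last first.
- by apply: ccontM; [exact: smo_kap|exact: smo_dcs].
- by apply: smo_ccont; apply: smoZ => //; exact: smoZ.
rewrite !cradintZ //; last exact: smoZ.
rewrite cradint_kap ?(prednK wg) /B; last exact: smo_dcs.
exact: kd_comb6.
Qed.

(** The mixed terms cancel, [car_sum] reduces the rest to its diagonal, and the [I0] terms add up to
    the weight, so that Euler's identity applies. Weight zero occurs only for F empty and J full;
    there the value at z0 is left over. *)
Lemma kd_homotopy : kd (kdh w) F J z + kdh (kd w) F J z =
  w F J z - ((F == finset.set0) && (J == [set: 'I_n]%SET))%:R * w F J z0.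
Proof.
rewrite [kd _ _ _ _]/kd -/s kd_part1 kd_part2 [kdh _ _ _ _]/kdh -/s kd_part3 kd_part4.
have CA := car_sum (fun k i K => A k i K) F; have CB := car_sum (fun k j K => B j k K) J.
apply: (etrans (kd_comb8 _ _ _ _ _ _ _ CA CB)).
have -> : \sum_i A i i F + \sum_i B i i J = 2 * rint (wt F J) (dC (z - z0) (w F J)) z.
  by apply: etrans (euler_kap z0 (wt F J) z (sw F J)); rewrite big_split.
rewrite -natrD -mulrDr -/(wt F J).
rewrite mulKf ?pnatr_eq0 //; have [w0|w0] := posnP (wt F J).
  have /eqP F0 : F == finset.set0 by move: w0 => /eqP; rewrite /wt addn_eq0 cards_eq0 => /andP[].
  have /eqP J0 : J == [set: 'I_n]%SET.
    move: w0 => /eqP; rewrite /wt addn_eq0 => /andP[_].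
    by rewrite cards_eq0 => /eqP h; rewrite -[J]finset.setCK h finset.setC0.
  by rewrite w0 mul0r add0r euler0 // F0 J0 !eqxx mul1r.
rewrite /I0 euler // [_ && _](_ : _ = false) ?mul0r ?subr0 //.
apply/negP => /andP[/eqP F0 /eqP J0]; move: w0.
by rewrite /wt F0 J0 finset.cards0 finset.setCT finset.cards0.
Qed.

End Homotopy.
End Koszul.

(** * Square zero and exactness up to the top class *)

Lemma kd_comb9 (C : comPzRingType) (a b c d : C) : a * (b * (c * d)) = c * (a * (b * d)).
Proof. by ring. Qed.

Lemma kd_comb10 (C : comPzRingType) (a b c d q w : C) :
  a * (b * (c * (d * (q * w)))) = a * (d * q) * (b * (c * w)).
Proof. by ring. Qed.

Lemma kd_comb11 (C : comPzRingType) (c d q w : C) : c * (d * (q * w)) = q * w * (c * d).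
Proof. by ring. Qed.

(** Exchanging i and k changes the sign of the summand, because creation operators anticommute and G
    is symmetric. *)
Lemma creation_sum (R : realType) (n : nat) (G : 'I_n -> 'I_n -> R[i]) (F : {set 'I_n}) :
  (forall i k, G i k = G k i) ->
  \sum_(i in F) \sum_(k in F :\ i) sg R i (F :\ i) * (sg R k (F :\ i :\ k) * G i k) = 0.
Proof.
move=> Gs; set S := \sum_(i in F) _.
have e1 : S = \sum_i \sum_k (if [&& i \in F, k \in F & i != k] then
    sg R i (F :\ i) * (sg R k (F :\ i :\ k) * G i k) else 0).
  rewrite /S big_mkcond; apply: eq_bigr => i _; case: (i \in F) => /=; last by rewrite big1.
  rewrite big_mkcond; apply: eq_bigr => k _.
  by rewrite finset.in_setD1 andbC eq_sym.
have e2 : S = - S.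
  rewrite {1}e1 exchange_big e1 -sumrN; apply: eq_bigr => i _; rewrite -sumrN; apply: eq_bigr => k _.
  have [iF|_] := boolP (i \in F); last by rewrite andbF /= oppr0.
  have [kF|_] := boolP (k \in F); last by rewrite oppr0.
  rewrite /= eq_sym; case: (eqVneq i k) => [_|ik] /=; first by rewrite oppr0.
  have E : F :\ k :\ i = F :\ i :\ k by rewrite finset.setDDl finset.setUC -finset.setDDl.
  have iK : i \notin F :\ i :\ k by rewrite !finset.inE eqxx andbF.
  have kK : k \notin F :\ i :\ k by rewrite !finset.inE eqxx.
  have Fi : F :\ i = k |: F :\ i :\ k by rewrite finset.setD1K // finset.in_setD1 eq_sym ik.
  have Fk : F :\ k = i |: F :\ i :\ k by rewrite -E finset.setD1K // finset.in_setD1 ik.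
  rewrite (Gs k i) E [in sg R k (F :\ k)]Fk [in sg R i (F :\ i)]Fi !mulrA -mulNr; congr (_ * _).
  rewrite !sg_U1 //; have : (val i != val k) by [].
  by rewrite neq_ltn => /orP[] h; rewrite h (ltnNge _ _) (ltnW h) /= expr1 expr0; ring.
have : S *+ 2 = 0 by rewrite mulr2n {2}e2 addrN.
by move/eqP; rewrite mulrn_eq0 /= => /eqP.
Qed.

Section KoszulSquare.
Variables (R : realType) (n : nat) (z0 : 'rV[R]_n * 'rV[R]_n) (e : R[i]).
Variable D : set ('rV[R]_n * 'rV[R]_n).
Hypothesis oD : open D.
Local Notation C := R[i].
Local Notation V := ('rV[R]_n * 'rV[R]_n)%type.
Local Notation forms := ({set 'I_n} -> {set 'I_n} -> V -> C).
Local Notation db := (dcs 'i).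
Local Notation zeta := (kap z0 'i).
Local Notation zbar := (kap z0 (- 'i)).
Local Notation kd := (kd z0 e).
Local Notation sg := (sg R).
Local Notation smoF := (fun w : forms => forall F J, smo D (w F J)).
Implicit Types (w : forms) (F J : {set 'I_n}) (z : V).

Lemma smo_kdD E w F J : open E -> (forall F J, smo E (w F J)) -> smo E (kd w F J).
Proof.
move=> oE sw; apply: smoD => //.
  by apply: smo_sum => // i _; apply: smoZ => //; exact: smo_dcs.
apply: smoZ => //; apply: smo_sum => // i _; apply: smoZ => //; apply: smoM => //; exact: smo_kap.
Qed.

Lemma kd_ext E w w' F J z : open E -> E z -> (forall F J y, E y -> w F J y = w' F J y) ->
  kd w F J z = kd w' F J z.
Proof.
move=> oE Ez ww.
have h1 : \sum_(i in F) sg i (F :\ i)%SET * db i (w (F :\ i)%SET J) z =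
    \sum_(i in F) sg i (F :\ i)%SET * db i (w' (F :\ i)%SET J) z.
  by apply: eq_bigr => i _; rewrite (dcs_ext _ _ oE Ez (ww _ _)).
have h2 : \sum_(i in J) sg i (J :\ i)%SET * (zeta i z * w F (J :\ i)%SET z) =
    \sum_(i in J) sg i (J :\ i)%SET * (zeta i z * w' F (J :\ i)%SET z).
  by apply: eq_bigr => i _; rewrite ww.
exact: (f_equal2 (fun a b => a + e * (-1) ^+ #|F| * b) h1 h2).
Qed.

Lemma kd0 F J z : kd (fun _ _ => fun=> 0) F J z = 0.
Proof. by rewrite /kd !big1 ?mulr0 ?addr0 // => i _; rewrite ?dcs_cst !mulr0. Qed.

Lemma kdB w w' F J z : smoF w -> smoF w' -> D z ->
  kd (fun F J y => w F J y - w' F J y) F J z = kd w F J z - kd w' F J z.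
Proof.
move=> sw sw' Dz; apply/esym; rewrite /kd opprD addrACA -mulrBr -!sumrB.
congr (_ + _ * _); apply: eq_bigr => i _; rewrite -mulrBr; last by rewrite -mulrBr.
congr (_ * _); have sN : smo D (fun y => (-1) * w' (F :\ i) J y) by exact: smoZ.
apply/esym; apply: (etrans (dcs_ext 'i i (g := fun y => w (F :\ i) J y + (-1) * w' (F :\ i) J y) oD Dz _)).
  by move=> y _; rewrite mulN1r.
apply: (etrans (dcsD _ _ (sw _ _) sN Dz)); apply: (f_equal (fun t => _ + t)).
by apply: (etrans (dcsZ _ _ _ oD (sw' _ _) Dz)); rewrite mulN1r.
Qed.

Lemma kdD w w' F J z : smoF w -> smoF w' -> D z ->
  kd (fun F J y => w F J y + w' F J y) F J z = kd w F J z + kd w' F J z.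
Proof.
move=> sw sw' Dz; apply/esym; rewrite /kd addrACA -mulrDr -!big_split.
congr (_ + _ * _); apply: eq_bigr => i _ /=; rewrite -mulrDr; last by rewrite -mulrDr.
by congr (_ * _); rewrite (dcsD _ _ (sw _ _) (sw' _ _) Dz).
Qed.

(** Derivatives commute, so do the functions [zeta], and these are holomorphic; the sign (-1)^|F|
    makes the two parts anticommute. *)
Lemma kd_kd w F J z : smoF w -> D z -> kd (kd w) F J z = 0.
Proof.
move=> sw Dz; have sdb i F' J' : smo D (db i (w F' J')) by exact: smo_dcs.
have szw i F' J' : smo D (fun y => zeta i y * w F' J' y) by apply: smoM => //; exact: smo_kap.
rewrite {1}/kd.
rewrite (eq_bigr (fun i => \sum_(k in F :\ i) sg i (F :\ i) * (sg k (F :\ i :\ k) *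
   db i (db k (w (F :\ i :\ k) J)) z) + - (e * (-1) ^+ #|F|) *
   \sum_(j in J) sg i (F :\ i) * (sg j (J :\ j) * (zeta j z * db i (w (F :\ i) (J :\ j)) z)))); last first.
  move=> i iF; rewrite /kd.
  apply: (etrans (f_equal (fun t => sg i (F :\ i) * t) (dcsD 'i i _ _ Dz))).
  - by apply: smo_sum => // k _; exact: smoZ.
  - by apply: smoZ => //; apply: smo_sum => // k _; exact: smoZ.
  rewrite (dcs_sum _ _ _ oD) //; last by move=> k _; exact: smoZ.
  rewrite mulrDr mulr_sumr; apply: (f_equal2 (fun a b => a + b)).
    apply: eq_bigr => k _; apply: (f_equal (fun t => sg i (F :\ i) * t)).
    exact: (dcsZ 'i i _ oD (sdb k _ _) Dz).
  apply: (etrans (f_equal (fun t => sg i (F :\ i) * t) (dcsZ 'i i _ oD _ Dz))).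
    by apply: smo_sum => // k _; exact: smoZ.
  rewrite (dcs_sum _ _ _ oD) //; last by move=> k _; exact: smoZ.
  have -> : - (e * (-1) ^+ #|F|) = e * (-1) ^+ #|F :\ i|.
    by rewrite [in LHS](cardsD1 i) iF exprS mulN1r mulrN opprK.
  rewrite mulrCA; apply: (f_equal (fun t => e * (-1) ^+ #|F :\ i| * t)).
  rewrite mulr_sumr; apply: eq_bigr => j _; apply: (f_equal (fun t => sg i (F :\ i) * t)).
  apply: (etrans (dcsZ 'i i _ oD (szw _ _ _) Dz)); apply: (f_equal (fun t => sg j (J :\ j) * t)).
  apply: (etrans (dcsM 'i i (smo_kap z0 'i j oD) (sw _ _) Dz)).
  by rewrite dcs_kap -expr2 sqr_i subrr !mul0r add0r.
rewrite big_split /= -mulr_sumr.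
have -> : \sum_(i in F) \sum_(k in F :\ i) sg i (F :\ i) * (sg k (F :\ i :\ k) *
   db i (db k (w (F :\ i :\ k) J)) z) = 0.
  pose G i k := db i (db k (w (F :\ i :\ k) J)) z.
  apply: (creation_sum (G := G)) => i k; rewrite /G.
  by rewrite (dcs_comm _ _ _ _ oD (sw _ _) Dz) finset.setDDl finset.setUC -finset.setDDl.
rewrite add0r mulNr addrC; apply/eqP; rewrite subr_eq0; apply/eqP; apply: (f_equal (fun t => _ * t)).
rewrite (eq_bigr (fun j => \sum_(i in F) sg i (F :\ i) * (sg j (J :\ j) *
   (zeta j z * db i (w (F :\ i) (J :\ j)) z)) + e * (-1) ^+ #|F| *
   \sum_(k in J :\ j) sg j (J :\ j) * (sg k (J :\ j :\ k) * (zeta j z * (zeta k z * w F (J :\ j :\ k) z))))); last first.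
  move=> j jJ; rewrite /kd !mulrDr; apply: (f_equal2 (fun a b => a + b)).
    by rewrite !mulr_sumr; apply: eq_bigr => i _; exact: kd_comb9.
  rewrite [zeta j z * _]mulrCA [sg j _ * _]mulrCA; apply: (f_equal (fun t => _ * t)).
  by rewrite !mulr_sumr; apply: eq_bigr => k _; apply: (f_equal (fun t => _ * t)); exact: mulrCA.
rewrite big_split /= -mulr_sumr exchange_big /=.
have -> : \sum_(j in J) \sum_(k in J :\ j) sg j (J :\ j) * (sg k (J :\ j :\ k) *
   (zeta j z * (zeta k z * w F (J :\ j :\ k) z))) = 0.
  pose G j k := zeta j z * (zeta k z * w F (J :\ j :\ k) z).
  apply: (creation_sum (G := G)) => j k; rewrite /G mulrCA.
  by rewrite finset.setDDl finset.setUC -finset.setDDl.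
by rewrite mulr0 addr0.
Qed.

End KoszulSquare.

Section KoszulExact.
Variables (R : realType) (n : nat) (z0 : 'rV[R]_n * 'rV[R]_n) (e : R[i]).
Hypothesis e2 : e * e = 1.
Variable D : set ('rV[R]_n * 'rV[R]_n).
Hypothesis oD : open D.
Local Notation C := R[i].
Local Notation V := ('rV[R]_n * 'rV[R]_n)%type.
Local Notation forms := ({set 'I_n} -> {set 'I_n} -> V -> C).
Local Notation db := (dcs 'i).
Local Notation zeta := (kap z0 'i).
Local Notation zbar := (kap z0 (- 'i)).
Local Notation kd := (kd z0 e).
Local Notation sg := (sg R).
Local Notation smoF := (fun w : forms => forall F J, smo D (w F J)).
Implicit Types (w : forms) (F J : {set 'I_n}) (z : V).

Definition qnorm z : R := \sum_i ((z - z0).1 0 i ^+ 2 + (z - z0).2 0 i ^+ 2).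

Lemma qnormE z : (qnorm z)%:C = \sum_i zeta i z * zbar i z.
Proof.
rewrite /qnorm rmorph_sum; apply: eq_bigr => i _; rewrite /kap /xco /yco.
rewrite mulNr; apply: (etrans _ (mulrC _ _)); apply: (etrans _ (subr_sqr _ _)).
by rewrite exprMn sqr_i mulN1r opprK rmorphD !rmorphXn.
Qed.

Lemma smo_qnorm E : open E -> smo E (fun z => (qnorm z)%:C).
Proof.
move=> oE; apply: (smo_ext oE (f := fun z => \sum_i zeta i z * zbar i z)).
  by move=> z _; rewrite qnormE.
by apply: smo_sum => // i _; apply: smoM => //; exact: smo_kap.
Qed.

Lemma qnorm_cont : continuous qnorm.
Proof. by have [] := smo_ccont (smo_qnorm (@openT V)). Qed.

Lemma qnorm_radial t z : qnorm (radial z0 t z) = t ^+ 2 * qnorm z.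
Proof.
rewrite /qnorm mulr_sumr; apply: eq_bigr => i _; rewrite /radial addrAC subrr add0r /= !mxE.
by ring.
Qed.

Lemma qnorm_small (d : R) z : 0 < d -> qnorm z < d ^+ 2 -> `|z - z0| < d.
Proof.
move=> d0 qd; have coord (a : R) : a ^+ 2 <= qnorm z -> `|a| < d.
  move=> aq; rewrite -(ltr_pXn2r (n := 2)) // ?nnegrE ?normr_ge0 ?ltW //.
  by rewrite real_normK ?num_real // (le_lt_trans aq).
have le (i : 'I_n) : (z - z0).1 0 i ^+ 2 + (z - z0).2 0 i ^+ 2 <= qnorm z.
  by rewrite /qnorm (bigD1 i) //= lerDl sumr_ge0 // => k _; rewrite addr_ge0 ?sqr_ge0.
have row (u : 'rV[R]_n) : (forall i, `|u 0 i| < d) -> `|u| < d.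
  move=> h; have [->|u0] := eqVneq `|u| 0; first by [].
  have [[i j] /= E] := mx_norm_neq0 u0; rewrite (ord1 i) in E; apply: le_lt_trans (h j); rewrite -E; exact: lexx.
rewrite prod_normE gt_max; apply/andP; split; apply: row => i; apply: coord.
  by apply: le_trans (le i); rewrite lerDl sqr_ge0.
by apply: le_trans (le i); rewrite lerDr sqr_ge0.
Qed.

Lemma open_qlt a : open [set z | qnorm z < a].
Proof. by apply: (open_comp (f := qnorm)) (@open_lt R a) => z _; exact: qnorm_cont. Qed.

Lemma open_qgt a : open [set z | a < qnorm z].
Proof. by apply: (open_comp (f := qnorm)) (@open_gt R a) => z _; exact: qnorm_cont. Qed.

Lemma open_qneq : open [set z | qnorm z != 0].
Proof. by apply: (open_comp (f := qnorm)) (@open_neq R 0) => z _; exact: qnorm_cont. Qed.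

Lemma qnorm_ge0 z : 0 <= qnorm z.
Proof. by rewrite sumr_ge0 // => i _; rewrite addr_ge0 ?sqr_ge0. Qed.

Lemma qnorm_z0 : qnorm z0 = 0.
Proof. by rewrite /qnorm subrr big1 // => i _; rewrite /= !mxE expr0n addr0. Qed.

Variable a : R.
Hypothesis a0 : 0 < a.
Local Notation N := [set z | qnorm z < a].

(* Away from z0 the Koszul differential is inverted by contraction. *)
Definition kdg w : forms := fun F J z => e * (-1) ^+ #|F| *
  \sum_(k | k \notin J) sg k J * (zbar k z * (((qnorm z)^-1)%:C * w F (k |: J) z)).

Lemma kdg0 w F J z : (forall K, w F K z = 0) -> kdg w F J z = 0.
Proof. by move=> w0; rewrite /kdg big1 ?mulr0 // => k _; rewrite w0 !mulr0. Qed.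

Lemma smo_union E E' (f : V -> C) : smo E f -> smo E' f -> smo (E `|` E') f.
Proof. by move=> [s] [s']; split=> vs x [/s|/s']; exact. Qed.

(** Since w vanishes near z0, the pole of the inverse squared norm does not matter. *)
Lemma smo_kdg w : smoF w -> (forall F J z, N z -> w F J z = 0) -> smoF (kdg w).
Proof.
move=> sw w0 F J; pose E := D `&` [set z | qnorm z != 0].
have oE : open E by apply: openI => //; exact: open_qneq.
have s1 : smo E (kdg w F J).
  apply: smoZ => //; apply: smo_sum => // k _; apply: smoZ => //; apply: smoM => //; first exact: smo_kap.
  apply: smoM => //; last by apply: smo_sub (sw _ _) => z [].
  by apply: smo_inv => //; [exact: smo_qnorm|move=> z []].
have s2 : smo N (kdg w F J).
  have := smo_cst (0 : C) (@open_qlt a); apply: smo_ext; first exact: (@open_qlt a).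
  by move=> z Nz; rewrite kdg0 // => K; exact: w0.
apply: smo_sub (smo_union s1 s2) => z Dz.
by have [q0|q0] := eqVneq (qnorm z) 0; [right; rewrite /= q0|left].
Qed.

(** In the lowest form degree the dbar terms drop out, and closedness says that multiplication by
    [zeta] kills w. Its anticommutator with contraction by [zbar] is the squared norm, which [kdg]
    divides out. *)
Lemma kdg_lead w F J z : smoF w -> (forall F J z, N z -> w F J z = 0) ->
  (forall F J z, D z -> kd w F J z = 0) -> D z ->
  (forall F' J z, (#|F'| < #|F|)%N -> D z -> w F' J z = 0) ->
  kd (kdg w) F J z = w F J z.
Proof.
move=> sw w0 kw Dz wF; have FD i : i \in F -> (#|F :\ i| < #|F|)%N.
  by move=> iF; rewrite [X in (_ < X)%N](cardsD1 i) iF.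
have db0 (g : V -> C) i : (forall y, D y -> g y = 0) -> db i g z = 0.
  by move=> g0; rewrite (dcs_ext _ _ oD Dz (g := fun=> 0)) ?dcs_cst.
rewrite /kd big1 ?add0r; last first.
  move=> i iF; rewrite db0 ?mulr0 // => y Dy; rewrite kdg0 // => K.
  exact: wF (FD i iF) Dy.
have ss : e * (-1) ^+ #|F| * (e * (-1) ^+ #|F|) = 1.
  by rewrite mulrACA e2 -expr2 sqrr_sign mulr1.
pose qi := ((qnorm z)^-1)%:C; pose G k j K := zeta j z * (zbar k z * (qi * w F K z)).
have -> : \sum_(j in J) sg j (J :\ j) * (zeta j z * kdg w F (J :\ j) z) = e * (-1) ^+ #|F| *
    \sum_(j in J) \sum_(k | k \notin J :\ j) sg j (J :\ j) * (sg k (J :\ j) * G k j (k |: J :\ j)).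
  rewrite mulr_sumr; apply: eq_bigr => j _; rewrite /kdg [zeta j z * _]mulrCA [LHS]mulrCA.
  apply: (f_equal (fun t => _ * t)); rewrite !mulr_sumr; apply: eq_bigr => k _.
  by apply: (f_equal (fun t => _ * t)); exact: mulrCA.
rewrite mulrA ss mul1r; have := car_sum G J.
have -> : \sum_(k | k \notin J) \sum_(j in k |: J)
     sg k J * (sg j ((k |: J) :\ j) * G k j ((k |: J) :\ j)) = 0.
  apply: big1 => k kJ.
  have K0 : \sum_(j in k |: J) sg j ((k |: J) :\ j) * (zeta j z * w F ((k |: J) :\ j) z) = 0.
    have := kw F (k |: J) z Dz; rewrite /kd big1 ?add0r; last first.
      by move=> i iF; rewrite db0 ?mulr0 // => y; exact: wF (FD i iF).
    move=> /(congr1 (fun t => e * (-1) ^+ #|F| * t)); rewrite mulr0 mulrA ss mul1r //.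
  apply: (etrans _ (etrans (f_equal (fun t => sg k J * (zbar k z * qi) * t) K0) (mulr0 _))).
  by rewrite mulr_sumr; apply: eq_bigr => j _; exact: kd_comb10.
rewrite addr0 => ->; have [q0|q0] := eqVneq (qnorm z) 0.
  by rewrite w0 /= ?q0 // big1 // => i _; rewrite /G w0 /= ?q0 // !mulr0.
rewrite (eq_bigr (fun i => qi * w F J z * (zeta i z * zbar i z))).
  rewrite -mulr_sumr -qnormE mulrAC /qi -rmorphM mulVf // mul1r //.
by move=> i _; exact: kd_comb11.
Qed.

(** Subtracting [kd (kdg w)] removes the lowest form degree, which can be raised only up to n; m
    counts the degrees left. *)
Lemma kd_exact_away m w : smoF w -> (forall F J z, N z -> w F J z = 0) ->
  (forall F J z, D z -> kd w F J z = 0) ->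
  (forall F J z, (#|F| + m <= n)%N -> D z -> w F J z = 0) ->
  exists2 s : forms, smoF s & forall F J z, D z -> w F J z = kd s F J z.
Proof.
elim: m w => [|m IH] w sw w0 kw wF.
  exists (fun _ _ => fun=> 0) => [F J|F J z Dz]; first exact: smo_cst.
  by rewrite kd0 wF // addn0 (leq_trans (max_card _)) // card_ord.
have sg := smo_kdg sw w0; have skd : smoF (kd (kdg w)) by move=> F J; exact: smo_kdD.
have g0 F J z : N z -> kdg w F J z = 0 by move=> Nz; apply: kdg0 => K; exact: w0.
have [||||s ss sE] := IH (fun F J y => w F J y - kd (kdg w) F J y).
- by move=> F J; exact: smoB.
- move=> F J z Nz; rewrite w0 // sub0r (kd_ext _ _ _ _ (@open_qlt a) Nz (w' := fun _ _ => fun=> 0) g0) kd0 oppr0 //.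
- by move=> F J z Dz; rewrite (kdB _ _ oD) // kw // (kd_kd _ _ oD) // subr0.
- move=> F J z Fm Dz; apply/eqP; rewrite subr_eq0 eq_sym; apply/eqP.
  have low F' J' y : (#|F'| < #|F|)%N -> D y -> w F' J' y = 0.
    by move=> FF Dy; apply: wF Dy; rewrite addnS; apply: leq_trans Fm; rewrite ltn_add2r.
  exact: kdg_lead.
exists (fun F J y => kdg w F J y + s F J y) => [F J|F J z Dz]; first exact: smoD.
by rewrite (kdD _ _ _ _ sg ss Dz) -sE // addrC subrK.
Qed.

End KoszulExact.

Lemma cradint_eq0 (R : realType) (V : normedModType R) (z0 : V) c (f : V -> R[i]) z :
  (forall t, 0 <= t <= 1 -> f (radial z0 t z) = 0) -> cradint z0 c f z = 0.
Proof.
move=> f0; have i0 : int01 (fun=> 0 : R) = 0 by exact: int01_cst.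
apply/eqP; rewrite eq_complex /=; apply/andP; split; apply/eqP; rewrite -[RHS]i0;
  by apply: eq_int01 => t t01; rewrite f0 // mulr0.
Qed.

Section KoszulLocal.
Variables (R : realType) (n : nat) (z0 : 'rV[R]_n * 'rV[R]_n) (e : R[i]).
Hypothesis e2 : e * e = 1.
Variable D : set ('rV[R]_n * 'rV[R]_n).
Hypotheses (oD : open D) (Dz0 : D z0).
Local Notation C := R[i].
Local Notation V := ('rV[R]_n * 'rV[R]_n)%type.
Local Notation forms := ({set 'I_n} -> {set 'I_n} -> V -> C).
Local Notation kd := (kd z0 e).
Implicit Types (w : forms) (F J : {set 'I_n}) (z : V).

Definition etop F J : C := ((F == finset.set0) && (J == [set: 'I_n]%SET))%:R.

Lemma kd_etop (c : C) F J z : kd (fun F J => fun=> etop F J * c) F J z = 0.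
Proof.
rewrite /kd big1 => [|i _]; last by rewrite dcs_cst mulr0.
rewrite big1 ?mulr0 ?addr0 // => j jJ; rewrite /etop.
have -> : (J :\ j == [set: 'I_n]%SET) = false.
  by apply/negP => /eqP/finset.setP/(_ j); rewrite !finset.inE eqxx.
by rewrite andbF !mul0r !mulr0.
Qed.

(* Near z0 the radial homotopy applies to a cut-off of w; what is left is *)
(* supported away from z0. *)
Lemma kd_exact w c : (forall F J, smo D (w F J)) ->
  (forall F J z, D z -> kd w F J z = etop F J * c) ->
  c = 0 /\ exists (s : forms) (c' : C), (forall F J, smo D (s F J)) /\
    forall F J z, D z -> w F J z = kd s F J z + etop F J * c'.
Proof.
move=> sw kw.
(* For F empty there is no dbar term, and the Koszul term vanishes at z0. *)
have c0 : c = 0.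
  have := kw finset.set0 [set: 'I_n]%SET z0 Dz0; rewrite /etop !eqxx mul1r => <-.
  rewrite /kd big1 => [|i]; last by rewrite finset.inE.
  by rewrite big1 ?mulr0 ?addr0 // => j _; rewrite kap0 mul0r mulr0.
split=> //; have {}kw F J z : D z -> kd w F J z = 0 by move=> Dz; rewrite kw // c0 mulr0.
have [d d0 hd] := open_ball oD Dz0.
(* The set where the squared norm is below d^2 lies in D; the cut-off is 1 where it is at most a and
   vanishes where it is at least b. *)
pose b := d ^+ 2 / 2; pose a := d ^+ 2 / 4.
have d2 : 0 < d ^+ 2 by rewrite exprn_gt0.
have a0 : 0 < a by rewrite divr_gt0.
have ab : a < b by rewrite /a /b; lra.
have bd : b < d ^+ 2 by rewrite /b; lra.
have qD z : qnorm z0 z < d ^+ 2 -> D z by move=> /(qnorm_small d0); exact: hd.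
have oT := @openT V.
pose chi z : C := (bump a b (qnorm z0 z))%:C.
have schi E : open E -> smo E chi by move=> oE; apply: smo_bump => //; exact: smo_qnorm.
pose wc : forms := fun F J z => if pselect (D z) then chi z * w F J z else 0.
have wcD F J z : D z -> wc F J z = chi z * w F J z.
  by rewrite /wc; case: pselect.
have swc F J : smo setT (wc F J).
  have s1 : smo D (wc F J).
    have := smoM oD (schi D oD) (sw F J); apply: smo_ext => // z Dz.
    by rewrite wcD.
  have s2 : smo [set z | b < qnorm z0 z] (wc F J).
    have oE := @open_qgt R n z0 b; have := smo_cst (0 : C) oE; apply: smo_ext => // z /= zb.
    by rewrite /wc; case: pselect => // Dz; rewrite /chi bump0 ?mul0r // ltW.
  apply: smo_sub (smo_union s1 s2) => z _; have [zb|zb] := ltP b (qnorm z0 z); first by right.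
  by left; apply: qD; exact: le_lt_trans bd.
have oN := @open_qlt R n z0 a.
have ND z : qnorm z0 z < a -> D z by move=> za; apply: qD; rewrite (lt_trans za) // (lt_trans ab).
have wcN F J z : qnorm z0 z < a -> wc F J z = w F J z.
  by move=> za; rewrite (wcD _ _ _ (ND z za)) -[chi z]/((bump a b (qnorm z0 z))%:C) bump1 ?mul1r // ltW.
have kwN F J z : qnorm z0 z < a -> kd wc F J z = 0.
  by move=> za; rewrite (kd_ext _ _ _ _ oN za (w' := w)) ?(kw _ _ _ (ND z za)) // => F' J' y; exact: wcN.
have rN t z : 0 <= t <= 1 -> qnorm z0 z < a -> qnorm z0 (radial z0 t z) < a.
  move=> /andP[t0 t1] za; rewrite qnorm_radial; apply: le_lt_trans za.
  by rewrite ler_piMl ?qnorm_ge0 // exprn_ile1.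
pose s := kdh z0 e wc; pose c' := w finset.set0 [set: 'I_n]%SET z0.
have ss F J : smo setT (s F J).
  apply: smoZ => //; apply: smoD => //; first apply: smo_sum => // i _.
    by apply: smoZ => //; apply: smoM => //; [exact: smo_kap|exact: smo_cradint].
  apply: smoZ => //; apply: smo_sum => // i _; apply: smoZ => //; apply: smo_cradint.
  exact: smo_dcs.
have ssD F J : smo D (s F J) by apply: smo_sub (ss F J).
have sk F J : smo D (kd s F J) by exact: smo_kdD.
have se F J : smo D (fun=> etop F J * c') by exact: smo_cst.
(* Segments from z0 stay in the region where the cut-off form equals w and is closed, so the second
   term of the homotopy formula vanishes there. *)
have near F J z : qnorm z0 z < a -> w F J z = kd s F J z + etop F J * c'.
  move=> za; have := kd_homotopy z0 e2 F J z swc.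
  have -> : kdh z0 e (kd wc) F J z = 0.
    rewrite /kdh [X in X + _]big1 => [|i _]; last first.
      by rewrite cradint_eq0 ?mulr0 // => t t01; exact: kwN (rN t z t01 za).
    rewrite big1 ?mulr0 ?addr0 ?mulr0 // => i _; rewrite cradint_eq0 ?mulr0 // => t t01.
    rewrite (@dcs_ext _ _ _ _ _ _ (fun=> 0) _ oN (rN t z t01 za)) ?dcs_cst //.
    by move=> y ya; exact: kwN.
  rewrite addr0 wcN // => ->; rewrite -/(etop F J); have [E|E] := eqVneq (etop F J) 0.
    by rewrite E !mul0r subr0 addr0.
  have [-> ->] : F = finset.set0 /\ J = [set: 'I_n]%SET.
    by move: E; rewrite /etop pnatr_eq0 eqb0 negbK => /andP[/eqP-> /eqP->].
  by rewrite wcN ?qnorm_z0 // /c' subrK.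
pose w1 : forms := fun F J z => w F J z - (kd s F J z + etop F J * c').
have sw1 F J : smo D (w1 F J) by apply: smoB => //; exact: smoD.
(* For m = n + 1 the condition on low form degrees is empty. *)
have [|||s' ss' sE] := @kd_exact_away R n z0 e e2 D oD a a0 n.+1 w1 sw1.
- by move=> F J z za; rewrite /w1 -near // subrr.
- move=> F J z Dz; rewrite /w1 (@kdB _ _ z0 e D oD w (fun F J z => kd s F J z + etop F J * c') F J z sw _ Dz).
    by rewrite kw // (kdD _ _ _ _ sk se Dz) // (kd_kd _ _ oD) // kd_etop addr0 subr0.
  by move=> F' J'; exact: smoD.
- by move=> F J z; rewrite addnS ltnNge leq_addl.
exists (fun F J z => s F J z + s' F J z), c'; split=> [F J|F J z Dz]; first exact: smoD.
rewrite (kdD _ _ _ _ ssD ss' Dz) -sE // /w1; set x := kd s F J z; set y := etop F J * c'.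
by rewrite addrAC addrC subrK.
Qed.

End KoszulLocal.

(** * Closed form of the functor Phi *)

Section Signs.
Variables (R : realType) (X : Type) (d : X -> nat).
Local Notation C := R[i].
Implicit Types (a : X -> C) (s : seq (X -> C)).

Lemma iter_gsgn k a x : iter k (gsgn d) a x = (-1) ^+ (k * d x) * a x.
Proof. by elim: k => [|k IH]; rewrite ?mul1r //= {1}/gsgn IH mulrA -exprD mulSn. Qed.

Lemma iter_ksgn k a x : iter k (ksgn d) a x = (-1) ^+ (k * (d x).+1) * a x.
Proof. by elim: k => [|k IH]; rewrite ?mul1r //= {1}/ksgn IH mulrA -exprD mulSn. Qed.

Lemma size_eps s : size (eps d s) = size s.
Proof. by elim: s => //= a s ->. Qed.

Lemma nth_eps s i : (i < size s)%N ->
  nth 0 (eps d s) i = iter (size s - i.+1) (gsgn d) (nth 0 s i).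
Proof. by elim: s i => //= a s IH [|i] /=; rewrite subSS ?subn0 // => /IH ->. Qed.

End Signs.

Section Matrices.
Variables (R : realType) (n : nat) (D : fukaya_data R n) (A : calgebra D).
Local Notation C := R[i].

Lemma mop_rank1 (s : seq ((mcrd A nat -> C) * seq nat)) l' x :
  all (fun aB => aB.2 == [:: 0%N]) s ->
  mop ndeg s (0%N, l', x) = (0%N == l')%:R * aop (map (fun aB y => aB.1 (0%N, 0%N, y)) s) x.
Proof.
move=> h0; suff h acc : mop_rec ndeg 0%N 0%N l' acc s x = (0%N == l')%:R *
    aop (rev acc ++ map (fun aB y => aB.1 (0%N, 0%N, y)) s) x by exact: (h [::]).
elim: s acc h0 => [|[a B] s IH] acc /=; first by rewrite cats0.
by move=> /andP[/eqP-> /IH h]; rewrite big_seq1 h rev_cons cat_rcons.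
Qed.

End Matrices.

Lemma sgn_cancel (C : pzRingType) (a c m : nat) (x : C) : a = c ->
  (-1) ^+ (a * m) * ((-1) ^+ (c * m) * x) = x.
Proof. by move=> ->; rewrite mulrA -expr2 sqrr_sign mul1r. Qed.

Section FormOp.
Variables (R : realType) (n : nat) (D : fukaya_data R n) (P : Type).
Local Notation C := R[i].
Local Notation G := (cls D).
Local Notation S := (Scrd D P).
Implicit Types (s : seq (S -> C)).

Lemma disk_nth0 b (s : seq ({set 'I_n} -> C)) i : (i < size s)%N -> nth 0 s i = 0 ->
  disk_op (f:=D) b s = 0.
Proof.
move=> si s0; rewrite -(cat_take_drop i s) (drop_nth 0 si) s0.
have := m_linear (f:=D) b (take i s) (drop i.+1 s) 1 0 0.
have -> : zscale 1 0 + 0 = 0 :> ({set 'I_n} -> C).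
  by apply/funext => K; rewrite /zscale addr0; exact: mulr0.
move=> /(congr1 (fun t => t - disk_op (f:=D) b (take i s ++ 0 :: drop i.+1 s))).
rewrite addrK subrr => e; apply/funext => K; have := congr1 (fun f : {set 'I_n} -> C => f K) e.
by rewrite /zscale mul1r.
Qed.

Definition at0 (p : P) (a : S -> C) : Lcrd D -> C := fun '(J, b) => a (finset.set0, J, b, p).

Lemma wedges0 k : wedges R (nseq k (finset.set0 : {set 'I_n})) = @ebasis R n finset.set0.
Proof. by elim: k => //= k ->; apply/funext => K; rewrite wedge1l. Qed.

(** For inputs without form part only the tuple of empty forms contributes; all form signs are then
    trivial, and the two applications of [eps] cancel. *)
Lemma form_opE sg gl s F J g p :
  (forall k i, sg (nseq k 0%N) i = 0%N) -> (forall k, gl (nseq k 0%N) = 0%N) ->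
  (forall i F J b p, F != finset.set0 -> nth 0 s i (F, J, b, p) = 0) ->
  form_op (D:=D) sg gl (eps (@Sdeg R n D P) s) (F, J, g, p) =
  (F == finset.set0)%:R * Lop (map (at0 p) s) (J, g).
Proof.
move=> sg0 gl0 s0; set t := eps _ s; have st : size t = size s by rewrite size_eps.
rewrite /form_op.
pose Phi b0 (l : seq G) := (F == finset.set0)%:R * disk_op (f:=D) b0
  (mkseq (fun i K => nth 0 s i (finset.set0, K, nth 0 l i, p)) (size s)) J.
transitivity (\sum_(bs \in [set bs : (size t).+1.-tuple G | \sum_(b <- bs) b = g])
    Phi (thead bs) (behead bs)).
  apply: eq_fsbigr => bs _; rewrite (bigD1 [tuple of nseq (size t) (finset.set0 : {set 'I_n})]) //=.
  rewrite big1 ?addr0 => [|Fs nFs].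
    have -> : map (@hdeg n) (nseq (size t) finset.set0) = nseq (size t) 0%N.
      by rewrite map_nseq /hdeg finset.cards0.
    rewrite gl0 expr0 mul1r wedges0 /Phi; congr (_ * disk_op _ _ _).
    apply: (@eq_from_nth _ 0); rewrite ?size_eps ?size_mkseq // => i it.
    have is_ : (i < size s)%N by rewrite -st.
    rewrite nth_eps ?size_mkseq // !nth_mkseq // sg0 /= nth_nseq it nth_eps //.
    apply/funext => K; rewrite iter_gsgn iter_gsgn /= /hdeg finset.cards0 add0n nth_behead.
    by apply: sgn_cancel; rewrite st.
  have [i it Fi] : exists2 i, (i < size t)%N & nth finset.set0 Fs i != finset.set0.
    apply: contrapT => h; case/negP: nFs; apply/eqP/val_inj/(@eq_from_nth _ finset.set0).
      by rewrite size_tuple size_nseq.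
    move=> i; rewrite size_tuple => it; rewrite nth_nseq it; apply/eqP/negPn/negP => Fi.
    by apply: h; exists i.
  have is_ : (i < size s)%N by rewrite -st.
  rewrite [m_eps _ _ _](_ : _ = 0) ?mulr0 // /m_eps (@disk_nth0 _ _ i) ?size_eps ?size_mkseq //.
  rewrite nth_eps ?size_mkseq // nth_mkseq //; apply/funext => K.
  by rewrite !iter_gsgn nth_eps // iter_gsgn s0 // !mulr0.
rewrite tuple_sum /Lop.
pose Psi b0 (l : seq G) := disk_op (f:=D) b0
  (mkseq (fun i K => nth 0 (map (at0 p) s) i (K, nth 0 l i)) (size (map (at0 p) s))) J.
transitivity ((F == finset.set0)%:R * \sum_(bs \in [set bs : (size (map (at0 p) s)).+1.-tuple G |
    \sum_(b <- bs) b = g]) Psi (thead bs) (behead bs)); last first.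
  congr (_ * _); apply: eq_fsbigr => bs _; rewrite /Psi; congr (disk_op _ _ _).
  by apply: eq_mkseq => i; apply/funext => K; rewrite nth_behead.
rewrite tuple_sum mulr_sumr size_map st; apply: eq_bigr => l _; rewrite /Phi /Psi size_map.
congr (_ * disk_op _ _ _); apply: (@eq_from_nth _ 0); rewrite !size_mkseq // => i is_.
by rewrite !nth_mkseq // (nth_map 0).
Qed.

End FormOp.

Lemma csum_to0 (R : realType) k : @csum_to R k (fun=> 0) 0.
Proof.
by split; rewrite /cpart; under eq_fun do rewrite big1 //; exact: cvg_cst.
Qed.

Lemma csum_bool (R : realType) k (b : bool) (f : seq nat -> R[i]) :
  csum k (fun e => b%:R * f e) = b%:R * csum k f.
Proof.
case: b; first by rewrite mul1r; congr (csum _ _); apply/funext => e; rewrite mul1r.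
rewrite mul0r; apply: csumE; have := csum_to0 R k; congr csum_to.
by apply/funext => e; rewrite mul0r.
Qed.

Lemma weave_ind (T : Type) (Q : T -> Prop) x0 e b s i : Q x0 -> Q b ->
  (forall j, Q (nth (x0, x0) s j).1 /\ Q (nth (x0, x0) s j).2) -> Q (nth x0 (weave e b s) i).
Proof.
move=> Q0; elim: s e b i => [|[a b'] s IH] e b i Qb Qs /=.
  by rewrite cats0 nth_nseq; case: ifP => _.
rewrite nth_cat size_nseq nth_nseq; case: ltnP => // _.
have [Qa Qb'] := Qs 0%N; case: (i - _)%N => [|j] //=.
by apply: IH => // k; exact: (Qs k.+1).
Qed.

Section PhiUnwind.
Variables (R : realType) (n : nat) (D : fukaya_data R n).
Local Notation C := R[i].
Local Notation G := (cls D).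
Local Notation U := (set_type (chart D)).
Local Notation TU := (set_type (chart D `*` [set: 'rV[R]_n])).
Local Notation Lm := ({set 'I_n} -> nov D).
Local Notation vec := ('I_n -> C).
Local Notation LE := (@LE R n D).
Local Notation OX := (U * vec)%type.
Local Notation Lcl := (@Lclass R n D).

(** The flat section through eta: parallel transport from p multiplies T^b by exp <x - x(p), db>. *)
Definition pexp (p : U) (eta : Lcrd D -> C) : Scrd D U -> C := fun '(F, J, b, u) =>
  (F == finset.set0)%:R * ((expR (pairb (fun i => val u 0 i - val p 0 i) b))%:C * eta (J, b)).

Definition Pobj (X : OX) : twobj (Ocan D) nat := @TwObj _ _ _ (Ocan D) nat [:: 0%N] (entry00 (theta X)).

Fixpoint Pchain (X : OX) (s : seq ((Lcrd D -> C) * OX)) :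
    seq ((mcrd (Ocan D) nat -> C) * twobj (Ocan D) nat) :=
  if s is (eta, Y) :: s' then (entry00 (pexp X.1 eta), Pobj Y) :: Pchain Y s' else [::].

(** This is tau - x, with tau = - i y at z. *)
Definition mz (z : TU) : vec := fun i => - ((val z).1 0 i +i* (val z).2 0 i).
Definition xv (z : TU) : 'I_n -> R := fun i => (val z).1 0 i.
Definition nu (p : U) : 'I_n -> R := fun i => - val p 0 i.
(** This is theta - x = alpha - x(p), which no longer depends on the base variable. *)
Definition cX (X : OX) : vec := vadd X.2 (nu X.1).

Fixpoint stc (X : OX) (s : seq ((Lcrd D -> C) * OX)) : seq (Lm * vec) :=
  if s is (eta, Y) :: s' then (lgau (nu X.1) (lc eta), cX Y) :: stc Y s' else [::].

(** Row e_J, column e_J'. The exponential is the gauge factor of T^b, and (-1)^|J| is the sign in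
    [Phi_matrix] for F empty. *)
Definition Fx (X : OX) (s : seq ((Lcrd D -> C) * OX)) : mcrd (Ohol D) (Hlab n) -> C :=
  fun '((J, v), (J', v'), (F, b, z)) => [&& v == 0%N, v' == 0%N & F == finset.set0]%:R *
    ((-1) ^+ #|J| * (expR (pairb (xv z) b))%:C * M (mz z) ((LE J, cX X) :: stc X s) J' b).

Definition ux (z : TU) : U := SigSub (mem_set (set_valP z).1).

Lemma val_ux (z : TU) : val (ux z) = (val z).1.
Proof. by []. Qed.

Lemma extend_ux (f : U -> C) (z : TU) : extend f (val z).1 = f (ux z).
Proof. by rewrite -val_ux extend_val. Qed.

Definition bmf (J : {set 'I_n}) (v : nat) : Scrd D TU -> C :=
  fun '(F, K, b, z) => [&& v == 0%N, F == finset.set0, K == J & b == 0]%:R.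

Definition e00 (a : mcrd (Ocan D) nat -> C) : Scrd D U -> C := fun x => a (0%N, 0%N, x).

Definition tchain X s : seq ((Scrd D TU -> C) * (Scrd D TU -> C)) :=
  [seq (to_tens (e00 aY.1), to_tens (e00 (ttwist aY.2))) | aY <- Pchain X s].

Definition vth (Y : OX) (z : TU) : vec := fun i => ((val z).1 0 i - val Y.1 0 i)%:C + Y.2 i.

Lemma at0_theta z Y : at0 z (to_tens (e00 (entry00 (theta Y)))) = Lcl (vth Y z).
Proof.
apply/funext => -[J b]; rewrite /at0 /to_tens finset.cards0 mul0n expr0 mul1r extend_ux.
by rewrite /e00 /entry00 /theta /Lclass !eqxx /= mul1r.
Qed.

Lemma at0_pexp z p eta : at0 z (to_tens (e00 (entry00 (pexp p eta)))) =
  fun '(J, b) => (expR (pairb (fun i => (val z).1 0 i - val p 0 i) b))%:C * eta (J, b).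
Proof.
apply/funext => -[J b]; rewrite /at0 /to_tens finset.cards0 mul0n expr0 mul1r extend_ux.
by rewrite /e00 /entry00 /pexp !eqxx /= !mul1r.
Qed.

Lemma at0_tau z : at0 z (@tau R n D) = Lcl (fibre_class z).
Proof. by apply/funext => -[J b]; rewrite /at0 /tau eqxx. Qed.

Lemma on0_to_tens (a : Scrd D U -> C) F J b z : F != finset.set0 ->
  (forall F J b u, F != finset.set0 -> a (F, J, b, u) = 0) -> to_tens a (F, J, b, z) = 0.
Proof. by move=> F0 a0; rewrite /to_tens extend_ux a0 ?mulr0. Qed.

Lemma tchain_on0 X s j F J b z : F != finset.set0 ->
  (nth (0, 0) (tchain X s) j).1 (F, J, b, z) = 0 /\ (nth (0, 0) (tchain X s) j).2 (F, J, b, z) = 0.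
Proof.
move=> F0; elim: s X j => [|[eta Y] s IH] X j; first by rewrite nth_nil.
case: j => [|j]; last exact: IH.
split; apply: (on0_to_tens _ _ _ F0) => F' J1 b' u F0'.
  by rewrite /e00 /entry00 /pexp /= (negbTE F0') mul0r mulr0.
by rewrite /e00 /entry00 /theta /= (negbTE F0') /= !mulr0.
Qed.

Lemma theta_on0 (Y : OX) F J b z : F != finset.set0 ->
  to_tens (e00 (entry00 (theta Y))) (F, J, b, z) = 0.
Proof. by move=> F0; apply: (on0_to_tens _ _ _ F0) => F' J1 b' u F0'; rewrite /e00 /entry00 /theta /= (negbTE F0') /= !mulr0. Qed.

Lemma oTU : open (chart D `*` [set: 'rV[R]_n]).
Proof.
rewrite (_ : _ `*` _ = fst @^-1` chart D); last by apply/seteqP; split=> z //= [].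
by apply: open_comp (@chart_open R n D) => z _; exact: cvg_fst.
Qed.

Lemma pderiv_cst (v : 'rV[R]_n * 'rV[R]_n) (c : C) (z : TU) : pderiv v (fun=> c) z = 0.
Proof. by rewrite (pderiv_restr oTU (fun=> c)) dC_cst. Qed.

Lemma dbar_bmf J v F J' b z : dbar (fun '(F', b', z') => bmf J v (F', J', b', z')) (F, b, z) = 0.
Proof.
rewrite /dbar big1 // => i iF; rewrite /bmf !pderiv_cst mulr0 addr0 sub0r.
have [->|b0] := eqVneq b 0; first by rewrite bdry_0 mul0r oppr0 mulr0.
by rewrite !andbF mulr0 oppr0 mulr0.
Qed.

(** The additional terms of [tens_op_eps] need at most one input. The word contains the basis
    element, so only this element alone is concerned, and dbar kills it: it is constant and has
    class zero. *)
Lemma tens_op_weave e J v X s c :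
  let w := weave e (@tau R n D) ((bmf J v, to_tens (e00 (entry00 (theta X)))) :: tchain X s) in
  aop (c := tens D) w c =
  let: (F, J', b, z) := c in (F == finset.set0)%:R * Lop (map (at0 z) w) (J', b).
Proof.
case: c => -[[F J'] b] z /=; set w := nseq _ _ ++ _.
have -> : tens_op_eps (eps (@Sdeg R n D TU) w) (F, J', b, z) =
    form_op (fun d i => sumn (drop i.+1 d)) (fun d => (size d * sumn d)%N) (eps (@Sdeg R n D TU) w) (F, J', b, z).
  rewrite /tens_op_eps /w; case: (head 0%N e) => [|[|h]] /=.
  - set w' := weave _ _ _; case E : w' => [|a l] /=; last by case: l E => [|? ?] E; exact: addr0.
    by have h := dbar_bmf J v F J' b z; rewrite -[RHS]addr0 -[X in _ = _ + X]h.
  - exact: addr0.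
  - exact: addr0.
rewrite form_opE //.
- by move=> k i; rewrite drop_nseq; elim: (k - _)%N.
- by move=> k; rewrite (_ : sumn _ = 0%N) ?muln0 //; elim: k.
move=> i {}F {}J' {}b {}z F0.
apply: (@weave_ind _ (fun a => a (F, J', b, z) = 0) 0 e _
   ((bmf J v, to_tens (e00 (entry00 (theta X)))) :: tchain X s)) => //.
  by rewrite /tau (negbTE F0) /= mulr0.
move=> [|j] /=; last exact: tchain_on0.
by split; [rewrite (negbTE F0) andbF | exact: theta_on0].
Qed.

Lemma tchain_stc z X s : [seq (lc (at0 z x.1), lc (at0 z x.2)) | x <- tchain X s] =
  [seq (x.1, lv x.2) | x <- [seq (lgau (xv z) x.1, vadd x.2 (xv z)) | x <- stc X s]].
Proof.
elim: s X => [//|[eta Y] s IH] X.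
rewrite [tchain _ _](_ : _ = (to_tens (e00 (entry00 (pexp X.1 eta))),
  to_tens (e00 (entry00 (theta Y)))) :: tchain Y s) // map_cons IH /=; congr ((_, _) :: _).
  rewrite at0_pexp; apply/funext => K; apply/funext => g; rewrite /lc /lgau gau_add /gau.
  by congr ((expR _)%:C * _).
rewrite at0_theta lc_Lclass; congr lv; apply/funext => i; rewrite /vth /cX /vadd /nu /xv.
by rewrite -addrA -rmorphD addrC [- _ + _]addrC.
Qed.

Lemma size_Pchain X s : size (Pchain X s) = size s.
Proof. by elim: s X => //= -[eta Y] s IH X /=; rewrite IH. Qed.

Lemma size_stc X s : size (stc X s) = size s.
Proof. by elim: s X => //= -[eta Y] s IH X /=; rewrite IH. Qed.

(** Each of tau, theta_0, theta_1, .. is x plus one of the classes [mz], [cX], and the flat sections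
    are gauge transforms by x of constant inputs. Hence [M_shift] takes exp <x, db> out of the
    operation. *)
Lemma Phi_matrixE X s : Phi_matrix (Pobj X) (Pchain X s) = Fx X s.
Proof.
apply/funext => -[[[J v] [J' v']] [[F b] z]]; rewrite /Phi_matrix /Phi_action /tw_mu.
set W := (_ :: _); set c := (F, J', b, z).
have Wall : all (fun x => (x.1.2 == [:: 0%N]) && (x.2.2 == [:: 0%N]))
    [seq ((aY.1, tbasis aY.2), tw_item aY.2) | aY <- W].
  by rewrite /W /=; elim: s X {W} => //= -[eta Y] s IH X; exact: IH.
have Wmap : [seq (fun y => x.1.1 (0%N, 0%N, y), fun y => x.2.1 (0%N, 0%N, y)) |
    x <- [seq ((aY.1, tbasis aY.2), tw_item aY.2) | aY <- W]] =
    ((bmf J v, to_tens (e00 (entry00 (theta X)))) :: tchain X s).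
  rewrite /W /=; congr ((_, _) :: _).
    by apply/funext => -[[[F' K] b'] z']; rewrite /bmf [0%N == v]eq_sym.
  rewrite /tchain -!map_comp; apply: eq_map => -[a Y] /=.
  by congr (_, _); apply/funext => -[[[F' K] b'] z'].
have sW : size W = (size s).+1 by rewrite /W /= size_map size_Pchain.
have E e : mop ndeg (weave e (tw_item (tau_obj D))
     [seq ((aY.1, tbasis aY.2), tw_item aY.2) | aY <- W]) (0%N, v', c) =
   ((v' == 0%N) && (F == finset.set0))%:R * Lop (weave e (Lcl (fibre_class z))
      [seq (at0 z x.1, at0 z x.2) |
         x <- ((bmf J v, to_tens (e00 (entry00 (theta X)))) :: tchain X s)]) (J', b).
  rewrite mop_rank1; last first.
    elim: [seq _ | aY <- W] e Wall (tw_item _) (erefl [:: 0%N] : (tw_item (tau_obj D)).2 = [:: 0%N]) =>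
      [|[a Y] l IH] e /= h T eT; rewrite all_cat all_nseq eT eqxx orbT //=.
    by move: h => /andP[/andP[-> /eqP h2] h3]; exact: IH.
  rewrite weave_map Wmap [X in weave e X _](_ : _ = @tau R n D); last first.
    by apply/funext => -[[[F' K] b'] z']; rewrite /tau_obj /= /entry00 /= mul1r.
  rewrite tens_op_weave mulrA -natrM mulnb [0%N == v']eq_sym; congr (_ * Lop _ _).
  by rewrite -at0_tau -weave_map.
rewrite (_ : csum _ _ = ((v' == 0%N) && (F == finset.set0))%:R * csum (size W).+1 (fun e =>
   Lop (weave e (Lcl (fibre_class z))
      [seq (at0 z x.1, at0 z x.2) |
         x <- ((bmf J v, to_tens (e00 (entry00 (theta X)))) :: tchain X s)]) (J', b))); last first.
  by rewrite -csum_bool; congr (csum _ _); apply/funext => e; exact: E.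
pose sM := (lsc ((v == 0%N)%:R) (LE J), vth X z) :: [seq (lgau (xv z) x.1, vadd x.2 (xv z)) | x <- stc X s].
have -> : csum (size W).+1 (fun e => Lop (weave e (Lcl (fibre_class z))
      [seq (at0 z x.1, at0 z x.2) |
         x <- ((bmf J v, to_tens (e00 (entry00 (theta X)))) :: tchain X s)]) (J', b)) =
    M (fibre_class z) sM J' b.
  have sM_ : size sM = size W by rewrite sW /sM /= size_map; rewrite size_stc.
  rewrite /M sM_; congr (csum _ _); apply/funext => e; rewrite LopE weave_map; congr (LB _ (weave _ _ _) _ _).
  rewrite /wch /sM -map_comp /=; congr ((_, _) :: _).
  - apply/funext => K; apply/funext => g; rewrite /lc /at0 /bmf eqxx /=; case: (v == 0%N) => /=.
      by rewrite lsc1 LE_at /ebasis; case: (K == J); rewrite ?mul1r ?mul0r.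
    by rewrite /lsc mul0r nov0.
  - by rewrite at0_theta.
  - exact: tchain_stc.
rewrite /Fx /sM; have [v0|v0] := eqVneq v 0%N; last by rewrite /= (M_Z 0 _ _ [::]) /lsc mul0r nov0 !mulr0 mul0r.
rewrite /= v0 addn0 lsc1; have [F0|F0] := eqVneq F finset.set0; last by rewrite !andbF !mul0r mulr0.
rewrite F0 finset.cards0 mul1n !andbT mulrCA; congr (_ * _); rewrite -mulrA; congr (_ * _).
rewrite -[RHS]/(lgau (xv z) (M (mz z) ((LE J, cX X) :: stc X s)) J' b) -M_shift /= lgau_LE.
have e1 : vadd (mz z) (xv z) = fibre_class z.
  apply/funext => i; rewrite /vadd /mz /xv /fibre_class.
  by apply/eqP; rewrite eq_complex /= addNr addr0 !eqxx.
have e2 : vadd (cX X) (xv z) = vth X z.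
  by apply/funext => i; rewrite /vth /cX /vadd /nu /xv -addrA -rmorphD addrC [- _ + _]addrC.
by rewrite e1 e2.
Qed.

End PhiUnwind.

(** * Flat extensions and the functor P *)

Section LocallyConstant.
Variables (R : realType) (V : normedModType R) (U : set V).
Hypothesis oU : open U.
Implicit Types (g : V -> R).

Lemma deriv0_local g x : (forall y v, U y -> derivable (g : V -> R^o) y v /\ 'D_v (g : V -> R^o) y = 0) ->
  U x -> exists2 d : R, 0 < d & forall y, `|y - x| < d -> g y = g x.
Proof.
move=> dg Ux; have [d d0 hd] := open_ball oU Ux; exists d => // y yd.
have inU (s : R) : 0 <= s <= 1 -> U (x + s *: (y - x)).
  move=> /andP[s0 s1]; apply: hd; rewrite addrAC subrr add0r normrZ ger0_norm //.
  by apply: le_lt_trans yd; rewrite ler_piMl.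
have [s s01 e] := @mvt_line R V g x (y - x) 1 ltr01 (fun s s01 => (dg _ (y - x) (inU s s01)).1).
apply/eqP; rewrite -subr_eq0; apply/eqP; move: e.
by rewrite scale1r [x + _]addrC subrK (dg _ (y - x) (inU s s01)).2 mulr0.
Qed.

(** Along t |-> h (x, t) a locally constant function has derivative zero, so its values at x and at
    the end point c agree. *)
Lemma contractible_cst g : contractible_set U ->
  (forall x, U x -> exists2 d : R, 0 < d & forall y, `|y - x| < d -> g y = g x) ->
  forall x y, U x -> U y -> g x = g y.
Proof.
move=> [h [c [hc hU h0 h1]]] lg; suff key x : U x -> g x = g c by move=> x y Ux Uy; rewrite !key.
move=> Ux; pose phi (t : R) := g (h (x, t)).
have loc (t0 : R) : 0 <= t0 <= 1 -> exists2 d : R, 0 < d & forall t, 0 <= t <= 1 ->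
    `|t - t0| < d -> phi t = phi t0.
  move=> t01; have [d d0 hd] := lg _ (hU _ _ Ux t01).
  have A0 : (U `*` `[0, 1]) (x, t0) by split=> //=; rewrite in_itv.
  have /subspace_continuousP/(_ _ A0)/cvgrPdist_lt/(_ _ d0) := hc.
  rewrite /within /= => /nbhs_ballP[r r0 hr]; exists r => // t tI tr; apply: hd; rewrite distrC.
  apply: hr; last by split=> //=; rewrite in_itv.
  split=> /=; first exact: ballxx.
  by rewrite -ball_normE /= distrC.
have [||t tI e] := @MVT R phi (fun=> 0) 0 1 ltr01.
- move=> t; rewrite in_itv /= => /andP[t0 t1].
  have [d d0 hd] := loc t (ltac:(by rewrite !ltW)).
  apply: near_eq_is_derive (is_derive_cst (phi t : R^o) _ _).
  near=> s; have s0 : 0 < s by near: s; exact: lt_nbhsr.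
  have s1 : s < 1 by near: s; exact: lt_nbhsl.
  have sd : `|s - t| < d.
    near: s; apply: filterS (nbhsx_ballx t d d0) => s; by rewrite -ball_normE /= distrC.
  by rewrite hd // !ltW.
- apply/subspace_continuousP => t; rewrite /= in_itv /= => t01.
  have [d d0 hd] := loc t t01; apply/cvgrPdist_lt => e e0; rewrite /within /=.
  apply/nbhs_ballP; exists d => //= s; rewrite -ball_normE /= => sd; rewrite in_itv /= => s01.
  change (`|phi t - phi s| < e); rewrite (hd s s01) ?subrr ?normr0 //.
  by rewrite distrC.
by move: e; rewrite mul0r /phi h0 // h1 // => /eqP; rewrite subr_eq0 => /eqP.
Unshelve. all: by end_near. Qed.

End LocallyConstant.

Section FlatExtension.
Variables (R : realType) (n : nat) (D : fukaya_data R n).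
Local Notation C := R[i].
Local Notation G := (cls D).
Local Notation U := (set_type (chart D)).
Local Notation V := 'rV[R]_n.

Definition rco (i : 'I_n) (u : V) : C := (u 0 i)%:C.

Lemma rcoD i (h : R) v u : rco i (h *: v + u) = h%:C * rco i v + rco i u.
Proof. by rewrite /rco !mxE rmorphD rmorphM. Qed.

Lemma rco_le i u : nc (rco i u) <= 1 * `|u|.
Proof. by rewrite nc_real mul1r; exact: coord_le. Qed.

Definition expo (p : U) (b : G) (u : V) : R := pairb (fun i => u 0 i - val p 0 i) b.

Lemma expoE p b u : (expo p b u)%:C = \sum_i (bdry b i)%:~R * rco i u - \sum_i (bdry b i)%:~R * rco i (val p).
Proof.
rewrite /expo /pairb rmorph_sum -sumrB; apply: eq_bigr => i _.
by rewrite rmorphM rmorphB rmorph_int /rco -mulrBr mulrC.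
Qed.

Lemma smo_expo E p b : open E -> smo E (fun u => (expo p b u)%:C).
Proof.
move=> oE; apply: (smo_ext oE (f := fun u => \sum_i (bdry b i)%:~R * rco i u - \sum_i (bdry b i)%:~R * rco i (val p))).
  by move=> u _; rewrite expoE.
apply: smoB => //; last exact: smo_cst.
by apply: smo_sum => // i _; apply: smoZ => //; exact: smo_linear oE (rcoD i) (rco_le i).
Qed.

Lemma dC_expo p b v u : dC v (fun u => (expo p b u)%:C) u = \sum_i (bdry b i)%:~R * rco i v.
Proof.
have oT := @openT V; have sr i : smo setT (rco i) by exact: smo_linear oT (rcoD i) (rco_le i).
have ss : smo setT (fun u => \sum_i (bdry b i)%:~R * rco i u) by apply: smo_sum => // i _; exact: smoZ.
rewrite (dC_ext v oT (I : setT u) (fun y _ => expoE p b y)).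
rewrite (dCB _ oT ss (smo_cst _ oT) I) dC_cst subr0 (dC_sum _ _ oT) //; last by move=> i _; exact: smoZ.
apply: eq_bigr => i _; rewrite (dCZ _ _ oT (sr i) I).
by rewrite (dC_linear (rcoD i)).
Qed.

Lemma dC_expo_evec p b i u : dC (evec R i) (fun u => (expo p b u)%:C) u = (bdry b i)%:~R.
Proof.
rewrite dC_expo (bigD1 i) //= big1 ?addr0 => [|k ki]; rewrite /rco /evec mxE ?eqxx ?mulr1 //.
by rewrite (negbTE ki) andbF mulr0.
Qed.

Lemma pexpE (p : U) eta F J b : (fun u : U => pexp p eta (F, J, b, u)) =
  fun u : U => (fun x => ((F == finset.set0)%:R * eta (J, b)) * (expR (expo p b x))%:C) (val u).
Proof. by apply/funext => u; rewrite /pexp mulrAC mulrA. Qed.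

Lemma pexp_flat (p : U) (eta : Lcrd D -> C) : flat_extension p eta (pexp p eta).
Proof.
have oD := @chart_open R n D.
split; [split; last exact: novikov_true| | |].
- move=> F J b; rewrite pexpE.
  exact: (smooth_restr oD (smoZ _ oD (smo_exp oD (smo_expo p b oD)))).
- by move=> F J b u F0; rewrite /pexp (negbTE F0) mul0r.
- apply/funext => -[[[F J] b] u]; rewrite /nabla big1 ?mulr0 // => i _.
  pose H (x : V) : C := ((F :\ i == finset.set0)%:R * eta (J, b)) * (expR (expo p b x))%:C.
  have Du : chart D (val u) by exact: set_valP.
  have HE : pexp p eta (F :\ i, J, b, u) = H (val u) by rewrite /pexp /H mulrAC mulrA.
  have -> : pderiv (evec R i) (fun u' : U => pexp p eta (F :\ i, J, b, u')) u = (bdry b i)%:~R * H (val u).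
    rewrite pexpE; apply: (etrans (pderiv_restr oD H _ u)).
    apply: (etrans (dCZ _ _ oD (smo_exp oD (smo_expo p b oD)) Du)).
    rewrite (dC_exp _ (smo_expo p b oD) Du) dC_expo_evec /H; ring.
  by rewrite HE subrr mulr0.
- move=> J b; rewrite /pexp eqxx mul1r (_ : pairb _ _ = 0) ?expR0 ?mul1r //.
  by rewrite /pairb big1 // => i _; rewrite subrr mul0r.
Qed.

Lemma dC_decomp_rV E (f : V -> C) v u : open E -> smo E f -> E u ->
  dC v f u = \sum_i rco i v * dC (evec R i) f u.
Proof.
move=> oE sf Eu; have d0 : dC (0 : V) f u = 0.
  by have := dCZdir 0 0 sf Eu; rewrite scale0r mul0r.
rewrite [in LHS](row_sum_delta v); elim: (index_enum _) => [|i r IH]; first by rewrite !big_nil.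
by rewrite !big_cons (dCDdir oE _ _ sf Eu) IH (dCZdir _ _ sf Eu).
Qed.

(** Divided by the exponential of [expo], a flat section has zero derivative on the contractible
    chart, so its value at p determines it. *)
Lemma flat_ext_eq (p : U) eta a : flat_extension p eta a -> a = pexp p eta.
Proof.
move=> [[sa _] a0 na ap]; have oD := @chart_open R n D.
apply/funext => -[[[F J] b] u]; have [->|F0] := eqVneq F finset.set0; last first.
  by rewrite a0 // /pexp (negbTE F0) mul0r.
pose f : V -> C := extend (fun u : U => a (finset.set0, J, b, u)).
have sf : smo (chart D) f by apply/(smoothP oD); exact: sa.
have df i (y : U) : dC (evec R i) f (val y) = (bdry b i)%:~R * f (val y).
  have := congr1 (fun g => g ([set i]%SET, J, b, y)) na; rewrite /nabla big_set1.
  have -> : [set i]%SET :\ i = finset.set0 by apply/finset.setP => k; rewrite !finset.inE; case: eqP.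
  rewrite -[0 _]/(0 : C) => /eqP; rewrite !mulf_eq0 !signr_eq0 /= subr_eq0 => /eqP.
  by rewrite /f extend_val.
have oN : open (chart D) := oD.
pose g x : C := (expR (- expo p b x))%:C * f x.
have sN : smo (chart D) (fun x => (- expo p b x)%:C).
  apply: (smo_ext oD (f := fun x => (-1) * (expo p b x)%:C)); last by apply: smoZ => //; exact: smo_expo.
  by move=> x _; rewrite mulN1r rmorphN.
have sE := smo_exp oD sN.
have sg : smo (chart D) g by exact: smoM.
have dNi i x : chart D x -> dC (evec R i) (fun x => (- expo p b x)%:C) x = - (bdry b i)%:~R.
  move=> Dx; rewrite -(dC_expo_evec p b i x) -mulN1r -(dCZ _ _ oD (smo_expo p b oD) Dx).
  by apply: (dC_ext _ oD Dx) => y _; rewrite mulN1r rmorphN.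
have dg v x : chart D x -> dC v g x = 0.
  move=> Dx; rewrite (dC_decomp_rV _ oD sg Dx) big1 // => i _.
  rewrite /g (dCM _ sE sf Dx) (dC_exp _ sN Dx) dNi //.
  have := df i (SigSub (mem_set Dx)); rewrite /= => ->; ring.
have cg : forall x, chart D x -> g x = g (val p).
  move=> x Dx; have Dp : chart D (val p) by exact: set_valP.
  have loc (P : C -> R) : (forall y v, chart D y -> derivable ((fun w => P (g w)) : V -> R^o) y v /\
      'D_v ((fun w => P (g w)) : V -> R^o) y = 0) -> P (g x) = P (g (val p)).
    move=> h; apply: (@contractible_cst R V (chart D) (fun w => P (g w)) (chart_contractible D) _ x (val p) Dx Dp).
    by move=> y Dy; exact: deriv0_local oD _ _ h Dy.
  apply/eqP; rewrite eq_complex; apply/andP; split; apply/eqP; apply: loc => y v Dy;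
    have [[_ d1] [_ d2]] := smo_c1 sg Dy; have := dg v y Dy; rewrite /dC => -[e1 e2].
    by split; [exact: d1|exact: e1].
  by split; [exact: d2|exact: e2].
have := cg (val u) (set_valP u).
rewrite /g {2}/f extend_val ap (_ : expo p b (val p) = 0); last first.
  by rewrite /expo /pairb big1 // => i _; rewrite subrr mul0r.
rewrite oppr0 expR0 mul1r /f extend_val /pexp eqxx mul1r => <-.
by rewrite mulrA -rmorphM expRN mulfV ?mul1r // gt_eqF // expR_gt0.
Qed.

Lemma xget_flat (p : U) (eta : Lcrd D -> C) : xget 0 (flat_extension p eta) = pexp p eta.
Proof. by apply: flat_ext_eq; exact: (xgetI _ (pexp_flat p eta)). Qed.

End FlatExtension.

(** * Components of the composite functor *)

Section BlockSums.
Variables (T : Type) (V : nmodType).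
Implicit Types (s : seq T) (p : seq (seq T)) (f : seq (seq T) -> V).

Lemma big_blocks_cons f x s : \sum_(p <- blocks (x :: s)) f p =
  \sum_(p <- blocks s) f ([:: x] :: p) +
  \sum_(p <- blocks s) (if p is b :: p' then f ((x :: b) :: p') else 0).
Proof.
rewrite /= big_flatten big_map -big_split; apply: eq_bigr => -[|b p] _ /=.
  by rewrite big_seq1 addr0.
by rewrite big_cons big_seq1.
Qed.

Lemma blocks_nonempty s : all (all (fun b : seq T => (0 < size b)%N)) (blocks s).
Proof.
elim: s => //= x s; elim: (blocks s) => //= p r IH; case: p => [|b p] /=; first exact: IH.
by move=> /andP[/andP[b0 bp] /IH ->]; rewrite ?b0 ?bp.
Qed.

Lemma big_all (P : pred (seq (seq T))) (r : seq (seq (seq T))) f : all P r ->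
  \sum_(p <- r) f p = \sum_(p <- r | P p) f p.
Proof. by elim: r => [|p r IH] /=; rewrite ?big_nil // !big_cons => /andP[-> /IH->]. Qed.

(** Used for the strict functor P, where a partition with a block of length at least two contributes
    zero. *)
Lemma blocks_sum1 f s : (forall p, ~~ all (fun b : seq T => size b == 1%N) p -> f p = 0) ->
  \sum_(p <- blocks s) f p = f [seq [:: x] | x <- s].
Proof.
elim: s f => [|x s IH] f f0; first by rewrite big_seq1.
rewrite big_blocks_cons (IH (fun p => f ([:: x] :: p))) => [|p np]; last by rewrite f0.
rewrite (big_all _ (blocks_nonempty s)) big1 ?addr0 // => -[|[|y b] p] //= _.
by rewrite f0.
Qed.

(** Used for the differential graded target, which has no operations with more than two inputs. *)
Lemma blocks_sum2 f s : (0 < size s)%N -> (forall p, (2 < size p)%N -> f p = 0) ->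
  \sum_(p <- blocks s) f p = f [:: s] + \sum_(i < (size s).-1) f [:: take i.+1 s; drop i.+1 s].
Proof.
elim: s f => // x [|y s] IH f _ f0; first by rewrite /= !big_cons big_nil big_ord0.
rewrite big_blocks_cons (IH (fun p => f ([:: x] :: p))) // => [|p p2]; last by rewrite f0 // ltnW.
rewrite (IH (fun p => if p is b :: p' then f ((x :: b) :: p') else 0)) // => [|[|b p] //]; last first.
  by move=> p2; rewrite f0.
rewrite [X in _ + X + _]big1 ?addr0 => [|i _]; last by rewrite f0.
by rewrite /= big_ord_recl /= ?take0 ?drop0 [LHS]addrCA.
Qed.

End BlockSums.

Section Composite.
Variables (R : realType) (n : nat) (D : fukaya_data R n).
Local Notation C := R[i].
Local Notation U := (set_type (chart D)).
Local Notation Lm := ({set 'I_n} -> nov D).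
Local Notation vec := ('I_n -> C).
Local Notation OX := (U * vec)%type.
Implicit Types (X : OX) (s : seq ((Lcrd D -> C) * OX)).

(** A strict functor sends a block of length other than one to zero; the block is replaced by the
    zero morphism. *)
Fixpoint collapse X (p : seq (seq ((Lcrd D -> C) * OX))) : seq ((Lcrd D -> C) * OX) :=
  if p is b :: p' then
    ((if b is [:: (eta, _)] then eta else 0), last X (unzip2 b)) :: collapse (last X (unzip2 b)) p'
  else [::].

Lemma map_blocks_collapse X p : map_blocks (P_functor D) X p = Pchain X (collapse X p).
Proof.
elim: p X => //= b p IH X; rewrite IH; congr ((_, _) :: _); rewrite /last_obj.
case: b => [|[eta Y] [|? ?]]; rewrite ?xget_flat //;
  apply/funext => -[[l l'] [[[F J] b] u]]; rewrite /entry00 /pexp; by rewrite !mulr0.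
Qed.

Lemma M_zero (v0 : vec) (s1 : seq (Lm * vec)) (v : vec) (s2 : seq (Lm * vec)) :
  M v0 (s1 ++ (0 : Lm, v) :: s2) = 0.
Proof.
have := M_Z (0 : nov D) (0 : Lm) v0 s1 v s2.
have -> : lsc 0 0 = 0 :> Lm by apply/funext => J; rewrite /lsc mul0r.
by move=> ->; apply/funext => J; rewrite /lsc mul0r.
Qed.

Lemma lgau0 u : lgau u (0 : Lm) = 0.
Proof. by apply/funext => J; exact: gau0. Qed.

Lemma stc_cat X s1 s2 : stc X (s1 ++ s2) = stc X s1 ++ stc (last X (unzip2 s1)) s2.
Proof. by elim: s1 X => //= -[eta Y] s1 IH X; rewrite IH. Qed.

Lemma stc_zero X s1 Y s2 : exists (t1 : seq (Lm * vec)) (c : vec) t2,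
  stc X (s1 ++ (0, Y) :: s2) = t1 ++ (0 : Lm, c) :: t2.
Proof.
rewrite stc_cat /= (_ : lc 0 = 0 :> Lm) // lgau0.
by exists (stc X s1), (cX Y), (stc Y s2).
Qed.

Lemma Fx_zero X s1 Y s2 : Fx X (s1 ++ (0, Y) :: s2) = 0.
Proof.
apply/funext => -[[[J v] [J' v']] [[F b] z]]; rewrite /Fx.
have [t1 [c [t2 ->]]] := stc_zero X s1 Y s2.
by rewrite -cat_cons M_zero mulr0 mulr0.
Qed.

(** By multilinearity a zero input makes [Fx] vanish, so only the partition into single morphisms
    survives. *)
Lemma comp_fmor X s : fmor (ainf_comp (P_functor D) (Phi_functor D)) X s = Fx X s.
Proof.
rewrite /= (eq_bigr (fun p => Fx X (collapse X p))) => [|p _]; last first.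
  by rewrite map_blocks_collapse; exact: Phi_matrixE.
rewrite blocks_sum1; first by congr Fx; elim: s X => //= -[eta Y] s IH X; rewrite IH.
move=> p; suff h Y t : ~~ all (fun b => size b == 1%N) p -> Fx Y (t ++ collapse (last Y (unzip2 t)) p) = 0.
  exact: (h X [::]).
elim: p t => //= b p IH t; rewrite negb_and => /orP[b1|/IH h].
  by case: b b1 => [|[eta Z] [|y l]] //= _; exact: Fx_zero.
set Z := last (last _ _) _; set e := (match b with [::] => _ | _ => _ end).
have hl : last Y (unzip2 (rcons t (e, Z))) = Z by rewrite /unzip2 map_rcons last_rcons.
by have := h (rcons t (e, Z)); rewrite hl cat_rcons.
Qed.

Lemma comp_fobj X : fobj (ainf_comp (P_functor D) (Phi_functor D)) X =
  @TwObj _ _ _ (Ohol D) _ [seq (J, v) | J <- enum {set 'I_n}, v <- [:: 0%N]] (Fx X [::]).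
Proof. by rewrite /= -[Phi_matrix _ [::]]/(Phi_matrix (Pobj X) (Pchain X [::])) Phi_matrixE. Qed.

End Composite.

(** * Twisted complexes over the holomorphic algebra *)

Section FiniteSums.
Variable R : realType.

Lemma csum_fin k (F : seq nat -> R[i]) d0 :
  (forall e, size e = k -> (d0 < sumn e)%N -> F e = 0) ->
  csum_to k F (\sum_(d < d0.+1) \sum_(e <- degs k d) F e).
Proof.
move=> F0; apply: (@cto_near R (fun=> \sum_(d < d0.+1) \sum_(e <- degs k d) F e) _ _ d0.+1); last exact: cto_cst.
move=> N dN; rewrite (sum_simplex k F dN) /cpart (sum_cubes k N xpredT F).
rewrite [RHS](bigID (fun e => (sumn e < d0.+1)%N)) /= [X in _ + X]big1_seq ?addr0 // => e.
by rewrite -leqNgt mem_cubes => /andP[h /andP[/eqP sz _]]; exact: F0.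
Qed.

Lemma size_weave (T : Type) e (b : T) s : size e = (size s).+1 ->
  size (weave e b s) = (sumn e + size s)%N.
Proof.
elim: s e b => [|[a b'] s IH] [|i e] b //= [] he; rewrite size_cat size_nseq /=.
  by case: e he => // _; rewrite !addn0.
by rewrite IH //; lia.
Qed.

Lemma sum_delta_seq (T : eqType) (B : seq T) (l : T) (f : T -> R[i]) : uniq B ->
  \sum_(k <- B) (k == l)%:R * f k = (l \in B)%:R * f l.
Proof.
move=> uB; have [lB|lB] := boolP (l \in B).
  rewrite (bigD1_seq l) //= eqxx big1 ?addr0 // => k /negbTE ->; by rewrite mul0r.
rewrite mul0r big1_seq // => k /andP[_ kB]; have [e|_] := eqVneq k l; last by rewrite mul0r.
by rewrite e (negbTE lB) in kB.
Qed.

Lemma sgn_dbl (a m : nat) : (-1) ^+ ((a + a) * m) = 1 :> R[i].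
Proof. by rewrite addnn -mul2n -mulnA exprM sqrrN expr1n expr1n. Qed.

End FiniteSums.

Section OholTwisted.
Variables (R : realType) (n : nat) (D : fukaya_data R n).
Local Notation C := R[i].
Local Notation O := (Ohol D).
Local Notation lab := (Hlab n).
Local Notation deg := (@Hlabdeg n).
Local Notation item := ((mcrd O lab -> C) * seq lab)%type.
Local Notation mopO := (mop (A := O) deg).
Implicit Types (X Y Z : twobj O lab) (a : mcrd O lab -> C).

Lemma mop_big (s : seq item) c : (2 < size s)%N -> mopO s c = 0.
Proof.
case: c => -[l l'] x; suff h l0 l1 acc : (2 < size acc + size s)%N ->
    mop_rec (A := O) deg l0 l1 l' acc s x = 0 by move=> /(h l l [::]).
elim: s l1 acc => [|[a B] s IH] l1 acc /=.
  rewrite addn0 -size_rev -(size_eps (@Hdeg R n D)) => h.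
  by case: (eps _ _) h => [|b [|b' [|b'' t]]] // _; rewrite mulr0.
by move=> h; rewrite big1 // => k _; apply: IH; rewrite /= addSnnS.
Qed.

Lemma mop0 l l' F b z : mopO [::] (l, l', (F, b, z)) = (l == l')%:R * ((F == finset.set0)%:R * W b z).
Proof. by []. Qed.

Lemma mop1 a B l l' x : uniq B ->
  mopO [:: (a, B)] (l, l', x) = (l' \in B)%:R * dbar (fun y => a (l, l', y)) x.
Proof.
move=> uB; rewrite -(sum_delta_seq l' (fun k => dbar (fun y => a (l, k, y)) x) uB) /=.
apply: eq_bigr => k _; congr (_ * dbar _ x); apply/funext => y.
by rewrite iter_ksgn sgn_dbl mul1r.
Qed.

Lemma mop2 a B a' B' l l' x : uniq B' ->
  mopO [:: (a, B); (a', B')] (l, l', x) = (l' \in B')%:R * \sum_(k <- B)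
    hprod (gsgn (@Hdeg R n D) (fun y => a (l, k, y)))
          (iter (deg l + deg k) (ksgn (@Hdeg R n D)) (fun y => a' (k, l', y))) x.
Proof.
move=> uB; have e k : iter (deg l + deg l) (ksgn (@Hdeg R n D)) (fun y => a (l, k, y)) = fun y => a (l, k, y).
  by apply/funext => y; rewrite iter_ksgn sgn_dbl mul1r.
rewrite mulr_sumr; apply: eq_bigr => k _; rewrite e.
by rewrite -(sum_delta_seq l' (fun k' => hprod (gsgn (@Hdeg R n D) (fun y => a (l, k, y)))
          (iter (deg l + deg k) (ksgn (@Hdeg R n D)) (fun y => a' (k, k', y))) x) uB).
Qed.

(** Words of more than two letters give zero over a differential graded algebra, so at most two
    twists can be inserted and the limits are finite sums. *)
Lemma tw_fin X s c : csum_to (size s).+1 (fun e =>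
    mopO (weave e (tw_item X) [seq ((aY.1, tbasis aY.2), tw_item aY.2) | aY <- s]) c)
  (\sum_(d < 3) \sum_(w <- words (d + size s) (tw_item X)
       [seq ((aY.1, tbasis aY.2), tw_item aY.2) | aY <- s]) mopO w c).
Proof.
set s' := map _ s; have ss : size s' = size s by rewrite size_map.
rewrite (eq_bigr (fun d : 'I_3 => \sum_(e <- degs (size s).+1 d) mopO (weave e (tw_item X) s') c)).
  apply: csum_fin => e se h; apply: mop_big; rewrite size_weave ss //; lia.
by move=> d _; rewrite -ss (sum_degs_weave (tw_item X) s' d (fun w => mopO w c)).
Qed.

Lemma words_big L b (s : seq (item * item)) c : (2 < L)%N -> \sum_(w <- words L b s) mopO w c = 0.
Proof.
by move=> L2; rewrite (@eq_words _ _ _ (fun=> 0)) ?big1 // => w sw; apply: mop_big; rewrite sw.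
Qed.

Lemma tw_mu1 X Y a c : tw_mu deg X [:: (a, Y)] c = mopO [:: (a, tbasis Y)] c +
  (mopO [:: tw_item X; (a, tbasis Y)] c + mopO [:: (a, tbasis Y); tw_item Y] c).
Proof.
rewrite /tw_mu (csumE (tw_fin _ _ _)) !big_ord_recl big_ord0 addr0 /=.
rewrite [X in _ + (_ + X)]words_big // addr0 /fintype.bump /= ?add0n ?addn1.
by rewrite !sum_wordsS !sum_words0 /= ?add0r ?addr0.
Qed.

Lemma tw_mu2 X Y Z a a' c : tw_mu deg X [:: (a, Y); (a', Z)] c = mopO [:: (a, tbasis Y); (a', tbasis Z)] c.
Proof.
rewrite /tw_mu (csumE (tw_fin _ _ _)) big_ord_recl /= [X in _ + X]big1 ?addr0.
  by rewrite add0n !sum_wordsS !sum_words0 /= ?add0r ?addr0.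
by move=> d _; apply: words_big; rewrite /fintype.bump /=; lia.
Qed.

Lemma tw_mu3 X s : (2 < size s)%N -> tw_mu deg X s = 0.
Proof.
move=> s2; apply/funext => c; rewrite /tw_mu (csumE (tw_fin _ _ _)) big1 // => d _.
by apply: words_big; exact: leq_trans s2 (leq_addl _ _).
Qed.

Lemma tw_curv X c : csum_to 1 (fun e => mopO (nseq (head 0%N e) (tw_item X)) c)
  (mopO [::] c + mopO [:: tw_item X] c + mopO [:: tw_item X; tw_item X] c).
Proof.
have := tw_fin X [::] c; rewrite /= !big_ord_recl big_ord0 addr0 /= !big_seq1 addrA.
by congr (csum_to 1 _ _); apply/funext => e; rewrite cats0.
Qed.

End OholTwisted.

(** * The gauge and the differential of the Hom complexes *)

Lemma par_comb (C : comPzRingType) (a b x : C) : a * a = 1 -> -1 * a * x = b * x -> a * b * x = - x.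
Proof. by move=> ha e; rewrite -mulrA -e mulrA mulrCA ha mulr1 mulN1r. Qed.

Section Gauge.
Variables (R : realType) (n : nat) (D : fukaya_data R n).
Local Notation C := R[i].
Local Notation G := (cls D).
Local Notation U := (set_type (chart D)).
Local Notation TU := (set_type (chart D `*` [set: 'rV[R]_n])).
Local Notation V2 := ('rV[R]_n * 'rV[R]_n)%type.
Local Notation Lm := ({set 'I_n} -> nov D).
Local Notation vec := ('I_n -> C).
Local Notation LE := (@LE R n D).
Local Notation OX := (U * vec)%type.
Local Notation E := (chart D `*` [set: 'rV[R]_n]).
Local Notation O := (Ohol D).
Local Notation lab := (Hlab n).
Local Notation deg := (@Hlabdeg n).
Local Notation arr := ({set 'I_n} -> {set 'I_n} -> {set 'I_n} -> G -> V2 -> C).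
Local Notation sg := (sg R).
Implicit Types (X Y : OX) (w : arr) (z : V2) (F J K : {set 'I_n}) (g : G).

Definition mv z : vec := fun i => - (z.1 0 i +i* z.2 0 i).
Definition xw z : 'I_n -> R := fun i => z.1 0 i.
Definition eg z g : C := (expR (pairb (xw z) g))%:C.

Definition Bas : seq lab := [seq (J, v) | J <- enum {set 'I_n}, v <- [:: 0%N]].
Definition FO X : twobj O lab := @TwObj _ _ _ O lab Bas (Fx X [::]).

Lemma BasE : Bas = [seq (J, 0%N) | J <- enum {set 'I_n}].
Proof. by rewrite /Bas; elim: (enum _) => //= J s ->. Qed.

Lemma mem_Bas J v : ((J, v) \in Bas) = (v == 0%N).
Proof.
rewrite BasE; apply/mapP/eqP => [[J' _ [_ ->]] //|->].
by exists J; rewrite ?mem_enum.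
Qed.

Lemma uniq_Bas : uniq Bas.
Proof. by rewrite BasE map_inj_uniq ?enum_uniq // => J J' []. Qed.

Lemma sum_Bas (f : lab -> C) : \sum_(k <- Bas) f k = \sum_J f (J, 0%N).
Proof. by rewrite BasE big_map big_enum. Qed.

(* The gauge transformation T^b |-> exp <x, d b> T^b turns the derivatives of
   the twisted complexes into ordinary derivatives. *)
Definition ug w : mcrd O lab -> C := fun '((J, v), (K, v'), (F, g, z)) =>
  ((v == 0%N) && (v' == 0%N))%:R * (eg (val z) g * w J K F g (val z)).

Definition nv w J F z : Lm := fun K g => w J K F g z.

(* the differential of the Hom complexes in the gauge *)
Definition Dg X Y w : arr := fun J K F g z =>
  \sum_(i in F) sg i (F :\ i)%SET * dcs 'i i (w J K (F :\ i)%SET g) z +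
  (-1) ^+ (#|F| + #|J|) * (M (mv z) [:: (nv w J F z, cX Y)] K g -
    (\sum_(J1 : {set 'I_n}) M (mv z) [:: (LE J, cX X)] J1 * nv w J1 F z K) g).

(* the components of the functor in the gauge *)
Definition cst (s : seq (Lm * vec)) X : arr := fun J K F g z =>
  (F == finset.set0)%:R * ((-1) ^+ #|J| * M (mv z) ((LE J, cX X) :: s) K g).

Lemma Fx_ug X s : Fx X s = ug (cst (stc X s) X).
Proof.
apply/funext => -[[[J v] [K v']] [[F g] z]]; rewrite /Fx /ug /cst.
case: (v == 0%N) => /=; last by rewrite !mul0r.
case: (v' == 0%N) => /=; last by rewrite !mul0r.
have -> : mz z = mv (val z) by [].
have -> : expR (pairb (xv z) g) = expR (pairb (xw (val z)) g) by [].
by rewrite /eg mul1r; case: (F == finset.set0); rewrite ?mul0r ?mulr0 // !mul1r mulrCA mulrA.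
Qed.

Lemma FO_item X : tw_item (FO X) = (ug (cst [::] X), Bas).
Proof. by rewrite /tw_item -(Fx_ug X [::]). Qed.

Lemma egE z g : (pairb (xw z) g)%:C = \sum_i (bdry g i)%:~R * xco i z.
Proof.
rewrite /pairb rmorph_sum; apply: eq_bigr => i _.
by rewrite rmorphM rmorph_int mulrC.
Qed.

Lemma smo_pair S g : open S -> smo S (fun z => (pairb (xw z) g)%:C).
Proof.
move=> oS; apply: (smo_ext oS (f := fun z => \sum_i (bdry g i)%:~R * xco i z)).
  by move=> z _; rewrite egE.
by apply: smo_sum => // i _; apply: smoZ => //; exact: smo_xco.
Qed.

Lemma smo_eg S g : open S -> smo S (eg^~ g).
Proof. by move=> oS; exact: (@smo_exp _ _ _ oS (fun z => pairb (xw z) g) (smo_pair g oS)). Qed.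

Lemma dcs_eg i g z : dcs 'i i (eg^~ g) z = (bdry g i)%:~R * eg z g.
Proof.
have oT := @openT V2.
have h v : dC v (eg^~ g) z = eg z g * \sum_k (bdry g k)%:~R * xco k v.
  rewrite (dC_exp _ (smo_pair g oT) I); congr (_ * _).
  rewrite (dC_ext v oT (I : setT z) (fun y _ => egE y g)) (dC_sum _ _ oT) //; last first.
    by move=> k _; apply: smoZ => //; exact: smo_xco.
  apply: eq_bigr => k _; rewrite (dCZ _ _ oT (smo_xco k oT) I).
  by rewrite dC_xco.
rewrite /dcs !h (bigD1 i) //= big1 => [|k ki]; last first.
  by rewrite /xco /ex /evec /= mxE (negbTE ki) andbF mulr0.
rewrite big1 => [|k _]; last by rewrite /xco /ey /= mxE mulr0.
by rewrite /xco /ex /evec /= mxE !eqxx addr0 !mulr0 addr0 mulr1 mulrC.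
Qed.

(** The derivative of exp <x, dg> cancels the term - <dg, e_i> of [dbar] and leaves the plain
    Dolbeault operator. *)
Lemma dbar_ug (w : {set 'I_n} -> G -> V2 -> C) (b : bool) F g (z : TU) :
  (forall F g, smo E (w F g)) ->
  dbar (fun '(F', g', z') => b%:R * (eg (val z') g' * w F' g' (val z'))) (F, g, z) =
  b%:R * (eg (val z) g * \sum_(i in F) sg i (F :\ i)%SET * dcs 'i i (w (F :\ i)%SET g) (val z)).
Proof.
move=> sw; have oE := oTU (D := D); have Ez : E (val z) by exact: set_valP.
rewrite /dbar !mulr_sumr; apply: eq_bigr => i iF.
pose H y : C := b%:R * (eg y g * w (F :\ i)%SET g y).
have P v : pderiv v (fun z' : TU => b%:R * (eg (val z') g * w (F :\ i)%SET g (val z'))) z = dC v H (val z).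
  exact: (pderiv_restr oE H).
rewrite !P.
have sH : smo E (fun y => eg y g * w (F :\ i)%SET g y) by apply: smoM => //; exact: smo_eg.
have e : dcs 'i i H (val z) = b%:R * ((bdry g i)%:~R * eg (val z) g * w (F :\ i)%SET g (val z) +
    eg (val z) g * dcs 'i i (w (F :\ i)%SET g) (val z)).
  by rewrite (dcsZ _ _ _ oE sH Ez) (dcsM _ _ (smo_eg g oE) (sw _ _) Ez) dcs_eg.
have e' : dC (evec R i, 0) H (val z) + 'i * dC (0, evec R i) H (val z) = dcs 'i i H (val z) by [].
rewrite [X in _ * X](_ : _ = (dC (evec R i, 0) H (val z) + 'i * dC (0, evec R i) H (val z))
   - (bdry g i)%:~R * H (val z)); last by rewrite addrAC.
rewrite e' e /H /sg.
set s := (-1) ^+ _; set d := dcs _ _ _ _; set a := (bdry g i)%:~R; set x := w _ _ _.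
by ring.
Qed.

Lemma hprodl (f f' : Hcrd D -> C) F g (z : TU) : (forall F b (z : TU), F != finset.set0 -> f (F, b, z) = 0) ->
  hprod (D := D) f f' (F, g, z) = \sum_(bb <- dec g) f (finset.set0, bb.1, z) * f' (F, bb.2, z).
Proof.
move=> f0; rewrite /hprod fsbig_dec; apply: eq_bigr => bb _.
rewrite -(wedge1l (fun K => f' (K, bb.2, z)) F) /wedge mulr_sumr; apply: eq_bigr => I _.
rewrite [ebasis _ _ I](_ : _ = (I == finset.set0)%:R) //.
have [->|I0] := eqVneq I finset.set0; last by rewrite (f0 I) // !(mulr0, mul0r).
by rewrite mulr1 mulrA [_ * f _]mulrC.
Qed.

Lemma hprodr (f f' : Hcrd D -> C) F g (z : TU) : (forall F b (z : TU), F != finset.set0 -> f' (F, b, z) = 0) ->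
  hprod (D := D) f f' (F, g, z) = \sum_(bb <- dec g) f (F, bb.1, z) * f' (finset.set0, bb.2, z).
Proof.
move=> f0; rewrite /hprod fsbig_dec; apply: eq_bigr => bb _.
rewrite -(wedge1r (fun K => f (K, bb.1, z)) F) /wedge mulr_suml; apply: eq_bigr => I _.
rewrite [ebasis _ _ (F :\: I)%SET](_ : _ = (F :\: I == finset.set0)%SET%:R) //.
have [->|I0] := eqVneq (F :\: I)%SET finset.set0; last by rewrite (f0 (F :\: I)%SET) // !(mulr0, mul0r).
by rewrite mulr1.
Qed.

Lemma eg_dec z g (bb : G * G) : bb \in dec g -> eg z bb.1 * eg z bb.2 = eg z g.
Proof. by rewrite mem_dec => /eqP <-; rewrite /eg pairbD expRD rmorphM. Qed.

(** By [M_lks] the entry vanishes unless |J| + |K| is odd. *)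
Lemma M_par v0 J c K g m : (-1) ^+ ((#|J| + #|K|) * m) * M v0 [:: (LE J, c)] K g =
  (-1) ^+ m * M v0 [:: (LE J, c)] K g.
Proof.
have := congr1 (fun f : Lm => f K g) (M_lks v0 [:: (LE J, c)]).
rewrite /= (_ : lks _ = lsc ((-1) ^+ #|J|.+1) (LE J)); last first.
  apply/funext => I; rewrite /lks /lsc /LE; have [->|_] := eqVneq I J; first reflexivity.
  rewrite !mulr0; reflexivity.
rewrite (M_Z _ _ _ [::]) /lsc !nov_sgnM; set x := M _ _ K g => e.
have {}e : (-1) ^+ #|J|.+1 * x = (-1) ^+ #|K| * x := e.
have {}e : (-1) ^+ (#|J| + #|K|) * x = - x.
  move: e; rewrite exprS exprD; have := sqrr_sign C #|J|; rewrite !expr2.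
  exact: par_comb.
elim: m => [|m IH]; first by rewrite muln0.
by rewrite mulnS exprD -mulrA IH mulrCA e mulrN exprS mulN1r mulNr.
Qed.

Lemma mop_left X s w J K F g (z : TU) :
  mop (A := O) deg [:: (ug (cst s X), Bas); (ug w, Bas)] ((J, 0%N), (K, 0%N), (F, g, z)) =
  eg (val z) g * (-1) ^+ #|J| * (\sum_(J1 : {set 'I_n})
    \sum_(bb <- dec g) (-1) ^+ ((#|J| + #|J1|) * #|F|.+1) *
      (M (mv (val z)) ((LE J, cX X) :: s) J1 bb.1 * w J1 K F bb.2 (val z))).
Proof.
rewrite (mop2 _ _ _ _ _ _ uniq_Bas) mem_Bas eqxx mul1r sum_Bas mulr_sumr; apply: eq_bigr => J1 _.
rewrite hprodl => [|F' b z' F0]; last by rewrite /gsgn /ug /cst (negbTE F0) !(mul0r, mulr0).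
rewrite mulr_sumr big_seq [RHS]big_seq; apply: eq_bigr => bb hbb.
rewrite iter_ksgn /gsgn /Hdeg /= finset.cards0 expr0 !mul1r /ug /cst /= !eqxx /= !mul1r -(eg_dec _ hbb).
rewrite /Hlabdeg /= !addn0.
move: ((-1) ^+ #|J|) ((-1) ^+ (_ * _)) (M _ _ _ _) (w _ _ _ _ _) (eg _ bb.1) (eg _ bb.2) => a b c d e f.
by ring.
Qed.

Lemma mop_right Y s w J K F g (z : TU) :
  mop (A := O) deg [:: (ug w, Bas); (ug (cst s Y), Bas)] ((J, 0%N), (K, 0%N), (F, g, z)) =
  eg (val z) g * (-1) ^+ (#|F| + #|J|) * (\sum_(J1 : {set 'I_n})
    \sum_(bb <- dec g) w J J1 F bb.1 (val z) * M (mv (val z)) ((LE J1, cX Y) :: s) K bb.2).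
Proof.
rewrite (mop2 _ _ _ _ _ _ uniq_Bas) mem_Bas eqxx mul1r sum_Bas mulr_sumr; apply: eq_bigr => J1 _.
rewrite hprodr => [|F' b z' F0]; last by rewrite iter_ksgn /ug /cst (negbTE F0) !(mul0r, mulr0).
rewrite mulr_sumr big_seq [RHS]big_seq; apply: eq_bigr => bb hbb.
rewrite iter_ksgn /gsgn /Hdeg /= finset.cards0 /ug /cst /= !eqxx /= !mul1r -(eg_dec _ hbb).
rewrite /Hlabdeg /= !addn0 muln1 !exprD; have := sqrr_sign C #|J1|; rewrite expr2.
move: ((-1) ^+ #|J|) ((-1) ^+ #|J1|) ((-1) ^+ #|F|) (M _ _ _ _) (w _ _ _ _ _) (eg _ bb.1) (eg _ bb.2) => a b c d e f h bb1.
rewrite [LHS](_ : _ = (b * b) * (f * h * (c * a) * (e * d))); last by ring.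
by rewrite bb1 mul1r.
Qed.

Definition smoA w := forall J K F g, smo E (w J K F g).

Lemma ug_off w l l' x : ~~ ((l.2 == 0%N) && (l'.2 == 0%N)) -> ug w (l, l', x) = 0.
Proof. by case: l l' x => [J v] [K v'] [[F g] z] /= /negbTE; rewrite /ug => ->; rewrite mul0r. Qed.

Lemma dbar0 x : dbar (D := D) (fun=> 0) x = 0.
Proof.
case: x => -[F g] z; rewrite /dbar big1 // => i _.
by rewrite !pderiv_cst !mulr0 subr0 addr0 mulr0.
Qed.

Lemma hprod0l f x : hprod (D := D) (fun=> 0) f x = 0.
Proof.
case: x => -[F g] z; rewrite hprodl // big1 // => bb _; by rewrite mul0r.
Qed.

Lemma mop_off w w' l l' x : ~~ ((l.2 == 0%N) && (l'.2 == 0%N)) ->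
  mop (A := O) deg [:: (ug w, Bas); (ug w', Bas)] (l, l', x) = 0.
Proof.
move=> h; rewrite (mop2 _ _ _ _ _ _ uniq_Bas); case: l' h => K v'; rewrite mem_Bas /=.
case v'0 : (v' == 0%N); last by rewrite mul0r.
rewrite andbT => l0; rewrite big1 ?mulr0 // => k _.
rewrite [gsgn _ _](_ : _ = fun=> 0) ?hprod0l //; apply/funext => y.
have e : ug w (l, k, y) = 0 by apply: ug_off; rewrite negb_and l0.
by change ((-1) ^+ Hdeg y * ug w (l, k, y) = 0); rewrite e mulr0.
Qed.

(** The twist of Y acts by m_1 on a row and the twist of X by composition in front; [M_par] brings
    the label signs to the common sign of [Dg]. *)
Lemma mu_ug X Y w : smoA w -> tw_mu deg (FO X) [:: (ug w, FO Y)] = ug (Dg X Y w).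
Proof.
move=> sw; apply/funext => -[[l l'] x]; rewrite tw_mu1 !FO_item; change (tbasis (FO Y)) with Bas.
have [h|h] := boolP ((l.2 == 0%N) && (l'.2 == 0%N)); last first.
  rewrite ug_off // !mop_off // !addr0 (mop1 _ _ _ _ uniq_Bas).
  rewrite [X in dbar X](_ : _ = fun=> 0) ?dbar0 ?mulr0 //; apply/funext => y; exact: ug_off.
case: l l' x h => [J v] [K v'] [[F g] z] h.
have [e1 e2] : v = 0%N /\ v' = 0%N by case/andP: h => /eqP ? /eqP ?.
rewrite {h}e1 {}e2.
rewrite (mop1 _ _ _ _ uniq_Bas) mem_Bas eqxx mul1r mop_left mop_right.
rewrite [dbar _ _](_ : _ = eg (val z) g *
   \sum_(i in F) sg i (F :\ i)%SET * dcs 'i i (w J K (F :\ i)%SET g) (val z)); last first.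
  have := @dbar_ug (w J K) true F g z (sw J K); rewrite mul1r => <-.
  by congr (dbar _ _); apply/funext => -[[F' g'] z'].
rewrite /ug /= mul1r /Dg mulrDr; congr (_ + _).
rewrite (lin_expand (nv w J F (val z)) K (M_lin (mv (val z)) [::] (cX Y) [::])) !nov_sum.
rewrite [\sum_J1 \sum_(bb <- _) w _ _ _ _ _ * _](_ : _ =
  \sum_J1 (nv w J F (val z) J1 * M (mv (val z)) [:: (LE J1, cX Y)] K) g); last first.
  by apply: eq_bigr => J1 _; rewrite novM.
rewrite [X in eg _ _ * _ * X + _](_ : _ = (-1) ^+ #|F|.+1 *
    \sum_J1 (M (mv (val z)) [:: (LE J, cX X)] J1 * nv w J1 F (val z) K) g).
  rewrite exprS exprD; move: (\sum_J1 _) (\sum_J1 _) ((-1) ^+ #|J|) ((-1) ^+ #|F|) (eg _ _) => p q a b e.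
  by ring.
rewrite mulr_sumr; apply: eq_bigr => J1 _; rewrite novM mulr_sumr; apply: eq_bigr => bb _.
by rewrite mulrA M_par -mulrA.
Qed.

End Gauge.

(** * Holomorphy of the components *)

Section Holomorphic.
Variables (R : realType) (n : nat) (D : fukaya_data R n).
Local Notation C := R[i].
Local Notation G := (cls D).
Local Notation V2 := ('rV[R]_n * 'rV[R]_n)%type.
Local Notation Lm := ({set 'I_n} -> nov D).
Local Notation vec := ('I_n -> C).
Local Notation E := (chart D `*` [set: 'rV[R]_n]).
Local Notation path := ((V2 -> vec) * (V2 -> vec))%type.
Implicit Types (s : seq (Lm * vec)) (z : V2).

Definition mvp : path := (@mv R n, @mv R n).
Definition cstp (c : vec) : path := (fun=> c, fun _ _ => 0).

Lemma mvE z i : mv z i = - (xco i z + 'i * yco i z).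
Proof. by rewrite /mv /xco /yco; congr (- _); rewrite mulrC [LHS]complexE mulrC. Qed.

Lemma affm_mv : affm mvp.
Proof.
split=> [x h t i|]; first by rewrite /= !mvE xcoD ycoD; ring.
exists 2 => // x y i; rewrite /= !mvE.
have -> : - (xco i y + 'i * yco i y) - - (xco i x + 'i * yco i x) = - (xco i (y - x) + 'i * yco i (y - x)).
  have -> : xco i (y - x) = xco i y - xco i x.
    by rewrite /xco [(y - x).1](_ : _ = y.1 - x.1) // !mxE rmorphB.
  have -> : yco i (y - x) = yco i y - yco i x.
    by rewrite /yco [(y - x).2](_ : _ = y.2 - x.2) // !mxE rmorphB.
  by ring.
rewrite ncN; apply: le_trans (ncD _ _) _; rewrite ncM nci mul1r mulr_natl mulr2n.
by apply: lerD; [have := xco_le i (y - x)|have := yco_le i (y - x)]; rewrite mul1r.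
Qed.

Lemma affm_cst c : affm (cstp c).
Proof.
split=> [*|]; first by rewrite /= mulr0 addr0.
by exists 0 => // *; rewrite /= subrr nc0 mul0r.
Qed.

Lemma affm_csts s : List.Forall (@affm R n _) (unzip2 [seq (a.1, cstp a.2) | a <- s]).
Proof. by elim: s => [|a s IH]; constructor; [exact: affm_cst|exact: IH]. Qed.

Lemma ev_csts s z : ev z [seq (a.1, cstp a.2) | a <- s] = s.
Proof. by rewrite /ev -map_comp; elim: s => //= -[a c] s ->. Qed.

Lemma smo_Mmv S s K g : open S -> smo S (fun z => M (mv z) s K g).
Proof.
move=> oS; apply: (smo_ext oS (f := fun z => M (mvp.1 z) (ev z [seq (a.1, cstp a.2) | a <- s]) K g)).
  by move=> z _; rewrite ev_csts.
by apply: smo_M => //; [exact: affm_mv|exact: affm_csts].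
Qed.

(** The deforming class depends on x + i y complex linearly, so each derivative along y_i is i times
    the one along x_i, and 1 + i^2 = 0. *)
Lemma dcs_M i s K g z : dcs 'i i (fun z => M (mv z) s K g) z = 0.
Proof.
set t := [seq (a.1, cstp a.2) | a <- s].
have h v : dC v (fun z => M (mv z) s K g) z =
   \sum_(j < (size t).+1) M (mvp.1 z) (ev z (dslot mvp t v j)) K g.
  have -> : (fun z => M (mv z) s K g) = fun z => M (mvp.1 z) (ev z t) K g.
    by apply/funext => y; rewrite ev_csts.
  by apply: isd_dC; apply: isd_M; [exact: affm_mv|exact: affm_csts].
rewrite /dcs !h mulr_sumr -big_split big1 //= => j _.
rewrite /dslot /ev !map_cat /=; set c := last _ _.
have -> : c.2 (ey R i) = (fun k => 'i * c.2 (ex R i) k).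
  pose Q (p : path) := p.2 (ey R i) = (fun k => 'i * p.2 (ex R i) k).
  have Q0 : Q mvp.
    by apply/funext => k; rewrite /= !mvE /xco /yco /ex /ey /= !mxE; ring.
  apply: (@Forall_last _ Q) => //; rewrite /unzip2 map_take; apply: Forall_take.
  rewrite /t -map_comp; elim: {t h j c} s => //= a s IH; constructor=> //.
  by apply/funext => k /=; rewrite mulr0.
rewrite lvZ M_Z /lsc ncstM mulrA -expr2 sqr_i mulN1r.
by rewrite subrr.
Qed.

End Holomorphic.

(** * Internal curvature of the images *)

Lemma mop_comb (C : comPzRingType) (a b c d e : C) : b * b = 1 -> a * a = 1 ->
  e * a * (a * b * (c * (b * d))) = e * (c * d).
Proof.
move=> hb ha; transitivity (e * (c * d) * ((a * a) * (b * b))); first by ring.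
by rewrite ha hb !mulr1.
Qed.

Lemma curv_comb (C : comPzRingType) (a b c d e : C) :
  a * (b * (c * d)) + c * b * ((e - d) * a) = a * (b * (c * e)).
Proof. by ring. Qed.

Section FunctorPart.
Variables (R : realType) (n : nat) (D : fukaya_data R n).
Hypothesis hW : weakly_unobstructed D.
Local Notation C := R[i].
Local Notation G := (cls D).
Local Notation U := (set_type (chart D)).
Local Notation TU := (set_type (chart D `*` [set: 'rV[R]_n])).
Local Notation V2 := ('rV[R]_n * 'rV[R]_n)%type.
Local Notation Lm := ({set 'I_n} -> nov D).
Local Notation vec := ('I_n -> C).
Local Notation LE := (@LE R n D).
Local Notation OX := (U * vec)%type.
Local Notation E := (chart D `*` [set: 'rV[R]_n]).
Local Notation O := (Ohol D).
Local Notation lab := (Hlab n).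
Local Notation deg := (@Hlabdeg n).
Local Notation FO := (@FO R n D).
Local Notation ug := (@ug R n D).
Local Notation item := ((Lcrd D -> C) * OX)%type.
Implicit Types (X Y : OX) (s : seq item).

Lemma Fuk_M X s : lc (Fuk_mu X s) = M X.2 [seq (lc a.1, a.2.2) | a <- s].
Proof.
apply/funext => K; apply/funext => g; rewrite /M /lc /Fuk_mu size_map.
congr (csum _ _); apply/funext => e; rewrite LopE weave_map lc_Lclass /wch -!map_comp.
by congr (LB _ (weave _ _ _) _ _); apply: eq_map => a /=; rewrite lc_Lclass.
Qed.

(** Morphism spaces of the Fukaya category vanish unless both the point and the potential agree. *)
Lemma chain_cases X s : is_chain (A := Fuk D) X s ->
  (exists s1 Y s2, s = s1 ++ (0, Y) :: s2) \/
  List.Forall (fun a : item => a.2.1 = X.1 /\ potential a.2.2 = potential (D := D) X.2) s.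
Proof.
elim: s X => [|[a Y] s IH] X /=; first by right.
move=> [_ [_ [[XY pXY]|->]] /IH [[s1 [Z [s2 ->]]]|h]].
- by left; exists ((a, Y) :: s1), Z, s2.
- right; constructor=> //; apply: List.Forall_impl h => b [-> ->]; by rewrite XY pXY.
- by left; exists ((0, Y) :: s1), Z, s2.
- by left; exists [::], Y, s.
Qed.

Lemma stc_same X s : List.Forall (fun a : item => a.2.1 = X.1) s ->
  stc X s = [seq (lgau (nu X.1) a.1, vadd a.2 (nu X.1)) | a <- [seq (lc a.1, a.2.2) | a <- s]].
Proof.
suff h p : p = X.1 -> List.Forall (fun a : item => a.2.1 = X.1) s -> stc X s =
   [seq (lgau (nu p) a.1, vadd a.2 (nu p)) | a <- [seq (lc a.1, a.2.2) | a <- s]] by exact: h.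
elim: s X => [|[a Y] s IH] X pX h //=; inversion h; subst.
rewrite (IH Y) //=; first by rewrite /cX H1.
  by apply: List.Forall_impl H2 => b ->; rewrite H1.
Qed.

(** Unless some input is zero, all objects lie over one point, so one gauge transformation serves
    the whole string. *)
Lemma mu_st X s : is_chain (A := Fuk D) X s ->
  lgau (nu X.1) (lc (Fuk_mu X s)) = M (cX X) (stc X s).
Proof.
move=> /chain_cases [[s1 [Y [s2 ->]]]|h]; rewrite Fuk_M.
  have [t1 [c [t2 ->]]] := stc_zero X s1 Y s2.
  by rewrite map_cat /= (_ : lc 0 = 0 :> Lm) // !M_zero lgau0.
rewrite -M_shift stc_same //; apply: List.Forall_impl h => a [-> _] //.
Qed.

Lemma potential_Wv v : potential (D := D) v = Wv v.
Proof.
apply/funext => g; rewrite /potential /Wv /M; congr (csum _ _); apply/funext => e.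
by rewrite LopE map_nseq lc_Lclass /= cats0.
Qed.

Lemma Wv_shift (v : vec) u : Wv (vadd v u) = gau u (Wv v) :> nov D.
Proof. exact: (congr1 (fun f : Lm => f finset.set0) (M_shift u v [::])). Qed.

Lemma gau_inj u : injective (gau (D := D) u).
Proof.
move=> x y /(congr1 (gau (fun i => - u i))); rewrite !gau_add !gau_id // => i; exact: addNr.
Qed.

Lemma W_eg g (z : TU) : W g z = eg (val z) g * Wv (mv (val z)) g.
Proof.
rewrite /W potential_Wv -[RHS]/(gau (xw (val z)) (Wv (mv (val z)) : nov D) g) -Wv_shift.
congr (Wv _ g); apply/funext => i.
by rewrite /vadd /mv /xw /fibre_class; apply/eqP; rewrite eq_complex /= addNr addr0 !eqxx.
Qed.

Lemma smo_cstA (s : seq (Lm * vec)) X : smoA (D := D) (cst s X).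
Proof.
move=> J K F g; have oE := oTU (D := D).
by apply: smoZ => //; apply: smoZ => //; exact: smo_Mmv.
Qed.

Lemma ug_mem w X Y : smoA (D := D) w -> tw_mem (FO X) (FO Y) (ug w).
Proof.
move=> sw; split.
  move=> [J v] [K v']; split; last exact: novikov_true.
  move=> F b; have oE := oTU (D := D).
  apply: (smooth_restr oE (F := fun z => ((v == 0%N) && (v' == 0%N))%:R * (eg z b * w J K F b z))).
  by apply: smoZ => //; apply: smoM => //; exact: smo_eg.
move=> [J v] [K v'] [[F g] z]; rewrite /FO /= !mem_Bas.
by case: ((v == 0%N) && (v' == 0%N)) => //; rewrite mul0r.
Qed.

(** By [Wv_shift] this is the potential at the class theta of X, as a function on the base. *)
Definition lamX X : Rcrd D -> C := fun '(F, g, u) => (F == finset.set0)%:R *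
  ((expR (pairb (fun i => val u 0 i) g))%:C * Wv (cX X) g).

Lemma lamX_even X : Reven (lamX X).
Proof.
have oD := @chart_open R n D.
split; [|exact: novikov_true|]; last first.
  move=> F b u; rewrite /lamX; have [->|] := eqVneq F finset.set0; last by rewrite mul0r.
  by rewrite finset.cards0.
move=> F b; pose q (x : 'rV[R]_n) : R := pairb (fun i => x 0 i) b.
have sq : smo (chart D) (fun x => (q x)%:C).
  apply: (smo_ext oD (f := fun u => \sum_i (bdry b i)%:~R * rco i u)).
    by move=> u _; rewrite /q /pairb rmorph_sum; apply: eq_bigr => i _; rewrite rmorphM rmorph_int mulrC.
  by apply: smo_sum => // i _; apply: smoZ => //; exact: smo_linear oD (rcoD i) (rco_le i).
apply: (smooth_restr oD (F := fun x => (F == finset.set0)%:R * ((expR (q x))%:C * Wv (cX X) b))).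
apply: smoZ => //; apply: smoM => //; first exact: smo_exp.
exact: smo_cst.
Qed.

Lemma dbar_cst (s : seq (Lm * vec)) X J K x : dbar (D := D) (fun y => ug (cst s X) ((J, 0%N), (K, 0%N), y)) x = 0.
Proof.
case: x => -[F g] z; have := @dbar_ug R n D (cst s X J K) true F g z (smo_cstA s X J K).
rewrite [X in dbar X _](_ : _ = fun y => ug (cst s X) ((J, 0%N), (K, 0%N), y)); last first.
  by apply/funext => -[[F' g'] z'].
move=> ->; rewrite big1 ?mulr0 // => i _; have oE := oTU (D := D); have Ez : E (val z) by exact: set_valP.
rewrite /cst (dcsZ _ _ _ oE _ Ez); last by apply: smoZ => //; exact: smo_Mmv.
rewrite (dcsZ _ _ _ oE _ Ez); last exact: smo_Mmv.
by rewrite dcs_M !mulr0.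
Qed.

Lemma mop_cst X (s : seq (Lm * vec)) Y (t : seq (Lm * vec)) J K F g (z : TU) :
  mop (A := O) deg [:: (ug (cst s X), Bas n); (ug (cst t Y), Bas n)] ((J, 0%N), (K, 0%N), (F, g, z)) =
  eg (val z) g * (F == finset.set0)%:R *
    M (mv (val z)) ((M (mv (val z)) ((LE J, cX X) :: s), cX Y) :: t) K g.
Proof.
rewrite mop_left /cst.
rewrite (lin_expand (M (mv (val z)) ((LE J, cX X) :: s)) K (M_lin (mv (val z)) [::] (cX Y) t)) nov_sum.
have [->|F0] := eqVneq F finset.set0; last first.
  rewrite !mulr0 mul0r big1 ?mulr0 ?mul0r // => J1 _; rewrite big1 // => bb _; by rewrite mul0r !mulr0.
rewrite mulr1 !mulr_sumr; apply: eq_bigr => J1 _; rewrite novM !mulr_sumr.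
apply: eq_bigr => bb _; rewrite finset.cards0 muln1 !exprD mul1r /=.
have := sqrr_sign C #|J1|; have := sqrr_sign C #|J|; rewrite !expr2 => ha hb.
exact: mop_comb hb ha.
Qed.

(** In m_1 m_1 = (W(c_X) - W(- x - i y)) id the second term is cancelled by the curvature of the
    holomorphic algebra; the gauge factor turns the first into [lamX X]. *)
Lemma FO_curvature X : has_curvature deg (FO X) (lamX X).
Proof.
move=> [J v] [K v'] [[F g] z]; change (tbasis (FO X)) with (Bas n).
rewrite !mem_Bas => /eqP -> /eqP ->.
have := tw_curv (FO X) ((J, 0%N), (K, 0%N), (F, g, z)); rewrite FO_item.
rewrite [ascal _ _](_ : _ = lamX X (F, g, ux z)); last exact: extend_ux.
congr (csum_to 1 _ _); rewrite mop0 (mop1 _ _ _ _ (uniq_Bas n)) dbar_cst mulr0 addr0.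
rewrite mop_cst (M_ainf1 hW) W_eg /lsc /lamX.
rewrite [X in _ + _ * X](_ : _ = (Wv (cX X) g - Wv (mv (val z)) g) * (K == J)%:R); last first.
  rewrite /LE; case: (K == J); last by rewrite mulr0 mulr0.
  by rewrite !mulr1.
have -> : ((J, 0%N) == (K, 0%N)) = (K == J) by rewrite eq_sym xpair_eqE eqxx andbT.
have -> : expR (pairb (fun i => val (ux z) 0 i) g) = expR (pairb (xw (val z)) g) by [].
rewrite -[(expR _)%:C]/(eg (val z) g).
exact: curv_comb.
Qed.

(** The diagonal entry of the label of the unit, over the points (u, 0), determines the internal
    curvature. *)
Lemma curvature_lamX X lam : has_curvature deg (FO X) lam -> lam = lamX X.
Proof.
move=> h; apply/funext => -[[F g] u].
have Eu : E (val u, 0) by split=> //; exact: set_valP.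
pose z : TU := SigSub (mem_set Eu).
have m0 : (finset.set0, 0%N) \in tbasis (FO X) by rewrite mem_Bas.
have h1 := h _ _ (F, g, z) m0 m0; have h2 := FO_curvature (F, g, z) m0 m0.
have := cto_unique h1 h2; rewrite eqxx !mul1r => e.
have := etrans (etrans (esym (extend_ux (fun u => lam (F, g, u)) z)) e) (extend_ux (fun u => lamX X (F, g, u)) z).
by rewrite (_ : ux z = u) //; apply: val_inj.
Qed.

Lemma lamX_inj X Y : lamX X = lamX Y -> Wv (cX X) = Wv (cX Y) :> nov D.
Proof.
move=> h; apply/funext => g; have := congr1 (fun f => f (finset.set0, g, X.1)) h.
rewrite /lamX eqxx !mul1r; apply: mulfI.
by rewrite eq_complex /= gt_eqF ?expR_gt0.
Qed.

(** Over one point both sides are shifted by the same class, and gauge transformations are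
    injective. *)
Lemma potential_cX X Y : X.1 = Y.1 ->
  potential (D := D) X.2 = potential (D := D) Y.2 <-> Wv (cX X) = Wv (cX Y) :> nov D.
Proof.
move=> XY; rewrite !potential_Wv /cX XY !Wv_shift; split=> [->//|]; exact: gau_inj.
Qed.

Lemma FO_mor X Y : Wv (cX X) = Wv (cX Y) :> nov D ->
  exists lam, [/\ Reven lam, has_curvature deg (FO X) lam & has_curvature deg (FO Y) lam].
Proof.
move=> h; exists (lamX X); split; [exact: lamX_even|exact: FO_curvature|].
rewrite (_ : lamX X = lamX Y); first exact: FO_curvature.
by apply/funext => -[[F g] u]; rewrite /lamX h.
Qed.

End FunctorPart.

(** * The A-infinity functor equations *)

Lemma degree_comb (C : comPzRingType) (a b c x y : C) : a * a = 1 ->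
  -1 * a * x = b * y -> a * c * x = -1 * (a * b) * (a * c * y).
Proof.
move=> ha e; transitivity (- c * (-1 * a * x)); first by ring.
rewrite e; transitivity (-1 * (a * a) * (b * c * y)); last by ring.
by rewrite ha; ring.
Qed.

Lemma sum_ends (C : comPzRingType) (a b : C) (f : nat -> C) N : (0 < N)%N ->
  a * (b * (f N + f 0%N)) + \sum_(i < N.-1) a * b * f i.+1 = a * (b * \sum_(i < N.+1) f i).
Proof.
case: N => // m _; rewrite big_ord_recl big_ord_recr -mulr_sumr /= /fintype.bump /= add1n.
rewrite [\sum_(i < m) f (1 + i)%N](eq_bigr (fun i : 'I_m => f i.+1)) => [|i _]; last by rewrite add1n.
by ring.
Qed.

Lemma neg_comb (C : comPzRingType) (a b x y : C) : a * b * x = -1 * x -> - (a * (x * (b * y))) = x * y.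
Proof. by move=> e; transitivity (- (a * b * x * y)); [ring | rewrite e; ring]. Qed.

Section FunctorAxioms.
Variables (R : realType) (n : nat) (D : fukaya_data R n).
Hypothesis hW : weakly_unobstructed D.
Local Notation C := R[i].
Local Notation G := (cls D).
Local Notation U := (set_type (chart D)).
Local Notation TU := (set_type (chart D `*` [set: 'rV[R]_n])).
Local Notation V2 := ('rV[R]_n * 'rV[R]_n)%type.
Local Notation Lm := ({set 'I_n} -> nov D).
Local Notation vec := ('I_n -> C).
Local Notation LE := (@LE R n D).
Local Notation OX := (U * vec)%type.
Local Notation E := (chart D `*` [set: 'rV[R]_n]).
Local Notation O := (Ohol D).
Local Notation lab := (Hlab n).
Local Notation deg := (@Hlabdeg n).
Local Notation FO := (@FO R n D).
Local Notation ug := (@ug R n D).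
Local Notation item := ((Lcrd D -> C) * OX)%type.
Local Notation FF := (ainf_comp (P_functor D) (Phi_functor D)).
Implicit Types (X Y : OX) (s : seq item).

Lemma last_cX X s : vstate (cX X) (stc X s) = cX (last X (unzip2 s)).
Proof. by rewrite /vstate; elim: s X => //= -[a Y] s IH X; exact: IH. Qed.

Lemma take_stc i X s : take i (stc X s) = stc X (take i s).
Proof. by elim: s i X => [|[a Y] s IH] [|i] X //=; rewrite IH. Qed.

Lemma drop_stc i X s : drop i (stc X s) = stc (last X (unzip2 (take i s))) (drop i s).
Proof. by elim: s i X => [|[a Y] s IH] [|i] X //=; rewrite IH. Qed.

Lemma is_chain_cat X s1 s2 : is_chain (A := Fuk D) X (s1 ++ s2) <->
  is_chain (A := Fuk D) X s1 /\ is_chain (A := Fuk D) (last X (unzip2 s1)) s2.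
Proof.
elim: s1 X => [|[a Y] s1 IH] X /=; first by tauto.
split=> [[h1 h2 /IH[h3 h4]]|[[h1 h2 h3] h4]]; first by split.
by split=> //; apply/IH.
Qed.

Lemma lks_lgau u (a : Lm) : lks (lgau u a) = lgau u (lks a).
Proof.
apply/funext => K; apply/funext => g; rewrite /lks /lgau /gau !nov_sgnM.
by rewrite mulrCA.
Qed.

Lemma stc_ksgn X s : stc X (ksgn_chain (A := Fuk D) s) = ksc (stc X s).
Proof.
elim: s X => [//|[a Y] s IH] X.
rewrite [ksgn_chain _](_ : _ = (ksgn (@Ldeg R n D) a, Y) :: ksgn_chain (A := Fuk D) s) //=.
rewrite IH lks_lgau; congr ((lgau _ _, _) :: _); apply/funext => K; apply/funext => g.
by rewrite /lks nov_sgnM.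
Qed.

Lemma last_ksgn X s : last X (unzip2 (ksgn_chain (A := Fuk D) s)) = last X (unzip2 s).
Proof. by rewrite /unzip2 /ksgn_chain -map_comp. Qed.

Lemma M_ksLE v0 J c (s : seq (Lm * vec)) :
  M v0 ((lks (LE J), c) :: s) = fun K => (-1) ^+ #|J|.+1 * M v0 ((LE J, c) :: s) K.
Proof.
rewrite (_ : lks _ = lsc ((-1) ^+ #|J|.+1) (LE J)); last first.
  apply/funext => I; rewrite /lks /lsc /LE; have [->|_] := eqVneq I J; first reflexivity.
  rewrite !mulr0; reflexivity.
exact: (M_Z _ _ _ [::]).
Qed.

Definition isX X := forall i, complex.Re (X.2 i) = 0.

Lemma FF_obj X : isX X -> @isobj R (tw O deg) (FO X).
Proof.
move=> _; split; first exact: uniq_Bas.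
- change (ttwist (FO X)) with (Fx X [::]); rewrite Fx_ug; exact: ug_mem (smo_cstA _ _).
- move=> [[[J v] [K v']] [[F g] z]]; change (ttwist (FO X)) with (Fx X [::]).
  rewrite /Fx; have [->|] := eqVneq v 0%N; last by rewrite mul0r.
  have [->|] := eqVneq v' 0%N; last by rewrite mul0r.
  have [->|] := eqVneq F finset.set0; last by rewrite mul0r.
  rewrite /mdeg /Hlabdeg /= /Hdeg /= finset.cards0 !addn0 mul1r => nz; apply: contrapT => /negP ev.
  apply: nz; have := M_par (mz z) J (cX X) K g 1; rewrite muln1 expr1 -signr_odd (negbTE ev) expr0 mul1r mulN1r.
  set x := M _ _ _ _ => e; rewrite (_ : x = 0) ?mulr0 //.
  by move/eqP: e; rewrite -subr_eq0 opprK -mulr2n mulrn_eq0 /= => /eqP.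
- by exists (lamX X); [exact: lamX_even|exact: FO_curvature].
Qed.

Lemma FF_mor X s : is_chain (A := Fuk D) X s ->
  @mor R (tw O deg) (FO X) (FO (last X (unzip2 s))) (Fx X s).
Proof.
move=> h; split; first by rewrite Fx_ug; exact: ug_mem (smo_cstA _ _).
case: (chain_cases h) => [[s1 [Y [s2 ->]]]|{h}hs]; first by right; exact: Fx_zero.
left; apply: (FO_mor hW); suff [XY pXY] : X.1 = (last X (unzip2 s)).1 /\
    potential (D := D) X.2 = potential (D := D) (last X (unzip2 s)).2 by apply/potential_cX.
suff h Z : X.1 = Z.1 -> potential (D := D) X.2 = potential (D := D) Z.2 -> X.1 = (last Z (unzip2 s)).1 /\
    potential (D := D) X.2 = potential (D := D) (last Z (unzip2 s)).2 by exact: h.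
elim: hs Z => [|[a Y] t [e1 e2] _ IH] Z h1 h2; first by split.
exact: (IH Y (esym e1) (esym e2)).
Qed.

Lemma FF_degree X s : Fx X (ksgn_chain (A := Fuk D) s) = ksgn (@mdeg R n D O lab deg) (Fx X s).
Proof.
apply/funext => -[[[J v] [K v']] [[F g] z]]; rewrite /ksgn /Fx.
have [->|_] := eqVneq v 0%N; last by rewrite mul0r mul0r mulr0.
have [->|_] := eqVneq v' 0%N; last by rewrite mul0r mul0r mulr0.
have [->|_] := eqVneq F finset.set0; last by rewrite mul0r mul0r mulr0.
rewrite stc_ksgn /mdeg /Hlabdeg /= /Hdeg /= finset.cards0 !addn0 !mul1r.
have := congr1 (fun f : Lm => f K g) (M_lks (mz z) ((LE J, cX X) :: stc X s)).
rewrite {1}/ksc map_cons [X in M _ (X :: _)](_ : _ = (lks (LE J), cX X)) // M_ksLE !nov_sgnM.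
rewrite -/(ksc (stc X s)); set x := M _ _ _ _; set y := M _ _ _ _ => e.
rewrite exprS exprD; have := sqrr_sign C #|J|; rewrite expr2 => ha; move: e; rewrite exprS.
move: ((-1) ^+ #|J|) ha ((-1) ^+ #|K|) (expR _)%:C x y => a ha b c x y e.
exact: degree_comb.
Qed.

Lemma FF_linear X s1 s2 (c : C) (a a' : Lcrd D -> C) Y :
  Fx X (s1 ++ (zscale c a + a', Y) :: s2) =
  zscale c (Fx X (s1 ++ (a, Y) :: s2)) + Fx X (s1 ++ (a', Y) :: s2).
Proof.
apply/funext => -[[[J v] [K v']] [[F g] z]].
change (Fx X (s1 ++ (zscale c a + a', Y) :: s2) ((J, v), (K, v'), (F, g, z)) =
  c * Fx X (s1 ++ (a, Y) :: s2) ((J, v), (K, v'), (F, g, z)) + Fx X (s1 ++ (a', Y) :: s2) ((J, v), (K, v'), (F, g, z))).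
rewrite /Fx !stc_cat /=.
have -> : lgau (nu (last X (unzip2 s1)).1) (lc (zscale c a + a')) =
   lsc (ncst c : nov D) (lgau (nu (last X (unzip2 s1)).1) (lc a)) + lgau (nu (last X (unzip2 s1)).1) (lc a').
  apply/funext => I; apply/funext => h; rewrite lmE novD /lsc ncstM /lgau /gau /lc.
  by rewrite -[(zscale c a + a') (I, h)]/(c * a (I, h) + a' (I, h)); ring.
have := M_lin (mz z) ((LE J, cX X) :: stc X s1) (cX Y) (stc Y s2) (ncst c : nov D).
move=> /(_ (lgau (nu (last X (unzip2 s1)).1) (lc a)) (lgau (nu (last X (unzip2 s1)).1) (lc a'))).
move=> /(congr1 (fun f : Lm => f K g)); rewrite /= => ->.
rewrite lmE novD /lsc ncstM.
move: (M _ _ _ _) (M _ _ _ _) => x y; ring.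
Qed.

Lemma size_map_blocks X p : size (map_blocks FF X p) = size p.
Proof. by elim: p X => //= b p IH X; rewrite IH. Qed.

(** The dbar part vanishes by holomorphy; what is left is m_1 applied after the component and m_1
    applied to e_J before it. *)
Lemma Dg_cst X s J K F g z : E z ->
  Dg X (last X (unzip2 s)) (cst (stc X s) X) J K F g z = (F == finset.set0)%:R *
   (M (mv z) [:: (M (mv z) ((LE J, cX X) :: stc X s), cX (last X (unzip2 s)))] K g +
    M (mv z) ((M (mv z) [:: (LE J, cX X)], cX X) :: stc X s) K g).
Proof.
move=> Ez; have oE := oTU (D := D); rewrite /Dg big1 ?add0r => [|i _]; last first.
  rewrite /cst (dcsZ _ _ _ oE _ Ez); last by apply: smoZ => //; exact: smo_Mmv.
  rewrite (dcsZ _ _ _ oE _ Ez); last exact: smo_Mmv.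
  by rewrite dcs_M !mulr0.
have e1 J1 : nv (cst (stc X s) X) J1 F z =
   lsc (ncst ((F == finset.set0)%:R * (-1) ^+ #|J1|) : nov D) (M (mv z) ((LE J1, cX X) :: stc X s)).
  by apply/funext => I; apply/funext => h; rewrite /nv /cst /lsc ncstM mulrA.
rewrite e1 (M_Z _ _ _ [::]) {1}/lsc ncstM.
case: (eqVneq F finset.set0) e1 => [->|F0] e1; last first.
  rewrite !mul0r nov_sum big1 ?subrr ?mulr0 // => J1 _.
  rewrite e1 mul0r /lsc (_ : ncst 0 = 0 :> nov D) ?mul0r ?mulr0 //.
  by apply/funext => h; rewrite /ncst mul0r.
rewrite finset.cards0 add0n !mul1r mulrBr mulrA -expr2 sqrr_sign mul1r; congr (_ + _).
rewrite (lin_expand (M (mv z) [:: (LE J, cX X)]) K (M_lin (mv z) [::] (cX X) (stc X s))) !nov_sum.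
rewrite mulr_sumr -sumrN; apply: eq_bigr => J1 _; rewrite e1 mul1r /lsc.
rewrite !novM mulr_sumr -sumrN; apply: eq_bigr => bb _; rewrite ncstM.
have := M_par (mv z) J (cX X) J1 bb.1 1; rewrite muln1 expr1 exprD /=.
exact: neg_comb.
Qed.

Lemma fun_sum (T : Type) I (r : seq I) (P : pred I) (f : I -> T -> C) x :
  (\sum_(i <- r | P i) f i) x = \sum_(i <- r | P i) f i x.
Proof. by apply: (big_morph (fun h : T -> C => h x)). Qed.

(** This is [M_ainf2] for the inputs e_J, a_1, .., a_k: the inner operations containing e_J are on
    the left, the others, which pass e_J with the sign (-1)^(|J|+1), have changed sides. *)
Lemma ainf_id X s J z (st := stc X s) : (0 < size s)%N ->
  \sum_(i < (size s).+1) M (mv z) ((M (mv z) ((LE J, cX X) :: take i st), vstate (cX X) (take i st)) :: drop i st) =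
  \sum_(r < (size s).+1) \sum_(q < (size s).+1 | (0 < q)%N && (r + q <= size s)%N)
    (fun K => (-1) ^+ #|J| * M (mv z) ((LE J, cX X) :: ksc (take r st) ++
      (M (vstate (cX X) (take r st)) (take q (drop r st)), vstate (cX X) (take (r + q) st)) :: drop (r + q) st) K) :> Lm.
Proof.
move=> s0; have := M_ainf2 hW (mv z) (s := (LE J, cX X) :: st).
rewrite /= size_stc ltnS => /(_ s0); rewrite big_ord_recl /=.
rewrite big_mkcond big_ord_recl /= add0r => /eqP; rewrite addr_eq0 => /eqP e.
transitivity (\sum_(j < (size s).+1) ainf_summand (mv z) ((LE J, cX X) :: st) 0 j.+1).
  by apply: eq_bigr => j _.
transitivity (\sum_(i < (size s).+1) (if (0 + fintype.bump 0 i <= (size s).+1)%N then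
   ainf_summand (mv z) ((LE J, cX X) :: st) 0 (fintype.bump 0 i) else 0)).
  by apply: eq_bigr => j _; have jl := ltn_ord j; rewrite /fintype.bump /= add1n add0n jl.
rewrite e -sumrN; apply: eq_bigr => r _; rewrite big_mkcond big_ord_recr /=.
have -> : (fintype.bump 0 r + (size s).+1 <= (size s).+1)%N = false.
  by rewrite /fintype.bump /=; lia.
rewrite addr0 [RHS]big_mkcond -sumrN; apply: eq_bigr => q _.
have -> : (fintype.bump 0 r + q <= (size s).+1)%N = (r + q <= size s)%N.
  by rewrite /fintype.bump /=; lia.
case: ifP => _; last by rewrite oppr0.
rewrite (_ : fintype.bump 0 r = r.+1) //.
transitivity (- M (mv z) ((lks (LE J), cX X) :: ksc (take r st) ++
  (M (vstate (cX X) (take r st)) (take q (drop r st)), vstate (cX X) (take (r + q) st)) :: drop (r + q) st)); first by [].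
rewrite M_ksLE; apply/funext => K.
by rewrite -[LHS]/(- ((-1) ^+ #|J|.+1 * _)) exprS mulN1r mulNr opprK.
Qed.

Lemma stc_ainf X s r q : is_chain (A := Fuk D) X s ->
  stc X (ksgn_chain (A := Fuk D) (take r s) ++
    (Fuk_mu (last X (unzip2 (take r s))) (take q (drop r s)), last X (unzip2 (take (r + q) s))) :: drop (r + q) s) =
  ksc (take r (stc X s)) ++ (M (vstate (cX X) (take r (stc X s))) (take q (drop r (stc X s))),
    vstate (cX X) (take (r + q) (stc X s))) :: drop (r + q) (stc X s).
Proof.
move=> ch; rewrite stc_cat stc_ksgn last_ksgn /= !take_stc !drop_stc take_stc !last_cX.
rewrite mu_st //; move: ch; rewrite -{1}(cat_take_drop r s) => /is_chain_cat[_].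
by rewrite -{1}(cat_take_drop q (drop r s)) => /is_chain_cat[].
Qed.

(** With a differential graded target only partitions into one or two blocks count. In [ainf_id] the
    terms with 0 < i < k are the products of two components, and the ends i = 0 and i = k form the
    differential of the component. *)
Lemma FF_ainf X s : is_chain (A := Fuk D) X s -> (0 < size s)%N ->
  \sum_(p <- blocks s) @mu R (tw O deg) (fobj FF X) (map_blocks FF X p) =
  \sum_(r < (size s).+1) \sum_(q < (size s).+1 | (0 < q)%N && (r + q <= size s)%N)
    fmor FF X (ksgn_chain (A := Fuk D) (take r s) ++
      (Fuk_mu (last X (unzip2 (take r s))) (take q (drop r s)), last X (unzip2 (take (r + q) s))) :: drop (r + q) s).
Proof.
move=> ch s0; rewrite (blocks_sum2 s0) => [|p p2]; last by apply: tw_mu3; rewrite size_map_blocks.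
have -> : @mu R (tw O deg) (fobj FF X) (map_blocks FF X [:: s]) =
    ug (Dg X (last X (unzip2 s)) (cst (stc X s) X)).
  change (tw_mu deg (fobj FF X) [:: (fmor FF X s, fobj FF (last X (unzip2 s)))] = ug (Dg X (last X (unzip2 s)) (cst (stc X s) X))).
  rewrite comp_fmor !comp_fobj; change (tw_mu deg (FO X) [:: (Fx X s, FO (last X (unzip2 s)))] =
    ug (Dg X (last X (unzip2 s)) (cst (stc X s) X))).
  by rewrite Fx_ug mu_ug //; exact: smo_cstA.
have T2 s1 s2 : @mu R (tw O deg) (fobj FF X) (map_blocks FF X [:: s1; s2]) =
   mop (A := O) deg [:: (ug (cst (stc X s1) X), Bas n);
     (ug (cst (stc (last X (unzip2 s1)) s2) (last X (unzip2 s1))), Bas n)].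
  apply/funext => c; change (tw_mu deg (fobj FF X) [:: (fmor FF X s1, fobj FF (last X (unzip2 s1)));
    (fmor FF (last X (unzip2 s1)) s2, fobj FF (last (last X (unzip2 s1)) (unzip2 s2)))] c = mop (A := O) deg [:: (ug (cst (stc X s1) X), Bas n);
     (ug (cst (stc (last X (unzip2 s1)) s2) (last X (unzip2 s1))), Bas n)] c).
  by rewrite !comp_fmor !comp_fobj tw_mu2 !Fx_ug.
under [X in _ + X]eq_bigr do rewrite T2.
under [RHS]eq_bigr do under eq_bigr do rewrite comp_fmor Fx_ug stc_ainf //.
apply/funext => -[[l l'] x].
rewrite -[LHS]/(ug _ (l, l', x) + (\sum_(i < _) _) (l, l', x)) !fun_sum.
under [RHS]eq_bigr do rewrite fun_sum.
have [h|h] := boolP ((l.2 == 0%N) && (l'.2 == 0%N)); last first.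
  rewrite ug_off // !big1 ?addr0 // => i _; last exact: mop_off.
  by rewrite big1 // => j _; exact: ug_off.
case: l l' x h => [J v] [K v'] [[F g] z] h.
have [e1 e2] : v = 0%N /\ v' = 0%N by case/andP: h => /eqP ? /eqP ?.
rewrite {h}e1 {}e2; have Ez : E (val z) by exact: set_valP.
under [X in _ + X]eq_bigr do rewrite mop_cst.
have ugE w : ug w ((J, 0%N), (K, 0%N), (F, g, z)) = eg (val z) g * w J K F g (val z).
  by rewrite /ug mul1r.
under [RHS]eq_bigr do under eq_bigr do rewrite ugE.
rewrite ugE Dg_cst //.
have := congr1 (fun f : Lm => f K g) (ainf_id X J (val z) s0); rewrite !lm_sum !nov_sum.
under [RHS]eq_bigr do rewrite lm_sum nov_sum.
move=> e.
transitivity (eg (val z) g * ((F == finset.set0)%:R * (\sum_(r < (size s).+1)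
   \sum_(q < (size s).+1 | (0 < q)%N && (r + q <= size s)%N)
    ((-1) ^+ #|J| * M (mv (val z)) ((LE J, cX X) :: ksc (take r (stc X s)) ++
      (M (vstate (cX X) (take r (stc X s))) (take q (drop r (stc X s))), vstate (cX X) (take (r + q) (stc X s))) :: drop (r + q) (stc X s)) K g)))); last first.
  rewrite !mulr_sumr; apply: eq_bigr => r _; rewrite !mulr_sumr; apply: eq_bigr => q _.
  by rewrite /cst.
rewrite [X in _ = _ * (_ * X)](_ : _ = \sum_(r < (size s).+1)
   \sum_(q < (size s).+1 | (0 < q)%N && (r + q <= size s)%N) ((-1) ^+ #|J| * M (mv (val z)) ((LE J, cX X) :: ksc (take r (stc X s)) ++
      (M (vstate (cX X) (take r (stc X s))) (take q (drop r (stc X s))), vstate (cX X) (take (r + q) (stc X s))) :: drop (r + q) (stc X s)) K : nov D) g); last first.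
  by apply: eq_bigr => r _; apply: eq_bigr => q _; rewrite nov_sgnM.
pose f i := M (mv (val z)) ((M (mv (val z)) ((LE J, cX X) :: take i (stc X s)), vstate (cX X) (take i (stc X s))) ::
  drop i (stc X s)) K g.
rewrite [X in _ = _ * (_ * X)](_ : _ = \sum_(i < (size s).+1) f i); last exact: (esym e).
have fi (i : nat) : M (mv (val z)) ((M (mv (val z)) ((LE J, cX X) :: stc X (take i s)),
    cX (last X (unzip2 (take i s)))) :: stc (last X (unzip2 (take i s))) (drop i s)) K g = f i.
  by rewrite /f take_stc drop_stc last_cX.
have fN := fi (size s); rewrite take_size drop_size in fN; have f0 := fi 0%N; rewrite take0 drop0 in f0.
under [X in _ + X]eq_bigr do rewrite fi.
rewrite [X in _ * (_ * X) + _](_ : _ = f (size s) + f 0%N); last by rewrite -fN -f0.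
exact: sum_ends.
Qed.

End FunctorAxioms.

(** * The Hom complexes *)

Section HomComplex.
Variables (R : realType) (n : nat) (D : fukaya_data R n).
Hypothesis hW : weakly_unobstructed D.
Local Notation C := R[i].
Local Notation G := (cls D).
Local Notation U := (set_type (chart D)).
Local Notation V2 := ('rV[R]_n * 'rV[R]_n)%type.
Local Notation Lm := ({set 'I_n} -> nov D).
Local Notation vec := ('I_n -> C).
Local Notation LE := (@LE R n D).
Local Notation OX := (U * vec)%type.
Local Notation E := (chart D `*` [set: 'rV[R]_n]).
Local Notation arr := ({set 'I_n} -> {set 'I_n} -> {set 'I_n} -> G -> V2 -> C).
Local Notation sg := (sg R).
Variables X Y : OX.
Local Notation Dg := (Dg X Y).
Local Notation smoA := (@smoA R n D).
Implicit Types (w : arr) (z : V2) (F J K : {set 'I_n}) (g : G) (A : Lm).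

Definition q1 (c : vec) J K g z : C := M (mv z) [:: (LE J, c)] K g.

Definition dbA w : arr := fun J K F g z => \sum_(i in F) sg i (F :\ i)%SET * dcs 'i i (w J K (F :\ i)%SET g) z.

Definition linA w : arr := fun J K F g z => (-1) ^+ (#|F| + #|J|) *
  ((\sum_(J1 : {set 'I_n}) \sum_(bb <- dec g) w J J1 F bb.1 z * q1 (cX Y) J1 K bb.2 z) -
   (\sum_(J1 : {set 'I_n}) \sum_(bb <- dec g) q1 (cX X) J J1 bb.1 z * w J1 K F bb.2 z)).

Lemma DgE w J K F g z : Dg w J K F g z = dbA w J K F g z + linA w J K F g z.
Proof.
rewrite /Dg /linA /dbA; congr (_ + _ * (_ - _)); last by rewrite nov_sum; apply: eq_bigr => J1 _; rewrite novM.
rewrite (lin_expand (nv w J F z) K (M_lin (mv z) [::] (cX Y) [::])) nov_sum.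
by apply: eq_bigr => J1 _; rewrite novM.
Qed.

Lemma smo_q1 c J K g : smo E (q1 c J K g).
Proof. exact: smo_Mmv (oTU (D := D)). Qed.

Lemma smo_dbA w : smoA w -> smoA (dbA w).
Proof. by move=> sw J K F g; have oE := oTU (D := D); apply: smo_sum => // i _; apply: smoZ => //; exact: smo_dcs. Qed.

Lemma smo_linA w : smoA w -> smoA (linA w).
Proof.
move=> sw J K F g; have oE := oTU (D := D); apply: smoZ => //; apply: smoB => //;
  apply: smo_sum => // J1 _; apply: smo_sum => // bb _; apply: smoM => //; exact: smo_q1.
Qed.

Lemma smo_Dg w : smoA w -> smoA (Dg w).
Proof.
move=> sw J K F g; have oE := oTU (D := D).
apply: (smo_ext oE (f := fun z => dbA w J K F g z + linA w J K F g z)); first by move=> z _; rewrite DgE.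
by apply: smoD => //; [exact: smo_dbA|exact: smo_linA].
Qed.

Definition addA (w w' : arr) : arr := fun J K F g z => w J K F g z + w' J K F g z.
Definition oppA (w : arr) : arr := fun J K F g z => -1 * w J K F g z.

Lemma smo_addA w w' : smoA w -> smoA w' -> smoA (addA w w').
Proof. by move=> s s' J K F g; apply: smoD => //; exact: oTU. Qed.

Lemma smo_oppA w : smoA w -> smoA (oppA w).
Proof. by move=> s J K F g; apply: smoZ => //; exact: oTU. Qed.

Lemma smo_zeroA : smoA (fun _ _ _ _ => fun=> 0).
Proof. by move=> J K F g; apply: smo_cst; exact: oTU. Qed.

Lemma dbA_ext w w' J K F g z : (forall F y, E y -> w J K F g y = w' J K F g y) -> E z ->
  dbA w J K F g z = dbA w' J K F g z.
Proof.
move=> ww Ez; have oE := oTU (D := D); apply: eq_bigr => i _; congr (_ * _).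
by apply: (dcs_ext _ _ oE Ez) => y; exact: ww.
Qed.

Lemma Dg_ext w w' J K F g z : (forall J K F g y, E y -> w J K F g y = w' J K F g y) -> E z ->
  Dg w J K F g z = Dg w' J K F g z.
Proof.
move=> ww Ez; rewrite !DgE (dbA_ext (w' := w')) //; last by move=> *; exact: ww.
by congr (_ + _ * (_ - _)); apply: eq_bigr => J1 _; apply: eq_bigr => bb _; rewrite ww.
Qed.

Lemma dbAD w w' J K F g z : smoA w -> smoA w' -> E z ->
  dbA (addA w w') J K F g z = dbA w J K F g z + dbA w' J K F g z.
Proof.
move=> s s' Ez; rewrite /dbA -big_split; apply: eq_bigr => i _.
by rewrite /addA (dcsD _ _ (s _ _ _ _) (s' _ _ _ _) Ez) mulrDr.
Qed.

Lemma linAD w w' J K F g z : linA (addA w w') J K F g z = linA w J K F g z + linA w' J K F g z.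
Proof.
rewrite /linA -mulrDr addrACA -opprD -!big_split; congr (_ * (_ - _)); apply: eq_bigr => J1 _;
  rewrite -big_split; apply: eq_bigr => bb _; rewrite /addA; [exact: mulrDl|exact: mulrDr].
Qed.

Lemma DgD w w' J K F g z : smoA w -> smoA w' -> E z ->
  Dg (addA w w') J K F g z = Dg w J K F g z + Dg w' J K F g z.
Proof. by move=> s s' Ez; rewrite !DgE dbAD // linAD addrACA. Qed.

Lemma dbAZ (c : C) w J K F g z : smoA w -> E z ->
  dbA (fun J K F g z => c * w J K F g z) J K F g z = c * dbA w J K F g z.
Proof.
move=> s Ez; rewrite /dbA mulr_sumr; apply: eq_bigr => i _.
by rewrite (dcsZ _ _ _ (oTU (D := D)) (s _ _ _ _) Ez) mulrCA.
Qed.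

Lemma linAZ (c : C) w J K F g z :
  linA (fun J K F g z => c * w J K F g z) J K F g z = c * linA w J K F g z.
Proof.
rewrite /linA mulrCA; congr (_ * _); rewrite mulrBr !mulr_sumr; congr (_ - _); apply: eq_bigr => J1 _;
  rewrite mulr_sumr; apply: eq_bigr => bb _; [exact: (esym (mulrA _ _ _))|exact: mulrCA].
Qed.

Lemma DgZ (c : C) w J K F g z : smoA w -> E z ->
  Dg (fun J K F g z => c * w J K F g z) J K F g z = c * Dg w J K F g z.
Proof. by move=> s Ez; rewrite !DgE dbAZ // linAZ mulrDr. Qed.

Lemma Dg_zero J K F g z : E z -> Dg (fun _ _ _ _ => fun=> 0) J K F g z = 0.
Proof.
move=> Ez; have := DgZ 0 J K F g smo_zeroA Ez; rewrite !mul0r => e; exact: e.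
Qed.

Lemma dbA_dbA w J K F g z : smoA w -> E z -> dbA (dbA w) J K F g z = 0.
Proof.
move=> sw Ez; have oE := oTU (D := D).
rewrite -[RHS](@creation_sum R n (fun i k => dcs 'i i (dcs 'i k (w J K (F :\ i :\ k)%SET g)) z) F); last first.
  move=> i k; rewrite finset.setDDl finset.setUC -finset.setDDl; exact: (dcs_comm 'i 'i i k oE (sw _ _ _ _) Ez).
apply: eq_bigr => i _; rewrite -mulr_sumr; congr (_ * _).
rewrite /dbA (dcs_sum _ _ _ oE _ Ez); last by move=> k _; apply: smoZ => //; exact: smo_dcs.
by apply: eq_bigr => k _; rewrite (dcsZ _ _ _ oE _ Ez) //; exact: smo_dcs.
Qed.

Lemma dcs_q1 i c J K g z : dcs 'i i (q1 c J K g) z = 0.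
Proof. exact: dcs_M. Qed.

(** The entries [q1] of m_1 are holomorphic, so dbar differentiates only w, and the sign (-1)^|F|
    makes the two parts anticommute. *)
Lemma dbA_linA w J K F g z : smoA w -> E z -> dbA (linA w) J K F g z + linA (dbA w) J K F g z = 0.
Proof.
move=> sw Ez; have oE := oTU (D := D).
pose S i := (\sum_(J1 : {set 'I_n}) \sum_(bb <- dec g) dcs 'i i (w J J1 (F :\ i)%SET bb.1) z * q1 (cX Y) J1 K bb.2 z) -
   (\sum_(J1 : {set 'I_n}) \sum_(bb <- dec g) q1 (cX X) J J1 bb.1 z * dcs 'i i (w J1 K (F :\ i)%SET bb.2) z).
have s1 F' J1 bb : smo E (fun y => w J J1 F' bb.1 y * q1 (cX Y) J1 K bb.2 y).
  by apply: smoM => //; exact: smo_q1.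
have s2 F' J1 bb : smo E (fun y => q1 (cX X) J J1 bb.1 y * w J1 K F' bb.2 y).
  by apply: smoM => //; exact: smo_q1.
have e1 : dbA (linA w) J K F g z = \sum_(i in F) sg i (F :\ i)%SET * (- (-1) ^+ (#|F| + #|J|) * S i).
  apply: eq_bigr => i iF; congr (_ * _); rewrite /linA (dcsZ _ _ _ oE _ Ez); last first.
    by apply: smoB => //; apply: smo_sum => // J1 _; apply: smo_sum.
  rewrite (cardsD1 i F) iF add1n addSn exprS mulN1r opprK; congr (_ * _).
  rewrite -[RHS]/((\sum_J1 _) - (\sum_J1 _)) -[X in _ - X]mul1r -[in RHS]mulNr.
  have sN : smo E (fun z => -1 * \sum_(J1 : {set 'I_n}) \sum_(bb <- dec g) q1 (cX X) J J1 bb.1 z * w J1 K (F :\ i)%SET bb.2 z).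
    by apply: smoZ => //; apply: smo_sum => // J1 _; apply: smo_sum.
  have sP : smo E (fun z => \sum_(J1 : {set 'I_n}) \sum_(bb <- dec g) w J J1 (F :\ i)%SET bb.1 z * q1 (cX Y) J1 K bb.2 z).
    by apply: smo_sum => // J1 _; apply: smo_sum.
  transitivity (dcs 'i i (fun z => (\sum_(J1 : {set 'I_n}) \sum_(bb <- dec g) w J J1 (F :\ i)%SET bb.1 z * q1 (cX Y) J1 K bb.2 z)
     + -1 * \sum_(J1 : {set 'I_n}) \sum_(bb <- dec g) q1 (cX X) J J1 bb.1 z * w J1 K (F :\ i)%SET bb.2 z) z).
    by apply: (dcs_ext _ _ oE Ez) => y _; rewrite mulN1r.
  rewrite (dcsD _ _ sP sN Ez) (dcsZ _ _ _ oE _ Ez); last by apply: smo_sum => // J1 _; apply: smo_sum.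
  congr (_ + _ * _); rewrite (dcs_sum _ _ _ oE _ Ez) //; try (by move=> J1 _; apply: smo_sum);
    apply: eq_bigr => J1 _; rewrite (dcs_sum _ _ _ oE _ Ez) //; apply: eq_bigr => bb _.
    by rewrite (dcsM _ _ (sw _ _ _ _) (smo_q1 _ _ _ _) Ez) dcs_q1 mulr0 addr0.
  by rewrite (dcsM _ _ (smo_q1 _ _ _ _) (sw _ _ _ _) Ez) dcs_q1 mul0r add0r.
have e2 : linA (dbA w) J K F g z = \sum_(i in F) sg i (F :\ i)%SET * ((-1) ^+ (#|F| + #|J|) * S i).
  transitivity ((-1) ^+ (#|F| + #|J|) * \sum_(i in F) sg i (F :\ i)%SET * S i); last first.
    by rewrite mulr_sumr; apply: eq_bigr => i _; rewrite mulrCA.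
  rewrite /linA; congr (_ * _); rewrite (eq_bigr (fun i => sg i (F :\ i)%SET * (\sum_(J1 : {set 'I_n}) \sum_(bb <- dec g) dcs 'i i (w J J1 (F :\ i)%SET bb.1) z * q1 (cX Y) J1 K bb.2 z) -
    sg i (F :\ i)%SET * (\sum_(J1 : {set 'I_n}) \sum_(bb <- dec g) q1 (cX X) J J1 bb.1 z * dcs 'i i (w J1 K (F :\ i)%SET bb.2) z))); last by move=> i _; rewrite mulrBr.
  rewrite sumrB; congr (_ - _).
    under [RHS]eq_bigr do rewrite mulr_sumr; rewrite [RHS]exchange_big; apply: eq_bigr => J1 _ /=.
    under [RHS]eq_bigr do rewrite mulr_sumr; rewrite [RHS]exchange_big; apply: eq_bigr => bb _ /=.
    by rewrite /dbA mulr_suml; apply: eq_bigr => i _; rewrite mulrA.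
  under [RHS]eq_bigr do rewrite mulr_sumr; rewrite [RHS]exchange_big; apply: eq_bigr => J1 _ /=.
  under [RHS]eq_bigr do rewrite mulr_sumr; rewrite [RHS]exchange_big; apply: eq_bigr => bb _ /=.
  by rewrite /dbA mulr_sumr; apply: eq_bigr => i _; rewrite mulrCA.
rewrite e1 e2 -big_split big1 //= => i _; by rewrite -mulrDr mulNr addNr mulr0.
Qed.

Definition qn J z : Lm := M (mv z) [:: (LE J, cX X)].

Lemma nv_linA w J F z : nv (linA w) J F z = fun K => (-1) ^+ (#|F| + #|J|) *
  (M (mv z) [:: (nv w J F z, cX Y)] K - \sum_(J1 : {set 'I_n}) qn J z J1 * nv w J1 F z K).
Proof.
apply/funext => K; apply/funext => g; rewrite nov_sgnM novD novN.
rewrite (lin_expand (nv w J F z) K (M_lin (mv z) [::] (cX Y) [::])) !nov_sum.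
by rewrite /nv /linA; congr (_ * (_ - _)); apply: eq_bigr => J1 _; rewrite novM.
Qed.

(** The two mixed products cancel, and the two squares of m_1 contribute W_Y - W(- x - i y) and W_X
    - W(- x - i y) with opposite signs. *)
Lemma linA_linA w J K F g z : Wv (cX X) = Wv (cX Y) :> nov D -> linA (linA w) J K F g z = 0.
Proof.
move=> WW; rewrite -[LHS]/(nv (linA (linA w)) J F z K g) nv_linA.
set P := fun J => nv w J F z; pose s J : nov D := (-1) ^+ (#|F| + #|J|).
have ss J' : s J' * s J' = 1 by rewrite /s -expr2 sqrr_sign.
have sq J' J1 : s J' * s J1 * qn J' z J1 = - qn J' z J1.
  apply/funext => h; rewrite /s -exprD (_ : (_ + _)%N = ((#|F| + #|F|) + (#|J'| + #|J1|))%N); last by lia.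
  rewrite exprD addnn -mul2n exprM sqrrN expr1n expr1n mul1r nov_sgnM.
  by have := M_par (mv z) J' (cX X) J1 h 1; rewrite muln1 expr1 mulN1r.
pose mY (a : Lm) := M (mv z) [:: (a, cX Y)].
have lY : lin mY by exact: (M_lin (mv z) [::] (cX Y) [::]).
have nE J' : nv (linA w) J' F z = lsc (s J') (mY (P J') + \sum_(J1 : {set 'I_n}) lsc (- qn J' z J1) (P J1)).
  rewrite nv_linA; apply/funext => I; rewrite /lsc lmE lm_sum -/(s J'); congr (_ * (_ + _)).
  by rewrite -sumrN; apply: eq_bigr => J1 _; rewrite mulNr.
rewrite -/(s J) nE -/(mY _) (linZ _ _ lY) (linD _ _ lY) (lin_sum _ _ _ _ lY).
rewrite {1}/lsc lmE lm_sum.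
have q2 J2 : \sum_(J1 : {set 'I_n}) qn J z J1 * qn J1 z J2 = (Wv (cX X) - Wv (mv z)) * (J2 == J)%:R.
  have := congr1 (fun f : Lm => f J2) (M_ainf1 hW (mv z) (LE J) (cX X)).
  by rewrite (lin_expand _ J2 (M_lin (mv z) [::] (cX X) [::])).
have mm : mY (mY (P J)) K = (Wv (cX Y) - Wv (mv z)) * P J K.
  exact: (congr1 (fun f : Lm => f K) (M_ainf1 hW (mv z) (P J) (cX Y))).
suff X0 : s J * (s J * (mY (mY (P J)) K + \sum_(J1 : {set 'I_n}) lsc (- qn J z J1) (mY (P J1)) K) -
   \sum_(J1 : {set 'I_n}) qn J z J1 * nv (linA w) J1 F z K) = 0.
  exact: (congr1 (fun x : nov D => x g) X0).
have -> : \sum_(J1 : {set 'I_n}) qn J z J1 * nv (linA w) J1 F z K =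
    s J * (\sum_(J1 : {set 'I_n}) - qn J z J1 * mY (P J1) K) + s J * (\sum_(J1 : {set 'I_n}) \sum_(J2 : {set 'I_n}) qn J z J1 * qn J1 z J2 * P J2 K).
  rewrite !mulr_sumr -big_split; apply: eq_bigr => J1 _; rewrite nE /lsc lmE lm_sum.
  have h : qn J z J1 * s J1 = s J * - qn J z J1.
    by rewrite -[LHS]mul1r -(ss J) -sq; ring.
  rewrite mulrA h -mulrA mulrDr mulrDr !mulr_sumr; congr (_ + _).
  by apply: eq_bigr => J2 _; rewrite /lsc; ring.
have -> : \sum_(J1 : {set 'I_n}) \sum_(J2 : {set 'I_n}) qn J z J1 * qn J1 z J2 * P J2 K = (Wv (cX X) - Wv (mv z)) * P J K.
  rewrite exchange_big /= (bigD1 J) //= [X in _ + X]big1 => [|J2 /negbTE nJ]; last first.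
    by rewrite -mulr_suml q2 nJ mulr0 mul0r.
  by rewrite addr0 -mulr_suml q2 eqxx mulr1.
rewrite mm WW.
set T := \sum_(J1 : {set 'I_n}) - qn J z J1 * mY (P J1) K.
move: T (s J) (Wv _ - Wv _) (P J K) => a b c d; ring.
Qed.

Lemma Dg_Dg w J K F g z : Wv (cX X) = Wv (cX Y) :> nov D -> smoA w -> E z -> Dg (Dg w) J K F g z = 0.
Proof.
move=> WW sw Ez; transitivity (Dg (addA (dbA w) (linA w)) J K F g z).
  by apply: Dg_ext => // *; rewrite DgE.
rewrite DgD //; [|exact: smo_dbA|exact: smo_linA]; rewrite !DgE dbA_dbA // linA_linA // add0r addr0.
by rewrite addrC dbA_linA.
Qed.

End HomComplex.

(** * Filtration and successive approximation *)

Section Filtration.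
Variables (R : realType) (n : nat) (D : fukaya_data R n).
Local Notation C := R[i].
Local Notation G := (cls D).
Local Notation U := (set_type (chart D)).
Local Notation V2 := ('rV[R]_n * 'rV[R]_n)%type.
Local Notation Lm := ({set 'I_n} -> nov D).
Local Notation vec := ('I_n -> C).
Local Notation LE := (@LE R n D).
Local Notation OX := (U * vec)%type.
Local Notation E := (chart D `*` [set: 'rV[R]_n]).
Local Notation arr := ({set 'I_n} -> {set 'I_n} -> {set 'I_n} -> G -> V2 -> C).
Local Notation sg := (sg R).

Definition below (g : G) : {fset G} := fset_set [set h : G | energy h < energy g].

Lemma below_finite (g : G) : finite_set [set h : G | energy h < energy g].
Proof.
by apply: (sub_finite_set _ (@energy_finite R n D (energy g))) => h /= /ltW.
Qed.

(** Replaces the real energy by a natural number which grows with it, so that induction along the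
    energy filtration is possible. *)
Definition lev (g : G) : nat := #|` below g|.

Lemma lev_lt (h g : G) : energy h < energy g -> (lev h < lev g)%N.
Proof.
move=> hg; have mb (x y : G) : (x \in below y) = (energy x < energy y).
  by rewrite /below in_fset_set ?mem_setE /=; [apply/idP/idP; rewrite ?inE | exact: below_finite].
have : (h |` below h `<=` below g)%fset.
  by apply/fsubsetP => x; rewrite in_fset1U !mb => /predU1P[->//|/lt_trans]; apply.
by move=> /fsubset_leq_card; rewrite cardfsU1 mb ltxx.
Qed.

Lemma dec_lev (g : G) (bb : G * G) : bb \in dec g ->
  (bb.1 = 0 /\ bb.2 = g \/ (lev bb.2 < lev g)%N) /\ (bb.2 = 0 /\ bb.1 = g \/ (lev bb.1 < lev g)%N).
Proof.
rewrite mem_dec => /eqP e; have h (a b : G) : a + b = g -> a = 0 /\ b = g \/ (lev b < lev g)%N.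
  move=> ab; have := @energy_ge0 R n D a; rewrite le_eqVlt => /predU1P[/esym/energy_eq0 a0|a0].
    by left; split=> //; rewrite -ab a0 add0r.
  by right; apply: lev_lt; rewrite -ab energyD ltrDr.
by split; [exact: h|apply: (h); rewrite addrC].
Qed.

Lemma sum_dec_last (f : G -> G -> C) g : \sum_(bb <- dec g | bb.2 == 0) f bb.1 bb.2 = f g 0.
Proof.
rewrite big_mkcond (sum_decC g (fun a b => if b == 0 then f a b else 0)) -big_mkcond /=.
by rewrite -(sum_dec_delta g (fun a => f a 0)); apply: eq_bigr => bb /eqP->.
Qed.

Lemma sum_dec_first (f : G -> G -> C) g : \sum_(bb <- dec g | bb.1 == 0) f bb.1 bb.2 = f 0 g.
Proof. by rewrite -(sum_dec_delta g (f 0)); apply: eq_bigr => bb /eqP->. Qed.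

Section Weights.
(** The weight is abstract: energy dominates, and a larger row has no larger weight. It is
    instantiated with and without the row degree. *)
Variables (X Y : OX) (wgt : {set 'I_n} -> G -> nat).
Hypothesis wgt1 : forall J J' h g, (lev h < lev g)%N -> (wgt J h < wgt J' g)%N.
Hypothesis wgt2 : forall (J J' : {set 'I_n}) g, J \subset J' -> (wgt J' g <= wgt J g)%N.
Local Notation Dg := (Dg X Y).
Local Notation smoA := (@smoA R n D).
Local Notation cA A := (cst [:: (A : Lm, cX Y)] X).
Implicit Types (w : arr) (z : V2) (F J K : {set 'I_n}) (g : G) (A : Lm).

Lemma wedge_class1l (u : vec) (h : {set 'I_n} -> C) K : wedge (class1 u) h K =
  \sum_(i in K) sg i (K :\ i)%SET * (u i * h (K :\ i)%SET).
Proof.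
rewrite /wedge /class1 (eq_bigr (fun I => \sum_(i < n) (if I == [set i]%SET then
   (-1) ^+ inversions I (K :\: I)%SET * (u i * h (K :\: I)%SET) else 0))) => [|I _]; last first.
  rewrite mulr_sumr mulr_suml; apply: eq_bigr => i _; case: eqP => _; last by rewrite !mulr0 mul0r.
  by rewrite mulr1 mulrA.
rewrite exchange_big [RHS]big_mkcond; apply: eq_bigr => i _ /=.
rewrite -big_mkcondr /=; case: ifP => iK.
  rewrite (big_pred1 [set i]%SET) // => I /=; case: eqP => [->|]; last by rewrite andbF.
  by rewrite finset.sub1set iK.
rewrite big1 // => I /andP[IK /eqP e]; by move: IK; rewrite e finset.sub1set iK.
Qed.

Lemma inversions_C (i : 'I_n) (I : {set 'I_n}) : i \notin I ->
  (-1) ^+ inversions I [set i]%SET * (-1) ^+ #|I| = sg i I :> C.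
Proof.
move=> iI; rewrite /sg -exprD -[LHS]signr_odd -[RHS]signr_odd; congr (_ ^+ (nat_of_bool _)).
have -> : inversions I [set i]%SET = #|[set k in I | (i < k)%N]%SET|.
  rewrite /inversions -(card_imset _ (f := fun k : 'I_n => (k, i))) => [|? ? []] //.
  apply: eq_card => -[a b]; rewrite !finset.inE /=; apply/idP/imsetP.
    move=> /and3P[aI /eqP -> ia]; exists a => //; by rewrite !finset.inE aI ia.
  by move=> [k]; rewrite !finset.inE => /andP[kI ik] [-> ->]; rewrite kI eqxx ik.
rewrite inversions1 -(cardsID [set k : 'I_n | (k < i)%N]%SET I).
have -> : #|I :&: [set k : 'I_n | (k < i)%N]%SET| = #|[set k in I | (k < i)%N]%SET|.
  by apply: eq_card => k; rewrite !finset.inE.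
have -> : #|I :\: [set k : 'I_n | (k < i)%N]%SET| = #|[set k in I | (i < k)%N]%SET|.
  apply: eq_card => k; rewrite !finset.inE -leqNgt; have [kI|] := boolP (k \in I); rewrite ?andbF //= andbT.
  rewrite leq_eqVlt; case: eqP => // /val_inj e; by rewrite e kI in iI.
by rewrite !oddD addbC -addbA addbb addbF.
Qed.

Lemma wedge_class1r (u : vec) (h : {set 'I_n} -> C) K : wedge (gsgn (@hdeg n) h) (class1 u) K =
  \sum_(i in K) sg i (K :\ i)%SET * (u i * h (K :\ i)%SET).
Proof.
rewrite /wedge /class1 (eq_bigr (fun I => \sum_(i < n) (if (K :\: I)%SET == [set i]%SET then
   (-1) ^+ inversions I [set i]%SET * (-1) ^+ #|I| * (u i * h I) else 0))) => [|I _]; last first.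
  rewrite mulr_sumr; apply: eq_bigr => i _; case: eqP => [->|_]; last by rewrite !mulr0.
  by rewrite /gsgn /hdeg mulr1; ring.
rewrite exchange_big [RHS]big_mkcond; apply: eq_bigr => i _ /=.
rewrite -big_mkcondr /=; case: ifP => iK.
  rewrite (big_pred1 (K :\ i)%SET) => [|I /=]; first by rewrite inversions_C // !finset.inE eqxx.
  apply/andP/eqP => [[IK /eqP e]|->].
    by rewrite -e finset.setDDr finset.setDv finset.set0U; apply/esym/finset.setIidPr.
  split; first exact: finset.subsetDl.
  by rewrite finset.setDDr finset.setDv finset.set0U; apply/eqP/finset.setIidPr; rewrite finset.sub1set.
rewrite big1 // => I /andP[IK /eqP e].
have : i \in (K :\: I)%SET by rewrite e finset.set11.
by rewrite !finset.inE iK andbF.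
Qed.

Lemma M1_lead (h : {set 'I_n} -> C) v c K : \sum_(J1 : {set 'I_n}) h J1 * M v [:: (LE J1, c)] K 0 =
  \sum_(i in K) sg i (K :\ i)%SET * ((c i - v i) * h (K :\ i)%SET).
Proof.
have -> : \sum_(J1 : {set 'I_n}) h J1 * M v [:: (LE J1, c)] K 0 = M v [:: (hl h : Lm, c)] K 0.
  rewrite (lin_expand _ K (M_lin v [::] c [::])) nov_sum; apply: eq_bigr => J1 _.
  by rewrite nov_at0 /hl eqxx mulr1.
rewrite M_lead1 (_ : (fun J => hl h J 0) = h); last by apply/funext => J; rewrite /hl eqxx mulr1.
rewrite (_ : gsgn _ (class1 v) = class1 (fun i => - v i)); last first.
  apply/funext => I; rewrite /gsgn /class1 mulr_sumr; apply: eq_bigr => i _.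
  by case: eqP => [->|_]; rewrite ?mulr0 // /hdeg cards1 expr1 mulN1r mulNr.
rewrite wedge_class1l wedge_class1r -big_split; apply: eq_bigr => i _ /=; ring.
Qed.

Lemma q1_lead c J K z : q1 c J K (0 : G) z = \sum_(i in K) sg i (K :\ i)%SET * ((c i - mv z i) * (K :\ i == J)%SET%:R).
Proof.
rewrite -(M1_lead (fun I => (I == J)%:R)) (bigD1 J) //= eqxx mul1r big1 ?addr0 // => I /negbTE ->.
by rewrite mul0r.
Qed.

Lemma q1_supp c J K z : ~~ (J \subset K) -> q1 c J K (0 : G) z = 0.
Proof.
move=> JK; rewrite q1_lead big1 // => i _; case: eqP => [e|_]; last by rewrite !mulr0.
by rewrite -e finset.subsetDl in JK.
Qed.

(** In class zero m_1 is exterior multiplication by a vector, so composition in front links row J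
    only to rows containing J; all other terms involve smaller energy. *)
Lemma linA_local w w' m J K F g z : (forall J K F g, (wgt J g <= m)%N -> w J K F g z = w' J K F g z) ->
  (wgt J g <= m)%N -> linA X Y w J K F g z = linA X Y w' J K F g z.
Proof.
move=> ww Jm; rewrite /linA; congr (_ * (_ - _)); apply: eq_bigr => J1 _; rewrite big_seq [RHS]big_seq;
  apply: eq_bigr => bb /dec_lev[h1 h2].
  congr (_ * _); apply: ww; case: h2 => [[_ ->] //|h]; exact: leq_trans (ltnW (wgt1 J J h)) Jm.
case: h1 => [[-> ->]|h]; last by congr (_ * _); apply: ww; exact: leq_trans (ltnW (wgt1 J1 J h)) Jm.
have [JJ|JJ] := boolP (J \subset J1); last by rewrite (q1_supp _ _ JJ) !mul0r.
by congr (_ * _); apply: ww; exact: leq_trans (wgt2 g JJ) Jm.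
Qed.

Lemma Dg_local w w' m J K F g z : (forall J K F g z, E z -> (wgt J g <= m)%N -> w J K F g z = w' J K F g z) ->
  (wgt J g <= m)%N -> E z -> Dg w J K F g z = Dg w' J K F g z.
Proof.
move=> ww Jm Ez; rewrite !DgE (dbA_ext (w' := w')) //; last by move=> F' y Ey; exact: ww.
by congr (_ + _); apply: (@linA_local _ _ m) => // *; exact: ww.
Qed.

Lemma wedge_eb (J K1 K : {set 'I_n}) : wedge (gsgn (@hdeg n) (@ebasis R n J)) (@ebasis R n K1) K =
  ((J \subset K) && ((K :\: J)%SET == K1))%:R * ((-1) ^+ inversions J (K :\: J)%SET * (-1) ^+ #|J|).
Proof.
rewrite /wedge; have [JK|JK] := boolP (J \subset K); last first.
  rewrite mul0r big1 // => I IK; rewrite /gsgn [ebasis _ J I](_ : _ = (I == J)%:R) //.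
  by case: eqP => [e|_]; [rewrite e (negbTE JK) in IK|rewrite !(mulr0, mul0r)].
rewrite (bigD1 J) //= big1 ?addr0 => [|I /andP[_ /negbTE IJ]]; last first.
  by rewrite /gsgn [ebasis _ J I](_ : _ = (I == J)%:R) // IJ !(mulr0, mul0r).
by rewrite /gsgn /ebasis /hdeg eqxx mulr1 mulrC.
Qed.

Lemma M2_coef v J K1 K c c' : M v [:: (LE J, c); (LE K1, c')] K (0 : G) =
  ((J \subset K) && ((K :\: J)%SET == K1))%:R * ((-1) ^+ inversions J (K :\: J)%SET * (-1) ^+ #|J|).
Proof.
rewrite -wedge_eb M_lead2 (_ : (fun J' => LE J J' 0) = @ebasis R n J); last first.
  by apply/funext => I; rewrite LE_at eqxx mulr1.
by congr (wedge _ _ K); apply/funext => I; rewrite LE_at eqxx mulr1.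
Qed.

Lemma M2_lead A v J c c' K g : (forall K1 h, (lev h < lev g)%N -> A K1 h = 0) ->
  M v [:: (LE J, c); (A, c')] K g = \sum_(K1 : {set 'I_n}) A K1 g *
    (((J \subset K) && ((K :\: J)%SET == K1))%:R * ((-1) ^+ inversions J (K :\: J)%SET * (-1) ^+ #|J|)).
Proof.
move=> A0; rewrite (lin_expand A K (M_lin v [:: (LE J, c)] c' [::])) nov_sum; apply: eq_bigr => K1 _.
rewrite novM (bigID (fun bb : G * G => bb.2 == 0)) /= [X in _ + X]big1_seq ?addr0; last first.
  move=> bb /andP[b0 /dec_lev[_ [[e _]|h]]]; first by rewrite e eqxx in b0.
  by rewrite (A0 K1 _ h) mul0r.
rewrite -(M2_coef v J K1 K c c').
by rewrite (sum_dec_last (fun a b => A K1 a * M v [:: (LE J, c); (LE K1, c')] K b)).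
Qed.

(** The component A K is given the weight of ~: K, since in class zero e_J ^ e_K is non-zero only if
    J lies in ~: K. *)
Lemma cA_local A A' m J K F g z : (forall K g, (wgt (~: K)%SET g <= m)%N -> A K g = A' K g) ->
  (wgt J g <= m)%N -> cA A J K F g z = cA A' J K F g z.
Proof.
move=> AA Jm; rewrite /cst; congr (_ * (_ * _)).
rewrite !(lin_expand _ K (M_lin (mv z) [:: (LE J, cX X)] (cX Y) [::])) !nov_sum.
apply: eq_bigr => K1 _; rewrite !novM big_seq [RHS]big_seq; apply: eq_bigr => bb /dec_lev[_ [[-> ->]|h]]; last first.
  by congr (_ * _); apply: AA; exact: leq_trans (ltnW (wgt1 _ J h)) Jm.
have [JK|JK] := boolP (J \subset (~: K1)%SET); first by congr (_ * _); apply: AA; exact: leq_trans (wgt2 g JK) Jm.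
have c0 : (J \subset K) && ((K :\: J)%SET == K1) = false.
  apply/negP => /andP[_ /eqP e]; move: JK; rewrite -e => /negP; apply.
  by apply/fintype.subsetP => i iJ; rewrite !finset.inE iJ.
have := M2_coef (mv z) J K1 K (cX X) (cX Y); rewrite c0 mul0r => e0.
by rewrite -[M _ _ K 0]/(M (mv z) [:: (LE J, cX X); (LE K1, cX Y)] K 0) e0 !mulr0.
Qed.

Lemma linA_lead w J K F g z : (forall J K F h, (lev h < lev g)%N -> w J K F h z = 0) ->
  linA X Y w J K F g z = (-1) ^+ (#|F| + #|J|) *
   ((\sum_(i in K) sg i (K :\ i)%SET * ((cX Y i - mv z i) * w J (K :\ i)%SET F g z)) -
    \sum_(J1 : {set 'I_n}) q1 (cX X) J J1 (0 : G) z * w J1 K F g z).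
Proof.
move=> w0; rewrite /linA -(M1_lead (fun I => w J I F g z)); congr (_ * (_ - _)); apply: eq_bigr => J1 _.
  rewrite -(sum_dec_last (fun a b => w J J1 F a z * q1 (cX Y) J1 K b z)).
  rewrite (bigID (fun bb : G * G => bb.2 == 0)) /= [X in _ + X]big1_seq ?addr0 // => bb /andP[b0 /dec_lev[_ [[e _]|h]]].
    by rewrite e eqxx in b0.
  by rewrite w0 // mul0r.
rewrite -(sum_dec_first (fun a b => q1 (cX X) J J1 a z * w J1 K F b z)).
rewrite (bigID (fun bb : G * G => bb.1 == 0)) /= [X in _ + X]big1_seq ?addr0 // => bb /andP[b0 /dec_lev[[[e _]|h] _]].
  by rewrite e eqxx in b0.
by rewrite w0 // mulr0.
Qed.

Lemma cAD (c : C) A B J K F g z : cA (lsc (ncst c : nov D) A + B) J K F g z = c * cA A J K F g z + cA B J K F g z.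
Proof.
rewrite /cst (M_lin (mv z) [:: (LE J, cX X)] (cX Y) [::]) lmE novD {1}/lsc ncstM.
by move: (M _ _ _ _) (M _ _ _ _) => x y; ring.
Qed.

Lemma cA0 J K F g z : cA 0 J K F g z = 0.
Proof. by rewrite /cst (M_zero (mv z) [:: (LE J, cX X)] (cX Y) [::]) !mulr0. Qed.

Definition vanish k w := forall J K F g z, E z -> (wgt J g < k)%N -> w J K F g z = 0.
(** Over distinct points the only morphism is zero. *)
Definition allowed A := X.1 = Y.1 \/ A = 0.

Hypothesis chainA : forall A, allowed A -> exists A', allowed A' /\
  forall J K F g z, E z -> Dg (cA A) J K F g z = cA A' J K F g z.
Hypothesis square0 : forall w J K F g z, smoA w -> E z -> Dg (Dg w) J K F g z = 0.
(** The leading-order problem: what has lowest weight in the error u is the image of a morphism plus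
    a coboundary, with both corrections vanishing in lower weights. *)
Hypothesis lead_step : forall k u A, allowed A -> smoA u -> vanish k u ->
  (forall J K F g z, E z -> Dg u J K F g z = cA A J K F g z) ->
  exists A1 s, [/\ allowed A1, smoA s, (forall K g, (wgt (~: K)%SET g < k)%N -> A1 K g = 0), vanish k s &
    forall J K F g z, E z -> wgt J g = k -> u J K F g z = cA A1 J K F g z + Dg s J K F g z].

Section Completion.
Variables (w : arr) (A0 : Lm).
Hypotheses (alA : allowed A0) (sw : smoA w).
Hypothesis Dw : forall J K F g z, E z -> Dg w J K F g z = cA A0 J K F g z.
Local Notation T := (Lm * arr)%type.

Definition Inv k (x : T) := [/\ allowed x.1, smoA x.2 & forall J K F g z, E z -> (wgt J g < k)%N ->
  w J K F g z = cA x.1 J K F g z + Dg x.2 J K F g z].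
Definition Ext k (x y : T) := (forall K g, (wgt (~: K)%SET g < k)%N -> x.1 K g = y.1 K g) /\
  (forall J K F g z, E z -> (wgt J g < k)%N -> x.2 J K F g z = y.2 J K F g z).

Lemma allowed_lin c A B : allowed A -> allowed B -> allowed (lsc (ncst c) A + B).
Proof.
case=> [e|->]; [by left|case=> [e|->]; [by left|right]].
apply/funext => K; apply/funext => g; by rewrite lmE novD /lsc ncstM !lm0E !nov0 mulr0 addr0.
Qed.

(** The error u = w - cA A - D s vanishes below weight k, and D u is again the image of a morphism
    because D D = 0, so the leading-order step applies to it. *)
Lemma completion_step k x : Inv k x -> exists y, Inv k.+1 y /\ Ext k x y.
Proof.
case: x => A s [/= al ss hk]; have [A' [al' hA']] := chainA al.
pose v := addA (cA A) (Dg s); pose u := addA w (oppA v).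
have sv : smoA v by apply: smo_addA; [exact: smo_cstA|exact: smo_Dg].
have su : smoA u by apply: smo_addA => //; exact: smo_oppA.
have [] := @lead_step k u (lsc (ncst (-1)) A' + A0) (allowed_lin _ al' alA) su.
- move=> J K F g z Ez h; rewrite /u /addA /oppA mulN1r (hk _ _ _ _ _ Ez h); exact: subrr.
- move=> J K F g z Ez; rewrite (DgD X Y J K F g sw (smo_oppA sv) Ez) Dw // (DgZ X Y (-1) J K F g sv Ez).
  rewrite (DgD X Y J K F g (@smo_cstA _ _ _ [:: (A, cX Y)] X) (smo_Dg X Y ss) Ez) square0 // addr0 hA' // cAD.
  by rewrite addrC.
move=> A1 [s1 [al1 ss1 A10 s10 h1]].
exists (lsc (ncst 1) A1 + A, addA s1 s); split; last first.
  split=> [K g h|J K F g z Ez h] /=; last by rewrite /addA s10 // add0r.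
  by rewrite lmE novD /lsc ncstM A10 // mulr0 add0r.
split=> /=; [exact: allowed_lin|exact: smo_addA|].
move=> J K F g z Ez; rewrite cAD mul1r (DgD X Y J K F g ss1 ss Ez) addrACA ltnS leq_eqVlt => /predU1P[h|h].
  rewrite -h1 // /u /addA /oppA mulN1r.
  by rewrite -[cA A J K F g z + Dg s J K F g z]/(v J K F g z) subrK.
have e1 : cA A1 J K F g z = 0.
  apply: (etrans _ (cA0 J K F g z)); apply: (@cA_local _ _ (wgt J g)) => // K' g' h'.
  by rewrite A10 ?lm0E ?nov0 //; exact: leq_ltn_trans h' h.
have e2 : Dg s1 J K F g z = 0.
  apply: (etrans _ (Dg_zero X Y J K F g Ez)); apply: (@Dg_local _ _ (wgt J g)) => // J' K' F' g' y Ey h'.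
  by rewrite s10 //; exact: leq_ltn_trans h' h.
apply: (etrans (hk _ _ _ _ _ Ez h)); apply: esym.
exact: (etrans (f_equal2 +%R (etrans (f_equal2 +%R e1 e2) (addr0 0)) erefl) (add0r _)).
Qed.

(** Stage k leaves the components of weight below k unchanged, so every component stabilises. *)
Lemma completion : exists A s, [/\ allowed A, smoA s & forall J K F g z, E z ->
  w J K F g z = cA A J K F g z + Dg s J K F g z].
Proof.
have ex (kx : nat * T) : exists y, Inv kx.1 kx.2 -> Inv kx.1.+1 y /\ Ext kx.1 kx.2 y.
  have [h|h] := pselect (Inv kx.1 kx.2); last by exists kx.2.
  by have [y hy] := completion_step h; exists y.
have [f hf] := choice ex.
pose x0 : T := (0, fun _ _ _ _ => fun=> 0).
pose sq := fix sq k := if k is k'.+1 then f (k', sq k') else x0.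
have I k : Inv k (sq k).
  elim: k => [|k IH]; last by have [] := hf (k, sq k) IH.
  by split=> //; [right|exact: smo_zeroA].
have X1 k m : (k <= m)%N -> Ext k (sq k) (sq m).
  elim: m => [|m IH]; first by rewrite leqn0 => /eqP->; split.
  rewrite leq_eqVlt => /predU1P[->|km]; first by split.
  have [a b] := IH km; have [_ [a' b']] := hf (m, sq m) (I m); split=> [K g h|J K F g z Ez h].
    rewrite a // a' //; exact: leq_trans h km.
  rewrite b // b' //; exact: leq_trans h km.
(* A component of weight k is final from stage k + 1 on; by locality the equation in weight k sees
   only such components. *)
pose Ai : Lm := fun K g => (sq (wgt (~: K)%SET g).+1).1 K g.
pose si : arr := fun J K F g z => (sq (wgt J g).+1).2 J K F g z.
exists Ai, si; split.
- have [e|ne] := pselect (X.1 = Y.1); [by left|right].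
  apply/funext => K; apply/funext => g; rewrite /Ai.
  by have [[//|->] _ _] := I (wgt (~: K)%SET g).+1.
- move=> J K F g; rewrite /si; have [_ ss _] := I (wgt J g).+1; exact: ss.
move=> J K F g z Ez; have [_ _ h] := I (wgt J g).+1; rewrite (h _ _ _ _ _ Ez (leqnn _)); congr (_ + _).
  by apply/esym; apply: (@cA_local _ _ (wgt J g)) => // K' g' le; apply: (X1 _ _ _).1.
apply/esym; apply: (@Dg_local _ _ (wgt J g)) => // J' K' F' g' y Ey le; by apply: (X1 _ _ _).2.
Qed.

End Completion.
End Weights.
End Filtration.

(** * Creation and annihilation on subsets *)

Section ContractionPair.
Variables (R : realType) (n : nat).
Local Notation C := R[i].
Local Notation sg := (sg R).
Implicit Types (h : {set 'I_n} -> C) (u : 'I_n -> C) (i : 'I_n) (F : {set 'I_n}).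

Definition cre u h F : C := \sum_(i in F) sg i (F :\ i)%SET * (u i * h (F :\ i)%SET).
Definition ann u h F : C := \sum_(i | i \notin F) sg i F * (u i * h (i |: F)%SET).
Definition cre1 i h F : C := if i \in F then sg i (F :\ i)%SET * h (F :\ i)%SET else 0.
Definition ann1 i h F : C := if i \notin F then sg i F * h (i |: F)%SET else 0.

(** The anticommutation relations, with annihilation in the single direction i. *)
Lemma cre_ann1 u i h F : cre u (ann1 i h) F + ann1 i (cre u h) F = u i * h F.
Proof.
have := @car_sum R n (fun k j K => if k == i then u j * h K else 0) F.
rewrite -big_mkcond (big_pred1 i) // => <-; congr (_ + _).
  apply: eq_bigr => j jF; rewrite -mulr_sumr; congr (_ * _); rewrite /ann1.
  rewrite (eq_bigr (fun k => if k == i then sg i (F :\ j)%SET * (u j * h (i |: F :\ j)%SET) else 0)); last first.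
    by move=> k _; case: eqP => [->|] //; rewrite mulr0.
  rewrite -big_mkcondr; case: ifP => iF.
    rewrite (big_pred1 i) => [|k /=]; first exact: mulrCA.
    by case: eqP => [->|]; rewrite ?andbF // iF.
  by rewrite mulr0 big1 // => k /andP[kF /eqP ki]; rewrite -ki kF in iF.
rewrite (eq_bigr (fun k => if k == i then sg i F * cre u h (i |: F)%SET else 0)); last first.
  move=> k kF; case: eqP => [->|_]; last by rewrite big1 // => j _; rewrite !mulr0.
  by rewrite /cre mulr_sumr.
rewrite -big_mkcondr /ann1; case: ifP => iF.
  by rewrite (big_pred1 i) // => k /=; case: eqP => [->|]; rewrite ?andbF // iF.
by rewrite big1 // => k /andP[kF /eqP ki]; rewrite -ki kF in iF.
Qed.

Lemma ann_cre1 u i h F : ann u (cre1 i h) F + cre1 i (ann u h) F = u i * h F.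
Proof.
have := @car_sum R n (fun k j K => if j == i then u k * h K else 0) F.
rewrite -big_mkcond (big_pred1 i) // => <-; rewrite addrC; congr (_ + _).
  rewrite (eq_bigr (fun j => if j == i then sg i (F :\ i)%SET * ann u h (F :\ i)%SET else 0)); last first.
    move=> j jF; case: eqP => [->|_]; last by rewrite big1 // => k _; rewrite !mulr0.
    by rewrite /ann mulr_sumr.
  rewrite -big_mkcondr /cre1; case: ifP => iF.
    by rewrite (big_pred1 i) // => k /=; case: eqP => [->|]; rewrite ?andbF // iF.
  by rewrite big1 // => k /andP[kF /eqP ki]; rewrite -ki kF in iF.
apply: eq_bigr => k kF; rewrite -mulr_sumr; congr (_ * _); rewrite /cre1.
rewrite (eq_bigr (fun j => if j == i then sg i ((k |: F) :\ i)%SET * (u k * h ((k |: F) :\ i)%SET) else 0)); last first.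
  by move=> j _; case: eqP => [->|] //; rewrite mulr0.
rewrite -big_mkcondr; case: ifP => iF.
  rewrite (big_pred1 i) => [|j /=]; first exact: mulrCA.
  by case: eqP => [->|]; rewrite ?andbF // iF.
by rewrite mulr0 big1 // => j /andP[jF /eqP ji]; rewrite -ji jF in iF.
Qed.

End ContractionPair.

(** * The leading-order problem over one point *)

Lemma sgJ_comb (C : comPzRingType) (a b : C) : a * a = 1 -> b * b = 1 -> a * (b * a) * (a * (b * a)) = 1.
Proof.
move=> ha hb; transitivity ((a * a) * (a * a) * (b * b)); first by ring.
by rewrite ha hb !mulr1.
Qed.

Section LeadSame.
Variables (R : realType) (n : nat) (D : fukaya_data R n).
Local Notation C := R[i].
Local Notation G := (cls D).
Local Notation U := (set_type (chart D)).
Local Notation V2 := ('rV[R]_n * 'rV[R]_n)%type.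
Local Notation Lm := ({set 'I_n} -> nov D).
Local Notation vec := ('I_n -> C).
Local Notation LE := (@LE R n D).
Local Notation OX := (U * vec)%type.
Local Notation E := (chart D `*` [set: 'rV[R]_n]).
Local Notation arr := ({set 'I_n} -> {set 'I_n} -> {set 'I_n} -> G -> V2 -> C).
Local Notation sg := (sg R).
Local Notation smoA := (@smoA R n D).
Implicit Types (w : arr) (z : V2) (F J K : {set 'I_n}) (g : G) (A : Lm).

(** Within one energy level the row term takes at most n + 1 values, so the energy dominates; rows
    of large degree come first. Without b only the energy counts. *)
Definition wgtb (b : bool) J g : nat := (lev g * n.+1 + (if b then n - #|J| else 0))%N.

Lemma wgtb1 b J J' h g : (lev h < lev g)%N -> (wgtb b J h < wgtb b J' g)%N.
Proof.
rewrite /wgtb => hg; have : ((lev h).+1 * n.+1 <= lev g * n.+1)%N by rewrite leq_mul2r hg orbT.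
have : ((if b then n - #|J| else 0) <= n)%N by case: b => //; exact: leq_subr.
move: (if b then _ else _) (if b then _ else _) => x y; lia.
Qed.

Lemma wgtb2 b (J J' : {set 'I_n}) g : J \subset J' -> (wgtb b J' g <= wgtb b J g)%N.
Proof. by move=> /subset_leq_card h; rewrite /wgtb leq_add2l; case: b => //; rewrite leq_sub2l. Qed.

Variables (X Y : OX).
Local Notation Dg := (Dg X Y).
Local Notation cA A := (cst [:: (A : Lm, cX Y)] X).
Local Notation vanish b := (vanish (wgtb b)).

(** At row ~: K and the full column the lowest term of the image of A is A K up to sign; it can be
    read off over the base point, by induction on the weight. *)
Lemma A_vanish b A k : vanish b k (cA A) -> forall K g, (wgtb b (~: K)%SET g < k)%N -> A K g = 0.
Proof.
move=> hk; suff h m : (m <= k)%N -> forall K g, (wgtb b (~: K)%SET g < m)%N -> A K g = 0 by exact: h.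
elim: m => // m IH mk K g; rewrite ltnS leq_eqVlt => /predU1P[wm|]; last exact: IH (ltnW mk) _ _.
have Ez : E (basepoint D, 0) by split=> //; exact: chart_basepoint.
have := hk (~: K)%SET [set: 'I_n]%SET finset.set0 g _ Ez; rewrite wm => /(_ mk).
rewrite /cst eqxx mul1r M2_lead => [|K1 h hg]; last by apply: (IH (ltnW mk)); rewrite -wm; exact: wgtb1.
rewrite (bigD1 K) //= big1 ?addr0 => [|K1 /negbTE nK]; last first.
  by rewrite finset.setTD finset.setCK eq_sym nK andbF mul0r mulr0.
rewrite finset.subsetT finset.setTD finset.setCK eqxx mul1r => /eqP.
by rewrite !mulf_eq0 !signr_eq0 !orbF /= => /eqP.
Qed.

Definition sgJ J : C := (-1) ^+ #|J| * ((-1) ^+ inversions J (~: J)%SET * (-1) ^+ #|J|).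

Lemma sgJ2 J : sgJ J * sgJ J = 1.
Proof.
have := sqrr_sign C #|J|; have := sqrr_sign C (inversions J (~: J)%SET); rewrite /sgJ !expr2.
by move=> hb ha; exact: sgJ_comb.
Qed.

(** For a column K other than the full set, the complement of K minus J is strictly larger than J,
    hence of smaller weight, where A vanishes. So the leading parts are exactly the top classes. *)
Lemma cA_lead A k J K F g z : (forall K g, (wgtb true (~: K)%SET g < k)%N -> A K g = 0) -> wgtb true J g = k ->
  cA A J K F g z = etop R F K * (sgJ J * A (~: J)%SET g).
Proof.
move=> A0 Jk; rewrite /cst M2_lead => [|K1 h hg]; last by apply: A0; rewrite -Jk; exact: wgtb1.
rewrite (bigD1 (K :\: J)%SET) //= big1 ?addr0 => [|K1 /negbTE nK]; last first.
  by rewrite eq_sym nK andbF mul0r mulr0.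
rewrite eqxx andbT /etop; have [->|KT] := eqVneq K [set: 'I_n]%SET.
  rewrite finset.subsetT finset.setTD andbT /sgJ; congr (_ * _).
  by move: (A _ _) => x; rewrite mul1r; ring.
rewrite andbF mul0r; have [JK|JK] := boolP (J \subset K); last by rewrite mul0r !mulr0.
rewrite (A0 (K :\: J)%SET) ?mul0r ?mulr0 // -Jk /wgtb ltn_add2l.
have : (#|J| < #|~: (K :\: J)%SET|)%N.
  apply: proper_card; apply/properP; split.
    by apply/fintype.subsetP => i iJ; rewrite !finset.inE iJ.
  have [i iK] : exists i, i \notin K.
    apply: contrapT => h; case/eqP: KT; apply/finset.setP => i; rewrite finset.inE; apply/negPn/negP => iK.
    by apply: h; exists i.
  have iJ : i \notin J by apply/negP => /(fintype.subsetP JK); rewrite (negbTE iK).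
  by exists i; rewrite // !finset.inE (negbTE iK) andbF.
move=> h; apply: ltn_sub2l => //; apply: leq_trans h _.
by rewrite -[X in (_ <= X)%N](card_ord n); exact: max_card.
Qed.

Hypotheses (imX : forall i, complex.Re (X.2 i) = 0) (imY : forall i, complex.Re (Y.2 i) = 0).

(** The point of TU representing Y: alpha is imaginary, and y is read from b = - i y. *)
Definition centre : V2 := (val Y.1, \row_i - complex.Im (Y.2 i)).

Lemma kap_cY i z : cX Y i - mv z i = kap centre 'i i z.
Proof.
have h1 : xco i centre = (val Y.1 0 i)%:C by [].
have h2 : yco i centre = - (complex.Im (Y.2 i))%:C by rewrite /yco mxE rmorphN.
have h3 : Y.2 i = 'i * (complex.Im (Y.2 i))%:C by rewrite [LHS]complexE imY add0r.
have h4 : (- val Y.1 0 i)%:C = - (val Y.1 0 i)%:C by rewrite rmorphN.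
rewrite kapE mvE /cX /vadd /nu h1 h2 h4 {1}h3 ?complexiE.
move: (xco i z) (yco i z) (val Y.1 0 i)%:C (complex.Im _)%:C => a b c d; ring.
Qed.

Lemma q1_sum h J z : \sum_(J1 : {set 'I_n}) q1 (cX X) J J1 (0 : G) z * h J1 = ann (fun i => cX X i - mv z i) h J.
Proof.
rewrite (eq_bigr (fun J1 => \sum_(i in J1) (if (J1 :\ i == J)%SET then sg i J * ((cX X i - mv z i) * h J1) else 0))); last first.
  move=> J1 _; rewrite q1_lead mulr_suml; apply: eq_bigr => i _; case: eqP => [->|_]; last by rewrite !mulr0 mul0r.
  by rewrite mulr1 mulrA.
rewrite (exchange_big_dep xpredT) //= /ann [RHS]big_mkcond; apply: eq_bigr => i _; rewrite -big_mkcondr.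
case: ifP => iJ.
  rewrite (big_pred1 (i |: J)%SET) // => J1 /=; apply/andP/eqP => [[iJ1 /eqP <-]|->].
    by rewrite finset.setD1K.
  by rewrite finset.setU1K // finset.setU11.
rewrite big1 // => J1 /andP[iJ1 /eqP e]; by move: iJ; rewrite -e !finset.inE eqxx.
Qed.

Lemma Dg_lead v J K F g z : (forall J K F h, (lev h < lev g)%N -> v J K F h z = 0) ->
  Dg v J K F g z = dbA v J K F g z + (-1) ^+ (#|F| + #|J|) *
    (cre (fun i => cX Y i - mv z i) (fun I => v J I F g z) K -
     ann (fun i => cX X i - mv z i) (fun I => v I K F g z) J).
Proof. by move=> v0; rewrite DgE (linA_lead X Y _ _ _ v0) q1_sum. Qed.

(** Composition in front leads in class zero to rows of larger degree, where v vanishes. What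
    remains on each row is the Dolbeault-Koszul differential centred at Y. *)
Lemma Dg_lead_kd v k J K F g z : vanish true k v -> wgtb true J g = k -> E z ->
  Dg v J K F g z = kd centre ((-1) ^+ #|J|) (fun F K => v J K F g) F K z.
Proof.
move=> vk Jk Ez; rewrite Dg_lead => [|J' K' F' h hg]; last by apply: vk => //; rewrite -Jk; exact: wgtb1.
rewrite [ann _ _ _](_ : _ = 0) ?subr0; last first.
  rewrite /ann big1 // => i iJ; rewrite vk ?mulr0 // -Jk /wgtb ltn_add2l cardsU1 iJ.
  have := max_card (mem J); have : (#|J| < n)%N; last by lia.
  have : (#|i |: J| <= n)%N by rewrite -[X in (_ <= X)%N](card_ord n); exact: max_card.
  by rewrite cardsU1 iJ.
rewrite /kd /dbA; congr (_ + _); rewrite exprD mulrC [in RHS]mulrC; rewrite [X in _ * X]mulrC; congr (_ * _).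
by apply: eq_bigr => i _; rewrite kap_cY.
Qed.

(** On each row and class of weight k, [kd_exact] writes u as a coboundary plus a constant multiple
    of the top class, and by [cA_lead] the top classes are the leading parts of images of
    morphisms. *)
Lemma lead_same : X.1 = Y.1 -> forall k u A, allowed X Y A -> smoA u -> vanish true k u ->
  (forall J K F g z, E z -> Dg u J K F g z = cA A J K F g z) ->
  exists A1 s, [/\ allowed X Y A1, smoA s, (forall K g, (wgtb true (~: K)%SET g < k)%N -> A1 K g = 0), vanish true k s &
    forall J K F g z, E z -> wgtb true J g = k -> u J K F g z = cA A1 J K F g z + Dg s J K F g z].
Proof.
move=> XY k u A _ su uk Du.
have A0 : forall K g, (wgtb true (~: K)%SET g < k)%N -> A K g = 0.
  apply: A_vanish => J K F g z Ez h; rewrite -Du //; apply: (etrans _ (Dg_zero X Y J K F g Ez)).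
  apply: (@Dg_local _ _ _ _ _ _ (@wgtb1 true) (@wgtb2 true) _ _ (wgtb true J g)) => // J' K' F' g' y Ey h'.
  by apply: uk => //; exact: leq_ltn_trans h' h.
have oE := oTU (D := D); have Ec : E centre by split=> //; exact: set_valP.
(* Solutions for all rows and classes are chosen at once; those of a weight other than k get
   zero. *)
have ex (x : {set 'I_n} * G) : exists y : ({set 'I_n} -> {set 'I_n} -> V2 -> C) * C, wgtb true x.1 x.2 = k ->
    (forall F K, smo E (y.1 F K)) /\ forall F K z, E z ->
    u x.1 K F x.2 z = kd centre ((-1) ^+ #|x.1|) y.1 F K z + etop R F K * y.2.
  case: x => J g /=; have [Jk|] := pselect (wgtb true J g = k); last by exists (fun _ _ => fun=> 0, 0).
  have e2 : (-1) ^+ #|J| * (-1) ^+ #|J| = 1 :> C by rewrite -expr2 sqrr_sign.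
  have [|_ [s [c' [ss hs]]]] := @kd_exact R n centre _ e2 _ oE Ec (fun F K => u J K F g) (sgJ J * A (~: J)%SET g) (fun F K => su J K F g).
    by move=> F K z Ez; rewrite -(Dg_lead_kd _ _ uk Jk Ez) Du // (cA_lead _ _ _ A0 Jk).
  by exists (s, c').
have [f hf] := choice ex.
pose A1 : Lm := fun K g => if wgtb true (~: K)%SET g == k then sgJ (~: K)%SET * (f ((~: K)%SET, g)).2 else 0.
pose s1 : arr := fun J K F g z => if wgtb true J g == k then (f (J, g)).1 F K z else 0.
have vs : vanish true k s1 by move=> J K F g z _ h; rewrite /s1 ltn_eqF.
exists A1, s1; split=> //.
- by left.
- move=> J K F g; rewrite /s1; case: eqP => [Jk|_]; last exact: smo_cst.
  by have [h _] := hf (J, g) Jk; exact: h.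
- by move=> K g h; rewrite /A1 ltn_eqF.
move=> J K F g z Ez Jk; have [_ h] := hf (J, g) Jk; apply: (etrans (h F K z Ez)); rewrite addrC.
have e1 : cA A1 J K F g z = etop R F K * (f (J, g)).2.
  rewrite (@cA_lead A1 k) //; last by move=> K' g' h'; rewrite /A1 ltn_eqF.
  by congr (_ * _); rewrite /A1 finset.setCK Jk eqxx mulrA sgJ2 mul1r.
have e3 : Dg s1 J K F g z = kd centre ((-1) ^+ #|J|) (f (J, g)).1 F K z.
  rewrite (Dg_lead_kd _ _ vs Jk Ez); apply: (kd_ext _ _ _ _ oE Ez) => F' K' y _.
  by rewrite /s1 Jk eqxx.
exact: (f_equal2 +%R (esym e1) (esym e3)).
Qed.

End LeadSame.

(** * The leading-order problem over distinct points *)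

Section ContractionAlgebra.
Variables (R : realType) (n : nat).
Local Notation C := R[i].
Local Notation sg := (sg R).
Implicit Types (f g : {set 'I_n} -> C) (h : {set 'I_n} -> {set 'I_n} -> C) (u : 'I_n -> C) (i : 'I_n) (J K : {set 'I_n}).

Lemma cre1_cre i u h J K : cre1 i (fun I => cre u (h I) K) J = cre u (fun I => cre1 i (h^~ I) J) K.
Proof.
rewrite /cre1; case: ifP => iJ; last by rewrite /cre big1 // => k _; rewrite !mulr0.
by rewrite /cre mulr_sumr; apply: eq_bigr => k _; rewrite mulrCA; congr (_ * _); rewrite mulrCA.
Qed.

Lemma ann_ann1 i u h J K : ann u (fun I => ann1 i (h I) K) J = ann1 i (fun I => ann u (h^~ I) J) K.
Proof.
rewrite /ann1; case: ifP => iJ; last by rewrite /ann big1 // => k _; rewrite !mulr0.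
by rewrite /ann mulr_sumr; apply: eq_bigr => k _; rewrite [RHS]mulrCA; congr (_ * _); rewrite mulrCA.
Qed.

Lemma creL u c f g K : cre u (fun I => c * (f I - g I)) K = c * (cre u f K - cre u g K).
Proof. rewrite /cre -sumrB mulr_sumr; apply: eq_bigr => k _; ring. Qed.

Lemma annL u c (s : {set 'I_n} -> C) f g J : (forall i, i \notin J -> s (i |: J)%SET = c) ->
  ann u (fun I => s I * (f I - g I)) J = c * (ann u f J - ann u g J).
Proof. move=> sc; rewrite /ann -sumrB mulr_sumr; apply: eq_bigr => k kJ; rewrite sc //; ring. Qed.

Lemma ann1L i c f g K : ann1 i (fun I => c * (f I - g I)) K = c * (ann1 i f K - ann1 i g K).
Proof. rewrite /ann1; case: ifP => _; last by rewrite subrr mulr0. ring. Qed.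

Lemma cre1L i c (s : {set 'I_n} -> C) f g J : (i \in J -> s (J :\ i)%SET = c) ->
  cre1 i (fun I => s I * (f I - g I)) J = c * (cre1 i f J - cre1 i g J).
Proof. rewrite /cre1; case: ifP => [iJ /(_ isT) ->|_ _]; last by rewrite subrr mulr0. ring. Qed.

Lemma creZ u c f K : cre u (fun I => c * f I) K = c * cre u f K.
Proof. rewrite /cre mulr_sumr; apply: eq_bigr => k _; ring. Qed.

Lemma annZ u c f K : ann u (fun I => c * f I) K = c * ann u f K.
Proof. rewrite /ann mulr_sumr; apply: eq_bigr => k _; ring. Qed.

End ContractionAlgebra.

Lemma homotopy_comb (C : comPzRingType) (P a1 a2 b1 b2 c1 c2 d1 d2 k1 k2 : C) : P * P = 1 ->
  b1 = c2 -> d1 = a2 -> c1 + a1 = k1 -> d2 + b2 = k2 ->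
  - P * (- P * (a1 - a2) - P * (b1 - b2)) + P * (P * (c1 - c2) - (- P) * (d1 - d2)) = k1 - k2.
Proof.
move=> PP -> -> <- <-.
transitivity (P * P * (c1 + a1 - (d2 + b2))); first by ring.
by rewrite PP mul1r.
Qed.

Lemma scale_comb (C : fieldType) (d P x y y' u : C) : d != 0 ->
  - P * x + P * (y - y') = d * u -> d^-1 * (- P * x) + P * (d^-1 * y - d^-1 * y') = u.
Proof.
move=> d0 e; transitivity (d^-1 * (- P * x + P * (y - y'))); first by ring.
by rewrite e mulKf.
Qed.

Section LeadDiff.
Variables (R : realType) (n : nat) (D : fukaya_data R n).
Local Notation C := R[i].
Local Notation G := (cls D).
Local Notation U := (set_type (chart D)).
Local Notation V2 := ('rV[R]_n * 'rV[R]_n)%type.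
Local Notation Lm := ({set 'I_n} -> nov D).
Local Notation vec := ('I_n -> C).
Local Notation OX := (U * vec)%type.
Local Notation E := (chart D `*` [set: 'rV[R]_n]).
Local Notation arr := ({set 'I_n} -> {set 'I_n} -> {set 'I_n} -> G -> V2 -> C).
Local Notation sg := (sg R).
Local Notation smoA := (@smoA R n D).
Implicit Types (w u : arr) (z : V2) (F J K : {set 'I_n}) (g : G) (A : Lm).
Variables (X Y : OX).
Hypotheses (imX : forall i, complex.Re (X.2 i) = 0) (imY : forall i, complex.Re (Y.2 i) = 0).
Local Notation Dg := (Dg X Y).
Local Notation cA A := (cst [:: (A : Lm, cX Y)] X).
Local Notation vanish b := (vanish (wgtb b)).

Variable i0 : 'I_n.

(* Its anticommutator with the leading part of the differential is the constant cX Y i0 - cX X i0. *)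
Definition Sc u : arr := fun J K F g z => (-1) ^+ (#|F| + #|J|) *
  (ann1 i0 (fun I => u J I F g z) K - cre1 i0 (fun I => u I K F g z) J).

Lemma smo_Sc u : smoA u -> smoA (Sc u).
Proof.
move=> su J K F g; have oE := oTU (D := D).
have sa : smo E (fun z => ann1 i0 (fun I => u J I F g z) K).
  by rewrite /ann1; case: (i0 \notin K); [exact: smoZ|exact: smo_cst].
have sc : smo E (fun z => cre1 i0 (fun I => u I K F g z) J).
  by rewrite /cre1; case: (i0 \in J); [exact: smoZ|exact: smo_cst].
exact: (smoZ _ oE (smoB oE sa sc)).
Qed.

Lemma dbA_Sc u J K F g z : smoA u -> E z -> dbA (Sc u) J K F g z = - (-1) ^+ (#|F| + #|J|) *
  (ann1 i0 (fun I => dbA u J I F g z) K - cre1 i0 (fun I => dbA u I K F g z) J).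
Proof.
move=> su Ez; have oE := oTU (D := D).
have ea i : smo E (fun y => ann1 i0 (fun I => u J I (F :\ i)%SET g y) K) /\
  dcs 'i i (fun y => ann1 i0 (fun I => u J I (F :\ i)%SET g y) K) z = ann1 i0 (fun I => dcs 'i i (u J I (F :\ i)%SET g) z) K.
  rewrite /ann1; case: ifP => _; split; [exact: smoZ|exact: (dcsZ _ _ _ oE (su _ _ _ _) Ez)|exact: smo_cst|exact: dcs_cst].
have ec i : smo E (fun y => cre1 i0 (fun I => u I K (F :\ i)%SET g y) J) /\
  dcs 'i i (fun y => cre1 i0 (fun I => u I K (F :\ i)%SET g y) J) z = cre1 i0 (fun I => dcs 'i i (u I K (F :\ i)%SET g) z) J.
  rewrite /cre1; case: ifP => _; split; [exact: smoZ|exact: (dcsZ _ _ _ oE (su _ _ _ _) Ez)|exact: smo_cst|exact: dcs_cst].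
have e1 : ann1 i0 (fun I => dbA u J I F g z) K = \sum_(i in F) sg i (F :\ i)%SET * ann1 i0 (fun I => dcs 'i i (u J I (F :\ i)%SET g) z) K.
  rewrite /ann1 /dbA; case: ifP => _; last by rewrite big1 // => i _; rewrite mulr0.
  by rewrite mulr_sumr; apply: eq_bigr => i _; rewrite mulrCA.
have e2 : cre1 i0 (fun I => dbA u I K F g z) J = \sum_(i in F) sg i (F :\ i)%SET * cre1 i0 (fun I => dcs 'i i (u I K (F :\ i)%SET g) z) J.
  rewrite /cre1 /dbA; case: ifP => _; last by rewrite big1 // => i _; rewrite mulr0.
  by rewrite mulr_sumr; apply: eq_bigr => i _; rewrite mulrCA.
rewrite e1 e2 -sumrB mulr_sumr; apply: eq_bigr => i iF.
have [sa da] := ea i; have [sc dc] := ec i.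
have sN : smo E (fun y => -1 * cre1 i0 (fun I => u I K (F :\ i)%SET g y) J) by exact: smoZ.
have -> : dcs 'i i (Sc u J K (F :\ i)%SET g) z = (-1) ^+ (#|(F :\ i)%SET| + #|J|) *
   (ann1 i0 (fun I => dcs 'i i (u J I (F :\ i)%SET g) z) K - cre1 i0 (fun I => dcs 'i i (u I K (F :\ i)%SET g) z) J).
  rewrite -da -dc; transitivity (dcs 'i i (fun y => (-1) ^+ (#|(F :\ i)%SET| + #|J|) *
    (ann1 i0 (fun I => u J I (F :\ i)%SET g y) K + -1 * cre1 i0 (fun I => u I K (F :\ i)%SET g y) J)) z).
    by apply: (dcs_ext _ _ oE Ez) => y _; rewrite mulN1r.
  rewrite (dcsZ _ _ _ oE (smoD oE sa sN) Ez) (dcsD _ _ sa sN Ez) (dcsZ _ _ _ oE sc Ez).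
  by rewrite mulN1r.
rewrite (cardsD1 i F) iF add1n addSn exprS mulN1r opprK.
move: ((-1) ^+ _) (ann1 _ _ _) (cre1 _ _ _) (sg _ _) => a b c d; ring.
Qed.

(** Morphisms between distinct points are zero, so u is closed in leading order. The anticommutator
    of [Sc] with the leading differential is the non-zero constant [de], so [Sc u] divided by [de]
    is a primitive. *)
Lemma lead_diff : val X.1 0 i0 <> val Y.1 0 i0 -> forall k u A, allowed X Y A -> smoA u -> vanish false k u ->
  (forall J K F g z, E z -> Dg u J K F g z = cA A J K F g z) ->
  exists A1 s, [/\ allowed X Y A1, smoA s, (forall K g, (wgtb false (~: K)%SET g < k)%N -> A1 K g = 0), vanish false k s &
    forall J K F g z, E z -> wgtb false J g = k -> u J K F g z = cA A1 J K F g z + Dg s J K F g z].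
Proof.
move=> XY k u A al su uk Du.
have A0 : A = 0 by case: al => // e; case: XY; rewrite e.
pose de : C := cX Y i0 - cX X i0.
(* The classes alpha are imaginary, so the real part of [de] is x_i0(X) - x_i0(Y). *)
have de0 : de != 0.
  apply/negP => /eqP /(congr1 (@complex.Re R)); rewrite /de /cX /vadd /nu !ReImE imX imY /=.
  by rewrite !add0r opprK => /eqP; rewrite addrC subr_eq0 => /eqP.
pose s : arr := fun J K F g z => if wgtb false J g == k then de^-1 * Sc u J K F g z else 0.
have ss : smoA s.
  move=> J K F g; have oE := oTU (D := D); rewrite /s; case: eqP => _; last exact: smo_cst.
  by apply: smoZ => //; exact: smo_Sc.
have vs : vanish false k s by move=> J K F g z _ h; rewrite /s ltn_eqF.
exists 0, s; split=> //; first by right.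
move=> J K F g z Ez Jk; rewrite cA0 add0r.
have low (J' : {set 'I_n}) (h : G) : (lev h < lev g)%N -> (wgtb false J' h < k)%N by move=> hg; rewrite -Jk; exact: wgtb1.
have u0 J' K' F' (h : G) : (lev h < lev g)%N -> u J' K' F' h z = 0 by move=> hg; apply: uk => //; exact: low.
have dE J' K' F' : dbA u J' K' F' g z = - (-1) ^+ (#|F'| + #|J'|) *
    (cre (fun i => cX Y i - mv z i) (fun I => u J' I F' g z) K' - ann (fun i => cX X i - mv z i) (fun I => u I K' F' g z) J').
  have := Du J' K' F' g z Ez; rewrite A0 cA0 Dg_lead // => /eqP.
  by rewrite addr_eq0 mulNr => /eqP.
apply/esym; rewrite Dg_lead; last by move=> J' K' F' h hg; apply: vs => //; exact: low.
pose s' : arr := fun J K F g z => de^-1 * Sc u J K F g z.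
have sE J' K' F' y : s J' K' F' g y = s' J' K' F' g y.
  by rewrite /s /s' (_ : wgtb false J' g == k) //; apply/eqP; exact: Jk.
have -> : dbA s J K F g z = dbA s' J K F g z.
  by apply: (dbA_ext (D := D) (w' := s')) => // F' y _; exact: sE.
have -> : (fun I => s J I F g z) = fun I => de^-1 * Sc u J I F g z by apply/funext => I; exact: sE.
have -> : (fun I => s I K F g z) = fun I => de^-1 * Sc u I K F g z by apply/funext => I; exact: sE.
rewrite (dbAZ _ _ _ _ _ (smo_Sc su) Ez) dbA_Sc //.
have -> : cre (fun i => cX Y i - mv z i) (fun I => de^-1 * Sc u J I F g z) K =
    de^-1 * cre (fun i => cX Y i - mv z i) (fun I => Sc u J I F g z) K.
  exact: creZ.
have -> : ann (fun i => cX X i - mv z i) (fun I => de^-1 * Sc u I K F g z) J =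
    de^-1 * ann (fun i => cX X i - mv z i) (fun I => Sc u I K F g z) J.
  exact: annZ.
apply: (scale_comb de0).
pose P : C := (-1) ^+ (#|F| + #|J|).
have PP : P * P = 1 by rewrite -expr2 sqrr_sign.
have e1 : ann1 i0 (fun I => dbA u J I F g z) K = - P * (ann1 i0 (fun I => cre (fun i => cX Y i - mv z i) (fun I => u J I F g z) I) K
    - ann1 i0 (fun I => ann (fun i => cX X i - mv z i) (fun I' => u I' I F g z) J) K).
  by rewrite -ann1L; congr (ann1 _ _ _); apply/funext => I; exact: dE.
have e2 : cre1 i0 (fun I => dbA u I K F g z) J = P * (cre1 i0 (fun I => cre (fun i => cX Y i - mv z i) (fun I' => u I I' F g z) K) J
    - cre1 i0 (fun I => ann (fun i => cX X i - mv z i) (fun I' => u I' K F g z) I) J).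
  rewrite -(@cre1L _ _ i0 P (fun I => - (-1) ^+ (#|F| + #|I|))); last first.
    by move=> iJ; rewrite /P (cardsD1 i0 J) iJ add1n addnS exprS mulN1r.
  by congr (cre1 _ _ _); apply/funext => I; exact: dE.
have e3 : cre (fun i => cX Y i - mv z i) (fun I => Sc u J I F g z) K = P * (cre (fun i => cX Y i - mv z i) (fun I => ann1 i0 (fun I => u J I F g z) I) K
   - cre (fun i => cX Y i - mv z i) (fun I => cre1 i0 (fun I' => u I' I F g z) J) K).
  by rewrite -creL.
have e4 : ann (fun i => cX X i - mv z i) (fun I => Sc u I K F g z) J = - P * (ann (fun i => cX X i - mv z i) (fun I => ann1 i0 (fun I' => u I I' F g z) K) J
   - ann (fun i => cX X i - mv z i) (fun I => cre1 i0 (fun I' => u I' K F g z) I) J).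
  rewrite -(@annL _ _ _ (- P) (fun I => (-1) ^+ (#|F| + #|I|))) // => i iJ.
  by rewrite /P cardsU1 iJ addnS exprS mulN1r.
rewrite e1 e2 e3 e4 (homotopy_comb PP (k1 := (cX Y i0 - mv z i0) * u J K F g z) (k2 := (cX X i0 - mv z i0) * u J K F g z)).
- by rewrite -mulrBl; congr (_ * _); rewrite /de; ring.
- exact: (cre1_cre _ _ (fun I I' => u I I' F g z)).
- exact: (ann_ann1 _ _ (fun I I' => u I I' F g z)).
- exact: cre_ann1.
- exact: ann_cre1.
Qed.

End LeadDiff.

(** * Quasi-isomorphism on Hom complexes *)

Section QuasiIso.
Variables (R : realType) (n : nat) (D : fukaya_data R n).
Hypothesis hW : weakly_unobstructed D.
Local Notation C := R[i].
Local Notation G := (cls D).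
Local Notation U := (set_type (chart D)).
Local Notation TU := (set_type (chart D `*` [set: 'rV[R]_n])).
Local Notation V2 := ('rV[R]_n * 'rV[R]_n)%type.
Local Notation Lm := ({set 'I_n} -> nov D).
Local Notation vec := ('I_n -> C).
Local Notation LE := (@LE R n D).
Local Notation OX := (U * vec)%type.
Local Notation E := (chart D `*` [set: 'rV[R]_n]).
Local Notation O := (Ohol D).
Local Notation lab := (Hlab n).
Local Notation deg := (@Hlabdeg n).
Local Notation FO := (@FO R n D).
Local Notation ug := (@ug R n D).
Local Notation arr := ({set 'I_n} -> {set 'I_n} -> {set 'I_n} -> G -> V2 -> C).
Local Notation smoA := (@smoA R n D).
Local Notation FF := (ainf_comp (P_functor D) (Phi_functor D)).
Implicit Types (w : arr) (z : V2) (F J K : {set 'I_n}) (g : G) (A : Lm).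

Lemma ug_ext w w' : (forall J K F g z, E z -> w J K F g z = w' J K F g z) -> ug w = ug w'.
Proof.
move=> ww; apply/funext => -[[[J v] [K v']] [[F g] z]].
by rewrite /ug ww //; exact: set_valP.
Qed.

Lemma eg_neq0 z g : eg (D := D) z g != 0.
Proof. by rewrite /eg eq_complex /= gt_eqF ?expR_gt0. Qed.

Lemma ug_inj w w' J K F g z : ug w = ug w' -> E z -> w J K F g z = w' J K F g z.
Proof.
move=> e Ez; have := congr1 (fun f => f ((J, 0%N), (K, 0%N), (F, g, SigSub (mem_set Ez) : TU))) e.
rewrite /ug !mul1r; exact: (mulfI (eg_neq0 z g)).
Qed.

Lemma ug_add w w' : ug (addA w w') = ug w + ug w'.
Proof.
apply/funext => -[[[J v] [K v']] [[F g] z]].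
rewrite -[RHS]/(ug w ((J, v), (K, v'), (F, g, z)) + ug w' ((J, v), (K, v'), (F, g, z))) /ug /addA.
by rewrite !mulrDr.
Qed.

Lemma ug_zero : ug (fun _ _ _ _ => fun=> 0) = 0.
Proof. by apply/funext => -[[[J v] [K v']] [[F g] z]]; rewrite /ug !mulr0. Qed.

(** The gauge factor has no zeros, so b can be divided by it. *)
Lemma mem_ug X Y b : tw_mem (FO X) (FO Y) b -> exists2 w, smoA w & b = ug w.
Proof.
move=> [bm bs]; have oE := oTU (D := D).
pose q g z : R := - pairb (xw z) g.
pose w : arr := fun J K F g z => (expR (q g z))%:C * extend (fun z' : TU => b ((J, 0%N), (K, 0%N), (F, g, z'))) z.
exists w.
  move=> J K F g; apply: smoM => //.
    apply: smo_exp => //; apply: (smo_ext oE (f := fun z => -1 * (pairb (xw z) g)%:C)).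
      by move=> z _; rewrite mulN1r rmorphN.
    by apply: smoZ => //; exact: smo_pair.
  apply/(smoothP oE); have [h _] := bm (J, 0%N) (K, 0%N); exact: h.
apply/funext => -[[[J v] [K v']] [[F g] z]]; rewrite /ug.
have [/andP[/eqP -> /eqP ->]|h] := boolP ((v == 0%N) && (v' == 0%N)).
  by rewrite mul1r /w extend_val mulrA /eg -rmorphM -expRD /q addrN expR0 mul1r.
rewrite mul0r; apply: contrapT => /bs; rewrite !mem_Bas; exact/negP.
Qed.

Variables X Y : OX.
Hypotheses (imX : forall i, complex.Re (X.2 i) = 0) (imY : forall i, complex.Re (Y.2 i) = 0).
Local Notation Dg := (Dg X Y).
Local Notation cA A := (cst [:: (A : Lm, cX Y)] X).
Local Notation muA A := (M (cX X) [:: (A : Lm, cX Y)]).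

Definition ungauge A : Lcrd D -> C := fun '(K, g) => lgau (fun i => - nu X.1 i) A K g.

Lemma ungaugeK A : lgau (nu X.1) (lc (ungauge A)) = A.
Proof.
apply/funext => K; rewrite /ungauge /lgau -[lc _ K]/(gau (fun i => - nu X.1 i) (A K)) gau_add gau_id // => i.
exact: addrN.
Qed.

Lemma sum2 (f : nat -> nat -> Lm) :
  \sum_(r < 2) \sum_(q < 2 | (0 < q)%N && (r + q <= 1)%N) f r q = f 0%N 1%N.
Proof.
rewrite !big_ord_recl big_ord0 addr0 [X in _ + X]big_pred0 => [|q].
  by rewrite addr0 big_mkcond !big_ord_recl big_ord0 /= add0r addr0.
by case: q => [[|[|]]].
Qed.

Lemma Dg_cA A J K F g z : E z -> Dg (cA A) J K F g z = cA (muA A) J K F g z.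
Proof.
move=> Ez; pose st := stc X [:: (ungauge A, Y)].
have key := etrans (@ainf_id R n D hW X [:: (ungauge A, Y)] J z isT)
  (sum2 (fun r q K => (-1) ^+ #|J| * M (mv z) ((LE J, cX X) :: ksc (take r st) ++
      (M (vstate (cX X) (take r st)) (take q (drop r st)), vstate (cX X) (take (r + q) st)) :: drop (r + q) st) K)).
have := congr1 (fun f : Lm => f K g) key.
rewrite lm_sum nov_sum [size _]/= !big_ord_recl big_ord0 addr0 /st /= ungaugeK nov_sgnM => e.
have := Dg_cst X [:: (ungauge A, Y)] J K F g Ez; rewrite /= ungaugeK => ->.
rewrite /cst addrC; congr (_ * _); exact: e.
Qed.

(** If a difference of morphisms has zero image, [A_vanish] kills it in every weight. *)
Lemma cA_inj A A' : (forall J K F g z, E z -> cA A J K F g z = cA A' J K F g z) -> A = A'.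
Proof.
move=> e; pose B := lsc (ncst (-1)) A' + A : Lm.
have B0 K g : B K g = 0.
  have := @A_vanish R n D X Y false B (wgtb (D := D) false (~: K)%SET g).+1; apply=> //.
  by move=> J K' F g' z Ez _; rewrite cAD e // mulN1r addNr.
apply/funext => K; apply/funext => g; have := B0 K g.
by rewrite /B lmE novD /lsc ncstM mulN1r addrC => /eqP; rewrite subr_eq0 => /eqP.
Qed.

Hypothesis WW : Wv (cX X) = Wv (cX Y) :> nov D.

Lemma muA_square A : muA (muA A) = 0.
Proof.
by rewrite (M_ainf1 hW) WW subrr; apply/funext => K; rewrite /lsc mul0r.
Qed.

(** Over one point the weight includes the row degree, which isolates a single row; over distinct
    points the homotopy mixes rows, and the weight is the energy alone. *)
Lemma solve w A0 : allowed X Y A0 -> smoA w ->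
  (forall J K F g z, E z -> Dg w J K F g z = cA A0 J K F g z) ->
  exists A s, [/\ allowed X Y A, smoA s & forall J K F g z, E z -> w J K F g z = cA A J K F g z + Dg s J K F g z].
Proof.
have ch A : allowed X Y A -> exists A', allowed X Y A' /\
    forall J K F g z, E z -> Dg (cA A) J K F g z = cA A' J K F g z.
  move=> al; exists (muA A); split=> [|*]; last exact: Dg_cA.
  by case: al => [e|->]; [left|right; exact: (M_zero (cX X) [::] (cX Y) [::])].
have sq w' J K F g z : smoA w' -> E z -> Dg (Dg w') J K F g z = 0 by exact: Dg_Dg.
have [e|ne] := pselect (X.1 = Y.1).
  exact: (completion (@wgtb1 R n D true) (@wgtb2 R n D true) ch sq (lead_same imY e)).
have [i0 hi] : exists i0, val X.1 0 i0 <> val Y.1 0 i0.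
  apply: contrapT => h; apply: ne; apply: val_inj; apply/rowP => i; apply: contrapT => hi; apply: h; by exists i.
exact: (completion (@wgtb1 R n D false) (@wgtb2 R n D false) ch sq (lead_diff imX imY hi)).
Qed.

End QuasiIso.

Section Main.
Variables (R : realType) (n : nat) (D : fukaya_data R n).
Hypothesis hW : weakly_unobstructed D.
Local Notation C := R[i].
Local Notation Lm := ({set 'I_n} -> nov D).
Local Notation E := (chart D `*` [set: 'rV[R]_n]).
Local Notation O := (Ohol D).
Local Notation deg := (@Hlabdeg n).
Local Notation FO := (@FO R n D).
Local Notation ug := (@ug R n D).
Local Notation smoA := (@smoA R n D).
Local Notation FF := (ainf_comp (P_functor D) (Phi_functor D)).

Lemma FF_functor : is_ainf_functor FF.
Proof.
split.
- move=> X hX; rewrite comp_fobj; exact: FF_obj.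
- move=> X s _ ch s0; rewrite !comp_fobj comp_fmor; exact: FF_mor.
- by move=> X s _ ch s0; rewrite !comp_fmor; exact: FF_degree.
- by move=> X s1 s2 c a a' Y _ ch ch'; rewrite !comp_fmor; exact: FF_linear.
- by move=> X s _ ch s0; exact: FF_ainf.
Qed.

(** If D w is the image of a, [solve] gives w = f(a') + D s, hence f(a) = f(d a') and a = d a' by
    injectivity of f. If D w = 0, it gives w = f(a) + D s with a closed. When [Wv (cX X)] and
    [Wv (cX Y)] differ, both Hom spaces are zero. *)
Lemma FF_quasi X Y : isobj (a := Fuk D) X -> isobj (a := Fuk D) Y -> quasi_iso FF X Y.
Proof.
move=> hX hY; rewrite /quasi_iso !comp_fobj.
pose A a : Lm := lgau (nu X.1) (lc a).
pose cA B := cst [:: (B : Lm, cX Y)] X.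
have fE a : fmor FF X [:: (a, Y)] = ug (cA (A a)) by rewrite comp_fmor Fx_ug.
have dE w : smoA w -> @mu R (tw O deg) (FO X) [:: (ug w, FO Y)] = ug (Dg X Y w) by exact: mu_ug.
have memE b : @mor R (tw O deg) (FO X) (FO Y) b ->
    (exists2 w, smoA w & b = ug w) /\ (Wv (cX X) = Wv (cX Y) :> nov D \/ b = 0).
  move=> [/mem_ug h1 h2]; split=> //; case: h2 => [[lam [_ l1 l2]]|]; last by right.
  by left; apply: lamX_inj; rewrite -(curvature_lamX hW l1) (curvature_lamX hW l2).
have ugE w : Wv (cX X) = Wv (cX Y) :> nov D \/ ug w = 0 -> smoA w -> @mor R (tw O deg) (FO X) (FO Y) (ug w).
  by move=> h sw; split; [exact: ug_mem|case: h => [h|]; [left; exact: FO_mor|right]].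
have aW a : @mor R (Fuk D) X Y a -> Wv (cX X) = Wv (cX Y) :> nov D \/ a = 0.
  by move=> [_ [[e1 e2]|]]; [left; apply/potential_cX|right].
have aal a : @mor R (Fuk D) X Y a -> allowed X Y (A a).
  move=> [_ [[e1 _]|->]]; [by left|right].
  by rewrite /A (_ : lc 0 = 0 :> Lm) // lgau0.
have d0 : Fuk_mu X [:: (0, Y)] = 0.
  by apply/funext => -[K g]; rewrite -[LHS]/(lc (Fuk_mu X [:: (0, Y)]) K g) Fuk_M (M_zero X.2 [::] Y.2 [::]).
have ad a : @mor R (Fuk D) X Y a -> A (Fuk_mu X [:: (a, Y)]) = M (cX X) [:: (A a, cX Y)].
  by move=> ma; rewrite /A mu_st.
have dm a : @mor R (Fuk D) X Y a -> @mor R (Fuk D) X Y (Fuk_mu X [:: (a, Y)]).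
  move=> [_ h]; split; first exact: novikov_true.
  by case: h => [h|->]; [left|right].
have A_inj a a' : A a = A a' -> a = a'.
  move=> e; apply/funext => -[K g]; have := congr1 (fun f : Lm => f K) e => /gau_inj.
  by move/(congr1 (fun f => f g)).
have A_of B : allowed X Y B -> (Wv (cX X) = Wv (cX Y) :> nov D) -> exists2 a, @mor R (Fuk D) X Y a & A a = B.
  move=> al h; exists (ungauge X B); last exact: ungaugeK.
  split; first exact: novikov_true.
  case: al => [e|->]; first by left; split=> //; apply/potential_cX.
  right; apply/funext => -[K g]; by rewrite /ungauge lgau0.
have fd a : @mor R (Fuk D) X Y a -> ug (cA (A (Fuk_mu X [:: (a, Y)]))) = ug (Dg X Y (cA (A a))).
  by move=> ma; rewrite ad //; apply: ug_ext => J K F g z Ez; rewrite Dg_cA.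
have f_inj a a' : ug (cA (A a)) = ug (cA (A a')) -> a = a'.
  by move=> e; apply: A_inj; apply: (@cA_inj _ _ _ X Y) => J K F g z Ez; exact: ug_inj e Ez.
have f0 : ug (cA (A 0)) = 0.
  rewrite -ug_zero; apply: ug_ext => J K F g z _; rewrite /A (_ : lc 0 = 0 :> Lm) // lgau0; exact: cA0.
have ss0 : smoA (fun _ _ _ _ => fun=> 0) by exact: smo_zeroA.
have D0 : ug (Dg X Y (fun _ _ _ _ => fun=> 0)) = 0.
  by rewrite -ug_zero; apply: ug_ext => *; exact: Dg_zero.
have Dsq s : Wv (cX X) = Wv (cX Y) :> nov D -> smoA s -> ug (Dg X Y (Dg X Y s)) = 0.
  by move=> h ss; rewrite -ug_zero; apply: ug_ext => *; exact: Dg_Dg.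
have m0 : @mor R (tw O deg) (FO X) (FO Y) 0 by rewrite -ug_zero; apply: ugE => //; right; exact: ug_zero.
have mF0 : @mor R (Fuk D) X Y 0 by split; [exact: novikov_true|right].
split.
- split=> [a ma|b mb].
    split; first exact: dm.
    change (Fuk_mu X [:: (Fuk_mu X [:: (a, Y)], Y)] = 0); apply: A_inj; rewrite !ad ?dm //; last exact: dm.
    have [h|->] := aW a ma; last by rewrite /A (_ : lc 0 = 0 :> Lm) // lgau0 !(M_zero (cX X) [::] (cX Y) [::]).
    by rewrite muA_square // /A (_ : lc 0 = 0 :> Lm) // lgau0.
  have [[w sw ->] h] := memE b mb; have sD := smo_Dg X Y sw; rewrite dE // dE //.
  case: h => [h|w0]; first by split; [apply: ugE => //; left|exact: Dsq].
  have e1 : ug (Dg X Y w) = 0.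
    rewrite -D0; apply: ug_ext => J K F g z Ez; apply: Dg_ext => // J' K' F' g' y Ey.
    by apply: (ug_inj (w := w)) => //; rewrite ug_zero.
  split; first by rewrite e1.
  rewrite -D0; apply: ug_ext => J K F g z Ez; apply: Dg_ext => // J' K' F' g' y Ey.
  by apply: (ug_inj (w := Dg X Y w)) => //; rewrite ug_zero.
- move=> a ma; rewrite !fE dE; last exact: smo_cstA.
  split; last exact: fd.
  by apply: ugE; [case: (aW a ma) => [|->]; [left|right; exact: f0]|exact: smo_cstA].
- move=> a ma da [b mb]; rewrite fE; have [[w sw ->] h] := memE b mb; rewrite dE // => e.
  have [WW|a0] := aW a ma; last by exists 0 => //; rewrite a0; exact: esym d0.
  have [B [s [alB ss hB]]] := solve hW hX hY WW (aal a ma) sw (fun J K F g z Ez => esym (ug_inj J K F g e Ez)).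
  have [a' ma' Ba] := A_of B alB WW; exists a' => //; apply: f_inj.
  apply: (etrans e); apply: (etrans _ (esym (fd a' ma'))); apply: ug_ext => J K F g z Ez.
  (* Substituting w = f(a') + D s removes the exact part, since D D = 0. *)
  transitivity (Dg X Y (addA (cA (A a')) (Dg X Y s)) J K F g z).
    by apply: Dg_ext => // J' K' F' g' y Ey; rewrite hB // Ba.
  rewrite (DgD X Y _ _ _ _ (@smo_cstA _ _ _ _ _) (smo_Dg X Y ss) Ez) (Dg_Dg hW) // addr0.
  by [].
- move=> b mb; have [[w sw ->] h] := memE b mb; rewrite dE // => e.
  case: h => [WW|b0]; last first.
    exists 0; split=> //; exists 0 => //; rewrite b0 fE f0 add0r.
    by rewrite -[X in @mu _ _ _ [:: (X, _)]]ug_zero dE // D0.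
  have al0 : allowed X Y (0 : Lm) by right.
  have [|B [s [alB ss hB]]] := solve hW hX hY WW al0 sw.
    move=> J K F g z Ez; rewrite cA0; apply: (ug_inj (w' := fun _ _ _ _ => fun=> 0)) => //.
    by rewrite e ug_zero.
  have [a ma Ba] := A_of B alB WW.
  have bE : ug w = ug (cA (A a)) + ug (Dg X Y s).
    by rewrite -ug_add; apply: ug_ext => J K F g z Ez; rewrite hB // /addA Ba.
  exists a; split=> //; last by exists (ug s); [apply: ugE => //; left|rewrite fE dE].
  change (Fuk_mu X [:: (a, Y)] = 0); apply: f_inj.
  apply: (etrans (fd a ma)); apply: (etrans _ (esym f0)); apply: (etrans _ e).
  apply: ug_ext => J K F g z Ez; apply/esym.
  transitivity (Dg X Y (addA (cA (A a)) (Dg X Y s)) J K F g z).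
    by apply: Dg_ext => // J' K' F' g' y Ey; rewrite hB // Ba.
  by rewrite (DgD X Y _ _ _ _ (@smo_cstA _ _ _ _ _) (smo_Dg X Y ss) Ez) (Dg_Dg hW) // addr0.
Qed.

End Main.

Theorem theorem1p4 (R : realType) (n : nat) (D : fukaya_data R n)
    (hW : weakly_unobstructed D) :
  quasi_equivalence_onto_image (ainf_comp (P_functor D) (Phi_functor D)).
Proof. by split; [exact: FF_functor|move=> X Y; exact: FF_quasi]. Qed.
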